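(* Let $N$ be a complete umbilic, not totally geodesic hypersurface in the space form $M_\kappa$ of dimension $n+1$ and constant sectional curvature $\kappa$, let $U$ be the exterior of $N$, and let $v$ be a smooth unit (tangent) vector field on $N$. Let $\nabla$ be the Levi-Civita connection of $N$, and for $p\in N$ let $(\nabla v)_p : T_pN\to T_pN$, $x\mapsto \nabla_x v$. Then the following assertions are equivalent: (a) The vector field $v$ bifoliates $U$. (b) For each $p\in N$, any real eigenvalue $\lambda$ of the restriction of the operator $(\nabla v)_p$ to $v(p)^\perp\subset T_pN$ satisfies $\lambda^2+\kappa\le 0$. (c) For each $p\in N$ and any real eigenvalue $\lambda$ of $(\nabla v)_p$, the following condition holds: (i) if $\kappa=0$: $\lambda=0$; (ii) if $\kappa>0$: $\lambda=0$ with algebraic multiplicity one; (iii) if $\kappa<0$: $\lambda^2\le-\kappa$.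
   Context: Setting. $M_\kappa$ is the $(n+1)$-dimensional space form of constant sectional curvature $\kappa$: Euclidean space $\mathbb{R}^{n+1}$ if $\kappa=0$, the round sphere of radius $1/\sqrt{\kappa}$ if $\kappa>0$, and hyperbolic space if $\kappa<0$, for which one uses the upper half-space model $\{(x_0,\dots,x_n)\in\mathbb{R}^{n+1}: x_0>0\}$ with metric $(dx_0^2+\cdots+dx_n^2)/(-\kappa x_0^2)$. A hypersurface is umbilic if all its principal curvatures are equal. The complete umbilic, not totally geodesic hypersurfaces $N\subset M_\kappa$ considered are exactly: (1) $\kappa=0$: round $n$-spheres; (2) $\kappa>0$: geodesic spheres which are not great spheres; (3) $\kappa<0$: (3a) geodesic spheres, (3b) horospheres (congruent by an isometry to $x_0=1$), (3c) hypersurfaces congruent by an isometry to the intersection of the half-space with a hyperplane through the origin that is not orthogonal to $\{x_0=0\}$. Exterior. The exterior $U$ of $N$ is the connected component of $M_\kappa\setminus N$ into which the opposite of the mean curvature vector field of $N$ points, except that for $\kappa>0$, $U$ is further restricted to be the open zone between $N$ and its antipodal image $-N$. Bifoliation. For $u\in TM_\kappa$, $\gamma_u$ is the geodesic of $M_\kappa$ with initial velocity $u$. Put $T_\kappa=\infty$ if $\kappa\le0$ and $T_\kappa=\pi/\sqrt{\kappa}$ if $\kappa>0$. A smooth unit vector field $v$ on $N$ forward foliates $U$ if the geodesic rays $\gamma_{v(p)}(0,T_\kappa)$, $p\in N$, are the leaves of a smooth foliation of $U$; it backward foliates $U$ if the rays $\gamma_{-v(p)}(0,T_\kappa)$, $p\in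 N$, are the leaves of a smooth foliation of $U$; it bifoliates $U$ if it does both. Since $v$ is unit, the image of $(\nabla v)_p$ is contained in $v(p)^\perp$, so $(\nabla v)_p$ preserves $v(p)^\perp$. *)

(* Defs.v *)
From HB Require Import structures.
From mathcomp Require Import all_boot all_order all_algebra.
From mathcomp Require Import all_classical all_reals all_analysis.

Set Implicit Arguments.
Unset Strict Implicit.
Unset Printing Implicit Defensive.

Import Order.TTheory GRing.Theory Num.Theory.
Import numFieldNormedType.Exports.

Local Open Scope classical_set_scope.
Local Open Scope ring_scope.

(* All manifolds below are subsets of a coordinate space 'rV[R]_m.+1. Maps and
   vector fields on a subset are represented by total functions of which only
   the values on that subset matter. *)

Section Smooth.
Context {R : realType}.

Fixpoint Ck (V W : normedModType R) (k : nat) (O : set V) (f : V -> W) : Prop :=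
  match k with
  | 0 => forall x, O x -> {for x, continuous f}
  | k.+1 => (forall x, O x -> differentiable f x) /\
            (forall w : V, Ck k O (fun x => 'D_w f x))
  end.

(* Smoothness on an arbitrary subset: local smooth extendability. *)
Definition smooth_on (V W : normedModType R) (A : set V) (f : V -> W) : Prop :=
  forall x, A x -> exists (O : set V) (F : V -> W),
    [/\ open O, O x, forall k, Ck k O F & forall y, (A `&` O) y -> F y = f y].

End Smooth.

Section SpaceForm.
Context {R : realType} {m : nat} (kappa : R).
Local Notation E := 'rV[R]_m.+1.
Implicit Types (S N U : set E) (p u w x y z a h : E) (c : R -> E) (v f : E -> E).

Definition dot u w : R := \sum_i u ord0 i * w ord0 i.

(* The space form M_kappa: the sphere of radius 1 / sqrt kappa, the whole
   coordinate space, or the upper half-space. Its dimension is m if 0 < kappa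
   and m.+1 otherwise. *)
Definition space_form : set E :=
  [set x | if 0 < kappa then dot x x = kappa^-1
           else kappa < 0 -> 0 < x ord0 ord0].

Definition metric p u w : R :=
  if kappa < 0 then dot u w / (- kappa * p ord0 ord0 ^+ 2) else dot u w.

Definition curve_at S p u c : Prop :=
  exists e : R, [/\ 0 < e,
    smooth_on [set t | - e < t < e] c,
    forall t, - e < t < e -> S (c t),
    c 0 = p & derive1 c 0 = u].

Definition tangent S p u : Prop := exists c, curve_at S p u c.

(* Let D be the Levi-Civita connection of the metric on its open domain in the
   coordinate space (the whole space, or the half-space if kappa < 0). If Y is a
   vector field with Y(p) = y whose coordinatewise derivative in the direction
   x is a, then D_x Y = a + Gamma_p(x, y), and [inner_cov p x y a z] is the
   inner product of D_x Y with z. The last three terms are the Christoffel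
   symbols of the first kind. *)
Definition inner_cov p x y a z : R :=
  metric p a z
  + 2^-1 * ('D_x (fun q => metric q y z) p + 'D_y (fun q => metric q x z) p
            - 'D_z (fun q => metric q x y) p).

(* [cov_deriv S v p x w]: w = nabla_x v at p, for the Levi-Civita connection of
   the metric induced on S, i.e. w is the tangential part of D_x v. *)
Definition cov_deriv S v p x w : Prop :=
  tangent S p w /\
  exists c, curve_at S p x c /\
    forall z, tangent S p z ->
      metric p w z = inner_cov p x (v p) (derive1 (v \o c) 0) z.

(* c is the maximal geodesic gamma_u, with u tangent at p: the tangential part
   of its acceleration D_{c'} c' vanishes. *)
Definition geodesic p u c : Prop :=
  [/\ smooth_on setT c,
      forall t, space_form (c t),
      c 0 = p, derive1 c 0 = u &
      forall t z, tangent space_form (c t) z ->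
        inner_cov (c t) (derive1 c t) (derive1 c t) (derive1n 2 c t) z = 0].

Definition geodesic_sphere p (r : R) : set E :=
  [set q | exists u c, [/\ tangent space_form p u, metric p u u = 1,
                           geodesic p u c & q = c r]].

Definition space_form_isometry f : Prop :=
  exists g : E -> E,
    [/\ smooth_on space_form f, smooth_on space_form g,
        forall p, space_form p -> space_form (f p) /\ g (f p) = p,
        forall p, space_form p -> space_form (g p) /\ f (g p) = p &
        forall p u w c d, curve_at space_form p u c -> curve_at space_form p w d ->
          metric (f p) (derive1 (f \o c) 0) (derive1 (f \o d) 0) = metric p u w].

(* The complete umbilic, not totally geodesic hypersurfaces. In
   [umbilic_hyperplane], a is a Euclidean normal vector of the hyperplane: the
   latter is not orthogonal to {x_0 = 0} iff a_0 != 0, and it meets the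
   half-space iff some other a_i is nonzero. *)
Inductive umbilic_hypersurface : set E -> Prop :=
| umbilic_round_sphere p (r : R) :
    kappa = 0 -> 0 < r ->
    umbilic_hypersurface [set q | dot (q - p) (q - p) = r ^+ 2]
| umbilic_small_sphere p (r : R) :
    0 < kappa -> space_form p -> 0 < r < pi / Num.sqrt kappa ->
    r != pi / (2 * Num.sqrt kappa) ->
    umbilic_hypersurface (geodesic_sphere p r)
| umbilic_geodesic_sphere p (r : R) :
    kappa < 0 -> space_form p -> 0 < r ->
    umbilic_hypersurface (geodesic_sphere p r)
| umbilic_horosphere f :
    kappa < 0 -> space_form_isometry f ->
    umbilic_hypersurface (f @` [set q : E | q ord0 ord0 = 1])
| umbilic_hyperplane f a :
    kappa < 0 -> space_form_isometry f ->
    a ord0 ord0 != 0 -> (exists2 i, i != ord0 & a ord0 i != 0) ->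
    umbilic_hypersurface (f @` [set q : E | 0 < q ord0 ord0 /\ dot a q = 0]).

(* h is the mean curvature vector at p of the hypersurface N of M_kappa, of
   dimension n: n h is the trace of the second fundamental form, computed on an
   orthonormal basis of T_p N formed by the velocities of curves c_i in N;
   II(c_i', c_i') is the part of D_{c_i'} c_i' tangent to M_kappa and normal
   to N. *)
Definition mean_curvature (n : nat) N p h : Prop :=
  [/\ tangent space_form p h,
      forall x, tangent N p x -> metric p h x = 0 &
      exists (e : 'I_n -> E) (c : 'I_n -> R -> E),
        [/\ forall i, curve_at N p (e i) (c i),
            forall i j, metric p (e i) (e j) = (i == j)%:R &
            forall z, tangent space_form p z ->
              (forall x, tangent N p x -> metric p z x = 0) ->
              n%:R * metric p h z =
                \sum_i inner_cov p (e i) (e i) (derive1n 2 (c i) 0) z]].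

(* For 0 < kappa, N and its antipodal image -N are disjoint and cut the sphere
   into two caps and the zone between them; the zone is the component of the
   complement of N and -N into which -H points. *)
Definition exterior (n : nat) N U : Prop :=
  let A := [set q | [/\ space_form q, ~ N q & 0 < kappa -> ~ N (- q)]] in
  (exists2 q, A q & U = connected_component A q) /\
  forall p, N p -> exists h c,
    [/\ mean_curvature n N p h, curve_at space_form p (- h) c &
        \forall t \near 0^'+, U (c t)].

Definition unit_vector_field N v : Prop :=
  smooth_on N v /\ forall p, N p -> tangent N p (v p) /\ metric p (v p) (v p) = 1.

(* gamma_u(0, T_kappa) *)
Definition ray p u : set E :=
  [set q | exists c t, [/\ geodesic p u c, 0 < t,
                           0 < kappa -> t < pi / Num.sqrt kappa & q = c t]].

(* A connected immersed one-dimensional submanifold, i.e. an injectively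
   immersed line or circle. *)
Definition immersed_curve (L : set E) : Prop :=
  exists c, [/\ smooth_on setT c, forall t, derive1 c t != 0, L = range c &
    injective c \/
    (forall t, c (t + 1) = c t) /\ {in `[0, 1[ &, injective c}].

(* A chart phi of the d.+1-dimensional manifold U, with domain W and inverse
   psi, onto an open cube, such that every member of F meets W in a countable
   (possibly empty) union of slices along the coordinate 0. *)
Definition flat_chart (d : nat) U (F : set (set E)) (W : set E)
    (phi : E -> 'rV[R]_d.+1) (psi : 'rV[R]_d.+1 -> E) : Prop :=
  let Q := [set s : 'rV[R]_d.+1 | forall i, -1 < s ord0 i < 1] in
  [/\ exists2 O, open O & W = U `&` O,
      smooth_on W phi /\ smooth_on Q psi,
      forall q, W q -> Q (phi q) /\ psi (phi q) = q,
      forall s, Q s -> W (psi s) /\ phi (psi s) = s &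
      forall L, F L -> exists2 C : set 'rV[R]_d, countable C &
        phi @` (L `&` W) = [set s | Q s /\ C (col' ord0 s)]].

(* F is the set of leaves of a smooth foliation by curves of the
   d.+1-dimensional manifold U. *)
Definition smooth_foliation (d : nat) U (F : set (set E)) : Prop :=
  [/\ forall L, F L -> immersed_curve L,
      forall L L', F L -> F L' -> L `&` L' !=set0 -> L = L',
      \bigcup_(L in F) L = U &
      forall q, U q -> exists W phi psi, W q /\ @flat_chart d U F W phi psi].

Definition forward_foliates (n : nat) N U v : Prop :=
  smooth_foliation n U [set L | exists2 p, N p & L = ray p (v p)].

Definition backward_foliates (n : nat) N U v : Prop :=
  smooth_foliation n U [set L | exists2 p, N p & L = ray p (- v p)].

Definition bifoliates (n : nat) N U v : Prop :=
  forward_foliates n N U v /\ backward_foliates n N U v.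

Definition nabla_eigenvalue N v p (lambda : R) : Prop :=
  exists x, [/\ tangent N p x, x != 0 & cov_deriv N v p x (lambda *: x)].

(* Eigenvalues of the restriction of (nabla v)_p to the orthogonal complement
   of v(p) in T_p N. *)
Definition nabla_perp_eigenvalue N v p (lambda : R) : Prop :=
  exists x, [/\ tangent N p x, metric p x (v p) = 0, x != 0 &
                cov_deriv N v p x (lambda *: x)].

(* k is the multiplicity of lambda as a root of the characteristic polynomial
   of (nabla v)_p, computed from its matrix B (acting on row vectors) in a
   basis of T_p N formed by the rows of e. *)
Definition nabla_alg_multiplicity (n : nat) N v p (lambda : R) (k : nat) : Prop :=
  exists (e : 'M[R]_(n, m.+1)) (B : 'M[R]_n),
    [/\ row_free e,
        forall x, tangent N p x <-> (x <= e)%MS,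
        forall i, cov_deriv N v p (row i e) (row i (B *m e)) &
        mup lambda (char_poly B) = k].

End SpaceForm.

(* Main.v *)
(* In all cases N is, up to a factor, the unit sphere S of a cone C (the complement of the origin,
   a half-space or an upper light cone, according to N being a sphere, a horosphere or a
   hypersurface equidistant from a hyperplane), and U is diffeomorphic to C in such a way that the
   geodesic rays become r |-> r (al(r) y + be(r) w(y)), y in S, where w is the field v on S. The
   map H sending r y to this point preserves the spheres r S, and it is singular at r y exactly if
   dw has at y an eigenvalue lam with al(r) + lam be(r) = 0; these lam are those for which
   lam^2 + kappa > 0 (and lam < 0, if kappa <= 0). If H has no singular point, it is a
   diffeomorphism by continuation in r from the identity of S, and maps the radial foliation to the
   rays. Conversely, at a singular point the rays near y focus to first order, which is impossible
   in a foliation chart. The signs of v and - v give both signs of lam, hence (a) <-> (b).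

   The diffeomorphism is the projection of Euclidean space, the sphere or the hyperboloid along
   the normal of the hyperplane section N. The exterior is identified with a component of the
   complement by evaluating the mean curvature vector on this normal.

   As |v| = 1, <nabla_x v, v> = 0, so an eigenvector for lam <> 0 is orthogonal to v, and 0 has
   algebraic multiplicity one iff no eigenvector for 0 is orthogonal to v. This is (b) <-> (c). *)

(* The cone depends on N, not only on the sign of kappa: in the hyperboloid, k is minus the square
   of the normal of the section, and kappa enters only through rho0 and (al, be). One argument on
   cones thus serves all families; each supplies its projection, its rays and its metric.

   The time t of a geodesic is replaced by r = t, sinh(q t) / q or tan(q t / 2), so that rays have
   the parameter set r > 0 in every case and U becomes the whole cone.

   Without singular points H is only a local diffeomorphism. To count the preimages of z, the
   coefficients are deformed from (1, 0) to (al r, be r) with z fixed. All intermediate maps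
   preserve rho, and solutions stay in a compact set, for a reason that differs with k, as S is not
   compact for k = 0 and -1.

   For the converse, the charts are arbitrary and a leaf may meet one in countably many slices; a
   measure argument shows that the transverse coordinates are constant along it. Focusing then
   contradicts the Wronskian condition: al + lam be and its derivative cannot vanish together. *)
Require Import Defs.
From HB Require Import structures.
From mathcomp Require Import all_boot all_order all_algebra.
From mathcomp Require Import all_classical all_reals all_analysis.
From mathcomp Require Import ring lra.
Set Implicit Arguments.
Unset Strict Implicit.
Unset Printing Implicit Defensive.

Import Order.TTheory GRing.Theory Num.Theory.
Import numFieldNormedType.Exports.

Local Open Scope classical_set_scope.
Local Open Scope ring_scope.

(** * Calculus of C^k maps *)

Section Diff.
Context {R : realType}.
Implicit Types V W X : normedModType R.

(** Differentiability with its remainder as an explicit inequality, the form in which [inv_diff]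
    establishes it for an inverse map. *)
Lemma differentiable_eps V W (f : V -> W) x (L : {linear V -> W}) :
  continuous L ->
  (forall e : R, 0 < e -> \forall h \near 0, `|f (h + x) - f x - L h| <= e * `|h|) ->
  differentiable f x /\ 'd f x = L :> (V -> W).
Proof.
move=> Lc fL.
have E : f \o shift x = cst (f x) + L +o_ 0 id.
  apply/eqaddoP => e e0; have := fL e e0; apply: filterS => h /=.
  by rewrite !fctE /= opprD addrA.
have dE := diff_unique Lc E; split=> //.
by apply/diff_locallyP; rewrite dE.
Qed.

Lemma differentiable_epsE V W (f : V -> W) x : differentiable f x ->
  forall e : R, 0 < e -> \forall h \near 0, `|f (h + x) - f x - 'd f x h| <= e * `|h|.
Proof.
move=> /diff_locally E e e0.
have /eqaddoP /(_ e e0) := E; apply: filterS => h /=.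
by rewrite !fctE /= opprD addrA.
Qed.

Lemma near_differentiable V W (f g : V -> W) x :
  (\forall y \near x, f y = g y) -> differentiable f x -> differentiable g x.
Proof.
move=> fg df; apply: (proj1 (@differentiable_eps _ _ g x ('d f x) (diff_continuous df) _)).
move=> e e0; have := differentiable_epsE df e0; rewrite -(nbhs_singleton fg).
have fg0 : \forall h \near 0, f (h + x) = g (h + x).
  by move: fg; rewrite (near_shift 0 x) /=; apply: filterS => h /=; rewrite subr0 addrC.
by apply: filterS2 fg0 => h -> .
Qed.

Lemma derive_lin V W (f : V -> W) x (df : differentiable f x) (a : R) u w :
  'D_(a *: u + w) f x = a *: 'D_u f x + 'D_w f x.
Proof. by rewrite !deriveE // linearP. Qed.

Lemma derive_sumv V W (f : V -> W) x I r (P : pred I) (a : I -> R) (u : I -> V) :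
  differentiable f x ->
  'D_(\sum_(i <- r | P i) a i *: u i) f x = \sum_(i <- r | P i) a i *: 'D_(u i) f x.
Proof.
move=> df; rewrite deriveE // linear_sum; apply: eq_bigr => i _.
by rewrite linearZ deriveE.
Qed.

Lemma derive_comp V W X (f : V -> W) (g : W -> X) x w :
  differentiable f x -> differentiable g (f x) ->
  'D_w (fun y => g (f y)) x = 'D_('D_w f x) g (f x).
Proof.
move=> df dg; rewrite deriveE; last exact: (differentiable_comp df dg).
by rewrite -[fun y => _]/(g \o f) diff_comp //= !deriveE.
Qed.


Lemma Ck_le1 V W k (O : set V) (f : V -> W) : Ck k.+1 O f -> Ck k O f.
Proof.
elim: k f => [|k IH] f [df Df]; first by move=> x Ox; exact: differentiable_continuous (df x Ox).
by split=> // w; apply: IH.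
Qed.

Lemma Ck_sub V W k (O P : set V) (f : V -> W) : P `<=` O -> Ck k O f -> Ck k P f.
Proof.
move=> PO; elim: k f => [|k IH] f; first by move=> H x /PO /H.
by case=> df Df; split=> [x /PO /df //|w]; exact: IH (Df w).
Qed.

Lemma Ck_ext V W k (O : set V) (f g : V -> W) :
  open O -> (forall x, O x -> f x = g x) -> Ck k O f -> Ck k O g.
Proof.
move=> oO; elim: k f g => [|k IH] f g fg.
  move=> H x Ox; have fx : f y @[y --> x] --> f x := H x Ox; rewrite (fg x Ox) in fx;
    change (g y @[y --> x] --> g x).
  apply: cvg_trans fx; apply: near_eq_cvg.
  by move: (open_nbhs_nbhs (conj oO Ox)); apply: filterS => y /fg ->.
have N x : O x -> \forall y \near x, f y = g y.
  by move=> Ox; move: (open_nbhs_nbhs (conj oO Ox)); apply: filterS => y /fg ->.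
case=> df Df; split=> [x Ox|w]; first by apply: near_differentiable (df x Ox); apply: N.
apply: IH (Df w) => x Ox; apply: near_eq_derive; exact: N.
Qed.

(** The sets P are arbitrary because [Ck] is a condition point by point, on derivatives taken in the
    whole space. *)
Lemma Ck_loc V W k (O : set V) (f : V -> W) :
  (forall x, O x -> exists2 P : set V, P x & Ck k P f) -> Ck k O f.
Proof.
elim: k f => [|k IH] f H; first by move=> x /H [P Px /(_ x Px)].
split=> [x /H [P Px [+ _]]|w]; first by apply.
by apply: IH => x /H [P Px [_ +]] => /(_ w); exists P.
Qed.

Lemma Ck_cst V W k (O : set V) (a : W) : Ck k O (fun _ => a).
Proof.
elim: k a => [|k IH] a; first by move=> x _; exact: cvg_cst.
split=> [x _|w]; first exact: differentiable_cst.
by have -> : (fun x => 'D_w (fun _ : V => a) x) = (fun _ => 0) by apply/funext => x; rewrite derive_cst.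
Qed.

Lemma derive_clin V W (f : {linear V -> W}) x w : continuous f -> 'D_w f x = f w.
Proof. by move=> fc; rewrite deriveE ?diff_lin //; exact: linear_differentiable. Qed.

Lemma Ck_lin V W k (O : set V) (f : {linear V -> W}) : continuous f -> Ck k O f.
Proof.
move=> fc; case: k => [|k]; first by move=> x _; exact: fc.
split=> [x _|w]; first exact: linear_differentiable.
have -> : (fun x => 'D_w f x) = (fun _ => f w) by apply/funext => x; rewrite derive_clin.
exact: Ck_cst.
Qed.

Lemma Ck_id V k (O : set V) : Ck k O (fun x : V => x).
Proof. by apply: (@Ck_lin V V k O idfun) => x; exact: cvg_id. Qed.

Lemma Ck_add V W k (O : set V) (f g : V -> W) : open O ->
  Ck k O f -> Ck k O g -> Ck k O (fun x => f x + g x).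
Proof.
move=> oO; elim: k f g => [|k IH] f g.
  by move=> Hf Hg x Ox; apply: continuousD; [apply: Hf|apply: Hg].
move=> [df Df] [dg Dg]; split=> [x Ox|w].
  by apply: differentiableD; [apply: df|apply: dg].
apply: Ck_ext oO _ (IH _ _ (Df w) (Dg w)) => x Ox /=.
by rewrite -[RHS]/('D_w (f + g) x) deriveD //; apply: diff_derivable; [apply: df|apply: dg].
Qed.

Lemma Ck_sum V W k (O : set V) I (r : seq I) (P : pred I) (f : I -> V -> W) : open O ->
  (forall i, P i -> Ck k O (f i)) -> Ck k O (fun x => \sum_(i <- r | P i) f i x).
Proof.
move=> oO H; elim: r => [|i r IH].
  have -> : (fun x => \sum_(i <- [::] | P i) f i x) = (fun _ => 0).
    by apply/funext => x; rewrite big_nil.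
  exact: Ck_cst.
have -> : (fun x => \sum_(j <- i :: r | P j) f j x) =
    (fun x => (if P i then f i x + \sum_(j <- r | P j) f j x else \sum_(j <- r | P j) f j x)).
  by apply/funext => x; rewrite big_cons.
by case Pi: (P i) => //; apply: Ck_add => //; exact: H.
Qed.

Lemma Ck_clin V W X k (O : set V) (f : V -> W) (g : {linear W -> X}) : open O ->
  continuous g -> Ck k O f -> Ck k O (fun x => g (f x)).
Proof.
move=> oO gc; elim: k f => [|k IH] f.
  by move=> Hf x Ox; apply: continuous_comp; [apply: Hf|apply: gc].
move=> [df Df]; split=> [x Ox|w].
  by apply: (@differentiable_comp _ _ _ _ f g); [apply: df|apply: linear_differentiable].
apply: Ck_ext oO _ (IH _ (Df w)) => x Ox /=; rewrite (derive_comp (g := g)) ?derive_clin //.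
  exact: df.
exact: linear_differentiable.
Qed.

Lemma Ck_mulr V k (O : set V) (f g : V -> R) : open O ->
  Ck k O f -> Ck k O g -> Ck k O (fun x => f x * g x).
Proof.
move=> oO; elim: k f g => [|k IH] f g.
  by move=> Hf Hg x Ox; apply: continuousM; [apply: Hf|apply: Hg].
move=> Hf Hg; have [df Df] := Hf; have [dg Dg] := Hg; split=> [x Ox|w].
  by apply: differentiableM; [apply: df|apply: dg].
apply: Ck_ext oO _ (Ck_add oO (IH _ _ (Ck_le1 Hf) (Dg w)) (IH _ _ (Ck_le1 Hg) (Df w))) => x Ox /=.
by rewrite -[RHS]/('D_w (f * g) x) deriveM //; apply: diff_derivable; [apply: df|apply: dg].
Qed.

Lemma Ck_inv V k (O : set V) (f : V -> R) : open O -> (forall x, O x -> f x != 0) ->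
  Ck k O f -> Ck k O (fun x => (f x)^-1).
Proof.
move=> oO f0; elim: k => [|k IH].
  by move=> Hf x Ox; apply: (@continuousV _ _ f); [apply: f0|apply: Hf].
move=> Hf; have [df Df] := Hf; split=> [x Ox|w].
  by apply: (@differentiableV _ _ f); [apply: df|apply: f0].
have Hi := IH (Ck_le1 Hf).
have Hm : Ck k O (fun x => -1 * ((f x)^-1 * (f x)^-1 * 'D_w f x)).
  by apply: Ck_mulr (Ck_cst _ _ _) _ => //; apply: Ck_mulr (Df w) => //; apply: Ck_mulr.
apply: Ck_ext oO _ Hm => x Ox /=.
rewrite [RHS](@deriveV _ _ f); [|exact: f0|by apply: diff_derivable; apply: df].
by rewrite mulN1r /= -exprVn expr2 scaleNr.
Qed.

Lemma diff_derive1_comp V (f : V -> R) (g : R -> R) x w a :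
  differentiable f x -> is_derive (f x) (1 : R) g a ->
  differentiable (fun y => g (f y)) x /\ 'D_w (fun y => g (f y)) x = a * 'D_w f x.
Proof.
move=> df dg; have dg' : differentiable g (f x) by apply/derivable1_diffP; case: dg.
split; first exact: (differentiable_comp df dg').
rewrite derive_comp //; have -> : 'D_w f x = 'D_w f x *: (1 : R) by rewrite scaler1.
by rewrite (deriveE _ dg') linearZ /= -deriveE // derive_val mulrC scaler1.
Qed.

Lemma Ck_sqrt V k (O : set V) (f : V -> R) : open O -> (forall x, O x -> 0 < f x) ->
  Ck k O f -> Ck k O (fun x => Num.sqrt (f x)).
Proof.
move=> oO f0; elim: k => [|k IH].
  by move=> Hf x Ox; apply: continuous_comp; [apply: Hf|apply: sqrt_continuous].
move=> Hf; have [df Df] := Hf.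
have H x w (Ox : O x) := diff_derive1_comp w (df x Ox) (is_derive1_sqrt (f0 x Ox)).
split=> [x Ox|w]; first by have [] := H x 0 Ox.
have Hm : Ck k O (fun x => (2 * Num.sqrt (f x))^-1 * 'D_w f x).
  apply: Ck_mulr (Df w) => //; apply: Ck_inv => //.
    by move=> x Ox; rewrite mulf_neq0 // gt_eqF // sqrtr_gt0 f0.
  by apply: Ck_mulr (Ck_cst _ _ _) (IH (Ck_le1 Hf)).
by apply: Ck_ext oO _ Hm => x Ox /=; have [_ ->] := H x w Ox.
Qed.

Lemma Ck_expR V k (O : set V) (f : V -> R) : open O ->
  Ck k O f -> Ck k O (fun x => expR (f x)).
Proof.
move=> oO; elim: k => [|k IH].
  by move=> Hf x Ox; apply: continuous_comp; [apply: Hf|apply: continuous_expR].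
move=> Hf; have [df Df] := Hf.
have H x w (Ox : O x) := diff_derive1_comp w (df x Ox) (is_derive_expR (f x)).
split=> [x Ox|w]; first by have [] := H x 0 Ox.
by apply: Ck_ext oO _ (Ck_mulr oO (IH (Ck_le1 Hf)) (Df w)) => x Ox /=; have [_ ->] := H x w Ox.
Qed.

Lemma Ck_sin_cos V k (O : set V) (f : V -> R) : open O ->
  Ck k O f -> Ck k O (fun x => sin (f x)) /\ Ck k O (fun x => cos (f x)).
Proof.
move=> oO; elim: k => [|k IH].
  move=> Hf; split=> x Ox; apply: continuous_comp.
  - exact: Hf.
  - exact: continuous_sin.
  - exact: Hf.
  - exact: continuous_cos.
move=> Hf; have [df Df] := Hf; have [IHs IHc] := IH (Ck_le1 Hf).
have Hs x w (Ox : O x) := diff_derive1_comp w (df x Ox) (is_derive_sin (f x)).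
have Hc x w (Ox : O x) := diff_derive1_comp w (df x Ox) (is_derive_cos (f x)).
split; (split=> [x Ox|w]).
- by have [] := Hs x 0 Ox.
- by apply: Ck_ext oO _ (Ck_mulr oO IHc (Df w)) => x Ox /=; have [_ ->] := Hs x w Ox.
- by have [] := Hc x 0 Ox.
- have Hm := Ck_mulr oO (Ck_cst k O (-1 : R)) (Ck_mulr oO IHs (Df w)).
  by apply: Ck_ext oO _ Hm => x Ox /=; have [_ ->] := Hc x w Ox; rewrite mulN1r mulNr.
Qed.

End Diff.

Section Comp.
Context {R : realType}.
Implicit Types V W X : normedModType R.

Lemma diff_scale V W (a : V -> R) (g : V -> W) x w :
  differentiable a x -> differentiable g x ->
  differentiable (fun y => a y *: g y) x /\
  'D_w (fun y => a y *: g y) x = 'D_w a x *: g x + a x *: 'D_w g x.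
Proof.
move=> da dg.
have bl : bilinear_for (GRing.Scale.Law.clone _ _ *:%R _) (GRing.Scale.Law.clone _ _ *:%R _)
   (@GRing.scale R W).
  split=> [u'|u] b y z /=; first by rewrite scalerDl scalerA.
  by rewrite scalerDr !scalerA mulrC.
pose sc : {bilinear R -> W -> W} :=
  HB.pack (@GRing.scale R W) (bilinear_isBilinear.Build R R W W _ _ (@GRing.scale R W) bl).
have scc : continuous (fun p : R * W => sc p.1 p.2) by move=> p; apply: scale_continuous.
have ds := @differentiable_bilin R _ _ _ sc (a x, g x) scc.
have dp := differentiable_pair da dg.
split; first exact: (differentiable_comp dp ds).
rewrite (derive_comp (f := fun y => (a y, g y)) (g := fun p : R * W => sc p.1 p.2)) //.
rewrite (deriveE _ ds) (@diff_bilin R _ _ _ sc _ scc) (deriveE _ dp) diff_pair //= -!deriveE //.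
by rewrite addrC.
Qed.

Lemma Ck_scale V W k (O : set V) (a : V -> R) (g : V -> W) : open O ->
  Ck k O a -> Ck k O g -> Ck k O (fun x => a x *: g x).
Proof.
move=> oO; elim: k a g => [|k IH] f g.
  by move=> Hf Hg x Ox; apply: continuousZ; [apply: Hf|apply: Hg].
move=> Hf Hg; have [df Df] := Hf; have [dg Dg] := Hg.
have H x w (Ox : O x) := diff_scale w (df x Ox) (dg x Ox).
split=> [x Ox|w]; first by have [] := H x 0 Ox.
apply: Ck_ext oO _ (Ck_add oO (IH _ _ (Df w) (Ck_le1 Hg)) (IH _ _ (Ck_le1 Hf) (Dg w))) => x Ox /=.
by have [_ ->] := H x w Ox.
Qed.

Lemma Ck_comp_basis V W X n (e : 'I_n -> W) (co : 'I_n -> {linear W -> R})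
    k (O : set V) (P : set W) (f : V -> W) (g : W -> X) :
  (forall i, continuous (co i)) -> (forall x, x = \sum_i co i x *: e i) ->
  open O -> (forall x, O x -> P (f x)) ->
  Ck k O f -> Ck k P g -> Ck k O (fun x => g (f x)).
Proof.
move=> coc He oO OP; elim: k g => [|k IH] g.
  by move=> Hf Hg x Ox; apply: continuous_comp; [apply: Hf|apply: Hg; exact: OP].
move=> Hf Hg; have [df Df] := Hf; have [dg Dg] := Hg.
split=> [x Ox|w].
  exact: (differentiable_comp (df x Ox) (dg _ (OP _ Ox))).
have Hm : Ck k O (fun x => \sum_i (co i ('D_w f x)) *: 'D_(e i) g (f x)).
  apply: Ck_sum => // i _; apply: Ck_scale => //.
    by apply: Ck_clin => //; exact: Df.
  exact: (IH _ (Ck_le1 Hf) (Dg (e i))).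
apply: Ck_ext oO _ Hm => x Ox /=.
rewrite (derive_comp w (df x Ox) (dg _ (OP _ Ox))) [in RHS](He ('D_w f x)).
by rewrite derive_sumv //; apply: dg; exact: OP.
Qed.

Definition coordl m n (i : 'I_m) (j : 'I_n) (x : 'M[R]_(m, n)) : R := x i j.
Lemma coordl_is_linear m n i j : linear (@coordl m n i j).
Proof. by move=> a x y; rewrite /coordl !mxE. Qed.
HB.instance Definition _ m n i j :=
  GRing.isLinear.Build R 'M[R]_(m, n) R _ (@coordl m n i j) (coordl_is_linear i j).

Lemma coordl_continuous m n i j : continuous (@coordl m n i j).
Proof. exact: coord_continuous. Qed.

Lemma Ck_comp V X m k (O : set V) (P : set 'rV[R]_m) (f : V -> 'rV[R]_m) (g : 'rV[R]_m -> X) :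
  open O -> (forall x, O x -> P (f x)) ->
  Ck k O f -> Ck k P g -> Ck k O (fun x => g (f x)).
Proof.
apply: (@Ck_comp_basis V _ X m (fun i => delta_mx 0 i) (fun i => coordl ord0 i)).
  by move=> i; exact: coordl_continuous.
by move=> x; rewrite [LHS]row_sum_delta.
Qed.

Lemma Ck_comp1 V X k (O : set V) (P : set R) (f : V -> R) (g : R -> X) :
  open O -> (forall x, O x -> P (f x)) ->
  Ck k O f -> Ck k P g -> Ck k O (fun x => g (f x)).
Proof.
apply: (@Ck_comp_basis V R X 1 (fun i => 1 : R) (fun i => idfun : {linear R -> R})).
  by move=> _ x; exact: cvg_id.
by move=> x; rewrite big_ord1 /= [RHS]mulr1.
Qed.

Lemma Ck_coord V m n k (O : set V) (f : V -> 'M[R]_(m, n)) i j : open O ->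
  Ck k O f -> Ck k O (fun x => f x i j).
Proof. by move=> oO Hf; apply: (Ck_clin (g := coordl i j)) => //; exact: coordl_continuous. Qed.

Lemma Ck_rV V m k (O : set V) (f : V -> 'rV[R]_m) : open O ->
  (forall i, Ck k O (fun x => f x ord0 i)) -> Ck k O f.
Proof.
move=> oO H.
have -> : f = (fun x => \sum_i f x ord0 i *: delta_mx ord0 i).
  by apply/funext => x; rewrite [LHS]row_sum_delta.
by apply: Ck_sum => // i _; apply: Ck_scale => //; exact: Ck_cst.
Qed.

Lemma Ck_row V m k (O : set V) (f : 'I_m -> V -> R) : open O ->
  (forall i, Ck k O (f i)) -> Ck k O (fun x => \row_i f i x).
Proof.
move=> oO H; apply: Ck_rV => // i.
by have -> : (fun x => (\row_j f j x) ord0 i) = f i by apply/funext => x; rewrite mxE.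
Qed.

Lemma Ck_opp V W k (O : set V) (f : V -> W) : open O -> Ck k O f -> Ck k O (fun x => - f x).
Proof.
move=> oO H; have -> : (fun x => - f x) = (fun x => (-1 : R) *: f x).
  by apply/funext => x; rewrite scaleN1r.
by apply: Ck_scale => //; exact: Ck_cst.
Qed.

Lemma Ck_sub_fun V W k (O : set V) (f g : V -> W) : open O ->
  Ck k O f -> Ck k O g -> Ck k O (fun x => f x - g x).
Proof. by move=> oO Hf Hg; apply: Ck_add => //; exact: Ck_opp. Qed.

Lemma Ck_exp V k (O : set V) (f : V -> R) p : open O -> Ck k O f -> Ck k O (fun x => f x ^+ p).
Proof.
move=> oO Hf; elim: p => [|p IH]; first exact: Ck_cst.
have -> : (fun x => f x ^+ p.+1) = (fun x => f x * f x ^+ p) by apply/funext => x; rewrite exprS.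
exact: Ck_mulr.
Qed.

Definition smooth V W (O : set V) (f : V -> W) := forall k, Ck k O f.

Lemma smooth_diff V W (O : set V) (f : V -> W) x : smooth O f -> O x -> differentiable f x.
Proof. by move=> H Ox; exact: (proj1 (H 1%N) x Ox). Qed.

Lemma smooth_derive V W (O : set V) (f : V -> W) w : smooth O f -> smooth O (fun x => 'D_w f x).
Proof. by move=> H k; have [_] := H k.+1; apply. Qed.

Lemma smooth_cont V W (O : set V) (f : V -> W) x : smooth O f -> O x -> {for x, continuous f}.
Proof. by move=> H; exact: (H 0%N). Qed.

Lemma smooth_smooth_on V W (O : set V) (f : V -> W) : open O -> smooth O f -> smooth_on O f.
Proof. by move=> oO H x Ox; exists O, f; split. Qed.

Lemma smooth_on_smooth V W (O : set V) (f : V -> W) : open O -> smooth_on O f -> smooth O f.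
Proof.
move=> oO H k; apply: Ck_loc => x Ox; have [P [F [oP Px HF FE]]] := H x Ox.
exists (O `&` P) => //; apply: (@Ck_ext _ _ _ k _ F); [exact: openI| |].
  by move=> y /FE.
by apply: Ck_sub (HF k) => y [].
Qed.

Lemma smooth_on_sub V W (A B : set V) (f : V -> W) : A `<=` B -> smooth_on B f -> smooth_on A f.
Proof.
move=> AB H x /AB /H [P [F [oP Px HF FE]]]; exists P, F; split=> // y [Ay Py].
by apply: FE; split=> //; exact: AB.
Qed.

Lemma smooth_on_comp V X m (A : set V) (B : set 'rV[R]_m) (f : V -> 'rV[R]_m) (g : 'rV[R]_m -> X) :
  (forall x, A x -> B (f x)) ->
  smooth_on A f -> smooth_on B g -> smooth_on A (fun x => g (f x)).
Proof.
move=> AB Hf Hg x Ax; have [Q [F [oO Ox HF FE]]] := Hf x Ax.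
have [P [G [oP Px HG GE]]] := Hg (f x) (AB _ Ax).
have oO' : open (Q `&` F @^-1` P).
  rewrite openE => y [Oy /= Py]; apply: filterI; first exact: (open_nbhs_nbhs (conj oO Oy)).
  by apply: (HF 0%N y Oy); exact: (open_nbhs_nbhs (conj oP Py)).
exists (Q `&` F @^-1` P), (fun y => G (F y)); split=> //.
- by split=> //=; rewrite FE.
- by move=> k; apply: (Ck_comp (P := P)) (HG k) => //; [move=> y []| apply: Ck_sub (HF k) => y []].
- by move=> y [Ay [Oy /= Py]]; rewrite FE ?GE //; split=> //; [exact: AB| rewrite -FE].
Qed.

Lemma smooth_on_comp1 V X (A : set V) (B : set R) (f : V -> R) (g : R -> X) :
  (forall x, A x -> B (f x)) ->
  smooth_on A f -> smooth_on B g -> smooth_on A (fun x => g (f x)).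
Proof.
move=> AB Hf Hg x Ax; have [Q [F [oO Ox HF FE]]] := Hf x Ax.
have [P [G [oP Px HG GE]]] := Hg (f x) (AB _ Ax).
have oO' : open (Q `&` F @^-1` P).
  rewrite openE => y [Oy /= Py]; apply: filterI; first exact: (open_nbhs_nbhs (conj oO Oy)).
  by apply: (HF 0%N y Oy); exact: (open_nbhs_nbhs (conj oP Py)).
exists (Q `&` F @^-1` P), (fun y => G (F y)); split=> //.
- by split=> //=; rewrite FE.
- by move=> k; apply: (Ck_comp1 (P := P)) (HG k) => //; [move=> y []| apply: Ck_sub (HF k) => y []].
- by move=> y [Ay [Oy /= Py]]; rewrite FE ?GE //; split=> //; [exact: AB| rewrite -FE].
Qed.

End Comp.

(** * The inverse function theorem *)

(** Completeness of the spaces of matrices, on which the contraction in [local_solve] relies. *)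
HB.instance Definition _ (R : realType) (m n : nat) :=
  Uniform_isComplete.Build 'M[R]_(m, n) (@cauchy_cvg 'M[R]_(m, n)).

Section Inverse.
Context {R : realType}.

Lemma rV_coord_norm m n (u : 'M[R]_(m, n)) i j : `|u i j| <= `|u|.
Proof.
rewrite [leRHS]/Num.Def.normr /= mx_normrE; apply: le_trans; last exact: (le_bigmax _ _ (i, j)).
by [].
Qed.

Lemma rV_norm_le m n (u : 'M[R]_(m, n)) (e : R) : 0 <= e ->
  (forall i j, `|u i j| <= e) -> `|u| <= e.
Proof.
by move=> e0 H; rewrite [leLHS]/Num.Def.normr /= mx_normrE; apply: bigmax_le.
Qed.

Lemma mulmx_norm_le m n (B : 'M[R]_(m, n)) :
  exists2 K : R, 0 < K & forall u : 'rV_m, `|u *m B| <= K * `|u|.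
Proof.
exists (1 + \sum_i \sum_j `|B i j|).
  by rewrite ltr_pwDl // sumr_ge0 // => i _; rewrite sumr_ge0.
move=> u; apply: rV_norm_le => [|i j].
  by rewrite mulr_ge0 // addr_ge0 // sumr_ge0 // => i _; rewrite sumr_ge0.
rewrite mxE; apply: le_trans (ler_norm_sum _ _ _) _.
rewrite mulrDl mul1r; apply: le_trans (_ : (\sum_i0 \sum_j0 `|B i0 j0|) * `|u| <= _);
  last by rewrite lerDr.
rewrite mulr_suml; apply: ler_sum => k _; rewrite normrM mulrC.
apply: ler_pM => //; last exact: rV_coord_norm.
by rewrite (bigD1 j) //= lerDl sumr_ge0.
Qed.

Lemma inj_unitmx n (B : 'M[R]_n) : (forall u : 'rV_n, u *m B = 0 -> u = 0) -> B \in unitmx.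
Proof.
move=> H; rewrite -row_free_unit -kermx_eq0; apply/eqP/eqP/rowV0P => u.
by move=> /sub_kermxP /H.
Qed.

Lemma is_derive_line (V : normedModType R) (y u : V) (t : R) :
  is_derive t (1 : R) (fun s : R => y + s *: u) u.
Proof.
split; first by apply: diff_derivable; apply: differentiableD => //; apply: differentiableZl.
rewrite deriveD //; last by apply: diff_derivable; apply: differentiableZl.
rewrite derive_cst add0r.
have [_ ->] := diff_scale (a := fun s : R => s) (g := fun _ : R => u) (1 : R) (x := t) ltac:(done)
  ltac:(done).
by rewrite derive_id derive_cst scaler0 addr0 scale1r.
Qed.

(** The mean value theorem on the segment from y to x, for f minus its linear part at x0, bounds the
    remainder by the oscillation of the partial derivatives near x0. The estimate is uniform in both
    points, as an inverse function argument requires. *)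
Lemma strict_diff1 m (O : set 'rV[R]_m) (f : 'rV[R]_m -> R) x0 (e : R) :
  open O -> O x0 -> Ck 1 O f -> 0 < e ->
  exists2 d : R, 0 < d & forall x y, `|x - x0| <= d -> `|y - x0| <= d ->
    [/\ O x, O y & `|f x - f y - 'D_(x - y) f x0| <= e * `|x - y|].
Proof.
move=> oO Ox0 [df Df] e0.
(* Each of the m partial derivatives gets the share e / (m + 1); the extra 1 keeps the denominator
   nonzero when m = 0. *)
have e'0 : 0 < e / (m%:R + 1) by rewrite divr_gt0 // ltr_wpDl // ler0n.
have N : \forall x \near x0, O x /\ forall i : 'I_m,
    `|'D_(delta_mx 0 i) f x0 - 'D_(delta_mx 0 i) f x| < e / (m%:R + 1).
  have N1 : \forall x \near x0, forall i : 'I_m,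
      `|'D_(delta_mx 0 i) f x0 - 'D_(delta_mx 0 i) f x| < e / (m%:R + 1).
    refine (@filter_forall _ _ (fun (i : 'I_m) (x : 'rV[R]_m) => `|'D_(delta_mx 0 i) f x0 -
      'D_(delta_mx 0 i) f x| < e / (m%:R + 1)) (nbhs x0) (nbhs_filter x0) _) => i.
    by have /cvgrPdist_lt /(_ _ e'0) := Df (delta_mx 0 i) x0 Ox0.
  by move: (open_nbhs_nbhs (conj oO Ox0)); apply: filterS2 N1 => x Hx Ox; split.
have /nbhs_ballP [d /= d0 dB] := N.
have dBn x : `|x - x0| < d -> O x /\ forall i : 'I_m,
    `|'D_(delta_mx 0 i) f x0 - 'D_(delta_mx 0 i) f x| < e / (m%:R + 1).
  by move=> H; apply: dB; rewrite -ball_normE /= distrC.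
exists (d / 2); first by rewrite divr_gt0.
move=> x y xd yd; have hd : d / 2 < d by rewrite ltr_pdivrMr // ltr_pMr // ltr1n.
have [Ox _] := dBn x (le_lt_trans xd hd); have [Oy _] := dBn y (le_lt_trans yd hd).
split=> //.
pose g (t : R) := f (y + t *: (x - y)) - t * 'D_(x - y) f x0.
have In (t : R) : 0 <= t <= 1 -> `|y + t *: (x - y) - x0| < d.
  move=> /andP[t0 t1]; have -> : y + t *: (x - y) - x0 = (1 - t) *: (y - x0) + t *: (x - x0).
    by rewrite !scalerBr !scalerBl !scale1r; apply/matrixP => i j; rewrite !mxE; ring.
  apply: le_lt_trans (ler_normD _ _) _; rewrite !normrZ (ger0_norm t0) ger0_norm ?subr_ge0 //.
  apply: le_lt_trans hd; have -> : d / 2 = (1 - t) * (d / 2) + t * (d / 2) by ring.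
  by apply: lerD; apply: ler_wpM2l; rewrite ?subr_ge0.
pose g' (t : R) := 'D_(x - y) f (y + t *: (x - y)) - 'D_(x - y) f x0.
have dg (t : R) : 0 <= t <= 1 -> is_derive t (1 : R) g (g' t).
  move=> t01; have [Ot _] := dBn _ (In t t01).
  have dl := is_derive_line y (x - y) t.
  have dD : differentiable (fun s : R => y + s *: (x - y)) t.
    by apply/derivable1_diffP; case: dl.
  have D2 : is_derive t (1 : R) (fun s : R => f (y + s *: (x - y))) ('D_(x - y) f (y + t *: (x - y))).
    split; first by apply: diff_derivable; apply: (differentiable_comp dD); exact: df.
    by rewrite (derive_comp (1 : R) dD) ?derive_val //; exact: df.
  have D3 : is_derive t (1 : R) (fun s : R => s * 'D_(x - y) f x0) ('D_(x - y) f x0).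
    have := is_derive_line 0 ('D_(x - y) f x0) t; congr is_derive.
    by apply/funext => s; rewrite add0r.
  exact: is_deriveB.
have [] := @MVT _ g g' 0 1 ltr01.
- by move=> t /[!in_itv] /= /andP[t0 t1]; apply: dg; rewrite !ltW.
- apply: continuous_in_subspaceT => t /set_mem /= /[!in_itv] /= t01.
  by apply: differentiable_continuous; apply/derivable1_diffP; case: (dg t t01).
move=> t /[!in_itv] /= /andP[t0 t1].
have yx : y + (x - y) = x by rewrite addrC subrK.
rewrite subr0 mulr1 {1 2}/g scale1r scale0r addr0 mul1r mul0r subr0 yx => E.
have -> : f x - f y - 'D_(x - y) f x0 = g' t by rewrite -E addrAC.
have [Ot Dt] := dBn _ (In t ltac:(by rewrite !ltW)).
rewrite /g' [X in 'D_X f (y + _)]row_sum_delta [X in 'D_X f x0]row_sum_delta.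
rewrite !derive_sumv; [|exact: df|exact: df].
rewrite -sumrB; apply: le_trans (ler_norm_sum _ _ _) _.
have -> : e * `|x - y| = \sum_(i < m) (e / (m%:R + 1)) * `|x - y| + e / (m%:R + 1) * `|x - y|.
  rewrite sumr_const card_ord -mulr_natr.
  have : (m%:R + 1 : R) != 0 by rewrite gt_eqF // ltr_wpDl // ler0n.
  by move=> ?; field.
rewrite -[leLHS]addr0; apply: lerD; last by rewrite mulr_ge0 // ltW.
apply: ler_sum => i _; rewrite -scalerBr normrZ mulrC; apply: ler_pM => //.
  by rewrite distrC ltW.
exact: rV_coord_norm.
Qed.

Lemma strict_diff m p (O : set 'rV[R]_m) (f : 'rV[R]_m -> 'rV[R]_p) x0 (e : R) :
  open O -> O x0 -> Ck 1 O f -> 0 < e ->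
  exists2 d : R, 0 < d & forall x y, `|x - x0| <= d -> `|y - x0| <= d ->
    [/\ O x, O y & `|f x - f y - 'D_(x - y) f x0| <= e * `|x - y|].
Proof.
move=> oO Ox0 Hf e0; have [df _] := Hf.
have H i := strict_diff1 oO Ox0 (Ck_coord (ord0 : 'I_1) i oO Hf) e0.
have [d0 d00 d0O] := strict_diff1 oO Ox0 (Ck_cst 1 O (0 : R)) e0.
have /choice [D HD] : forall i : 'I_p, exists d : R, 0 < d /\ forall x y, `|x - x0| <= d -> `|y -
  x0| <= d ->
    [/\ O x, O y & `|f x ord0 i - f y ord0 i - 'D_(x - y) (fun x => f x ord0 i) x0| <= e * `|x - y|].
  by move=> i; have [d1 d10 Hd] := H i; exists d1.
have Dgt i : 0 < D i by have [] := HD i.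
pose d := \big[Num.min/d0]_(i < p) D i.
have dgt : 0 < d by rewrite /d; apply: (@big_ind _ (fun x : R => 0 < x)) => // a b;
  rewrite lt_min => -> ->.
exists d => // x y xd yd.
have dd0 : d <= d0 by apply: bigmin_le_id.
have [Ox Oy _] := d0O x y (le_trans xd dd0) (le_trans yd dd0); split=> //.
apply: rV_norm_le => [|i j]; first by rewrite mulr_ge0 // ltW.
rewrite ord1.
have di : d <= D j by apply: bigmin_le_cond.
have [_ /(_ x y (le_trans xd di) (le_trans yd di))] := HD j.
case=> _ _; rewrite !mxE; congr (`|_ - _| <= _).
have cd : differentiable (coordl ord0 j) (f x0) by apply: linear_differentiable;
  exact: coordl_continuous.
rewrite (derive_comp (g := coordl ord0 j) (x - y) (df _ Ox0) cd).
by rewrite derive_clin //; exact: coordl_continuous.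
Qed.

(** A solution of f x = z is a fixed point of x - (f x - z) B^-1, which contracts by 1/2 since f
    differs from B by a map of Lipschitz constant 1 / (2 K), where K bounds the inverse of B. The
    ball of radius d is mapped into itself because z is within d / (2 K) of f x0. *)
Lemma local_solve m (f : 'rV[R]_m.+1 -> 'rV[R]_m.+1) (B : 'M[R]_m.+1) x0 (d K : R) :
  B \in unitmx -> 0 < d -> 0 < K -> (forall u : 'rV_m.+1, `|u *m invmx B| <= K * `|u|) ->
  (forall x y, `|x - x0| <= d -> `|y - x0| <= d ->
     `|f x - f y - (x - y) *m B| <= (2 * K)^-1 * `|x - y|) ->
  (forall x y, `|x - x0| <= d -> `|y - x0| <= d -> `|x - y| <= 2 * K * `|f x - f y|) /\
  (forall z, `|z - f x0| <= d / (2 * K) -> exists2 x, `|x - x0| <= d & f x = z).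
Proof.
move=> uB d0 K0 HK Hf.
have K2 : 0 < 2 * K by rewrite mulr_gt0.
have key x y : `|x - x0| <= d -> `|y - x0| <= d ->
    `|(f x - f y - (x - y) *m B) *m invmx B| <= 2^-1 * `|x - y|.
  move=> xd yd; apply: le_trans (HK _) _.
  have -> : 2^-1 * `|x - y| = K * ((2 * K)^-1 * `|x - y|).
    by field; rewrite gt_eqF.
  by apply: ler_wpM2l; [exact: ltW | exact: Hf].
split=> [x y xd yd|z zd].
  have E : x - y = (f x - f y) *m invmx B - (f x - f y - (x - y) *m B) *m invmx B.
    by rewrite -mulmxBl subKr mulmxK.
  have := key x y xd yd; have := HK (f x - f y).
  have : `|x - y| <= `|(f x - f y) *m invmx B| + `|(f x - f y - (x - y) *m B) *m invmx B|.
    by rewrite {1}E; exact: ler_normB.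
  lra.
pose T x := x - (f x - z) *m invmx B.
have TT x y : `|x - x0| <= d -> `|y - x0| <= d -> `|T x - T y| <= 2^-1 * `|x - y|.
  move=> xd yd; rewrite -normrN; have -> : - (T x - T y) = (f x - f y - (x - y) *m B) *m invmx B.
    rewrite mulmxBl mulmxK // /T !mulmxBl.
    by apply/matrixP => i j; rewrite !mxE; ring.
  exact: key.
pose U := [set x : 'rV[R]_m.+1 | `|x - x0| <= d].
have Ux0 : U x0 by rewrite /U /= subrr normr0 ltW.
have TU : set_fun U U T.
  move=> x Ux; rewrite /U /=.
  have -> : T x - x0 = (T x - T x0) + (T x0 - x0) by rewrite addrA subrK.
  apply: le_trans (ler_normD _ _) _.
  have h1 := TT x x0 Ux Ux0.
  have h2 : `|T x0 - x0| <= d / 2.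
    have -> : T x0 - x0 = - ((f x0 - z) *m invmx B) by rewrite /T addrC addKr.
    rewrite normrN; apply: le_trans (HK _) _; rewrite -[`|f x0 - z|]normrN opprB.
    have -> : d / 2 = K * (d / (2 * K)) by field; rewrite gt_eqF.
    by apply: ler_wpM2l => //; exact: ltW.
  move: Ux; rewrite /U /= => Ux; lra.
pose Tf : {fun U >-> U} := HB.pack T (isFun.Build _ _ U U T TU).
have ct : is_contraction Tf.
  exists (2^-1)%:nng; split; first by rewrite /= invf_lt1 ?ltr1n.
  by move=> [x y] [/= Ux Uy]; exact: TT.
have clU : closed U.
  have -> : U = closed_ball_ (fun x => `|x|) x0 d.
    by apply/seteqP; split=> x; rewrite /U /closed_ball_ /= distrC.
  exact: closed_closed_ball_.
have [x Ux Ex] := banach_fixed_point ct clU ltac:(by exists x0).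
exists x => //.
have : (f x - z) *m invmx B = 0.
  have : x - T x = (f x - z) *m invmx B by rewrite /T opprB addrC subrK.
  by move=> <-; rewrite [X in X - _]Ex subrr.
move=> /(congr1 (mulmx^~ B)); rewrite mulmxKV // mul0mx => /eqP; rewrite subr_eq0 => /eqP //.
Qed.

End Inverse.

Section InverseFunction.
Context {R : realType}.

Lemma Ck_prod (V : normedModType R) k (O : set V) I (r : seq I) (f : I -> V -> R) : open O ->
  (forall i, Ck k O (f i)) -> Ck k O (fun x => \prod_(i <- r) f i x).
Proof.
move=> oO H; elim: r => [|i r IH].
  have -> : (fun x => \prod_(i <- [::]) f i x) = (fun _ => 1 : R).
    by apply/funext => x; rewrite big_nil.
  exact: Ck_cst.
have -> : (fun x => \prod_(j <- i :: r) f j x) = (fun x => f i x * \prod_(j <- r) f j x).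
  by apply/funext => x; rewrite big_cons.
exact: Ck_mulr.
Qed.

Lemma Ck_det (V : normedModType R) k (O : set V) n (M : V -> 'M[R]_n) : open O ->
  (forall i j, Ck k O (fun x => M x i j)) -> Ck k O (fun x => \det (M x)).
Proof.
move=> oO H; apply: Ck_sum => // s _.
by apply: Ck_mulr => //; [exact: Ck_cst | exact: Ck_prod].
Qed.

(** Cramer's rule: the entries of the inverse are quotients of polynomials in the entries of M. *)
Lemma Ck_invmx (V : normedModType R) k (O : set V) n (M : V -> 'M[R]_n) : open O ->
  (forall x, O x -> M x \in unitmx) ->
  (forall i j, Ck k O (fun x => M x i j)) ->
  forall i j, Ck k O (fun x => invmx (M x) i j).
Proof.
move=> oO uM H i j.
apply: (@Ck_ext _ _ _ _ _ (fun x => (\det (M x))^-1 * ((-1) ^+ (j + i) * \det (row' j (col' i (M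
  x)))))) => //.
  by move=> x /uM ux; rewrite /invmx ux !mxE /cofactor.
apply: Ck_mulr => //.
  apply: Ck_inv => //; last exact: Ck_det.
  by move=> x /uM; rewrite unitmxE unitfE.
apply: Ck_mulr => //; first exact: Ck_cst.
apply: Ck_det => // a b.
have -> : (fun x => row' j (col' i (M x)) a b) = (fun x => M x (lift j a) (lift i b)).
  by apply/funext => x; rewrite !mxE.
exact: H.
Qed.

Section InvFun.
Variables (m : nat) (C D : set 'rV[R]_m.+1) (f g : 'rV[R]_m.+1 -> 'rV[R]_m.+1).
Hypotheses (oC : open C) (oD : open D) (sf : smooth C f).
Hypotheses (fC : forall x, C x -> D (f x) /\ g (f x) = x).
Hypotheses (gD : forall y, D y -> C (g y) /\ f (g y) = y).
Hypothesis df0 : forall x h, C x -> 'D_h f x = 0 -> h = 0.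

Let J x : 'M[R]_m.+1 := \matrix_i 'D_(delta_mx 0 i) f x.

Lemma derive_jac x h : C x -> 'D_h f x = h *m J x.
Proof.
move=> Cx; rewrite {1}[h]row_sum_delta derive_sumv; last exact: smooth_diff sf Cx.
by rewrite mulmx_sum_row; apply: eq_bigr => i _; rewrite rowK.
Qed.

Lemma jac_unit x : C x -> J x \in unitmx.
Proof. by move=> Cx; apply: inj_unitmx => u; rewrite -derive_jac //; exact: df0. Qed.

(** [local_solve] yields a preimage of y near g y0; as f is injective on C, this preimage is g y. *)
Lemma inv_lipschitz y0 : D y0 ->
  exists2 L : R, 0 < L & \forall y \near y0, D y /\ `|g y - g y0| <= L * `|y - y0|.
Proof.
move=> Dy0; have [Cx fx] := gD Dy0; set x0 := g y0 in Cx fx *.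
have uJ := jac_unit Cx.
have [K K0 HK] := mulmx_norm_le (invmx (J x0)).
have e0 : 0 < (2 * K)^-1 by rewrite invr_gt0 mulr_gt0.
have [d d0 Hd] := strict_diff oC Cx (sf 1) e0.
have Hd' x y : `|x - x0| <= d -> `|y - x0| <= d ->
     `|f x - f y - (x - y) *m J x0| <= (2 * K)^-1 * `|x - y|.
  by move=> xd yd; rewrite -derive_jac //; have [] := Hd x y xd yd.
have [Hi Hs] := local_solve uJ d0 K0 HK Hd'.
exists (2 * K); first by rewrite mulr_gt0.
have dK : 0 < d / (2 * K) by rewrite divr_gt0 // mulr_gt0.
have N := @nbhsx_ballx _ _ y0 _ dK.
have N2 := open_nbhs_nbhs (conj oD Dy0).
apply: filterS2 N N2 => y; rewrite -ball_normE /= distrC -fx => yd Dy; split=> //.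
have [x xd fxy] := Hs y (ltW yd).
have [Cx' _ _] := Hd x x xd xd.
have gy : g y = x by rewrite -fxy; exact: (proj2 (fC Cx')).
rewrite gy -fxy; apply: Hi => //.
by rewrite subrr normr0 ltW.
Qed.

Lemma inv_diff y0 : D y0 -> differentiable g y0 /\ forall u, 'D_u g y0 = u *m invmx (J (g y0)).
Proof.
move=> Dy0; have [Cx fx] := gD Dy0; set x0 := g y0 in Cx fx *.
have uJ := jac_unit Cx.
have [K K0 HK] := mulmx_norm_le (invmx (J x0)).
have [L L0 HL] := inv_lipschitz Dy0.
pose A : {linear 'rV[R]_m.+1 -> 'rV[R]_m.+1} := mulmxr (invmx (J x0)).
have Ac : continuous A.
  move=> x; apply: differentiable_continuous.
  have sA : smooth setT A.
    move=> k; apply: Ck_rV; first exact: openT.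
    move=> i; apply: (Ck_ext (f := fun x => \sum_j coordl ord0 j x * invmx (J x0) j i)) => //;
      first exact: openT.
      by move=> y _; rewrite mxE.
    apply: Ck_sum => [|j _]; first exact: openT.
    apply: Ck_mulr; [exact: openT | | exact: Ck_cst].
    by apply: Ck_lin; exact: coordl_continuous.
  exact: (smooth_diff sA).
have H (e : R) : 0 < e -> \forall h \near (0 : 'rV[R]_m.+1), `|g (h + y0) - g y0 - A h| <= e * `|h|.
  move=> e0; have e1 : 0 < e / (K * L) by rewrite divr_gt0 // mulr_gt0.
  have [d d0 Hd] := strict_diff oC Cx (sf 1) e1.
  have N1 : \forall h \near (0 : 'rV[R]_m.+1), D (h + y0) /\ `|g (h + y0) - x0| <= L * `|h|.
    move: HL; rewrite (near_shift 0 y0) /=; apply: filterS => h /=.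
    by rewrite subr0 addrK.
  have N2 : \forall h \near (0 : 'rV[R]_m.+1), L * `|h| <= d.
    have dL : 0 < d / L by rewrite divr_gt0.
    have := @nbhsx_ballx _ _ (0 : 'rV[R]_m.+1) _ dL; apply: filterS => h.
    rewrite -ball_normE /= sub0r normrN => /ltW.
    by rewrite ler_pdivlMr // mulrC.
  apply: filterS2 N1 N2 => h [Dh gh] Lh.
  have [Ch fh] := gD Dh; set x := g (h + y0) in Ch fh gh *.
  have xd : `|x - x0| <= d by exact: le_trans gh Lh.
  have x0d : `|x0 - x0| <= d by rewrite subrr normr0 ltW.
  have [_ _ Hx] := Hd x x0 xd x0d.
  rewrite derive_jac // fh fx addrK in Hx.
  have -> : x - x0 - A h = - ((h - (x - x0) *m J x0) *m invmx (J x0)).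
    by rewrite /A /= mulmxBl mulmxK // opprB.
  rewrite normrN; apply: le_trans (HK _) _.
  apply: le_trans (_ : K * (e / (K * L) * (L * `|h|)) <= _).
    apply: ler_wpM2l; first exact: ltW.
    by apply: le_trans Hx _; apply: ler_wpM2l => //; exact: ltW.
  by rewrite le_eqVlt; apply/orP; left; apply/eqP; field; rewrite !gt_eqF.
have [dg dE] := differentiable_eps Ac H.
by split=> // u; rewrite deriveE // dE.
Qed.

(** Induction on the order: the derivative of g is the inverse Jacobian of f composed with g, so it
    is as regular as g. *)
Lemma inv_smooth : smooth D g.
Proof.
elim=> [|k IH]; first by move=> y /inv_diff [/differentiable_continuous].
split=> [y /inv_diff [] //|u].
have HK : Ck k C (fun x => u *m invmx (J x)).
  apply: Ck_rV => // i.
  apply: (Ck_ext (f := fun x => \sum_j u ord0 j * invmx (J x) j i)) => //.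
    by move=> y _; rewrite mxE.
  apply: Ck_sum => // j _; apply: Ck_mulr; [by []|exact: Ck_cst|].
  apply: Ck_invmx => // [x|a b]; first exact: jac_unit.
  have -> : (fun x => J x a b) = (fun x => 'D_(delta_mx 0 a) f x ord0 b).
    by apply/funext => x; rewrite mxE.
  by apply: Ck_coord => //; exact: smooth_derive.
apply: (Ck_ext (f := fun y => u *m invmx (J (g y)))) => //.
  by move=> y /inv_diff [_ ->].
by apply: (Ck_comp (P := C) (g := fun x => u *m invmx (J x))) => // y /gD [].
Qed.

End InvFun.

(** The indicator of P, composed with the retraction [cl] of the line onto [0, b], has derivative 0
    everywhere and is therefore constant. *)
Lemma locally_constant (P : R -> Prop) (b : R) : 0 <= b ->
  (forall t, 0 <= t <= b -> \forall s \near t, 0 <= s <= b -> (P s <-> P t)) ->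
  P 0 -> P b.
Proof.
move=> b0 H P0.
pose cl (t : R) := Num.max 0 (Num.min t b).
have clc : continuous cl.
  move=> t; apply: (@continuous_max R R (fun=> 0) (fun x => Num.min x b)); first exact: cvg_cst.
  by apply: (@continuous_min R R id (fun=> b)); [exact: cvg_id|exact: cvg_cst].
have cl01 t : 0 <= cl t <= b.
  by rewrite /cl le_max lexx /= ge_max b0 ge_min lexx orbT.
pose phi (t : R) : R := if `[< P (cl t) >] then 1 else 0.
have dphi x : is_derive x (1 : R) phi 0.
  have dc : is_derive x (1 : R) (fun _ : R => phi x) 0 by split;
    [apply: derivable_cst|rewrite derive_cst].
  apply: near_eq_is_derive dc.
  have N : \forall s \near x, P (cl s) <-> P (cl x).
    have N0 : nbhs x (cl @^-1` [set s | 0 <= s <= b -> (P s <-> P (cl x))]) :=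
      clc x _ (H (cl x) (cl01 x)).
    by move: N0; apply: filterS => s /=; apply.
  apply: filterS N => s E; rewrite /phi /=.
  by congr (if _ then _ else _); apply/asboolP/asboolP => /E.
have := @is_derive_0_is_cst _ phi 0 b dphi.
have cl0 : cl 0 = 0 by rewrite /cl min_l // maxxx.
have clb : cl b = b by rewrite /cl minxx max_r.
rewrite /phi cl0 clb; case: asboolP => // _; case: asboolP => // _ /eqP.
by rewrite oner_eq0.
Qed.

End InverseFunction.

(** * Uniqueness along a homotopy *)

Section Homotopy.
Context {R : realType} {m : nat}.
Local Notation V := 'rV[R]_m.+1.
Variables (C : set V) (w : V -> V) (a b : R -> R) (z : V).
Hypotheses (oC : open C) (sw : smooth C w) (ca : continuous a) (cb : continuous b).

Let G (t : R) (x : V) : V := a t *: x + b t *: w x.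

Lemma near_within (f : R -> R) (t0 e : R) : continuous f -> 0 < e ->
  \forall t \near t0, `|f t - f t0| < e.
Proof.
move=> cf e0; have /cvgrPdist_lt /(_ _ e0) := cf t0.
by apply: filterS => t; rewrite distrC.
Qed.

(** Near x0, every G t with t close to t0 is a small Lipschitz perturbation of the invertible
    differential B of G t0, so [local_solve] applies on one ball for all these t. *)
Lemma local_continuation t0 x0 d0 : C x0 -> G t0 x0 = z ->
  (forall h, a t0 *: h + b t0 *: 'D_h w x0 = 0 -> h = 0) -> 0 < d0 ->
  exists d, [/\ 0 < d, d <= d0, forall x, `|x - x0| <= d -> C x &
    \forall t \near t0, exists x, [/\ `|x - x0| <= d, G t x = z &
      forall y, `|y - x0| <= d -> G t y = z -> y = x]].
Proof.
move=> Cx0 Gx0 Hinj d00.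
pose Jw : 'M[R]_m.+1 := \matrix_i 'D_(delta_mx 0 i) w x0.
have dwE h : 'D_h w x0 = h *m Jw.
  rewrite {1}[h]row_sum_delta derive_sumv; last exact: smooth_diff sw Cx0.
  by rewrite mulmx_sum_row; apply: eq_bigr => i _; rewrite rowK.
pose B := (a t0)%:M + b t0 *: Jw.
have BE h : h *m B = a t0 *: h + b t0 *: 'D_h w x0.
  by rewrite /B mulmxDr mul_mx_scalar -scalemxAr dwE.
have uB : B \in unitmx by apply: inj_unitmx => u; rewrite BE; exact: Hinj.
have [K K0 HK] := mulmx_norm_le (invmx B).
have [L L0 HL] := mulmx_norm_le Jw.
pose b1 := `|b t0| + 1; have b10 : 0 < b1 by rewrite ltr_wpDl.
(* The deviation of G t from B comes from the change of a, the remainder of w and the change of b;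
   each is allowed a third of the 1 / (2 K) of [local_solve], whence the 6. *)
have e0 : 0 < (6 * K * b1)^-1 by rewrite invr_gt0 !mulr_gt0.
have [d1 d10 Hd1] := strict_diff oC Cx0 (sw 1) e0.
pose d := Num.min d0 d1; have d_gt0 : 0 < d by rewrite /d lt_min d00 d10.
have dd0 : d <= d0 by rewrite /d ge_min lexx.
have dd1 : d <= d1 by rewrite /d ge_min lexx orbT.
have dC x : `|x - x0| <= d -> C x.
  by move=> xd; have [] := Hd1 x x (le_trans xd dd1) (le_trans xd dd1).
exists d; split=> //.
have K6 : 0 < (6 * K)^-1 by rewrite invr_gt0 mulr_gt0.
have KL6 : 0 < (6 * K * L)^-1 by rewrite invr_gt0 !mulr_gt0.
pose M := `|x0| + `|w x0| + 1; have M0 : 0 < M by rewrite ltr_wpDl // addr_ge0.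
(* This bounds the distance of G t x0 from z by d / (2 K), one half for each coefficient. *)
have dKM : 0 < d / (2 * K) / (2 * M) by rewrite !divr_gt0 // mulr_gt0.
have Na := near_within t0 ca K6; have Nb := near_within t0 cb KL6.
have Nb1 := near_within t0 cb (@ltr01 R).
have Na2 := near_within t0 ca dKM; have Nb2 := near_within t0 cb dKM.
near=> t.
have ha : `|a t - a t0| < (6 * K)^-1 by near: t.
have hb : `|b t - b t0| < (6 * K * L)^-1 by near: t.
have hb1 : `|b t| <= b1.
  have h1 : `|b t - b t0| < 1 by near: t.
  by rewrite /b1 -(subrK (b t0) (b t)) addrC; apply: le_trans (ler_normD _ _) _; rewrite lerD2l ltW.
have ha2 : `|a t - a t0| < d / (2 * K) / (2 * M) by near: t.
have hb2 : `|b t - b t0| < d / (2 * K) / (2 * M) by near: t.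
have Hs x y : `|x - x0| <= d -> `|y - x0| <= d ->
     `|G t x - G t y - (x - y) *m B| <= (2 * K)^-1 * `|x - y|.
  move=> xd yd; have [_ _ Hxy] := Hd1 x y (le_trans xd dd1) (le_trans yd dd1).
  have -> : G t x - G t y - (x - y) *m B = (a t - a t0) *: (x - y) +
      b t *: (w x - w y - 'D_(x - y) w x0) + (b t - b t0) *: 'D_(x - y) w x0.
    by rewrite BE /G; apply/matrixP => i j; rewrite !mxE; ring.
  apply: le_trans (ler_normD _ _) _.
  have -> : (2 * K)^-1 * `|x - y| = (6 * K)^-1 * `|x - y| + b1 * ((6 * K * b1)^-1 * `|x - y|)
     + (6 * K * L)^-1 * (L * `|x - y|) by field; rewrite !gt_eqF.
  apply: lerD; first (apply: le_trans (ler_normD _ _) _; apply: lerD); rewrite normrZ.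
  - by apply: ler_wpM2r => //; exact: ltW.
  - by apply: ler_pM.
  - by apply: ler_pM => //; [exact: ltW | rewrite dwE].
have [Hi Hsv] := local_solve uB d_gt0 K0 HK Hs.
have zd : `|z - G t x0| <= d / (2 * K).
  rewrite -Gx0 /G; have -> : a t0 *: x0 + b t0 *: w x0 - (a t *: x0 + b t *: w x0)
     = - ((a t - a t0) *: x0 + (b t - b t0) *: w x0).
    by apply/matrixP => i j; rewrite !mxE; ring.
  rewrite normrN; apply: le_trans (ler_normD _ _) _; rewrite !normrZ.
  have -> : d / (2 * K) = d / (2 * K) / (2 * M) * M + d / (2 * K) / (2 * M) * M.
    by field; rewrite !gt_eqF.
  apply: lerD; apply: ler_pM => //; [exact: ltW| |exact: ltW|].
    by rewrite /M -addrA lerDl addr_ge0.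
  by rewrite /M addrC addrA lerDr addr_ge0.
have [x xd Gx] := Hsv z zd.
exists x; split=> // y yd Gy.
apply/eqP; rewrite -subr_eq0 -normr_le0.
by apply: le_trans (Hi y x yd xd) _; rewrite Gy Gx subrr normr0 mulr0.
Unshelve. all: by end_near. Qed.

Lemma G_continuous t0 x0 : C x0 -> {for (x0, t0), continuous (fun p : V * R => G p.2 p.1)}.
Proof.
move=> Cx0.
have c1 : {for (x0, t0), continuous (fun p : V * R => p.1)} by exact: cvg_fst.
have c2 : {for (x0, t0), continuous (fun p : V * R => p.2)} by exact: cvg_snd.
apply: continuousD; apply: continuousZ => //.
- by apply: continuous_comp => //; exact: ca.
- by apply: continuous_comp => //; exact: cb.
- by apply: (@continuous_comp _ _ _ (fun p : V * R => p.1) w) => //; exact: (smooth_cont sw).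
Qed.

(** Tube lemma: around each x of K the map stays off z for nearby points and times, and compactness
    makes the neighbourhood of t0 uniform in x. *)
Lemma tube (K : set V) t0 : compact K -> K `<=` C -> (forall x, K x -> G t0 x <> z) ->
  \forall t \near t0, forall x, K x -> G t x <> z.
Proof.
move=> /compact_near_coveringP cK KC H.
have := cK R (nbhs t0) (fun t x => G t x <> z) _; apply => x Kx.
have := @G_continuous t0 x (KC x Kx).
have o : open_nbhs (G t0 x) [set y | y <> z].
  split; last exact: H.
  have -> : [set y | y <> z] = ~` [set z] by [].
  by apply: closed_openC; apply: accessible_closed_set1; apply: hausdorff_accessible;
    exact: norm_hausdorff.
by move=> /(_ _ (open_nbhs_nbhs o)).
Qed.

(* The set of the t such that G t x = z has exactly one solution x is open and closed in [0, r1]: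
   [local_continuation] gives existence and local uniqueness, [tube] excludes other solutions. *)
Lemma homotopy_unique (K : set V) (r1 : R) : 0 <= r1 -> compact K -> K `<=` C ->
  (forall t x, 0 <= t <= r1 -> C x -> G t x = z -> K x) ->
  (forall t x h, 0 <= t <= r1 -> C x -> G t x = z -> a t *: h + b t *: 'D_h w x = 0 -> h = 0) ->
  let P t := exists x, [/\ C x, G t x = z & forall y, C y -> G t y = z -> y = x] in
  P 0 -> P r1.
Proof.
move=> r10 cK KC HK Hinj P; apply: locally_constant => // t0 t01.
have [Pt0|nPt0] := pselect (P t0).
  have [x0 [Cx0 Gx0 U0]] := Pt0.
  have [d [d0 _ dC N]] := local_continuation Cx0 Gx0 (fun h => Hinj t0 x0 h t01 Cx0 Gx0) ltr01.
  have cK' : compact (K `&` ~` ball x0 d).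
    by apply: compact_closedI => //; apply: open_closedC; exact: ball_open.
  have H' x : (K `&` ~` ball x0 d) x -> G t0 x <> z.
    move=> [Kx nb] Gx; apply: nb; rewrite (U0 x (KC x Kx) Gx); exact: ballxx.
  have N2 := tube cK' (fun x Hx => KC x (proj1 Hx)) H'.
  apply: filterS2 N N2 => t [x [xd Gx Ux]] H2 tr; split=> // _.
  exists x; split; [exact: dC|by []|] => y Cy Gy; apply: Ux => //.
  have [yb|nyb] := pselect (ball x0 d y).
    by move: yb; rewrite -ball_normE /= distrC => /ltW.
  by case: (H2 y) => //; split=> //; exact: HK tr Cy Gy.
(* Unique solvability fails at t0 either for want of a solution or because there are two; both
   situations persist for t near t0. *)
have [[x1 [Cx1 Gx1]]|nex] := pselect (exists x1, C x1 /\ G t0 x1 = z); last first.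
  have N := tube cK KC (fun x Kx Gx => nex (ex_intro _ x (conj (KC x Kx) Gx))).
  apply: filterS N => t H tr; split=> // -[x [Cx Gx _]].
  by case: (H x (HK t x tr Cx Gx)).
have [x2 [Cx2 Gx2 x12]] : exists x2, [/\ C x2, G t0 x2 = z & x2 <> x1].
  apply: contrapT => H; apply: nPt0; exists x1; split=> // y Cy Gy.
  by apply: contrapT => yx; apply: H; exists y.
(* A third of the distance keeps the two balls disjoint, so that the continued solutions remain
   distinct. *)
have dd : 0 < `|x2 - x1| / 3.
  by rewrite divr_gt0 // normr_gt0 subr_eq0; apply/eqP.
have [d1 [d10 d1d d1C N1]] := local_continuation Cx1 Gx1 (fun h => Hinj t0 x1 h t01 Cx1 Gx1) dd.
have [d2 [d20 d2d d2C N2]] := local_continuation Cx2 Gx2 (fun h => Hinj t0 x2 h t01 Cx2 Gx2) dd.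
apply: filterS2 N1 N2 => t [y1 [y1d Gy1 _]] [y2 [y2d Gy2 _]] tr; split=> // -[x [Cx Gx Ux]].
exfalso; move: (Ux _ (d1C _ y1d) Gy1) (Ux _ (d2C _ y2d) Gy2) => E1 E2; subst y1 y2.
have : `|x2 - x1| <= `|x - x1| + `|x - x2|.
  by have := ler_distD x x2 x1; rewrite (distrC x2 x) [X in _ <= X -> _]addrC.
have := le_trans y1d d1d; have := le_trans y2d d2d; lra.
Qed.

End Homotopy.

(** * Foliation of a cone by rays *)

Section Radial.
Context {R : realType}.

Lemma open_preimage (T U : topologicalType) (O : set T) (P : set U) (f : T -> U) :
  open O -> open P -> (forall x, O x -> {for x, continuous f}) -> open (O `&` f @^-1` P).
Proof.
move=> oO oP fc; rewrite openE => x [Ox Px]; apply: filterI.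
  exact: (open_nbhs_nbhs (conj oO Ox)).
by apply: (fc x Ox); exact: (open_nbhs_nbhs (conj oP Px)).
Qed.

Definition cube d : set 'rV[R]_d.+1 := [set s | forall i, -1 < s ord0 i < 1].
Arguments cube d _ : clear implicits.

Lemma cubeE d (s : 'rV[R]_d.+1) : cube d s <-> `|s| < 1.
Proof.
split=> [H|H i]; last first.
  by rewrite -ltr_norml; apply: le_lt_trans H; exact: rV_coord_norm.
rewrite /Num.Def.normr /= mx_normrE; apply: bigmax_lt => // -[i j] _ /=.
by rewrite ord1 ltr_norml; exact: H.
Qed.

Lemma open_cube d : open (cube d).
Proof.
have -> : cube d = ball (0 : 'rV[R]_d.+1) 1.
  by apply/seteqP; split=> s; rewrite -ball_normE /= sub0r normrN => /cubeE.
exact: ball_open.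
Qed.

Section Chart.
Variables (n : nat) (x0 : 'rV[R]_n.+1) (i : 'I_n.+1) (d : R).
Hypotheses (xi0 : x0 ord0 i != 0) (d0 : 0 < d).
Local Notation V := 'rV[R]_n.+1.

(** Chart near a point x0 whose coordinate i is nonzero: coordinate 0 of [ray_coord] measures x_i
    relative to x0_i, the others locate the intersection of the ray of x with the hyperplane x_i =
    x0_i. Rays from the origin are thus lines along coordinate 0. *)
Definition ray_coef (x : V) := x ord0 i / x0 ord0 i.
Definition ray_ins (s : V) : V :=
  \row_j (if unlift i j is Some k then s ord0 (lift ord0 k) else 0).
Definition ray_param (s : V) : V := (1 + d * s ord0 ord0) *: (x0 + d *: ray_ins s).
Definition ray_coord (x : V) : V :=
  \row_j (if unlift ord0 j is Some k
          then ((ray_coef x)^-1 * x ord0 (lift i k) - x0 ord0 (lift i k)) / d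
          else (ray_coef x - 1) / d).

Lemma ray_param_coord x : 0 < ray_coef x -> ray_param (ray_coord x) = x.
Proof.
move=> l0; apply/rowP => j; rewrite !mxE unlift_none.
have dn : d != 0 by rewrite gt_eqF.
have -> : 1 + d * ((ray_coef x - 1) / d) = ray_coef x by field.
case: unliftP => [k ->|->]; rewrite ?mxE ?liftK; first by field; rewrite dn gt_eqF.
by rewrite mulr0 addr0 /ray_coef divfK.
Qed.

Lemma ray_coef_param s : ray_coef (ray_param s) = 1 + d * s ord0 ord0.
Proof. by rewrite /ray_coef !mxE unlift_none mulr0 addr0 mulfK. Qed.

Lemma ray_coord_param (s : V) : 0 < 1 + d * s ord0 ord0 -> ray_coord (ray_param s) = s.
Proof.
move=> l0; apply/rowP => j; rewrite !mxE ray_coef_param.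
have dn : d != 0 by rewrite gt_eqF.
case: unliftP => [k ->|->]; last by rewrite ord1 /=; field.
by rewrite !mxE !liftK; field; rewrite dn gt_eqF.
Qed.

Lemma ray_param_smooth : smooth setT ray_param.
Proof.
move=> k; have oT : open [set: V] by exact: openT.
have Hc j : Ck k setT (fun s : V => s ord0 j) by apply: Ck_coord => //; exact: Ck_id.
apply: Ck_scale => //; first by apply: Ck_add => //; [exact: Ck_cst|apply: Ck_mulr => //;
  exact: Ck_cst].
apply: Ck_add => //; first exact: Ck_cst.
apply: Ck_scale => //; first exact: Ck_cst.
apply: Ck_row => // j; case: unlift => [l|]; [exact: Hc|exact: Ck_cst].
Qed.

Definition ray_dom := [set x | 0 < ray_coef x].

Lemma open_ray_dom : open ray_dom.
Proof.
have -> : ray_dom = setT `&` ray_coef @^-1` [set t | 0 < t].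
  by apply/seteqP; split=> x //= [].
apply: open_preimage; [exact: openT|exact: open_gt|] => x _.
have H : Ck 0 setT ray_coef.
  apply: Ck_mulr; [exact: openT| |exact: Ck_cst].
  by apply: Ck_coord; [exact: openT|exact: Ck_id].
exact: H.
Qed.

Lemma ray_coord_smooth : smooth ray_dom ray_coord.
Proof.
move=> k; have oT := open_ray_dom.
have Hc j : Ck k ray_dom (fun s : V => s ord0 j) by apply: Ck_coord => //; exact: Ck_id.
have Hl : Ck k ray_dom ray_coef by apply: Ck_mulr => //; exact: Ck_cst.
apply: Ck_row => // j; case: unlift => [l|]; last first.
  by apply: Ck_mulr; [| apply: Ck_sub_fun => //; exact: Ck_cst | exact: Ck_cst].
apply: Ck_mulr; [by []| |exact: Ck_cst].
apply: Ck_sub_fun => //; last exact: Ck_cst.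
by apply: Ck_mulr => //; apply: Ck_inv => // x /= l0; rewrite gt_eqF.
Qed.

Lemma ray_coefZ (r : R) y : ray_coef (r *: y) = r * ray_coef y.
Proof. by rewrite /ray_coef mxE mulrA. Qed.

Lemma ray_coord_ray (y : V) (r : R) : 0 < r -> 0 < ray_coef y ->
  col' ord0 (ray_coord (r *: y)) =
  \row_k (((ray_coef y)^-1 * y ord0 (lift i k) - x0 ord0 (lift i k)) / d).
Proof.
move=> r0 l0; apply/rowP => k; rewrite !mxE liftK ray_coefZ mxE; field.
by rewrite !gt_eqF.
Qed.

Lemma ray_param_ray (y s : V) : 0 < ray_coef y ->
  col' ord0 s = \row_k (((ray_coef y)^-1 * y ord0 (lift i k) - x0 ord0 (lift i k)) / d) ->
  ray_param s = ((1 + d * s ord0 ord0) / ray_coef y) *: y.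
Proof.
move=> l0 E; rewrite /ray_param -scalerA; congr (_ *: _); apply/rowP => j; rewrite !mxE.
case: unliftP => [k ->|->]; last first.
  rewrite mulr0 addr0 /ray_coef invf_div divfK //.
  by apply: contraTneq l0 => y0; rewrite /ray_coef y0 mul0r ltxx.
have := congr1 (fun M : 'rV[R]_n => M ord0 k) E; rewrite !mxE => ->.
by field; rewrite !gt_eqF.
Qed.

End Chart.

Section RadialFol.
Variables (n : nat) (C : set 'rV[R]_n.+1) (rho : 'rV[R]_n.+1 -> R) (H g : 'rV[R]_n.+1 -> 'rV[R]_n.+1).
Local Notation V := 'rV[R]_n.+1.
Hypotheses (oC : open C) (CZ : forall c x, 0 < c -> C x -> C (c *: x)).
Hypotheses (rho_gt0 : forall x, C x -> 0 < rho x).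
Hypotheses (rhoZ : forall c x, 0 < c -> C x -> rho (c *: x) = c * rho x).
Hypotheses (sH : smooth C H) (sg : smooth C g).
Hypotheses (HC : forall x, C x -> C (H x) /\ g (H x) = x).
Hypotheses (gC : forall x, C x -> C (g x) /\ H (g x) = x).

Definition cone_leaf (y : V) : set V := [set q | exists2 r, 0 < r & q = H (r *: y)].

Lemma rho_scale_inj y y' (r r' : R) : C y -> C y' -> rho y = 1 -> rho y' = 1 -> 0 < r -> 0 < r' ->
  r *: y = r' *: y' -> r = r' /\ y = y'.
Proof.
move=> Cy Cy' ry ry' r0 r'0 E.
have := congr1 rho E; rewrite !rhoZ // ry ry' !mulr1 => rr; split=> //.
by move: E; rewrite -rr => /scalerI; apply; rewrite gt_eqF.
Qed.

Lemma cone_neq0 x : C x -> x != 0.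
Proof.
move=> Cx; apply/eqP => x0; have := rhoZ (ltr0n R 2) Cx.
by rewrite x0 scaler0 -x0; have := rho_gt0 Cx; lra.
Qed.

Lemma H_inj x y : C x -> C y -> H x = H y -> x = y.
Proof. by move=> /HC [_ {2}<-] /HC [_ {2}<-] ->. Qed.

Lemma dH_inj x h : C x -> 'D_h H x = 0 -> h = 0.
Proof.
move=> Cx Hh; have [CH gH] := HC Cx.
have dH := smooth_diff sH Cx; have dg := smooth_diff sg CH.
have := derive_comp h dH dg; rewrite Hh derive0.
have N : \forall y \near x, g (H y) = id y.
  by move: (open_nbhs_nbhs (conj oC Cx)); apply: filterS => y /HC [].
by rewrite (near_eq_derive _ N) derive_id.
Qed.

Lemma cone_leaf_immersed y : C y -> immersed_curve (cone_leaf y).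
Proof.
(* The exponential parametrises the open half-line by the whole line, as [immersed_curve]
   requires. *)
move=> Cy; pose l (t : R) := expR t *: y.
have sl : smooth setT l.
  move=> k; apply: Ck_scale; [exact: openT| |exact: Ck_cst].
  by apply: Ck_expR; [exact: openT|exact: Ck_id].
have lC t : C (l t) by apply: CZ => //; exact: expR_gt0.
have sc : smooth setT (fun t => H (l t)).
  by move=> k; apply: (Ck_comp (P := C)); [exact: openT|move=> t _|exact: sl|exact: sH].
exists (fun t => H (l t)); split.
- by apply: smooth_smooth_on; [exact: openT|].
- move=> t; apply/eqP; rewrite derive1E.
  have dl := smooth_diff sl (I : setT t).
  have dexp : differentiable (fun s : R => expR s) t.
    by apply/derivable1_diffP; exact: derivable_expR.
  rewrite (derive_comp (1 : R) dl (smooth_diff sH (lC t))) => /dH_inj => /(_ (lC t)).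
  have [_ ->] := diff_scale (a := fun s : R => expR s) (g := fun _ : R => y) (1 : R) (x := t)
     dexp ltac:(done).
  rewrite derive_cst scaler0 addr0 derive_val => /eqP.
  by rewrite scaler_eq0 (negbTE (cone_neq0 Cy)) orbF gt_eqF ?expR_gt0.
- apply/seteqP; split=> q.
    by move=> [r r0 ->]; exists (ln r) => //; rewrite /l lnK.
  by move=> [t _ <-]; exists (expR t); rewrite ?expR_gt0.
- left=> s t /(H_inj (lC s) (lC t)) /eqP; rewrite -subr_eq0 -scalerBl scaler_eq0.
  by rewrite (negbTE (cone_neq0 Cy)) orbF subr_eq0 => /eqP /expR_inj.
Qed.

(** H carries the radial foliation to the leaves, so the inverse g followed by [ray_coord] is a flat
    chart. *)
Lemma cone_foliation :
  smooth_foliation n C [set L | exists2 y, C y /\ rho y = 1 & L = cone_leaf y].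
Proof.
have rn q : C q -> C ((rho q)^-1 *: q) /\ rho ((rho q)^-1 *: q) = 1.
  move=> Cq; have r0 := rho_gt0 Cq; have ri : 0 < (rho q)^-1 by rewrite invr_gt0.
  by rewrite rhoZ // mulVf ?gt_eqF //; split=> //; exact: CZ.
split.
- by move=> _ [y [Cy _] ->]; exact: cone_leaf_immersed.
- move=> _ _ [y [Cy ry] ->] [y' [Cy' ry'] ->] [q [[r r0 ->] [r' r'0 E]]].
  have E' := H_inj (CZ r0 Cy) (CZ r'0 Cy') E.
  by have [_ ->] := rho_scale_inj Cy Cy' ry ry' r0 r'0 E'.
- apply/seteqP; split=> q.
    by move=> [_ [y [Cy _] ->] [r r0 ->]]; have [] := HC (CZ r0 Cy).
  move=> Cq; have [Cg Hg] := gC Cq; have [C1 r1] := rn _ Cg.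
  exists (cone_leaf ((rho (g q))^-1 *: g q)); first by exists ((rho (g q))^-1 *: g q).
  exists (rho (g q)); first exact: rho_gt0.
  by rewrite scalerA divff ?scale1r ?Hg // gt_eqF ?rho_gt0.
move=> q Cq; have [Cx0 Hg] := gC Cq; set x0 := g q in Cx0 Hg *.
have [i xi0] : exists i, x0 ord0 i != 0.
  apply/existsP; apply: contraNT (cone_neq0 Cx0); rewrite negb_exists => /forallP H0.
  by apply/eqP/rowP => i; rewrite mxE; apply/eqP; have := H0 i; rewrite negbK.
have /nbhs_ballP [e /= e0 eC] := open_nbhs_nbhs (conj oC Cx0).
(* The bound e / 2 keeps the parametrised cube inside C, the bound 1 / 2 keeps its radial factor
   positive. *)
pose d := Num.min (e / 2) 2^-1.
have d0 : 0 < d by rewrite /d lt_min divr_gt0 //= invr_gt0.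
have de : d < e by rewrite /d gt_min; apply/orP; left; rewrite ltr_pdivrMr // ltr_pMr // ltr1n.
have d1 : d < 1 by rewrite /d gt_min; apply/orP; right; rewrite invf_lt1 // ltr1n.
have Qpos s : cube n s -> 0 < 1 + d * s ord0 ord0.
  move=> /(_ ord0) /andP[s1 _]; have : d * (-1) < d * s ord0 ord0 by rewrite ltr_pM2l.
  by rewrite mulrN1; move: d1; lra.
have QC s : cube n s -> C (ray_param x0 i d s).
  move=> Qs; apply: CZ; first exact: Qpos.
  apply: eC; rewrite -ball_normE /= opprD addrA subrr sub0r normrN normrZ gtr0_norm //.
  apply: le_lt_trans de; rewrite -[leRHS]mulr1; apply: ler_wpM2l; first exact: ltW.
  apply: rV_norm_le => // a j; rewrite ord1 mxE; case: unlift => [k|]; last by rewrite normr0.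
  by have := Qs (lift ord0 k); rewrite -ltr_norml => /ltW.
pose W0 := ray_dom x0 i `&` ray_coord x0 i d @^-1` cube n.
have oW0 : open W0.
  apply: open_preimage; [exact: open_ray_dom|exact: open_cube|].
  by move=> x Wx; exact (smooth_cont (@ray_coord_smooth n x0 i d) Wx).
have W0C x : W0 x -> C x.
  by move=> [lx Qx]; rewrite -(ray_param_coord xi0 d0 lx); exact: QC.
have oW : open (C `&` g @^-1` W0).
  by apply: open_preimage => // x Cx; apply: smooth_cont sg Cx.
exists (C `&` g @^-1` W0), (fun x => ray_coord x0 i d (g x)), (fun s => H (ray_param x0 i d s)).
split.
  split=> //; rewrite -/x0.
  have lx0 : ray_coef x0 i x0 = 1 by rewrite /ray_coef divff.
  split; first by rewrite /ray_dom /= lx0.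
  move=> j; rewrite mxE lx0 invr1; case: unlift => [k|]; rewrite ?mul1r subrr mul0r; lra.
split.
- by exists (C `&` g @^-1` W0) => //; apply/seteqP; split=> [x [Cx Wx]|x [_ [Cx Wx]]]; split.
- split; apply: smooth_smooth_on => //.
  + move=> k; apply: (Ck_comp (P := ray_dom x0 i)) => //; last exact: ray_coord_smooth.
      by move=> x [_ []].
    by apply: Ck_sub (sg k) => x [].
  + exact: open_cube.
  + move=> k; apply: (Ck_comp (P := C)); [exact: open_cube|exact: QC| |exact: sH].
    by apply: Ck_sub (ray_param_smooth x0 i d k).
- move=> x [Cx [lx Qx]]; split=> //; rewrite ray_param_coord //; exact: (proj2 (gC Cx)).
- move=> s Qs; have [C1 g1] := HC (QC s Qs).
  have E := ray_coord_param xi0 d0 (Qpos s Qs).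
  split; last by rewrite g1.
  split=> //=; rewrite g1; split=> /=; last by rewrite E.
  by rewrite /ray_dom /= ray_coef_param //; exact: Qpos.
- move=> _ [y [Cy ry] ->].
  (* A leaf meets the chart in at most one slice; the set of slices is empty when [ray_coef] is not
     positive on y. *)
  exists [set s' | 0 < ray_coef x0 i y /\ s' = \row_k (((ray_coef x0 i y)^-1 * y ord0 (lift i k) -
    x0 ord0 (lift i k)) / d)].
    apply: (@sub_countable _ _ _ [set \row_k (((ray_coef x0 i y)^-1 * y ord0 (lift i k) - x0 ord0
      (lift i k)) / d)]).
      by apply: subset_card_le => s [].
    exact: countable1.
  apply/seteqP; split=> s.
    move=> [x [[r r0 xE] [Cx [lx Qx]]] <-]; split=> //.
    have [_ gx] := HC (CZ r0 Cy); rewrite xE gx in lx Qx *.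
    have ly : 0 < ray_coef x0 i y by move: lx; rewrite /ray_dom /= ray_coefZ pmulr_rgt0.
    by split=> //; exact: ray_coord_ray.
  move=> [Qs [ly E]].
  have P := ray_param_ray d0 ly E.
  have r0 : 0 < (1 + d * s ord0 ord0) / ray_coef x0 i y by rewrite divr_gt0 // Qpos.
  have [C1 g1] := HC (QC s Qs).
  have E2 := ray_coord_param xi0 d0 (Qpos s Qs).
  exists (H (ray_param x0 i d s)); last by rewrite g1.
  split; first by exists ((1 + d * s ord0 ord0) / ray_coef x0 i y) => //; rewrite P.
  split=> //=; rewrite g1; split=> /=; last by rewrite E2.
  by rewrite /ray_dom /= ray_coef_param //; exact: Qpos.
Qed.

End RadialFol.
End Radial.

(** * Foliations of a cone and focal points *)

Section CoreTools.
Context {R : realType}.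

Lemma differentiable_near_open (T : normedModType R) (V : normedModType R) (O : set V) (P : T -> V) x :
  open O -> O (P x) -> differentiable P x -> \forall e \near x, O (P e).
Proof.
move=> oO Ox dP; have c : {for x, continuous P} by exact: differentiable_continuous.
have N : nbhs x (P @^-1` O) by apply: c; exact: (open_nbhs_nbhs (conj oO Ox)).
by move: N; apply: filterS.
Qed.

Lemma derive_sumf (T W : normedModType R) n (f : 'I_n -> T -> W) x w :
  (forall i, differentiable (f i) x) ->
  differentiable (fun y => \sum_i f i y) x /\
  'D_w (fun y => \sum_i f i y) x = \sum_i 'D_w (f i) x.
Proof.
move=> H; have -> : (fun y => \sum_i f i y) = \sum_i f i.
  by apply/funext => y; rewrite fct_sumE.
split; first exact: differentiable_sum.
by rewrite derive_sum // => i; exact: diff_derivable.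
Qed.

(** Product rule for a derivative whose direction and base point both vary. It yields second
    derivatives along curves, with the acceleration in the first term. *)
Lemma derive_dir (T W : normedModType R) m (O : set 'rV[R]_m) (f : 'rV[R]_m -> W)
    (u P : T -> 'rV[R]_m) x w : open O -> O (P x) -> Ck 2 O f ->
  differentiable u x -> differentiable P x ->
  differentiable (fun e => 'D_(u e) f (P e)) x /\
  'D_w (fun e => 'D_(u e) f (P e)) x =
    'D_('D_w u x) f (P x) + 'D_('D_w P x) (fun q => 'D_(u x) f q) (P x).
Proof.
move=> oO Ox [df Df] du dP.
have Ddf v := proj1 (Df v).
pose F e := \sum_i u e ord0 i *: 'D_(delta_mx ord0 i) f (P e).
have N : \forall e \near x, F e = 'D_(u e) f (P e).
  apply: filterS (differentiable_near_open oO Ox dP) => e Oe.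
  by rewrite [in RHS](row_sum_delta (u e)) derive_sumv //; exact: df.
have dui i : differentiable (fun e => u e ord0 i) x.
  by apply: (differentiable_comp du (g := coordl ord0 i)); apply: linear_differentiable;
    exact: coordl_continuous.
have duiE i : 'D_w (fun e => u e ord0 i) x = 'D_w u x ord0 i.
  rewrite (derive_comp (g := coordl ord0 i) w du) ?derive_clin //; first exact: coordl_continuous.
  by apply: linear_differentiable; exact: coordl_continuous.
have dfi i : differentiable (fun e => 'D_(delta_mx ord0 i) f (P e)) x.
  exact: (differentiable_comp dP (Ddf _ _ Ox)).
have Hi i := diff_scale w (dui i) (dfi i).
have [dF DF] := derive_sumf w (fun i => proj1 (Hi i)).
split; first exact: (near_differentiable N dF).
rewrite -(near_eq_derive _ N) DF.
under eq_bigr => i _ do rewrite (proj2 (Hi i)).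
rewrite big_split /=; congr (_ + _).
  rewrite [in RHS](row_sum_delta ('D_w u x)) derive_sumv; last exact: df.
  by apply: eq_bigr => i _; rewrite duiE.
have N2 : \forall q \near P x, \sum_i u x ord0 i *: 'D_(delta_mx ord0 i) f q = 'D_(u x) f q.
  move: (open_nbhs_nbhs (conj oO Ox)); apply: filterS => q Oq.
  by rewrite [in RHS](row_sum_delta (u x)) derive_sumv //; exact: df.
rewrite -(near_eq_derive _ N2).
have Hc i := diff_scale ('D_w P x) (a := fun _ => u x ord0 i) (differentiable_cst _ _) (Ddf
  (delta_mx ord0 i) _ Ox).
rewrite (proj2 (derive_sumf ('D_w P x) (fun i => proj1 (Hc i)))).
apply: eq_bigr => i _; rewrite (proj2 (Hc i)) derive_cst scale0r add0r.
by rewrite (derive_comp (g := 'D_(delta_mx ord0 i) f) w dP) //; exact: Ddf.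
Qed.

(** A continuous function taking two values takes all values of an interval, which has positive
    Lebesgue measure and so is not countable. This makes the transverse coordinates of a flat chart
    constant along a leaf. *)
Lemma countable_range_constant (f : R -> R) (a b : R) (D : set R) : a <= b ->
  (forall t, a <= t <= b -> {for t, continuous f}) ->
  countable D -> (forall t, a <= t <= b -> D (f t)) -> f a = f b.
Proof.
move=> ab fc cD fD; apply: contrapT => /eqP fab.
have fcw : {within `[a, b], continuous f}.
  by apply: continuous_in_subspaceT => t /set_mem /= /[!in_itv] /= t01; exact: fc.
pose lo := Num.min (f a) (f b); pose hi := Num.max (f a) (f b).
have lohi : lo < hi.
  rewrite /lo /hi; move: fab; rewrite neq_lt => /orP[h|h]; first by rewrite min_l ?max_r // ltW.
  by rewrite min_r ?max_l // ltW.
have sD : `[lo, hi]%classic `<=` D.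
  move=> v /= /[!in_itv] /= vlh.
  by have [c /[!in_itv] /= cab <-] := IVT ab fcw vlh; exact: fD.
have cI : countable `[lo, hi]%classic by apply: sub_countable cD; exact: subset_card_le.
have := countable_lebesgue_measure0 cI.
rewrite lebesgue_measure_itv /= lte_fin lohi -EFinB => /eqP.
by rewrite eqe subr_eq0 gt_eqF.
Qed.

Lemma differentiable_idf (V : normedModType R) (x : V) : differentiable (fun y : V => y) x.
Proof. by []. Qed.

Lemma diff_scalec (V W : normedModType R) (a : R) (f : V -> W) x h : differentiable f x ->
  differentiable (fun y => a *: f y) x /\ 'D_h (fun y => a *: f y) x = a *: 'D_h f x.
Proof.
move=> df; have [d E] := diff_scale h (a := fun _ : V => a) (differentiable_cst _ _) df.
by split=> //; rewrite E derive_cst scale0r add0r.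
Qed.

Lemma diff_add (V W : normedModType R) (f g : V -> W) x h :
  differentiable f x -> differentiable g x ->
  differentiable (fun y => f y + g y) x /\ 'D_h (fun y => f y + g y) x = 'D_h f x + 'D_h g x.
Proof.
move=> df dg; split; first exact: differentiableD.
by rewrite -deriveD //; exact: diff_derivable.
Qed.

Lemma diff_line (V : normedModType R) (y u : V) (t : R) :
  differentiable (fun s : R => y + s *: u) t /\ 'D_1 (fun s : R => y + s *: u) t = u.
Proof.
have [d1 E1] := diff_scale (1 : R) (differentiable_idf t) (differentiable_cst u t).
have [d E] := diff_add (1 : R) (differentiable_cst y t) d1; split=> //.
by rewrite E E1 !derive_cst derive_id scaler0 addr0 add0r scale1r.
Qed.

(** Differentiate f(c y) = c f(y). It allows eigenvectors of 'D w to be moved along a ray to the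
    unit sphere. *)
Lemma homogeneous_derive (V W : normedModType R) (C : set V) (f : V -> W) (c : R) x h :
  open C -> C x -> C (c *: x) -> 0 < c -> (forall y, C y -> f (c *: y) = c *: f y) ->
  (forall y, C y -> differentiable f y) -> 'D_h f (c *: x) = 'D_h f x.
Proof.
move=> oC Cx Ccx c0 fZ df.
have d1 : differentiable (fun y : V => c *: y) x.
  by apply: (@differentiableZ _ _ _ id).
have dl : 'D_h (fun y : V => c *: y) x = c *: h.
  by have [_ ->] := diff_scalec c h (differentiable_idf x); rewrite derive_id.
have E := derive_comp h d1 (df _ Ccx); rewrite dl in E.
have N : \forall y \near x, c *: f y = f (c *: y).
  by move: (open_nbhs_nbhs (conj oC Cx)); apply: filterS => y /fZ.
rewrite -(near_eq_derive _ N) in E.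
have E2 : 'D_h (fun y => c *: f y) x = c *: 'D_h f x.
  by have [_ ->] := diff_scalec c h (df _ Cx).
rewrite E2 in E; have E3 : 'D_(c *: h) f (c *: x) = c *: 'D_h f (c *: x).
  by rewrite !deriveE ?linearZ //; exact: df.
by move: E; rewrite E3 => /scalerI /esym; apply; rewrite gt_eqF.
Qed.

End CoreTools.

Section Core.
Context {R : realType} {n : nat}.
Local Notation V := 'rV[R]_n.+1.
Variables (C : set V) (rho : V -> R) (w : V -> V) (al be : R -> R).
Hypotheses (oC : open C) (CZ : forall c x, 0 < c -> C x -> C (c *: x)).
Hypotheses (srho : smooth C rho) (rho_gt0 : forall x, C x -> 0 < rho x).
Hypotheses (rhoZ : forall c x, 0 < c -> C x -> rho (c *: x) = c * rho x).
Hypotheses (sw : smooth C w) (wZ : forall c x, 0 < c -> C x -> w (c *: x) = c *: w x).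
Hypotheses (sal : smooth setT al) (sbe : smooth setT be).
Hypotheses (al0 : al 0 = 1) (be0 : be 0 = 0) (be_gt0 : forall r, 0 < r -> 0 < be r).
Hypothesis wron : forall r, 0 < r -> al r * 'D_1 be r - 'D_1 al r * be r != 0.
Hypothesis HG : forall r x, 0 <= r -> C x ->
  C (al r *: x + be r *: w x) /\ rho (al r *: x + be r *: w x) = rho x.
Hypothesis proper : forall z r1, C z -> 0 <= r1 -> exists K, [/\ compact K, K `<=` C &
  forall t x, 0 <= t <= r1 -> C x -> al t *: x + be t *: w x = z -> K x].

(* The leaf issued from the point y of the unit sphere {rho = 1} of C is the curve
   r |-> cone_map (r *: y), where w is the field on the unit sphere, extended homogeneously. A
   singular point of cone_map on it corresponds to an eigenvalue lam of 'D w with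
   al r + lam * be r = 0. *)
Definition cone_map x := al (rho x) *: x + be (rho x) *: w x.
Definition no_focal := forall y h lam r, C y -> rho y = 1 -> 'D_h rho y = 0 -> h != 0 ->
  'D_h w y = lam *: h -> 0 < r -> al r + lam * be r != 0.

Definition unit_ray_leaves : set (set V) := [set L | exists2 y, C y /\ rho y = 1 & L = cone_leaf
  cone_map y].

Let dal r : differentiable al r. Proof. exact: (smooth_diff sal (I : setT r)). Qed.
Let dbe r : differentiable be r. Proof. exact: (smooth_diff sbe (I : setT r)). Qed.

Lemma cone_map_smooth : smooth C cone_map.
Proof.
move=> k; apply: Ck_add => //; apply: Ck_scale => //; try exact: Ck_id.
- by apply: (Ck_comp1 (P := setT)) => //; exact: sal.
- by apply: (Ck_comp1 (P := setT)) => //; exact: sbe.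
Qed.

Lemma derive_rhoE c x h : 0 < c -> C x -> 'D_h rho (c *: x) = 'D_h rho x.
Proof.
move=> c0 Cx; apply: (homogeneous_derive (C := C)) => //; first exact: CZ.
  by move=> y Cy; rewrite rhoZ.
by move=> y; exact: smooth_diff.
Qed.

Lemma derive_wE c x h : 0 < c -> C x -> 'D_h w (c *: x) = 'D_h w x.
Proof.
move=> c0 Cx; apply: (homogeneous_derive (C := C)) => //; first exact: CZ.
  by move=> y Cy; rewrite wZ.
by move=> y; exact: smooth_diff.
Qed.

Lemma derive_comb (a b : R) x h : C x -> 'D_h (fun x => a *: x + b *: w x) x = a *: h + b *: 'D_h w x.
Proof.
move=> Cx; have dw := smooth_diff sw Cx.
have [d1 E1] := diff_scalec a h (differentiable_idf x).
have [d2 E2] := diff_scalec b h dw.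
by have [_ ->] := diff_add h d1 d2; rewrite E1 E2 derive_id.
Qed.

(** The map with coefficients al r, be r preserves rho, so a vector killed by its differential is
    tangent to a level set of rho. *)
Lemma tangent_comb r x h : 0 <= r -> C x -> al r *: h + be r *: 'D_h w x = 0 -> 'D_h rho x = 0.
Proof.
move=> r0 Cx E.
have dw := smooth_diff sw Cx.
have dG : differentiable (fun x => al r *: x + be r *: w x) x.
  have [d1 _] := diff_scalec (al r) h (differentiable_idf x).
  have [d2 _] := diff_scalec (be r) h dw.
  by have [] := diff_add h d1 d2.
have [CG _] := HG r0 Cx.
have := derive_comp h dG (smooth_diff srho CG); rewrite derive_comb // E derive0.
have N : \forall y \near x, rho (al r *: y + be r *: w y) = rho y.
  by move: (open_nbhs_nbhs (conj oC Cx)); apply: filterS => y Cy; exact: (proj2 (HG r0 Cy)).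
by rewrite (near_eq_derive _ N).
Qed.

Lemma derive_cone_map x h : C x -> 'D_h rho x = 0 ->
  'D_h cone_map x = al (rho x) *: h + be (rho x) *: 'D_h w x.
Proof.
move=> Cx E; have dr := smooth_diff srho Cx; have dw := smooth_diff sw Cx.
have da : differentiable (fun x => al (rho x)) x by exact: (differentiable_comp dr (dal _)).
have db : differentiable (fun x => be (rho x)) x by exact: (differentiable_comp dr (dbe _)).
have daE : 'D_h (fun x => al (rho x)) x = 0 by rewrite (derive_comp h dr (dal _)) E derive0.
have dbE : 'D_h (fun x => be (rho x)) x = 0 by rewrite (derive_comp h dr (dbe _)) E derive0.
have [d1 E1] := diff_scale h da (differentiable_idf x).
have [d2 E2] := diff_scale h db dw.
have [_ E3] := diff_add h d1 d2.
by rewrite [LHS]E3 E1 E2 daE dbE !scale0r !add0r derive_id.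
Qed.

Lemma cone_map_rho x : C x -> C (cone_map x) /\ rho (cone_map x) = rho x.
Proof. by move=> Cx; apply: HG => //; exact: ltW (rho_gt0 Cx). Qed.

Let normalize x : C x -> let y := (rho x)^-1 *: x in [/\ C y, rho y = 1 & x = rho x *: y].
Proof.
move=> Cx; have r0 := rho_gt0 Cx; have ri : 0 < (rho x)^-1 by rewrite invr_gt0.
split; first exact: CZ.
  by rewrite rhoZ // mulVf // gt_eqF.
by rewrite scalerA divff ?scale1r // gt_eqF.
Qed.

(** A kernel vector is, after rescaling x to the unit sphere, an eigenvector of 'D w with eigenvalue
    - al r / be r, which [no_focal] rules out. *)
Lemma comb_inj r x h : no_focal -> 0 <= r -> C x -> al r *: h + be r *: 'D_h w x = 0 -> h = 0.
Proof.
move=> NF; rewrite le_eqVlt => /orP[/eqP <-|r0] Cx E.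
  by move: E; rewrite al0 be0 scale1r scale0r addr0.
have Dr := tangent_comb (ltW r0) Cx E.
have [Cy ry xE] := normalize Cx; set y := _ *: x in Cy ry xE.
have rx := rho_gt0 Cx.
apply/eqP; apply: contrapT => /negP h0.
have b0 := be_gt0 r0.
have dwE : 'D_h w y = (- (al r / be r)) *: h.
  rewrite -(derive_wE h rx Cy) -xE; move/eqP: E; rewrite addrC addr_eq0 => /eqP /(congr1 ( *:%R (be
    r)^-1)).
  by rewrite scalerA mulVf ?gt_eqF // scale1r => ->; rewrite scalerN scalerA scaleNr mulrC.
have Dry : 'D_h rho y = 0 by rewrite -(derive_rhoE h rx Cy) -xE.
have := NF y h _ r Cy ry Dry h0 dwE r0.
have bn : be r != 0 by rewrite gt_eqF.
by rewrite mulNr (divfK bn) subrr eqxx.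
Qed.

(** The homotopy starts from the identity at t = 0; [proper] supplies the compact set and [comb_inj]
    the invertible differentials. *)
Lemma comb_unique z r1 : no_focal -> C z -> 0 <= r1 ->
  exists x, [/\ C x, al r1 *: x + be r1 *: w x = z &
    forall y, C y -> al r1 *: y + be r1 *: w y = z -> y = x].
Proof.
move=> NF Cz r10; have [K [cK KC HK]] := proper Cz r10.
have ca : continuous al by move=> r; apply: (smooth_cont sal).
have cb : continuous be by move=> r; apply: (smooth_cont sbe).
apply: (homotopy_unique oC sw ca cb r10 cK KC HK).
  by move=> t x h /andP[t0 _] Cx _; exact: comb_inj.
exists z; rewrite al0 be0; split=> //; first by rewrite scale1r scale0r addr0.
by move=> y _; rewrite scale1r scale0r addr0.
Qed.

(** On the level rho = r, [cone_map] has the constant coefficients al r and be r, so its inverse at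
    z solves the equation of [comb_unique] for r = rho z. Vectors killed by its differential are
    tangent to the level, where [comb_inj] excludes them. *)
Lemma no_focal_foliation : no_focal -> smooth_foliation n C unit_ray_leaves.
Proof.
move=> NF.
have /choice [g Hg] : forall z, exists x, C z ->
    [/\ C x, cone_map x = z & forall y, C y -> cone_map y = z -> y = x].
  move=> z; have [Cz|nCz] := pselect (C z); last by exists z.
  have [x [Cx E U]] := comb_unique NF Cz (ltW (rho_gt0 Cz)).
  have rx : rho x = rho z by rewrite -E; have [_ ->] := HG (ltW (rho_gt0 Cz)) Cx.
  exists x => _; split=> //; first by rewrite /cone_map rx.
  move=> y Cy yE; apply: U => //.
  have ry : rho y = rho z by rewrite -yE; have [_ ->] := cone_map_rho Cy.
  by rewrite -ry.
have HC x : C x -> C (cone_map x) /\ g (cone_map x) = x.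
  move=> Cx; have [CH _] := cone_map_rho Cx; split=> //.
  by have [_ _ U] := Hg _ CH; rewrite -(U x).
have gC x : C x -> C (g x) /\ cone_map (g x) = x by move=> /Hg [].
have sg : smooth C g.
  apply: (inv_smooth oC oC cone_map_smooth HC gC) => x h Cx E.
  have [CH _] := cone_map_rho Cx.
  have Dr : 'D_h rho x = 0.
    have := derive_comp h (smooth_diff cone_map_smooth Cx) (smooth_diff srho CH).
    rewrite E derive0.
    have N : \forall y \near x, rho (cone_map y) = rho y.
      by move: (open_nbhs_nbhs (conj oC Cx)); apply: filterS => y /cone_map_rho [].
    by rewrite (near_eq_derive _ N).
  refine (comb_inj NF (ltW (rho_gt0 Cx)) Cx _).
  by rewrite -(derive_cone_map Cx Dr).
exact: (cone_foliation oC CZ rho_gt0 rhoZ cone_map_smooth sg HC gC).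
Qed.

End Core.

Section CoreConverse.
Context {R : realType} {n : nat}.
Local Notation V := 'rV[R]_n.+1.
Variables (C : set V) (rho : V -> R) (w : V -> V) (al be : R -> R).
Hypotheses (oC : open C) (CZ : forall c x, 0 < c -> C x -> C (c *: x)).
Hypotheses (srho : smooth C rho) (rho_gt0 : forall x, C x -> 0 < rho x).
Hypotheses (rhoZ : forall c x, 0 < c -> C x -> rho (c *: x) = c * rho x).
Hypotheses (sw : smooth C w) (wZ : forall c x, 0 < c -> C x -> w (c *: x) = c *: w x).
Hypotheses (sal : smooth setT al) (sbe : smooth setT be).
Hypothesis wron : forall r, 0 < r -> al r * 'D_1 be r - 'D_1 al r * be r != 0.
Hypothesis HG : forall r x, 0 <= r -> C x ->
  C (al r *: x + be r *: w x) /\ rho (al r *: x + be r *: w x) = rho x.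
Local Notation H := (cone_map rho w al be).

Let dal r : differentiable al r. Proof. exact: (smooth_diff sal (I : setT r)). Qed.
Let dbe r : differentiable be r. Proof. exact: (smooth_diff sbe (I : setT r)). Qed.

Let A (t : R) := t * al t.
Let B (t : R) := t * be t.

Let dA t : differentiable A t /\ 'D_1 A t = al t + t * 'D_1 al t.
Proof.
have [d E] := diff_scale (1 : R) (differentiable_idf t) (dal t).
by split; [exact: d|rewrite [LHS]E derive_id scale1r].
Qed.
Let dB t : differentiable B t /\ 'D_1 B t = be t + t * 'D_1 be t.
Proof.
have [d E] := diff_scale (1 : R) (differentiable_idf t) (dbe t).
by split; [exact: d|rewrite [LHS]E derive_id scale1r].
Qed.

(** The leaf of y parametrised by the value of rho, as a combination of the fixed vectors y and w
    y. *)
Let path y (t : R) := A t *: y + B t *: w y.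

Let pathE y t : C y -> rho y = 1 -> 0 < t -> H (t *: y) = path y t.
Proof.
move=> Cy ry t0; rewrite /cone_map rhoZ // ry mulr1 wZ // /path /A /B !scalerA.
by rewrite ![_ * t]mulrC.
Qed.

Let pathC y t : C y -> rho y = 1 -> 0 < t -> C (path y t) /\ rho (path y t) = t.
Proof.
move=> Cy ry t0; rewrite -pathE //.
have Cty : C (t *: y) by exact: CZ.
have rt : rho (t *: y) = t by rewrite rhoZ // ry mulr1.
by have [] := HG (ltW (rho_gt0 Cty)) Cty; rewrite rt /cone_map rt.
Qed.

Let dpath y t : differentiable (path y) t /\ 'D_1 (path y) t = 'D_1 A t *: y + 'D_1 B t *: w y.
Proof.
have [d1 E1] := diff_scale (1 : R) (proj1 (dA t)) (differentiable_cst y t).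
have [d2 E2] := diff_scale (1 : R) (proj1 (dB t)) (differentiable_cst (w y) t).
have [d E] := diff_add (1 : R) d1 d2.
by split=> //; rewrite [LHS]E E1 E2 !derive_cst !scaler0 !addr0.
Qed.

Lemma derive_dir_const (O : set V) (f : V -> R) (u P : R -> V) (c : R) :
  open O -> O (P 0) -> Ck 2 O f -> differentiable u 0 -> differentiable P 0 ->
  'D_1 P 0 = 0 -> (\forall e \near (0 : R), 'D_(u e) f (P e) = c) ->
  'D_('D_1 u 0) f (P 0) = 0.
Proof.
move=> oO OP sf du dP P0 N.
have [_ E] := derive_dir (1 : R) oO OP sf du dP.
have Z : 'D_1 (fun e => 'D_(u e) f (P e)) (0 : R) = 0.
  by rewrite (near_eq_derive (g := fun _ => c)) ?derive_cst.
by move: E; rewrite Z P0 derive0 addr0 => <-.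
Qed.

(* The coordinates other than 0 of a flat chart phi are constant along the leaves. If h is an
   eigenvector at a focal point, the velocity u e of the leaf through y + e h at time r is killed
   by them for all e, and differentiating at e = 0, where the base point is stationary, so is the
   multiple u' 0 of h. The function rho, which is the time on each leaf, excludes coordinate 0. *)
Lemma foliation_no_focal : smooth_foliation n C (unit_ray_leaves C rho w al be) ->
  no_focal C rho w al be.
Proof.
case=> _ _ _ chart y h lam r Cy ry Dr h0 Dw r0; apply/eqP => bad.
have rr : 0 < r := r0.
have [C0 rho0] := pathC Cy ry r0.
have [W [phi [psi [W0 [[Ow oO WE] [sphi spsi] phiQ psiW slices]]]]] := chart _ C0.
have oW : open W by rewrite WE; exact: openI.
have WC x : W x -> C x by rewrite WE => -[].
have Sphi := smooth_on_smooth oW sphi.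
(* The base points move on the unit sphere through y with velocity h: since 'D_h rho vanishes at y,
   normalising does not change the velocity. *)
pose z (e : R) := y + e *: h.
pose ye (e : R) := (rho (z e))^-1 *: z e.
have dz e : differentiable z e /\ 'D_1 z e = h.
  exact: diff_line.
have z0 : z 0 = y by rewrite /z scale0r addr0.
have Cz0 : C (z 0) by rewrite z0.
have NC : \forall e \near (0 : R), C (z e) := differentiable_near_open oC Cz0 (proj1 (dz 0)).
have drz : differentiable (fun e => rho (z e)) 0 /\ 'D_1 (fun e => rho (z e)) (0 : R) = 0.
  have dr := smooth_diff srho Cz0; split; first exact: (differentiable_comp (proj1 (dz 0)) dr).
  by rewrite (derive_comp (1 : R) (proj1 (dz 0)) dr) (proj2 (dz 0)) z0.
have rz0 : rho (z 0) != 0 by rewrite z0 ry oner_eq0.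
have dri : differentiable (fun e => (rho (z e))^-1) 0 /\ 'D_1 (fun e => (rho (z e))^-1) (0 : R) = 0.
  split; first exact: (@differentiableV _ _ (fun e => rho (z e)) 0 (proj1 drz) rz0).
  rewrite [LHS](@deriveV _ _ (fun e => rho (z e)) 0 1 rz0); last exact: diff_derivable (proj1 drz).
  by rewrite (proj2 drz) scaler0.
have dye : differentiable ye 0 := proj1 (diff_scale (1 : R) (proj1 dri) (proj1 (dz 0))).
have Dye : 'D_1 ye 0 = h.
  rewrite (proj2 (diff_scale (1 : R) (proj1 dri) (proj1 (dz 0)))).
  by rewrite (proj2 dri) (proj2 (dz 0)) z0 ry invr1 scale0r add0r scale1r.
have ye0 : ye 0 = y by rewrite /ye z0 ry invr1 scale1r.
have Cye e : C (z e) -> C (ye e) /\ rho (ye e) = 1.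
  move=> Cz; have r1 := rho_gt0 Cz; have ri : 0 < (rho (z e))^-1 by rewrite invr_gt0.
  by split; [exact: CZ | rewrite rhoZ // mulVf // gt_eqF].
have Cye0 : C (ye 0) by rewrite ye0.
have dwye : differentiable (fun e => w (ye e)) 0 /\ 'D_1 (fun e => w (ye e)) (0 : R) = lam *: h.
  have dw := smooth_diff sw Cye0; split; first exact: (differentiable_comp dye dw).
  by rewrite (derive_comp (1 : R) dye dw) Dye ye0.
have lin (a b : R) : differentiable (fun e => a *: ye e + b *: w (ye e)) 0 /\
    'D_1 (fun e => a *: ye e + b *: w (ye e)) (0 : R) = (a + b * lam) *: h.
  have [d1 E1] := diff_scalec a (1 : R) dye; have [d2 E2] := diff_scalec b (1 : R) (proj1 dwye).
  have [d E] := diff_add (1 : R) d1 d2; split=> //.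
  by rewrite E E1 E2 Dye (proj2 dwye) scalerA scalerDl.
pose P e := path (ye e) r; pose u e := 'D_1 A r *: ye e + 'D_1 B r *: w (ye e).
have [dP DP] := lin (A r) (B r); have [du Du] := lin ('D_1 A r) ('D_1 B r).
rewrite -/(P) in dP DP; rewrite -/(u) in du Du.
have P0E : P 0 = path y r by rewrite /P ye0.
have WP0 : W (P 0) by rewrite P0E.
(* Here the focal equation enters: the point reached at time r is stationary to first order in e. *)
have DP0 : 'D_1 P 0 = 0.
  by rewrite DP /A /B -mulrA -mulrDr [be r * lam]mulrC bad mulr0 scale0r.
have NW : \forall e \near (0 : R), W (P e) := differentiable_near_open oW WP0 dP.
(* On the leaf of ye e, the transverse coordinate takes countably many values near time r; it is
   therefore constant there and kills the velocity u e. *)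
have key i : \forall e \near (0 : R), 'D_(u e) (fun x => phi x ord0 (lift ord0 i)) (P e) = 0.
  apply: filterS2 NC NW => e Ce We; have [Cy' ry'] := Cye e Ce.
  have [dpe Dpe] := dpath (ye e) r.
  have Nt : \forall t \near r, 0 < t /\ W (path (ye e) t).
    have N1 := @differentiable_near_open R R V W (path (ye e)) r oW We dpe.
    have N2 := open_nbhs_nbhs (conj (@open_gt _ 0) r0).
    by apply: filterS2 N1 N2 => t; split.
  have /nbhs_ballP [d /= d0 dN] := Nt.
  have [|D cD DE] := slices (cone_leaf H (ye e)); first by exists (ye e).
  pose f t := phi (path (ye e) t) ord0 (lift ord0 i).
  have fc t : ball r d t -> {for t, continuous f}.
    move=> /dN [t0 Wt]; apply: differentiable_continuous.
    apply: (differentiable_comp (proj1 (dpath (ye e) t)) (g := fun x => phi x ord0 (lift ord0 i))).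
    exact: (smooth_diff (fun k => Ck_coord ord0 (lift ord0 i) oW (Sphi k)) Wt).
  have fD t : ball r d t -> ((fun c : 'rV[R]_n => c ord0 i) @` D) (f t).
    move=> /dN [t0 Wt].
    have : [set s : V | (forall i : 'I_n.+1, -1 < s ord0 i < 1) /\ D (col' ord0 s)] (phi (path (ye
      e) t)).
      rewrite -DE; exists (path (ye e) t) => //; split=> //.
      by exists t => //; rewrite pathE.
    by move=> [_ Dt]; exists (col' ord0 (phi (path (ye e) t))) => //; rewrite mxE.
  have cD' : countable ((fun c : 'rV[R]_n => c ord0 i) @` D) by apply: sub_countable cD;
    exact: card_image_le.
  have fr t : ball r d t -> f t = f r.
    move=> bt; have br : ball r d r by exact: ballxx.
    have I s : Num.min t r <= s <= Num.max t r -> ball r d s.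
      move: bt; rewrite -!ball_normE /= ![`|r - _|]distrC !ltr_distl.
      by rewrite ge_min le_max; case: (leP t s); case: (leP r s) => /=; lra.
    have [tr|rt] := leP t r.
      by apply: (countable_range_constant tr (D := (fun c : 'rV[R]_n => c ord0 i) @` D)) => // s
        st; [apply: fc|apply: fD]; apply: I; rewrite min_l ?max_r.
    by symmetry; apply: (countable_range_constant (ltW rt) (D := (fun c : 'rV[R]_n => c ord0 i) @`
      D)) => // s st; [apply: fc|apply: fD]; apply: I; rewrite min_r ?max_l // ltW.
  have Df : 'D_1 f r = 0.
    rewrite (near_eq_derive (g := fun _ => f r)) ?derive_cst //.
    by have := @nbhsx_ballx _ _ r _ d0; apply: filterS => t; exact: fr.
  have := derive_comp (g := fun x => phi x ord0 (lift ord0 i)) (1 : R) dpe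
     (smooth_diff (fun k => Ck_coord ord0 (lift ord0 i) oW (Sphi k)) We).
  by rewrite -/(f) Df Dpe => <-.
have u0E : u 0 = 'D_1 (path y) r by rewrite (proj2 (dpath y r)) /u ye0.
have dphi := smooth_diff Sphi WP0.
have Ecoord v i : 'D_v phi (P 0) ord0 i = 'D_v (fun x => phi x ord0 i) (P 0).
  rewrite (derive_comp (g := coordl ord0 i) v dphi) ?derive_clin //; first exact: coordl_continuous.
  by apply: linear_differentiable; exact: coordl_continuous.
have Du0 i : 'D_('D_1 u 0) (fun x => phi x ord0 (lift ord0 i)) (P 0) = 0.
  by apply: (derive_dir_const oW WP0 _ du dP DP0 (key i)); apply: Ck_coord.
have D0 i : 'D_(u 0) (fun x => phi x ord0 (lift ord0 i)) (P 0) = 0 := nbhs_singleton (key i).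
(* Each leaf is parametrised by rho, which therefore has derivative 1 along every velocity u e. *)
have Hrho : \forall e \near (0 : R), 'D_(u e) rho (P e) = 1.
  apply: filterS NC => e Ce; have [Cy' ry'] := Cye e Ce.
  have [dpe Dpe] := dpath (ye e) r; have [CP _] := pathC Cy' ry' r0.
  have := derive_comp (1 : R) dpe (smooth_diff srho CP); rewrite Dpe => <-.
  rewrite (near_eq_derive (g := fun t => t)) ?derive_id //.
  have := open_nbhs_nbhs (conj (@open_gt _ 0) r0); apply: filterS => t t0.
  by have [] := pathC Cy' ry' t0.
have Drho1 := nbhs_singleton Hrho.
have Drho0 := derive_dir_const oC (WC _ WP0) (srho 2) du dP DP0 Hrho.
have injphi v : 'D_v phi (P 0) = 0 -> v = 0.
  move=> E; have [Qp pp] := phiQ _ WP0.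
  have Qopen := @open_cube R n.
  have dpsi := smooth_diff (smooth_on_smooth Qopen spsi) Qp.
  have := derive_comp v dphi dpsi; rewrite E derive0.
  rewrite (near_eq_derive (g := fun x => x)) ?derive_id //.
  by have := open_nbhs_nbhs (conj oW WP0); apply: filterS => x /phiQ [].
pose c0 := 'D_(u 0) phi (P 0) ord0 ord0; pose c1 := 'D_('D_1 u 0) phi (P 0) ord0 ord0.
have drho := smooth_diff srho (WC _ WP0).
(* In the chart, u 0 and its derivative have only coordinate 0, so they are proportional. Applying
   rho, whose derivatives along them are 1 and 0, gives c1 = 0. *)
have E : c1 *: u 0 + (- c0) *: 'D_1 u 0 = 0.
  apply: injphi; apply/rowP => j; rewrite derive_lin //.
  have -> : 'D_(- c0 *: 'D_1 u 0) phi (P 0) = - c0 *: 'D_('D_1 u 0) phi (P 0).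
    by rewrite !deriveE // linearZ.
  rewrite !mxE; case: (unliftP ord0 j) => [k ->|->]; last by rewrite -/c0 -/c1; ring.
  by rewrite !Ecoord D0 Du0 !mulr0 addr0.
have c10 : c1 = 0.
  have := congr1 (fun v => 'D_v rho (P 0)) E; rewrite derive_lin // derive0 Drho1.
  have -> : 'D_(- c0 *: 'D_1 u 0) rho (P 0) = - c0 *: 'D_('D_1 u 0) rho (P 0).
    by rewrite !deriveE // linearZ.
  by rewrite Drho0 scaler0 addr0 scaler1.
have u'0 : 'D_1 u 0 = 0.
  apply: injphi; apply/rowP => j; rewrite mxE.
  case: (unliftP ord0 j) => [k ->|->]; last exact: c10.
  by rewrite Ecoord Du0.
move: u'0; rewrite Du => /eqP; rewrite scaler_eq0 (negbTE h0) orbF.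
rewrite (proj2 (dA r)) (proj2 (dB r)) => /eqP E1.
have E2 : 'D_1 al r + lam * 'D_1 be r = 0.
  have : r * ('D_1 al r + lam * 'D_1 be r) = 0.
    by rewrite -[LHS]add0r -[X in X + _]bad -E1; ring.
  by move/eqP; rewrite mulf_eq0 gt_eqF //= => /eqP.
(* Both al + lam be and its derivative vanish at r, which forces the Wronskian to vanish. *)
have : al r * 'D_1 be r - 'D_1 al r * be r = 0.
  have -> : al r = - (lam * be r) by apply/eqP; rewrite -addr_eq0 bad.
  have -> : 'D_1 al r = - (lam * 'D_1 be r) by apply/eqP; rewrite -addr_eq0 E2.
  ring.
by apply/eqP; exact: wron.
Qed.

End CoreConverse.

(** * Transport of foliations by diffeomorphisms *)

Section Transport.
Context {R : realType}.

(** Q is the union of the preimages of P under all local smooth extensions of f. *)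
Lemma smooth_on_preimage_open (V W : normedModType R) (A : set V) (f : V -> W) (P : set W) :
  smooth_on A f -> open P -> exists2 Q, open Q & A `&` f @^-1` P = A `&` Q.
Proof.
move=> sf oP.
pose I := [set QF : set V * (V -> W) | [/\ open QF.1, smooth QF.1 QF.2 &
   forall y, (A `&` QF.1) y -> QF.2 y = f y]].
exists (\bigcup_(QF in I) (QF.1 `&` QF.2 @^-1` P)).
  apply: bigcup_open => -[Q F] [/= oQ sF _]; apply: open_preimage => // x.
  exact: smooth_cont.
apply/seteqP; split=> x [Ax].
  move=> Px; split=> //; have [Q [F [oQ Qx sF FE]]] := sf x Ax.
  by exists (Q, F) => //; split=> //=; rewrite FE.
by move=> [[Q F] [/= oQ sF FE] [Qx /= Px]]; split=> //=; rewrite -FE.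
Qed.

Variables (m1 m2 d : nat) (U1 : set 'rV[R]_m1.+1) (U2 : set 'rV[R]_m2.+1).
Variables (D : 'rV[R]_m1.+1 -> 'rV[R]_m2.+1) (D' : 'rV[R]_m2.+1 -> 'rV[R]_m1.+1).
Hypotheses (sD : smooth_on U1 D) (sD' : smooth_on U2 D').
Hypotheses (DU : forall x, U1 x -> U2 (D x) /\ D' (D x) = x).
Hypotheses (DU' : forall y, U2 y -> U1 (D' y) /\ D (D' y) = y).

Lemma transport_inj x y : U1 x -> U1 y -> D x = D y -> x = y.
Proof. by move=> /DU [_ {2}<-] /DU [_ {2}<-] ->. Qed.

Lemma immersed_transport L : L `<=` U1 -> immersed_curve L -> immersed_curve (D @` L).
Proof.
move=> LU [c [sc dc LE ci]].
have cU t : U1 (c t) by apply: LU; rewrite LE; exists t.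
have sDc : smooth_on setT (fun t => D (c t)) by apply: smooth_on_comp sD.
exists (fun t => D (c t)); split=> //.
- move=> t; apply/eqP => dDc.
  have oT := @openT R.
  have dDct := smooth_diff (smooth_on_smooth oT sDc) (I : setT t).
  have [U2t _] := DU (cU t).
  have [Q [G [oQ Qx sG GE]]] := sD' U2t.
  have N := @differentiable_near_open R R _ Q (fun t => D (c t)) t oQ Qx dDct.
  have E : \forall s \near t, G (D (c s)) = c s.
    apply: filterS N => s Qs; have [U2s {2}<-] := DU (cU s).
    by apply: GE; split.
  have := dc t; rewrite derive1E -(near_eq_derive _ E).
  rewrite (derive_comp (f := fun t => D (c t)) (1 : R) dDct (smooth_diff sG Qx)).
  have E1 : 'D_1 (fun t => D (c t)) t = 0 by rewrite -derive1E.
  by rewrite E1 derive0 eqxx.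
- rewrite LE; apply/seteqP; split=> y.
    by move=> [x [t _ <-] <-]; exists t.
  by move=> [t _ <-]; exists (c t) => //; exists t.
case: ci => [ci|[cp ci]]; [left|right].
  by move=> s t /transport_inj /ci; apply.
split=> [t|s t s01 t01 /transport_inj E]; first by rewrite cp.
by apply: ci => //; exact: E.
Qed.

(** U1 and U2 may lie in coordinate spaces of different dimensions: a zone of the round sphere has
    one coordinate more than the cone. *)
Lemma foliation_transport F : smooth_foliation d U1 F -> smooth_foliation d U2 [set D @` L | L in F].
Proof.
move=> [im dis cov chart].
have FU L : F L -> L `<=` U1 by move=> FL x Lx; rewrite -cov; exists L.
split.
- by move=> _ [L FL <-]; apply: immersed_transport; [exact: FU|exact: im].
- move=> _ _ [L FL <-] [L' FL' <-] [_ [[x Lx <-] [x' Lx' /esym E]]].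
  have xx := transport_inj (FU _ FL _ Lx) (FU _ FL' _ Lx') E; subst x'.
  by congr (D @` _); apply: dis => //; exists x.
- apply/seteqP; split=> y.
    by move=> [_ [L FL <-] [x Lx <-]]; have [] := DU (FU _ FL _ Lx).
  move=> U2y; have [U1x E] := DU' U2y; move: U1x; rewrite -[U1 in X in X -> _]cov => -[L FL Lx].
  by exists (D @` L); [exists L|exists (D' y)].
move=> y U2y; have [U1x E] := DU' U2y.
have [W [phi [psi [Wx [[P oP WE] [sphi spsi] phiQ psiW slices]]]]] := chart _ U1x.
have WU x : W x -> U1 x by rewrite WE => -[].
have [Q oQ QE] := smooth_on_preimage_open sD' oP.
have W2E : U2 `&` D' @^-1` W = U2 `&` Q.
  rewrite -QE WE; apply/seteqP; split=> z [U2z]; first by move=> [_ ?].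
  by move=> Pz; have [] := DU' U2z.
exists (U2 `&` D' @^-1` W), (fun y => phi (D' y)), (fun s => D (psi s)); split=> //.
split.
- by exists Q.
- split.
    by apply: (smooth_on_comp (B := W)) sphi => [z []//|]; apply: smooth_on_sub sD' => z [].
  by apply: (smooth_on_comp (B := U1)) sD => // s /psiW [/WU].
- by move=> z [U2z /= /phiQ [Qz ->]]; split=> //; have [] := DU' U2z.
- move=> s /psiW [Ws Es]; have [U2s Ds] := DU (WU _ Ws); split; last by rewrite Ds.
  by split=> //=; rewrite Ds.
- move=> _ [L FL <-]; have [X cX XE] := slices L FL; exists X => //; rewrite -XE.
  apply/seteqP; split=> s.
    move=> [_ [[x Lx <-] [_ /= Wx']] <-]; have [_ Ex] := DU (FU _ FL _ Lx).
    by rewrite Ex in Wx' *; exists x.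
  move=> [x [Lx Wx'] <-]; have [U2x Ex] := DU (FU _ FL _ Lx).
  exists (D x); last by rewrite Ex.
  by split; [exists x|split=> //=; rewrite Ex].
Qed.

End Transport.

(** * Quadratic cones *)

Section ConeGeometry.
Context {R : realType} {n : nat}.
Local Notation V := 'rV[R]_n.+1.
Variable k : R.
Implicit Types x y z : V.

(* For k = 1, 0 and -1, [cone k] is the complement of the origin, a half-space and the upper light
   cone, its unit sphere [csph k] is the round sphere, a hyperplane and the hyperboloid, and [Bf k]
   is the form inducing the metric of the latter. *)
Definition tdot x y : R := \sum_(i < n) x ord0 (lift ord0 i) * y ord0 (lift ord0 i).
Definition Qf x y : R := x ord0 ord0 * y ord0 ord0 + k * tdot x y.
Definition Bf x y : R := tdot x y + k * (x ord0 ord0 * y ord0 ord0).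
Definition cone : set V := [set x | 0 < Qf x x /\ (k <= 0 -> 0 < x ord0 ord0)].
Definition rho x : R := Num.sqrt (Qf x x).

Lemma tdotC x y : tdot x y = tdot y x.
Proof. by apply: eq_bigr => i _; rewrite mulrC. Qed.
Lemma tdotDl x y z : tdot (x + y) z = tdot x z + tdot y z.
Proof. by rewrite -big_split; apply: eq_bigr => i _; rewrite mxE mulrDl. Qed.
Lemma tdotZl a x z : tdot (a *: x) z = a * tdot x z.
Proof. by rewrite mulr_sumr; apply: eq_bigr => i _; rewrite mxE mulrA. Qed.
Lemma tdot_ge0 x : 0 <= tdot x x.
Proof. by apply: sumr_ge0 => i _; rewrite -expr2 sqr_ge0. Qed.
Lemma tdotDr x y z : tdot z (x + y) = tdot z x + tdot z y.
Proof. by rewrite tdotC tdotDl !(tdotC _ z). Qed.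
Lemma tdotZr a x z : tdot z (a *: x) = a * tdot z x.
Proof. by rewrite tdotC tdotZl tdotC. Qed.

Lemma tdot_CS x y : tdot x y ^+ 2 <= tdot x x * tdot y y.
Proof.
have [y0|y0] := eqVneq (tdot y y) 0.
  have xy : tdot x y = 0.
    apply: big1 => i _; have /eqP : y ord0 (lift ord0 i) = 0; last by move=> /eqP ->; rewrite mulr0.
    move/eqP: y0; rewrite psumr_eq0 => [/allP /(_ i (mem_index_enum i)) /=|j _].
      by rewrite mulf_eq0 orbb => /eqP.
    by rewrite -expr2 sqr_ge0.
  by rewrite xy expr0n /= mulr_ge0 // tdot_ge0.
have yp : 0 < tdot y y by rewrite lt_neqAle eq_sym y0 tdot_ge0.
have := tdot_ge0 (tdot y y *: x + (- tdot x y) *: y).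
have -> : tdot (tdot y y *: x + (- tdot x y) *: y) (tdot y y *: x + (- tdot x y) *: y) =
    tdot y y * (tdot x x * tdot y y - tdot x y ^+ 2).
  by rewrite tdotDl !tdotDr !tdotZl !tdotZr (tdotC y x); ring.
by rewrite pmulr_rge0 // subr_ge0.
Qed.

Lemma QfC x y : Qf x y = Qf y x. Proof. by rewrite /Qf tdotC mulrC. Qed.
Lemma QfDl x y z : Qf (x + y) z = Qf x z + Qf y z.
Proof. by rewrite /Qf tdotDl mxE; ring. Qed.
Lemma QfZl a x z : Qf (a *: x) z = a * Qf x z.
Proof. by rewrite /Qf tdotZl mxE; ring. Qed.
Lemma QfDr x y z : Qf z (x + y) = Qf z x + Qf z y.
Proof. by rewrite QfC QfDl !(QfC _ z). Qed.
Lemma QfZr a x z : Qf z (a *: x) = a * Qf z x.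
Proof. by rewrite QfC QfZl QfC. Qed.
Lemma BfC x y : Bf x y = Bf y x. Proof. by rewrite /Bf tdotC; ring. Qed.
Lemma BfDl x y z : Bf (x + y) z = Bf x z + Bf y z.
Proof. by rewrite /Bf tdotDl mxE; ring. Qed.
Lemma BfZl a x z : Bf (a *: x) z = a * Bf x z.
Proof. by rewrite /Bf tdotZl mxE; ring. Qed.
Lemma BfZr a x z : Bf z (a *: x) = a * Bf z x.
Proof. by rewrite BfC BfZl BfC. Qed.

Lemma smooth_Qf (T : normedModType R) p (O : set T) (f g : T -> V) : open O ->
  Ck p O f -> Ck p O g -> Ck p O (fun t => Qf (f t) (g t)).
Proof.
move=> oO sf sg.
have H j : Ck p O (fun t => f t ord0 j * g t ord0 j) by apply: Ck_mulr => //; exact: Ck_coord.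
apply: Ck_add => //; apply: Ck_mulr => //; first exact: Ck_cst.
by apply: Ck_sum.
Qed.

Lemma open_cone : open cone.
Proof.
have oT := @openT V.
have o1 : open [set x | 0 < Qf x x].
  have -> : [set x | 0 < Qf x x] = setT `&` (fun x => Qf x x) @^-1` [set t | 0 < t].
    by apply/seteqP; split=> x //= [].
  apply: open_preimage; [exact: openT|exact: open_gt|] => x _.
  by have := @smooth_Qf V 0 setT id id oT (Ck_id _ _) (Ck_id _ _); apply.
have o2 : open [set x : V | 0 < x ord0 ord0].
  have -> : [set x : V | 0 < x ord0 ord0] = setT `&` (fun x : V => x ord0 ord0) @^-1` [set t | 0 < t].
    by apply/seteqP; split=> x //= [].
  apply: open_preimage; [exact: openT|exact: open_gt|] => x _.
  exact: coordl_continuous.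
have [k0|k0] := leP k 0.
  have -> : cone = [set x | 0 < Qf x x] `&` [set x : V | 0 < x ord0 ord0].
    by apply/seteqP; split=> x [Qx H]; split=> //; exact: H.
  exact: openI.
have -> // : cone = [set x | 0 < Qf x x].
apply/seteqP; split=> x; first by case.
by move=> H; split=> //; rewrite leNgt k0.
Qed.

Lemma coneZ c x : 0 < c -> cone x -> cone (c *: x).
Proof.
move=> c0 [Qx H]; split; first by rewrite QfZl QfZr !mulr_gt0.
by move=> /H x0; rewrite mxE mulr_gt0.
Qed.

Lemma rho_gt0 x : cone x -> 0 < rho x.
Proof. by move=> [Qx _]; rewrite sqrtr_gt0. Qed.

Lemma rho_sq x : cone x -> rho x ^+ 2 = Qf x x.
Proof. by move=> [Qx _]; rewrite sqr_sqrtr // ltW. Qed.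

Lemma rhoZ c x : 0 < c -> cone x -> rho (c *: x) = c * rho x.
Proof.
move=> c0 _; rewrite /rho QfZl QfZr mulrA -expr2 sqrtrM ?sqr_ge0 //.
by rewrite sqrtr_sqr gtr0_norm.
Qed.

Lemma smooth_rho : smooth cone rho.
Proof.
move=> p; apply: Ck_sqrt; [exact: open_cone|by move=> x []|].
by apply: smooth_Qf; [exact: open_cone|exact: Ck_id|exact: Ck_id].
Qed.

Lemma diff_Qf (T : normedModType R) (f g : T -> V) t u :
  differentiable f t -> differentiable g t ->
  differentiable (fun s => Qf (f s) (g s)) t /\
  'D_u (fun s => Qf (f s) (g s)) t = Qf ('D_u f t) (g t) + Qf (f t) ('D_u g t).
Proof.
move=> df dg.
have cd (h : T -> V) j : differentiable h t -> differentiable (fun s => h s ord0 j) t /\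
    'D_u (fun s => h s ord0 j) t = 'D_u h t ord0 j.
  move=> dh; have dc : differentiable (coordl ord0 j) (h t).
    by apply: linear_differentiable; exact: coordl_continuous.
  split; first exact: (differentiable_comp dh dc).
  by rewrite (derive_comp (g := coordl ord0 j) u dh dc) derive_clin //; exact: coordl_continuous.
have pr j : differentiable (fun s => f s ord0 j * g s ord0 j) t /\
   'D_u (fun s => f s ord0 j * g s ord0 j) t = 'D_u f t ord0 j * g t ord0 j + f t ord0 j * 'D_u g t
     ord0 j.
  have [d1 E1] := cd f j df; have [d2 E2] := cd g j dg.
  by have := diff_scale u d1 d2; rewrite E1 E2.
have [d1 E1] := derive_sumf u (fun i : 'I_n => proj1 (pr (lift ord0 i))).
have [d2 E2] := diff_scalec k u d1.
have [d3 E3] := diff_add u (proj1 (pr ord0)) d2.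
split; first exact: d3.
rewrite [LHS]E3 (proj2 (pr ord0)) E2 E1 /Qf /tdot.
under eq_bigr => i _ do rewrite (proj2 (pr (lift ord0 i))).
by rewrite big_split /= /GRing.scale /=; ring.
Qed.

Lemma derive_rho x h : cone x -> 'D_h rho x = Qf x h / rho x.
Proof.
move=> Cx; have [Qx _] := Cx.
have [dQ EQ] := diff_Qf h (differentiable_idf x) (differentiable_idf x).
have [_ ->] := diff_derive1_comp h dQ (is_derive1_sqrt Qx).
rewrite EQ derive_id (QfC h x) -/(rho x).
by field; rewrite gt_eqF // rho_gt0.
Qed.

Definition csph : set V := [set y | cone y /\ rho y = 1].

Lemma csphP y : csph y <-> Qf y y = 1 /\ (k <= 0 -> 0 < y ord0 ord0).
Proof.
split=> [[[Q0 H] r1]|[Q1 H]]; first by split=> //; rewrite -rho_sq ?r1 ?expr1n.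
have Cy : cone y by split=> //; rewrite Q1.
by split=> //; rewrite /rho Q1 sqrtr1.
Qed.

Lemma csph_tangent y h : csph y -> 'D_h rho y = Qf y h.
Proof. by move=> [Cy r1]; rewrite derive_rho // r1 divr1. Qed.

Lemma csph_normalize x : cone x -> csph ((rho x)^-1 *: x) /\ x = rho x *: ((rho x)^-1 *: x).
Proof.
move=> Cx; have r0 := rho_gt0 Cx; have ri : 0 < (rho x)^-1 by rewrite invr_gt0.
split; first by split; [exact: coneZ|rewrite rhoZ // mulVf // gt_eqF].
by rewrite scalerA divff ?scale1r // gt_eqF.
Qed.

Hypothesis hk : [\/ k = 1, k = 0 | k = -1].

(** For k = 1 and -1 the forms satisfy Q = k B identically; for k = 0, tangency to the hyperplane
    makes coordinate 0 of x vanish. *)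
Lemma Qf_Bf x y : Qf y x = 0 -> csph y -> Qf x x = k * Bf x x.
Proof.
case: hk => kE; rewrite /Qf /Bf kE.
- by move=> _ _; ring.
- move=> E /csphP [_ y0]; have := y0; rewrite kE lexx => /(_ isT) {}y0.
  move: E; rewrite !mul0r !addr0 => /eqP; rewrite mulf_eq0 gt_eqF //= => /eqP ->; ring.
- by move=> _ _; ring.
Qed.

Lemma cone_Bf_eq0 x y w : csph y -> Qf y w = 0 -> Qf y x = 0 -> (Bf x w = 0 \/ k = 0) -> Qf x w = 0.
Proof.
case: hk => kE Sy; rewrite /Qf /Bf kE.
- move=> _ _ [|/eqP]; last by rewrite oner_eq0.
  by rewrite !mul1r addrC.
- move=> E _ _; have [_] := (csphP y).1 Sy; rewrite kE lexx => /(_ isT) y0.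
  move: E; rewrite !mul0r !addr0 => /eqP; rewrite mulf_eq0 gt_eqF //= => /eqP ->; ring.
- move=> _ _ [|/eqP]; last by rewrite oppr_eq0 oner_eq0.
  by move=> E; rewrite -[RHS]oppr0 -E; ring.
Qed.

Variables (w0 : V -> V) (al be : R -> R).
Hypothesis sw0 : smooth_on csph w0.
Hypothesis Qw0 : forall y, csph y -> Qf y (w0 y) = 0 /\ Bf (w0 y) (w0 y) = 1.
Hypotheses (sal : smooth setT al) (sbe : smooth setT be).
Hypothesis albe : forall r, al r ^+ 2 + k * be r ^+ 2 = 1.
Hypothesis al_gt0 : forall r, k <= 0 -> 0 < al r.
Hypothesis be_ge0 : forall r, 0 <= r -> 0 <= be r.

Definition wext x := rho x *: w0 ((rho x)^-1 *: x).

Lemma wextE y : csph y -> wext y = w0 y.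
Proof. by move=> [_ r1]; rewrite /wext r1 invr1 !scale1r. Qed.

Lemma wext_smooth : smooth cone wext.
Proof.
have oC := open_cone.
apply: smooth_on_smooth => //.
have s1 : smooth cone (fun x => (rho x)^-1 *: x).
  move=> p; apply: Ck_scale => //; last exact: Ck_id.
  by apply: Ck_inv => [//|x /rho_gt0|]; [rewrite lt0r => /andP[]|exact: smooth_rho].
have s2 : smooth_on cone (fun x => w0 ((rho x)^-1 *: x)).
  apply: (smooth_on_comp (B := csph)) => //; last exact: smooth_smooth_on.
  by move=> x Cx; have [] := csph_normalize Cx.
have s3 := smooth_on_smooth oC s2.
apply: smooth_smooth_on => // p; apply: Ck_scale => //; exact: smooth_rho.
Qed.

Lemma wextZ c x : 0 < c -> cone x -> wext (c *: x) = c *: wext x.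
Proof.
move=> c0 Cx; rewrite /wext rhoZ // -scalerA; congr (_ *: (_ *: w0 _)).
rewrite scalerA invfM mulrAC mulVf ?mul1r // gt_eqF //.
Qed.

Lemma Qw y : csph y -> Qf (w0 y) (w0 y) = k.
Proof. by move=> Sy; have [Q1 B1] := Qw0 Sy; rewrite (Qf_Bf Q1 Sy) B1 mulr1. Qed.

(** With a and b the time coordinates of y and w0 y, Cauchy-Schwarz on the space coordinates reads
    a^2 b^2 <= (a^2 - 1) (1 + b^2). The bound keeps the combinations of y and w0 y in the upper
    light cone. *)
Lemma w0_bound y : k = -1 -> csph y -> w0 y ord0 ord0 ^+ 2 <= y ord0 ord0 ^+ 2 - 1.
Proof.
move=> kE Sy; have [Q1 B1] := Qw0 Sy; have [Qy yp] := (csphP y).1 Sy.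
have := tdot_CS y (w0 y); move: Q1 B1 Qy; rewrite /Qf /Bf kE.
set a := y ord0 ord0; set b := w0 y ord0 ord0; set p := tdot y y; set q := tdot y (w0 y).
set s := tdot _ _ => E1 E2 E3.
have -> : q = a * b by lra.
have -> : s = 1 + b ^+ 2 by rewrite expr2; lra.
have -> : p = a ^+ 2 - 1 by rewrite expr2; lra.
have -> : (a * b) ^+ 2 = a ^+ 2 * b ^+ 2 by ring.
nra.
Qed.

(** The relation al^2 + k be^2 = 1 keeps Q = 1. The sign of coordinate 0 is delicate only for k =
    -1, where [w0_bound] gives (be w_0)^2 < (al y_0)^2. *)
Lemma comb_csph y r : 0 <= r -> csph y -> csph (al r *: y + be r *: w0 y).
Proof.
move=> r0 Sy; have [Q1 _] := Qw0 Sy; have [Qy yp] := (csphP y).1 Sy.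
apply/csphP; split.
  rewrite !(QfDl, QfDr, QfZl, QfZr) Qy Q1 (QfC (w0 y) y) Q1 Qw //; apply: etrans (albe r); ring.
move=> k0; rewrite !mxE; have y0 := yp k0; have a0 := al_gt0 r k0; have b0 := be_ge0 r0.
have ab := albe r.
case: hk => kE.
- by move: k0; rewrite kE ler10.
- have : w0 y ord0 ord0 = 0.
    by move: Q1; rewrite /Qf kE mul0r addr0 => /eqP; rewrite mulf_eq0 gt_eqF //= => /eqP.
  by move=> ->; rewrite mulr0 addr0 mulr_gt0.
- have wb := w0_bound kE Sy.
  rewrite kE mulN1r in ab.
  set a := y ord0 ord0 in y0 wb *; set b := w0 y ord0 ord0 in wb *.
  have h1 : (be r * b) ^+ 2 < (al r * a) ^+ 2.
    have -> : (be r * b) ^+ 2 = be r ^+ 2 * b ^+ 2 by ring.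
    have -> : (al r * a) ^+ 2 = (1 + be r ^+ 2) * a ^+ 2.
      by rewrite exprMn; congr (_ * _); lra.
    have := sqr_ge0 (be r); have : 0 < a ^+ 2 by rewrite exprn_gt0.
    nra.
  have aa : 0 < al r * a by rewrite mulr_gt0.
  have [h|h] := leP 0 (be r * b); first by rewrite ltr_wpDr.
  have : `|be r * b| < `|al r * a|.
    by rewrite -ltr_sqr ?nnegrE // !real_normK ?num_real.
  rewrite (gtr0_norm aa) (ltr0_norm h); lra.
Qed.

Lemma comb_cone r x : 0 <= r -> cone x ->
  cone (al r *: x + be r *: wext x) /\ rho (al r *: x + be r *: wext x) = rho x.
Proof.
move=> r0 Cx; have [Sy xE] := csph_normalize Cx; set y := (rho x)^-1 *: x in Sy xE *.
have rx := rho_gt0 Cx; have [Cy _] := Sy.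
have wx : wext x = rho x *: w0 y by rewrite /wext.
have [Cz rz] := comb_csph r0 Sy.
have -> : al r *: x + be r *: wext x = rho x *: (al r *: y + be r *: w0 y).
  by rewrite wx [X in al r *: X]xE scalerDr !scalerA [al r * _]mulrC [be r * _]mulrC.
split; first exact: (coneZ rx Cz).
by rewrite (rhoZ rx Cz) rz mulr1.
Qed.

Lemma segment_bounded (f : R -> R) r1 : smooth setT f -> 0 <= r1 ->
  exists M, forall t, 0 <= t <= r1 -> f t <= M.
Proof.
move=> sf r10; have fc : {within `[0, r1], continuous f}.
  by apply: continuous_subspaceT => t; exact: (smooth_cont sf).
by have [c _ Hc] := EVT_max r10 fc; exists (f c) => t t01; apply: Hc; rewrite in_itv.
Qed.

Lemma tdot_coord x i : `|x ord0 (lift ord0 i)| ^+ 2 <= tdot x x.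
Proof.
rewrite real_normK ?num_real // /tdot (bigD1 i) //= expr2 lerDl.
by apply: sumr_ge0 => j _; rewrite -expr2 sqr_ge0.
Qed.

Lemma level_compact (c M : R) : 0 < c ->
  exists K, [/\ compact K, K `<=` cone &
    forall x, cone x -> rho x = c -> (forall j, `|x ord0 j| <= M) -> K x].
Proof.
move=> c0.
(* Coordinate 0 is only required to be nonnegative, to make K closed; the strict inequality comes
   back from Q = c^2 > 0 and k <= 0. *)
pose K : set V := [set x | [/\ Qf x x = c ^+ 2, (k <= 0 -> 0 <= x ord0 ord0) & forall j, `|x ord0
  j| <= M]].
exists K; split.
- apply: bounded_closed_compact.
    exists `|M|; split; first exact: num_real.
    move=> M' MM' x [_ _ H]; apply: rV_norm_le => [|i j].
      by apply: le_trans (ltW MM').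
    by rewrite ord1; apply: le_trans (H j) _; apply: le_trans (ler_norm _) (ltW MM').
  have clc j (P : set R) : closed P -> closed [set x : V | P (x ord0 j)].
    move=> cP; apply: (closed_comp (f := coordl ord0 j)) cP => x _; exact: coordl_continuous.
  have -> : K = [set x | Qf x x = c ^+ 2] `&` ([set x : V | k <= 0 -> 0 <= x ord0 ord0] `&`
      \bigcap_(j in [set: 'I_n.+1]) [set x : V | `|x ord0 j| <= M]).
    apply/seteqP; split=> x; first by move=> [h1 h2 h3]; do 2 split=> //; move=> j _; exact: h3.
    by move=> [h1 [h2 h3]]; split=> // j; exact: h3.
  apply: closedI.
    apply: (closed_comp (f := fun x => Qf x x) (D := [set t | t = c ^+ 2])); last exact: closed_eq.
    move=> x _; have := @smooth_Qf V 0 setT id id (@openT V) (Ck_id _ _) (Ck_id _ _); exact.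
  apply: closedI.
    have [k0|k0] := leP k 0.
      have -> : [set x : V | true -> 0 <= x ord0 ord0] = [set x : V | [set t | 0 <= t] (x ord0 ord0)].
        by apply/seteqP; split=> x /=; [apply|].
      by apply: clc; exact: closed_ge.
    have -> : [set x : V | false -> 0 <= x ord0 ord0] = setT by apply/seteqP; split.
    exact: closedT.
  apply: closed_bigI => j _.
  have -> : [set x : V | `|x ord0 j| <= M] = [set x : V | ([set t | - M <= t] `&` [set t | t <= M])
    (x ord0 j)].
    by apply/seteqP; split=> x /=; rewrite ler_norml => /andP.
  by apply: clc; apply: closedI; [exact: closed_ge|exact: closed_le].
- move=> x [Qx H _]; have Q0 : 0 < Qf x x by rewrite Qx exprn_gt0.
  split=> // k0; rewrite lt_neqAle H // andbT eq_sym; apply/eqP => x0.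
  move: Q0; rewrite /Qf x0 mul0r add0r; apply/negP; rewrite -leNgt.
  by apply: mulr_le0_ge0 => //; exact: tdot_ge0.
- move=> x Cx rx H; split=> //; first by rewrite -rx rho_sq.
  by move=> k0; apply: ltW; have [_] := Cx; apply.
Qed.

(** As rho is preserved, it is enough to bound the coordinates of x. For k = 1, rho is the norm. For
    k = 0, al = 1 and w has norm rho, so x stays within be t * rho z of z. For k = -1, w is
    Q-orthogonal to x, so Q(x, z) = al t * rho(z)^2, while Cauchy-Schwarz bounds Q(x, z) below by
    x_0 (z_0 - s), with s the length of the space part of z. *)
Lemma comb_proper z r1 : cone z -> 0 <= r1 -> exists K, [/\ compact K, K `<=` cone &
  forall t x, 0 <= t <= r1 -> cone x -> al t *: x + be t *: wext x = z -> K x].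
Proof.
move=> Cz r10.
have [Ma HMa] := segment_bounded sal r10; have [Mb HMb] := segment_bounded sbe r10.
suff [M HM] : exists M, forall t x, 0 <= t <= r1 -> cone x -> al t *: x + be t *: wext x = z ->
    forall j, `|x ord0 j| <= M.
  have [K [cK KC HK]] := level_compact M (rho_gt0 Cz).
  exists K; split=> // t x t01 Cx E; apply: HK => //; last exact: (HM t).
  by rewrite -E; case/andP: (t01) => t0 _; have [_ ->] := comb_cone t0 Cx.
have rz := rho_gt0 Cz.
have rE t x : 0 <= t <= r1 -> cone x -> al t *: x + be t *: wext x = z -> rho x = rho z.
  by move=> /andP[t0 _] Cx <-; have [_ ->] := comb_cone t0 Cx.
have sqle (a b : R) : 0 <= b -> `|a| ^+ 2 <= b ^+ 2 -> `|a| <= b.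
  by move=> b0; rewrite ler_sqr ?nnegrE.
case: hk => kE.
- exists (rho z) => t x t01 Cx E j; rewrite -(rE t x) //.
  apply: sqle; first exact: ltW (rho_gt0 Cx).
  rewrite rho_sq // /Qf kE mul1r; case: (unliftP ord0 j) => [i ->|->].
    by apply: le_trans (tdot_coord x i) _; rewrite lerDr -expr2 sqr_ge0.
  by rewrite real_normK ?num_real // expr2 lerDl tdot_ge0.
- exists (\sum_j `|z ord0 j| + `|Mb| * rho z + rho z) => t x t01 Cx E j.
  have k0 : k <= 0 by rewrite kE.
  have a1 : al t = 1.
    have := albe t; rewrite kE mul0r addr0 => /eqP; rewrite sqrf_eq1 => /orP[/eqP //|/eqP a1].
    by have := al_gt0 t k0; rewrite a1 oppr_gt0 ltr10.
  have zs : `|z ord0 j| <= \sum_j `|z ord0 j| by rewrite (bigD1 j) //= lerDl sumr_ge0.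
  have rx := rE t x t01 Cx E.
  case: (unliftP ord0 j) => [i ji|->]; last first.
    apply: le_trans (_ : rho z <= _); last by rewrite lerDr addr_ge0 ?sumr_ge0 // mulr_ge0 // ltW.
    apply: sqle; first exact: ltW.
    by rewrite -rx rho_sq // /Qf kE mul0r addr0 real_normK ?num_real // expr2.
  have [Sy xE] := csph_normalize Cx; have [Q1 B1] := Qw0 Sy.
  have xj : x ord0 j = z ord0 j - be t * wext x ord0 j by rewrite -E a1 !mxE; ring.
  have wj : `|wext x ord0 j| <= rho z.
    rewrite /wext mxE normrM (gtr0_norm (rho_gt0 Cx)) rx -[leRHS]mulr1 ler_wpM2l ?(ltW rz) //.
    apply: sqle => //; rewrite expr1n -B1 /Bf kE mul0r addr0 ji; rewrite -?rx; exact: tdot_coord.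
  rewrite xj; apply: le_trans (ler_normB _ _) _.
  apply: le_trans (_ : \sum_j `|z ord0 j| + `|Mb| * rho z <= _); last by rewrite lerDl ltW.
  apply: lerD => //; rewrite normrM; apply: ler_pM => //.
  case/andP: (t01) => t0 _; rewrite ger0_norm ?be_ge0 //.
  by apply: le_trans (HMb t t01) _; exact: ler_norm.
have k0 : k <= 0 by rewrite kE oppr_le0.
have [Qz z0] := Cz; have {}z0 := z0 k0.
pose s := Num.sqrt (tdot z z).
have s2 : s ^+ 2 = tdot z z by rewrite sqr_sqrtr // tdot_ge0.
have s0 : 0 <= s by exact: sqrtr_ge0.
have sz : s < z ord0 ord0.
  rewrite -ltr_sqr ?nnegrE // ?ltW // s2; move: Qz; rewrite /Qf kE mulN1r subr_gt0 expr2 //.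
exists (`|Ma| * rho z ^+ 2 / (z ord0 ord0 - s)) => t x t01 Cx E j.
have rx := rE t x t01 Cx E.
have [Qx x0] := Cx; have {}x0 := x0 k0.
have Qxx : Qf x x = rho z ^+ 2 by rewrite -rx rho_sq.
have txx : tdot x x = x ord0 ord0 ^+ 2 - rho z ^+ 2 by rewrite -Qxx /Qf kE expr2; ring.
have tx2 : tdot x x <= x ord0 ord0 ^+ 2 by rewrite txx gerBl sqr_ge0.
have [Sy xE] := csph_normalize Cx; have [Q1 B1] := Qw0 Sy.
have Qxw : Qf x (wext x) = 0 by rewrite {1}xE /wext QfZl QfZr Q1 !mulr0.
have Qxz : Qf x z = al t * rho z ^+ 2.
  by rewrite -[in LHS]E QfDr (QfZr (al t) x x) (QfZr (be t) (wext x) x) Qxw mulr0 addr0 Qxx.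
have CS := tdot_CS x z.
have h1 : tdot x z <= x ord0 ord0 * s.
  apply: le_trans (ler_norm _) _; apply: sqle; first by rewrite mulr_ge0 // ltW.
  rewrite real_normK ?num_real //; apply: le_trans CS _; rewrite exprMn s2.
  by apply: ler_wpM2r => //; exact: tdot_ge0.
have h2 : x ord0 ord0 * (z ord0 ord0 - s) <= `|Ma| * rho z ^+ 2.
  have -> : x ord0 ord0 * (z ord0 ord0 - s) = Qf x z + (tdot x z - x ord0 ord0 * s).
    by rewrite /Qf kE; ring.
  rewrite Qxz; apply: le_trans (_ : al t * rho z ^+ 2 <= _); first lra.
  apply: ler_wpM2r; first exact: sqr_ge0.
  by apply: le_trans (HMa t t01) _; exact: ler_norm.
have h3 : x ord0 ord0 <= `|Ma| * rho z ^+ 2 / (z ord0 ord0 - s).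
  by rewrite ler_pdivlMr ?subr_gt0.
apply: le_trans h3; case: (unliftP ord0 j) => [i ->|->]; last by rewrite gtr0_norm.
by apply: sqle (ltW x0) _; apply: le_trans (tdot_coord x i) tx2.
Qed.

End ConeGeometry.

(** * Bifoliations in the model *)

Section Curves.
Context {R : realType} {m : nat}.
Local Notation E := 'rV[R]_m.+1.

Lemma open_oo (e : R) : open [set t : R | - e < t < e].
Proof.
have -> : [set t : R | - e < t < e] = ball (0 : R) e.
  by apply/seteqP; split=> t; rewrite -ball_normE /= sub0r normrN ltr_norml.
exact: ball_open.
Qed.

Lemma curve_diff (S : set E) p u c : curve_at S p u c ->
  [/\ c 0 = p, differentiable c 0, 'D_1 c 0 = u & \forall t \near (0 : R), S (c t)].
Proof.
move=> [e [e0 sc cS c0 dc]]; have o := @open_oo e.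
have I0 : [set t : R | - e < t < e] 0 by rewrite /= oppr_lt0 e0.
split; [exact: c0|exact: (smooth_diff (smooth_on_smooth o sc) I0)|by rewrite -derive1E|].
by have := open_nbhs_nbhs (conj o I0); apply: filterS => t; exact: cS.
Qed.

Lemma curve_deriv (V : normedModType R) (S O : set E) p u c (P : E -> V) :
  open O -> smooth O P -> O p -> curve_at S p u c ->
  differentiable (fun t => P (c t)) 0 /\ 'D_1 (fun t => P (c t)) (0 : R) = 'D_u P p.
Proof.
move=> oO sP Op /curve_diff [c0 dc Dc _].
have dP : differentiable P (c 0) by rewrite c0; exact: smooth_diff sP Op.
split; first exact: (differentiable_comp dc dP).
by rewrite (derive_comp (1 : R) dc dP) Dc c0.
Qed.

Lemma smooth_on_dir (T W : normedModType R) (A : set T) (O : set E) (u g : T -> E) (P : E -> W) :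
  open O -> smooth O P -> (forall t, A t -> O (g t)) ->
  smooth_on A u -> smooth_on A g -> smooth_on A (fun t => 'D_(u t) P (g t)).
Proof.
move=> oO sP AO su sg t At.
have [Q1 [F [oQ1 Q1t sF FE]]] := su t At.
have [Q2 [G [oQ2 Q2t sG GE]]] := sg t At.
have oQ : open (Q1 `&` (Q2 `&` G @^-1` O)).
  apply: openI => //; apply: open_preimage => // x Qx; exact: (sG 0%N).
exists (Q1 `&` (Q2 `&` G @^-1` O)), (fun t => 'D_(F t) P (G t)); split=> //.
- by split=> //; split=> //=; rewrite GE //; exact: AO.
- move=> k; apply: (Ck_ext (f := fun t => \sum_i F t ord0 i *: 'D_(delta_mx ord0 i) P (G t))) => //.
    move=> s [_ [_ /= Os]]; rewrite [in RHS](row_sum_delta (F s)) derive_sumv //.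
    exact: smooth_diff sP Os.
  apply: Ck_sum => // i _; apply: Ck_scale => //.
    by apply: Ck_coord => //; apply: Ck_sub (sF k) => s [].
  apply: (Ck_comp (P := O) (g := 'D_(delta_mx ord0 i) P)) => //.
  + by move=> s [_ []].
  + by apply: Ck_sub (sG k) => s [_ []].
  + exact: smooth_derive.
- by move=> s [As [Q1s [Q2s _]]]; rewrite FE ?GE.
Qed.

Lemma smooth_on_opp (T W : normedModType R) (A : set T) (f : T -> W) :
  smooth_on A f -> smooth_on A (fun t => - f t).
Proof.
move=> sf t At; have [Q [F [oQ Qt sF FE]]] := sf t At.
exists Q, (fun t => - F t); split=> //; first by move=> k; apply: Ck_opp.
by move=> s /FE ->.
Qed.

End Curves.

(* N is homothetic, by theta = rho0^-1 P with inverse vth, to the unit sphere of [cone k], and its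
   exterior U is diffeomorphic to the cone by D, with inverse D'. *)
Section Model.
Context {R : realType} {m n : nat}.
Local Notation E := 'rV[R]_m.+1.
Local Notation V := 'rV[R]_n.+1.
Variables (kappa k rho0 : R) (N U O : set E) (P : E -> V) (vth : V -> E).
Variables (D : E -> V) (D' : V -> E) (al be : R -> R).
Hypothesis hk : [\/ k = 1, k = 0 | k = -1].
Hypotheses (oO : open O) (sP : smooth O P) (NO : N `<=` O) (rho0_gt0 : 0 < rho0).
Hypothesis svth : smooth_on (csph k) vth.
Hypothesis N_th : forall p, N p -> csph k (rho0^-1 *: P p) /\ vth (rho0^-1 *: P p) = p.
Hypothesis S_vth : forall y, csph k y -> N (vth y) /\ P (vth y) = rho0 *: y.
Hypotheses (sD : smooth_on U D) (sD' : smooth_on (cone k) D').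
Hypotheses (DU : forall x, U x -> cone k (D x) /\ D' (D x) = x).
Hypotheses (DU' : forall y, cone k y -> U (D' y) /\ D (D' y) = y).
Hypothesis ray_eq : forall p u, N p -> tangent N p u -> metric kappa p u u = 1 ->
  ray kappa p u = [set q | exists2 r, 0 < r &
    q = D' (r *: (al r *: (rho0^-1 *: P p) + be r *: 'D_u P p))].
Hypothesis metric_P : forall p x z, N p -> tangent N p x -> tangent N p z ->
  metric kappa p x z = Bf k ('D_x P p) ('D_z P p).
Hypothesis cov_P : forall v p x z c, unit_vector_field kappa N v -> N p ->
  curve_at N p x c -> tangent N p z ->
  inner_cov kappa p x (v p) (derive1 (v \o c) 0) z =
  Bf k ('D_1 (fun e : R => 'D_(v (c e)) P (c e)) 0) ('D_z P p).
Hypothesis metric_gt0 : forall p x, N p -> x != 0 -> 0 < metric kappa p x x.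
Hypotheses (sal : smooth setT al) (sbe : smooth setT be).
Hypothesis albe : forall r, al r ^+ 2 + k * be r ^+ 2 = 1.
Hypothesis al_gt0 : forall r, k <= 0 -> 0 < al r.
Hypotheses (al0 : al 0 = 1) (be0 : be 0 = 0) (be_gt0 : forall r, 0 < r -> 0 < be r).
Hypothesis wron : forall r, 0 < r -> al r * 'D_1 be r - 'D_1 al r * be r != 0.
Let bad lam := 0 < lam ^+ 2 + kappa /\ (kappa <= 0 -> lam < 0).
Hypothesis focal : forall lam, (exists2 r, 0 < r & al r + rho0 * lam * be r = 0) <-> bad lam.

Let be_ge0 r : 0 <= r -> 0 <= be r.
Proof. by rewrite le_eqVlt => /orP[/eqP <-|/be_gt0 /ltW //]; rewrite be0. Qed.

Let rn0 : rho0 != 0. Proof. by rewrite gt_eqF. Qed.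

(** Curves of N are read on the unit sphere; differentiating rho = 1 along them makes their
    velocities Q-orthogonal to y. *)
Lemma theta_path p x c : N p -> curve_at N p x c ->
  let h := rho0^-1 *: 'D_x P p in let y := rho0^-1 *: P p in
  [/\ csph k y, differentiable (fun e => rho0^-1 *: P (c e)) 0,
      'D_1 (fun e => rho0^-1 *: P (c e)) (0 : R) = h,
      \forall e \near (0 : R), csph k (rho0^-1 *: P (c e)) & Qf k y h = 0].
Proof.
move=> Np Hc h y; have [Sy _] := N_th Np.
have [d1 E1] := curve_deriv oO sP (NO Np) Hc.
have [c0 dc Dc Nc] := curve_diff Hc.
have [d2 E2] := diff_scalec (rho0^-1) (1 : R) d1.
have NS : \forall e \near (0 : R), csph k (rho0^-1 *: P (c e)) by apply: filterS Nc => e /N_th [].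
split; [exact: Sy|exact: d2|by rewrite E2 E1|exact: NS|].
have dr : differentiable (rho k) y by apply: smooth_diff (@smooth_rho _ _ k) (proj1 Sy).
rewrite -(csph_tangent _ Sy).
have dr' : differentiable (rho k) (rho0^-1 *: P (c 0)) by rewrite c0.
have := derive_comp (1 : R) d2 dr'; rewrite E2 E1 c0 -/h -/y => <-.
rewrite (near_eq_derive (g := fun _ => 1 : R)) ?derive_cst //.
by apply: filterS NS => e [].
Qed.

(** A tangent vector h of the unit sphere is realised by the normalised line y + t h, moved to N by
    vth. All velocities come from a single extension T of vth, so that L is homogeneous:
    [eigen_model_perp] needs L (lam h) = lam L h. *)
Lemma tangent_path y : csph k y -> exists L : V -> E,
  (forall a h, L (a *: h) = a *: L h) /\ forall h, Qf k y h = 0 -> exists c,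
    curve_at N (vth y) (L h) c /\ 'D_(L h) P (vth y) = rho0 *: h.
Proof.
move=> Sy; have [Q [T [oQ Qy sT TE]]] := svth Sy.
have dT := smooth_diff sT Qy.
exists (fun h => 'D_h T y); split; first by move=> a h; rewrite !deriveE // linearZ.
move=> h Qh; have [Cy ry] := Sy.
have oC := @open_cone R n k.
have [dz Dz] := diff_line y h 0.
have z0 : y + (0 : R) *: h = y by rewrite scale0r addr0.
have Cz0 : cone k (y + (0 : R) *: h) by rewrite z0.
have NC := @differentiable_near_open R R V _ (fun s : R => y + s *: h) 0 oC Cz0 dz.
have /nbhs_ballP [e /= e0 eC] := NC.
have eC' t : - e < t < e -> cone k (y + t *: h).
  by move=> te; apply: eC; rewrite -ball_normE /= sub0r normrN ltr_norml.
pose s (t : R) := (rho k (y + t *: h))^-1 *: (y + t *: h).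
have oe := @open_oo R e.
have sl : smooth [set t : R | - e < t < e] (fun t => y + t *: h).
  move=> p; apply: Ck_add => //; first exact: Ck_cst.
  by apply: Ck_scale => //; [exact: Ck_id|exact: Ck_cst].
have ss : smooth [set t : R | - e < t < e] s.
  move=> p; apply: Ck_scale => //; apply: Ck_inv => //.
    by move=> t /eC' /rho_gt0; rewrite lt0r => /andP[].
  exact: (Ck_comp oe eC' (sl p) (@smooth_rho _ _ k p)).
have sS t : - e < t < e -> csph k (s t) by move=> /eC' /csph_normalize [].
have I0 : [set t : R | - e < t < e] 0 by rewrite /= oppr_lt0 e0.
have s0 : s 0 = y by rewrite /s z0 ry invr1 scale1r.
have drz : differentiable (fun t : R => rho k (y + t *: h)) 0 /\ 'D_1 (fun t : R => rho k (y + t *: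
  h)) (0 : R) = 0.
  have dr := smooth_diff (@smooth_rho _ _ k) Cz0; split; first exact: (differentiable_comp dz dr).
  by rewrite (derive_comp (1 : R) dz dr) Dz z0 csph_tangent.
have rz0 : rho k (y + (0 : R) *: h) != 0 by rewrite z0 ry oner_eq0.
have dri : differentiable (fun t : R => (rho k (y + t *: h))^-1) 0 /\ 'D_1 (fun t : R => (rho k (y
  + t *: h))^-1) (0 : R) = 0.
  split; first exact: (@differentiableV _ _ (fun t : R => rho k (y + t *: h)) 0 (proj1 drz) rz0).
  rewrite [LHS](@deriveV _ _ (fun t : R => rho k (y + t *: h)) 0 1 rz0);
    last exact: diff_derivable (proj1 drz).
  by rewrite (proj2 drz) scaler0.
have Ds : 'D_1 s 0 = h.
  rewrite (proj2 (diff_scale (1 : R) (proj1 dri) dz)).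
  by rewrite (proj2 dri) Dz z0 ry invr1 scale0r add0r scale1r.
have ds : differentiable s 0 := smooth_diff ss I0.
have svs : smooth_on [set t : R | - e < t < e] (fun t => vth (s t)).
  by apply: (smooth_on_comp (B := csph k)) => //; exact: smooth_smooth_on.
have Hc : curve_at N (vth y) ('D_h T y) (fun t => vth (s t)).
  exists e; split; [exact: e0|exact: svs|by move=> t /sS /S_vth []|by rewrite s0|].
  have Qs0 : Q (s 0) by rewrite s0.
    have NQ := differentiable_near_open oQ Qs0 ds.
    have Nt : \forall t \near (0 : R), T (s t) = vth (s t).
      have := open_nbhs_nbhs (conj oe I0); apply: filterS2 NQ => t Qt te.
      by apply: TE; split=> //; exact: sS.
    rewrite derive1E -(near_eq_derive _ Nt).
    have dTs : differentiable T (s 0) by rewrite s0.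
    by rewrite (derive_comp (1 : R) ds dTs) Ds s0.
exists (fun t => vth (s t)); split=> //.
have [Ny Py] := S_vth Sy.
have [_ <-] := curve_deriv oO sP (NO Ny) Hc.
have Nt : \forall t \near (0 : R), rho0 *: s t = P (vth (s t)).
  have := open_nbhs_nbhs (conj oe I0); apply: filterS => t te.
  by have [_ ->] := S_vth (sS t te).
by rewrite -(near_eq_derive _ Nt); have [_ ->] := diff_scalec rho0 (1 : R) ds; rewrite Ds.
Qed.

Lemma tangent_opp p u : N p -> tangent N p u -> tangent N p (- u).
Proof.
move=> Np [c [e [e0 sc cN c0 dc]]].
exists (fun t => c (- t)), e; split=> //.
- apply: (smooth_on_comp1 (B := [set t : R | - e < t < e]) (f := fun t => - t)) => //.
    by move=> t /= te; lra.
  apply: smooth_smooth_on; first exact: open_oo.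
  by move=> p'; apply: Ck_opp; [exact: open_oo|exact: Ck_id].
- by move=> t te; apply: cN; lra.
- by rewrite oppr0.
have [_ dc0 Dc0 _] := @curve_diff _ _ N p u c ltac:(by exists e).
have [d1 D1] := diff_scalec (-1) (1 : R) (differentiable_idf (0 : R)).
have d1' : differentiable (fun t : R => - t) 0.
  by apply: near_differentiable d1; near=> t; rewrite scaleN1r.
have D1' : 'D_1 (fun t : R => - t) (0 : R) = -1.
  rewrite (near_eq_derive (g := fun t : R => -1 *: t)); last by near=> t; rewrite scaleN1r.
  by rewrite D1 derive_id scaleN1r.
have dc0' : differentiable c (- 0) by rewrite oppr0.
rewrite derive1E (derive_comp (1 : R) d1' dc0') D1' oppr0.
by rewrite deriveE // linearN -deriveE // Dc0.
Unshelve. all: by end_near. Qed.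

Section Field.
Variable v : E -> E.
Hypothesis hv : unit_vector_field kappa N v.

Definition model_field y := 'D_(v (vth y)) P (vth y).
Local Notation w0 := model_field.

Let sw0 : smooth_on (csph k) w0.
Proof.
apply: (smooth_on_dir oO sP) => //; first by move=> y /S_vth [] /NO.
apply: (smooth_on_comp (B := N) (f := vth) (g := v)) => //; first by move=> y /S_vth [].
by have [] := hv.
Qed.

Lemma model_field_unit y : csph k y -> Qf k y (w0 y) = 0 /\ Bf k (w0 y) (w0 y) = 1.
Proof.
move=> Sy; have [Ny Py] := S_vth Sy; have [_ /(_ _ Ny) [tv mv]] := hv.
have [c Hc] := tv; have [_ _ _ _] := theta_path Ny Hc.
rewrite Py scalerA mulVf // scale1r QfZr => /eqP; rewrite mulf_eq0 invr_eq0 (negbTE rn0) /= => /eqP Q0.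
by split=> //; rewrite -metric_P.
Qed.

Local Notation wx := (wext k w0).
Let swx : smooth (cone k) wx. Proof. exact: wext_smooth. Qed.

Lemma model_core : smooth_foliation n (cone k) (unit_ray_leaves (cone k) (rho k) wx al be) <->
  no_focal (cone k) (rho k) wx al be.
Proof.
have oC := @open_cone R n k.
have HG r x := comb_cone hk model_field_unit albe al_gt0 be_ge0 (r := r) (x := x).
split.
  apply: foliation_no_focal => //; try exact: smooth_rho; try exact: swx.
  - exact: coneZ.
  - exact: rho_gt0.
  - exact: rhoZ.
  - exact: wextZ.
apply: no_focal_foliation => //; try exact: smooth_rho; try exact: swx.
- exact: coneZ.
- exact: rho_gt0.
- exact: rhoZ.
- exact: wextZ.
- exact: (comb_proper hk model_field_unit sal sbe albe al_gt0 be_ge0).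
Qed.

Lemma cone_map_ray y r : csph k y -> 0 < r ->
  cone_map (rho k) wx al be (r *: y) = r *: (al r *: y + be r *: w0 y).
Proof.
move=> Sy r0; have [Cy ry] := Sy.
have E1 : wx (r *: y) = r *: w0 y by rewrite (wextZ _ r0 Cy) (wextE _ Sy).
rewrite /cone_map (rhoZ r0 Cy) ry mulr1 E1 scalerDr !scalerA.
by rewrite (mulrC r (al r)) (mulrC r (be r)).
Qed.

Let leafE p : N p -> D @` (ray kappa p (v p)) =
    cone_leaf (cone_map (rho k) wx al be) (rho0^-1 *: P p) /\
  D' @` cone_leaf (cone_map (rho k) wx al be) (rho0^-1 *: P p) = ray kappa p (v p).
Proof.
move=> Np; have [_ /(_ _ Np) [tv mv]] := hv; have [Sy vy] := N_th Np.
rewrite ray_eq //; set y := rho0^-1 *: P p in Sy vy *.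
have wy : w0 y = 'D_(v p) P p by rewrite /w0 vy.
have HG r := comb_csph hk model_field_unit albe al_gt0 be_ge0 (y := y) (r := r).
have Cr r : 0 < r -> cone k (r *: (al r *: y + be r *: w0 y)).
  by move=> r0; apply: coneZ => //; have [] := HG r (ltW r0) Sy.
split; apply/seteqP; split=> q.
- move=> [_ [r r0 ->] <-]; exists r => //; rewrite cone_map_ray //.
  by rewrite -wy; have [_ ->] := DU' (Cr r r0).
- move=> [r r0 ->]; exists (D' (r *: (al r *: y + be r *: w0 y))); first by exists r; rewrite -?wy.
  by have [_ ->] := DU' (Cr r r0); rewrite cone_map_ray.
- by move=> [_ [r r0 ->] <-]; exists r; rewrite -?wy ?cone_map_ray.
- by move=> [r r0 ->]; exists (r *: (al r *: y + be r *: w0 y)); rewrite ?wy //; exists r;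
  rewrite ?cone_map_ray ?wy.
Qed.

Lemma model_foliation : forward_foliates kappa n N U v <-> no_focal (cone k) (rho k) wx al be.
Proof.
rewrite -model_core /forward_foliates; split=> F.
  have := foliation_transport sD sD' DU DU' F; congr (smooth_foliation _ _ _).
  apply/seteqP; split=> L.
    by move=> [_ [p Np ->] <-]; exists (rho0^-1 *: P p); [exact: (proj1 (N_th Np))|have [-> _] :=
      leafE Np].
  move=> [y Sy ->]; have [Ny Py] := S_vth Sy.
  exists (ray kappa (vth y) (v (vth y))); first by exists (vth y).
  have yE : rho0^-1 *: P (vth y) = y by rewrite Py scalerA (mulVf rn0) scale1r.
  by have [-> _] := leafE Ny; rewrite yE.
have := foliation_transport sD' sD DU' DU F; congr (smooth_foliation _ _ _).
apply/seteqP; split=> L.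
  move=> [_ [y Sy ->] <-]; have [Ny Py] := S_vth Sy; exists (vth y); first exact: Ny.
  have yE : rho0^-1 *: P (vth y) = y by rewrite Py scalerA (mulVf rn0) scale1r.
  by have [_ <-] := leafE Ny; rewrite yE.
move=> [p Np ->]; exists (cone_leaf (cone_map (rho k) wx al be) (rho0^-1 *: P p)).
  by exists (rho0^-1 *: P p); [exact: (proj1 (N_th Np))|].
by have [_ ->] := leafE Np.
Qed.

(** Along a curve of N, the field read in V is [wext] composed with the projected curve, so
    covariant derivatives of v become derivatives of the homogeneous field. *)
Lemma model_derive p x c : N p -> curve_at N p x c ->
  differentiable (fun e : R => 'D_(v (c e)) P (c e)) 0 /\
  'D_1 (fun e : R => 'D_(v (c e)) P (c e)) 0 = 'D_(rho0^-1 *: 'D_x P p) wx (rho0^-1 *: P p).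
Proof.
move=> Np Hc; have [Sy d1 E1 NS _] := theta_path Np Hc.
have [c0 _ _ Nc] := curve_diff Hc.
have dw : differentiable wx (rho0^-1 *: P (c 0)) by rewrite c0; apply: smooth_diff swx (proj1 Sy).
have Nt : \forall e \near (0 : R), wx (rho0^-1 *: P (c e)) = 'D_(v (c e)) P (c e).
  apply: filterS Nc => e Ne; have [Se ve] := N_th Ne.
  by rewrite (wextE _ Se) /w0 ve.
split; first by apply: near_differentiable Nt _; exact: (differentiable_comp d1 dw).
by rewrite -(near_eq_derive _ Nt) (derive_comp (1 : R) d1 dw) E1 c0.
Qed.

(** Differentiating Q(x, wext x) = 0 along h shows that the derivative of the field is tangent to
    the unit sphere, so the tangential projection in [cov_deriv] loses nothing. *)
Lemma perp_Qf y h : csph k y -> Qf k y h = 0 -> Bf k h (w0 y) = 0 \/ k = 0 -> Qf k y ('D_h wx y) = 0.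
Proof.
move=> Sy Qh Bh; have [Q1 B1] := model_field_unit Sy.
have Qhw : Qf k h (w0 y) = 0 by exact: (cone_Bf_eq0 hk Sy Q1 Qh Bh).
have dw := smooth_diff swx (proj1 Sy).
have [_ E] := diff_Qf k h (differentiable_idf y) dw.
have Nz : \forall x \near y, Qf k x (wx x) = 0.
  have := open_nbhs_nbhs (conj (@open_cone R n k) (proj1 Sy)); apply: filterS => x Cx.
  have [Sx xE] := csph_normalize Cx; have [Q2 _] := model_field_unit Sx.
  by rewrite {1}xE /wext QfZl QfZr Q2 !mulr0.
have E0 : 'D_h (fun x => Qf k x (wx x)) y = 0.
  by rewrite (near_eq_derive (g := fun _ => 0 : R) _ Nz) derive_cst.
by move: E; rewrite E0 derive_id (wextE _ Sy) Qhw add0r => <-.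
Qed.

(** [cov_deriv] only gives an equality after pairing with tangent vectors. Here both sides are
    tangent, so their difference can be paired with itself. *)
Lemma perp_eigen_model p lam : N p -> nabla_perp_eigenvalue kappa N v p lam ->
  exists h, [/\ Qf k (rho0^-1 *: P p) h = 0, h != 0 &
    'D_h wx (rho0^-1 *: P p) = (rho0 * lam) *: h].
Proof.
move=> Np [x [tx mx x0 [tlx [c [Hc H]]]]].
have [Sy d1 E1 NS Qh] := theta_path Np Hc; set y := rho0^-1 *: P p in Sy Qh *.
set h := rho0^-1 *: 'D_x P p in E1 Qh *.
have Px : 'D_x P p = rho0 *: h by rewrite scalerA divff // scale1r.
have [_ /(_ _ Np) [tv mv]] := hv.
have Nvy : vth y = p by have [] := N_th Np.
have wy : w0 y = 'D_(v p) P p by rewrite /w0 Nvy.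
have Bh : Bf k h (w0 y) = 0.
  have := mx; rewrite (metric_P Np tx tv) wy Px BfZl => /eqP.
  by rewrite mulf_eq0 (negbTE rn0) => /eqP.
have h0 : h != 0.
  apply: contraTneq (metric_gt0 Np x0) => h0.
  by rewrite metric_P // Px h0 scaler0 -(scale0r (0 : V)) BfZl mul0r ltxx.
exists h; split=> //.
have Qa := perp_Qf Sy Qh (or_introl Bh).
have [_ Da] := model_derive Np Hc; rewrite -/h -/y in Da.
(* The defect d of the eigenvector equation is tangent, hence the image of some z tangent to N;
   being B-orthogonal to itself, it vanishes by positivity of the metric. *)
pose d := 'D_h wx y + (- (rho0 * lam)) *: h.
have Qd : Qf k y d = 0 by rewrite /d QfDr QfZr Qa Qh mulr0 addr0.
have [L [LZ HL]] := tangent_path Sy.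
have [cz [Hz Pz]] := HL _ Qd; rewrite Nvy in Hz Pz.
set z := L d in Hz Pz.
have tz : tangent N p z by exists cz.
have dP := smooth_diff sP (NO Np).
have E := H z tz; rewrite (cov_P hv Np Hc tz) Da (metric_P Np tlx tz) Pz in E.
have E2 : Bf k d (rho0 *: d) = 0.
  rewrite {1}/d BfDl -E; have -> : 'D_(lam *: x) P p = (rho0 * lam) *: h.
    by rewrite deriveE // linearZ -deriveE //= Px scalerA mulrC.
  by rewrite -BfDl -scalerDl subrr BfZl mul0r.
have z0 : z = 0.
  apply: contrapT => /eqP /(metric_gt0 Np).
  by rewrite (metric_P Np tz tz) Pz BfZl E2 mulr0 ltxx.
have d0 : d = 0.
  move: Pz; rewrite z0 derive0 => /esym /eqP; rewrite scaler_eq0 (negbTE rn0) => /eqP //.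
by apply/eqP; rewrite -subr_eq0 -scaleNr -/d d0.
Qed.

(** For k nonzero, differentiating Q(x, wext x) = 0 along h gives Q(h, w) = 0, since lam h is
    Q-orthogonal to y. For k = 0 the form Q only sees coordinate 0, and |w| = 1 is differentiated
    instead, which yields lam B(h, w) = 0. *)
Lemma eigen_Bf y h lam : csph k y -> Qf k y h = 0 -> 'D_h wx y = lam *: h ->
  lam != 0 \/ k != 0 -> Bf k h (w0 y) = 0.
Proof.
move=> Sy Qh Dw Hl; have dw := smooth_diff swx (proj1 Sy).
have [Q1 B1] := model_field_unit Sy.
have oC := @open_cone R n k.
have [k0|k0] := eqVneq k 0; last first.
  have Q2 : Qf k h (w0 y) = 0.
    have [_ E] := diff_Qf k h (differentiable_idf y) dw.
    have Nz : \forall x \near y, Qf k x (wx x) = 0.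
      have := open_nbhs_nbhs (conj oC (proj1 Sy)); apply: filterS => x Cx.
      have [Sx xE] := csph_normalize Cx; have [Q2 _] := model_field_unit Sx.
      by rewrite {1}xE /wext QfZl QfZr Q2 !mulr0.
    have E0 : 'D_h (fun x => Qf k x (wx x)) y = 0.
      by rewrite (near_eq_derive (g := fun _ => 0 : R) _ Nz) derive_cst.
    by move: E; rewrite E0 derive_id (wextE _ Sy) Dw QfZr Qh mulr0 addr0.
  move: Q2; rewrite /Qf /Bf; case: hk => kE; [|by move: k0; rewrite kE eqxx|]; rewrite kE => Q2.
    by rewrite -[RHS]Q2; ring.
  by rewrite -[RHS]oppr0 -[in RHS]Q2; ring.
have l0 : lam != 0 by case: Hl => //; rewrite k0 eqxx.
have wz x : cone k x -> wx x ord0 ord0 = 0 /\ Qf 1 (wx x) (wx x) = Qf k x x.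
  move=> Cx; have [Sx xE] := csph_normalize Cx; have [Q2 B2] := model_field_unit Sx.
  have [_ Hp] := (csphP _ _).1 Sx; have {}Hp := Hp ltac:(by rewrite k0).
  have w00 : w0 ((rho k x)^-1 *: x) ord0 ord0 = 0.
    have nz : ((rho k x)^-1 *: x) ord0 ord0 != 0 by rewrite gt_eqF.
    move: Q2; rewrite /Qf [X in _ + X * _]k0 mul0r addr0 => /eqP.
    by rewrite mulf_eq0 (negbTE nz) => /eqP.
  split; first by rewrite /wext mxE w00 mulr0.
  rewrite -(rho_sq Cx) /wext QfZl QfZr mulrA -expr2 -[RHS]mulr1; congr (_ * _).
  apply: etrans B2; rewrite /Qf /Bf w00; ring.
have [_ E1] := diff_Qf 1 h dw dw.
have [_ E2] := diff_Qf k h (differentiable_idf y) (differentiable_idf y).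
have Nz : \forall x \near y, Qf 1 (wx x) (wx x) = Qf k x x.
  by have := open_nbhs_nbhs (conj oC (proj1 Sy)); apply: filterS => x /wz [].
move: E1; rewrite (near_eq_derive _ Nz) E2 derive_id (QfC k h y) Qh addr0 Dw QfZl QfZr (QfC 1 (wx y) h).
move=> /esym /eqP; rewrite -mulr2n mulrn_eq0 /= mulf_eq0 (negbTE l0) /= => /eqP.
have [w00 _] := wz y (proj1 Sy).
by rewrite -(wextE w0 Sy) /Qf /Bf w00 k0 => Q3; rewrite -[RHS]Q3; ring.
Qed.

Lemma eigen_model_perp y h lam : csph k y -> Qf k y h = 0 -> h != 0 ->
  'D_h wx y = (rho0 * lam) *: h -> lam != 0 \/ k != 0 ->
  nabla_perp_eigenvalue kappa N v (vth y) lam.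
Proof.
move=> Sy Qh h0 Dw Hl; have [Ny Py] := S_vth Sy.
have Bh : Bf k h (w0 y) = 0.
  by apply: eigen_Bf Dw _ => //; case: Hl => ?; [left; rewrite mulf_neq0|right].
have [L [LZ HL]] := tangent_path Sy.
have [c [Hc Px]] := HL h Qh; set x := L h in Hc Px.
have Qlh : Qf k y (lam *: h) = 0 by rewrite QfZr Qh mulr0.
have [c' [Hc' Px']] := HL _ Qlh; rewrite LZ -/x in Hc' Px'.
have tx : tangent N (vth y) x by exists c.
have tlx : tangent N (vth y) (lam *: x) by exists c'.
have [_ /(_ _ Ny) [tv mv]] := hv.
exists x; split; [exact: tx| | |].
- by rewrite (metric_P Ny tx tv) Px BfZl -/(w0 y) Bh mulr0.
- apply/eqP => x0; move: Px; rewrite x0 derive0 => /esym /eqP.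
  by rewrite scaler_eq0 (negbTE rn0) (negbTE h0).
- split=> //; exists c; split=> // z tz.
  rewrite (cov_P hv Ny Hc tz) (metric_P Ny tlx tz) Px'.
  have [_ ->] := model_derive Ny Hc; rewrite Px Py !scalerA (mulVf rn0) !scale1r Dw.
  by rewrite mulrC.
Qed.

Lemma model_forward : forward_foliates kappa n N U v <->
  forall p, N p -> forall lam, nabla_perp_eigenvalue kappa N v p lam -> ~ bad lam.
Proof.
rewrite model_foliation; split=> H.
  move=> p Np lam pe /focal [r r0 E]; have [h [Qh h0 Dw]] := perp_eigen_model Np pe.
  have [Sy _] := N_th Np; have [Cy ry] := Sy.
  have := H _ h _ r Cy ry _ h0 Dw r0; rewrite csph_tangent // E eqxx => /(_ Qh).
  by [].
move=> y h lam r Cy ry Dr h0 Dw r0; apply/eqP => E.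
have Sy : csph k y by split.
have Qh : Qf k y h = 0 by rewrite -csph_tangent.
have [Ny _] := S_vth Sy.
have Dw' : 'D_h wx y = (rho0 * (lam / rho0)) *: h by rewrite Dw mulrCA divff // mulr1.
(* When k = 0, the focal equation with lam = 0 would read al r = 0, against [al_gt0]. *)
have Hl : lam / rho0 != 0 \/ k != 0.
  have [k0|?] := eqVneq k 0; last by right.
  left; apply/eqP => l0; have al1 := al_gt0 r; rewrite k0 lexx in al1.
  have lz : lam = 0 by move/eqP: l0; rewrite mulf_eq0 invr_eq0 (negbTE rn0) orbF => /eqP.
  by move: E (al1 isT); rewrite lz mul0r addr0 => ->; rewrite ltxx.
apply: (H _ Ny _ (eigen_model_perp Sy Qh h0 Dw' Hl)).
by apply/focal; exists r => //; rewrite mulrCA divff // mulr1.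
Qed.

End Field.

Lemma unit_field_opp v : unit_vector_field kappa N v -> unit_vector_field kappa N (fun p => - v p).
Proof.
move=> [sv Hv]; split; first exact: smooth_on_opp.
move=> p Np; have [tv mv] := Hv p Np; have to := tangent_opp Np tv; split=> //.
have dP := smooth_diff sP (NO Np).
move: mv; rewrite (metric_P Np tv tv) (metric_P Np to to).
have -> : 'D_(- v p) P p = (-1) *: 'D_(v p) P p by rewrite !deriveE // linearN scaleN1r.
by rewrite BfZl BfZr => ->; ring.
Qed.

Lemma perp_eigen_opp v p lam : unit_vector_field kappa N v -> N p ->
  nabla_perp_eigenvalue kappa N v p lam ->
  nabla_perp_eigenvalue kappa N (fun p => - v p) p (- lam).
Proof.
move=> hv Np [x [tx mx x0 [tlx [c [Hc H]]]]].
have hv' := unit_field_opp hv.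
have [_ /(_ _ Np) [tv mv]] := hv; have [_ /(_ _ Np) [tv' mv']] := hv'.
have dP := smooth_diff sP (NO Np).
have DN u : 'D_(- u) P p = (-1) *: 'D_u P p by rewrite !deriveE // linearN scaleN1r.
have tlx' : tangent N p (- lam *: x) by rewrite scaleNr; exact: tangent_opp.
exists x; split=> //.
  by move: mx; rewrite (metric_P Np tx tv) (metric_P Np tx tv') DN BfZr => ->; rewrite mulr0.
split=> //; exists c; split=> // z tz.
rewrite (cov_P hv' Np Hc tz) (metric_P Np tlx' tz) scaleNr DN BfZl.
rewrite -(metric_P Np tlx tz) (H z tz) (cov_P hv Np Hc tz).
have [dF _] := model_derive hv Np Hc.
have [c0 dc _ Nc] := curve_diff Hc.
have Nt : \forall e \near (0 : R), -1 *: 'D_(v (c e)) P (c e) = 'D_(- v (c e)) P (c e).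
  apply: filterS Nc => e Ne; have dPe := smooth_diff sP (NO Ne).
  by rewrite !deriveE // linearN scaleN1r.
rewrite -(near_eq_derive _ Nt); have [_ ->] := diff_scalec (-1) (1 : R) dF.
by rewrite BfZl.
Qed.

Lemma model_bifoliates v : unit_vector_field kappa N v ->
  bifoliates kappa n N U v <->
  forall p, N p -> forall lam, nabla_perp_eigenvalue kappa N v p lam -> lam ^+ 2 + kappa <= 0.
Proof.
move=> hv; have hv' := unit_field_opp hv.
have F := model_forward hv; have F' := model_forward hv'.
split.
  move=> [/F H /F' H'] p Np lam pe; rewrite leNgt; apply/negP => b.
  have [k0|k0] := leP kappa 0; last by apply: (H p Np lam pe); split=> //; rewrite leNgt k0.
  have l0 : lam != 0 by apply: contraTneq b => ->; rewrite expr0n /= add0r -leNgt.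
  have [l1|l1] := ltP lam 0; first by apply: (H p Np lam pe); split.
  apply: (H' p Np (- lam) (perp_eigen_opp hv Np pe)); split; first by rewrite sqrrN.
  by rewrite oppr_lt0 lt_neqAle eq_sym l0 l1.
move=> H; split; [apply/F|apply/F'] => p Np lam pe [b _].
  by move: (H p Np lam pe); rewrite leNgt b.
have := perp_eigen_opp hv' Np pe.
have -> : (fun p => - - v p) = v by apply/funext => q; rewrite opprK.
by move=> /(H p Np); rewrite sqrrN leNgt b.
Qed.

End Model.

Section NormalizedPair.
Context {R : realType}.
Variables (k rho0 : R) (A B : R -> R).
Hypotheses (sA : smooth setT A) (sB : smooth setT B).
Hypothesis norm_gt0 : forall r, 0 < A r ^+ 2 + k * B r ^+ 2.
Hypotheses (A_gt0 : forall r, k <= 0 -> 0 < A r) (A0 : A 0 = rho0) (B0 : B 0 = 0).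
Hypotheses (rho0_gt0 : 0 < rho0) (B_gt0 : forall r, 0 < r -> 0 < B r).
Hypothesis wronAB : forall r, 0 < r -> A r * 'D_1 B r - 'D_1 A r * B r != 0.

(* For k <> 0 the geodesic rays are A r *: y + B r *: w up to a positive factor, and [nal], [nbe]
   rescale the pair so that the curve stays on the unit sphere of the cone. *)
Definition pair_norm r := Num.sqrt (A r ^+ 2 + k * B r ^+ 2).
Definition nal r := A r / pair_norm r.
Definition nbe r := B r / pair_norm r.

Lemma pair_norm_gt0 r : 0 < pair_norm r. Proof. by rewrite sqrtr_gt0. Qed.
Let norm_neq0 r : pair_norm r != 0. Proof. by rewrite gt_eqF // pair_norm_gt0. Qed.

Lemma pair_norm_sq r : pair_norm r ^+ 2 = A r ^+ 2 + k * B r ^+ 2.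
Proof. by rewrite sqr_sqrtr // ltW. Qed.

Lemma smooth_pair_inv : smooth setT (fun r => (pair_norm r)^-1).
Proof.
move=> p; have oT := @openT R; apply: Ck_inv => //.
apply: Ck_sqrt => //; apply: Ck_add => //; first exact: Ck_exp.
by apply: Ck_mulr => //; [exact: Ck_cst|exact: Ck_exp].
Qed.

Lemma nal_smooth : smooth setT nal.
Proof. by move=> p; apply: Ck_mulr; [exact: openT|exact: sA|exact: smooth_pair_inv]. Qed.
Lemma nbe_smooth : smooth setT nbe.
Proof. by move=> p; apply: Ck_mulr; [exact: openT|exact: sB|exact: smooth_pair_inv]. Qed.

Lemma nal_nbe r : nal r ^+ 2 + k * nbe r ^+ 2 = 1.
Proof.
have -> : nal r ^+ 2 + k * nbe r ^+ 2 = (A r ^+ 2 + k * B r ^+ 2) / pair_norm r ^+ 2.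
  by rewrite /nal /nbe; field.
by rewrite pair_norm_sq divff // gt_eqF.
Qed.

Lemma nal_gt0 r : k <= 0 -> 0 < nal r.
Proof. by move=> /(A_gt0 r) Ar; rewrite divr_gt0 // pair_norm_gt0. Qed.

Lemma nal0 : nal 0 = 1.
Proof.
rewrite /nal /pair_norm A0 B0 expr0n /= mulr0 addr0 sqrtr_sqr gtr0_norm // divff //.
by rewrite gt_eqF.
Qed.

Lemma nbe0 : nbe 0 = 0. Proof. by rewrite /nbe B0 mul0r. Qed.

Lemma nbe_gt0 r : 0 < r -> 0 < nbe r.
Proof. by move=> r0; rewrite divr_gt0 ?B_gt0 // pair_norm_gt0. Qed.

(** Multiplying both functions by the same factor multiplies their Wronskian by its square. *)
Lemma nwron r : 0 < r -> nal r * 'D_1 nbe r - 'D_1 nal r * nbe r != 0.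
Proof.
move=> r0.
have dA := smooth_diff sA (I : setT r); have dB := smooth_diff sB (I : setT r).
have df := smooth_diff smooth_pair_inv (I : setT r).
have [_ EA] := diff_scale (1 : R) dA df; have [_ EB] := diff_scale (1 : R) dB df.
rewrite /GRing.scale /= in EA EB.
have -> : nal r * 'D_1 nbe r - 'D_1 nal r * nbe r =
   (pair_norm r)^-1 ^+ 2 * (A r * 'D_1 B r - 'D_1 A r * B r).
  by rewrite [X in _ * X - _]EB [X in _ - X * _]EA /nal /nbe; ring.
by rewrite mulf_neq0 ?wronAB // expf_neq0 // invr_eq0.
Qed.

Lemma nfocal c r : (nal r + c * nbe r == 0) = (A r + c * B r == 0).
Proof.
have -> : nal r + c * nbe r = (A r + c * B r) / pair_norm r by rewrite /nal /nbe; field.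
by rewrite mulf_eq0 invr_eq0 (negbTE (norm_neq0 r)) orbF.
Qed.

End NormalizedPair.

Lemma Qf_comb (R : realType) n (k a b : R) (x y : 'rV[R]_n.+1) :
  Qf k (a *: x + b *: y) (a *: x + b *: y) =
  a ^+ 2 * Qf k x x + 2 * a * b * Qf k x y + b ^+ 2 * Qf k y y.
Proof. by rewrite !QfDl !QfDr !QfZl !QfZr (QfC k y x); ring. Qed.

(** * Rays in curvature kappa = - q^2, with q possibly 0 *)

Section Nonpositive.
Context {R : realType} {m n : nat}.
Local Notation E := 'rV[R]_m.+1.
Local Notation V := 'rV[R]_n.+1.
Variables (q k rho0 : R) (N O : set E) (P : E -> V) (vth P' : V -> E).
Let kappa := - q ^+ 2.
Let U := [set x | [/\ O x, cone k (P x) & rho0 < rho k (P x)]].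
Let C' := [set z : V | cone k z /\ rho0 < rho k z].
Hypothesis hk : [\/ k = 1, k = 0 | k = -1].
Hypotheses (oO : open O) (sP : smooth O P) (NO : N `<=` O) (rho0_gt0 : 0 < rho0).
Hypothesis ck_gt0 : 0 < rho0 ^+ 2 * q ^+ 2 + k.
Hypothesis svth : smooth_on (csph k) vth.
Hypothesis N_th : forall p, N p -> csph k (rho0^-1 *: P p) /\ vth (rho0^-1 *: P p) = p.
Hypothesis S_vth : forall y, csph k y -> N (vth y) /\ P (vth y) = rho0 *: y.
Hypothesis sP' : smooth_on C' P'.
Hypothesis P'P : forall x, U x -> P' (P x) = x.
Hypothesis PP' : forall z, C' z -> U (P' z) /\ P (P' z) = z.
Hypothesis ray_P : forall p u, N p -> tangent N p u -> metric kappa p u u = 1 ->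
  ray kappa p u = [set x | exists2 r, 0 < r &
    x = P' ((rho0 * Num.sqrt (1 + q ^+ 2 * r ^+ 2)) *: (rho0^-1 *: P p) + r *: 'D_u P p)].
Hypothesis metric_P : forall p x z, N p -> tangent N p x -> tangent N p z ->
  metric kappa p x z = Bf k ('D_x P p) ('D_z P p).
Hypothesis cov_P : forall v p x z c, unit_vector_field kappa N v -> N p ->
  curve_at N p x c -> tangent N p z ->
  inner_cov kappa p x (v p) (derive1 (v \o c) 0) z =
  Bf k ('D_1 (fun e : R => 'D_(v (c e)) P (c e)) 0) ('D_z P p).
Hypothesis metric_gt0 : forall p x, N p -> x != 0 -> 0 < metric kappa p x x.

Let s (r : R) := Num.sqrt (1 + q ^+ 2 * r ^+ 2).
Let A r := rho0 * s r.
Let B (r : R) := r.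
Let ck := rho0 ^+ 2 * q ^+ 2 + k.

Let s_gt0 r : 0 < s r.
Proof. by rewrite sqrtr_gt0 ltr_pwDl // mulr_ge0 // sqr_ge0. Qed.
Let s_sq r : s r ^+ 2 = 1 + q ^+ 2 * r ^+ 2.
Proof. by rewrite sqr_sqrtr // addr_ge0 // mulr_ge0 // sqr_ge0. Qed.
Let normE r : A r ^+ 2 + k * B r ^+ 2 = rho0 ^+ 2 + ck * r ^+ 2.
Proof. by rewrite /A exprMn s_sq /B /ck; ring. Qed.
Let norm_gt0 r : 0 < A r ^+ 2 + k * B r ^+ 2.
Proof. by rewrite normE ltr_pwDl ?exprn_gt0 // mulr_ge0 ?sqr_ge0 // ltW. Qed.
Let A_gt0 r : k <= 0 -> 0 < A r. Proof. by move=> _; rewrite mulr_gt0. Qed.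
Let A0 : A 0 = rho0. Proof. by rewrite /A /s expr0n /= mulr0 addr0 sqrtr1 mulr1. Qed.
Let ss : smooth setT s.
Proof.
move=> p; have oT := @openT R; apply: Ck_sqrt => //.
  by move=> r _; rewrite ltr_pwDl // mulr_ge0 // sqr_ge0.
apply: Ck_add => //; first exact: Ck_cst.
by apply: Ck_mulr => //; [exact: Ck_cst|apply: Ck_exp => //; exact: Ck_id].
Qed.
Let sA : smooth setT A.
Proof. by move=> p; apply: Ck_mulr; [exact: openT|exact: Ck_cst|exact: ss]. Qed.
Let sB : smooth setT B. Proof. by move=> p; exact: Ck_id. Qed.
Let wronAB r : 0 < r -> A r * 'D_1 B r - 'D_1 A r * B r != 0.
Proof.
move=> r0; have ds := smooth_diff ss (I : setT r).
have [_ EA] := diff_scalec rho0 (1 : R) ds; rewrite /GRing.scale /= in EA.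
have [d2 E2] := diff_scale (1 : R) ds ds; rewrite /GRing.scale /= in E2.
have E3 : 'D_1 (fun y => s y * s y) r = 2 * (q ^+ 2 * r).
  have -> : (fun y => s y * s y) = (fun y => 1 + q ^+ 2 * (y * y)).
    by apply/funext => y; rewrite -!expr2 s_sq.
  have [d4 E4] := diff_scale (1 : R) (differentiable_idf r) (differentiable_idf r).
  have [d5 E5] := diff_scalec (q ^+ 2) (1 : R) d4.
  have [_ E6] := diff_add (1 : R) (differentiable_cst (1 : R) r) d5.
  rewrite [LHS]E6 E5 E4 derive_cst derive_id /GRing.scale /=; ring.
have sn : s r != 0 by rewrite gt_eqF.
have E7 : 'D_1 s r = q ^+ 2 * r / s r.
  have : s r * 'D_1 s r = q ^+ 2 * r by lra.
  by move=> <-; field.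
have -> : A r * 'D_1 B r - 'D_1 A r * B r = rho0 * (s r ^+ 2 - q ^+ 2 * r ^+ 2) / s r.
  by rewrite [X in _ * X - _]derive_id [X in _ - X * _]EA E7 /A /B; field.
by rewrite s_sq addrK mulr1 mulf_neq0 // ?invr_eq0 // gt_eqF.
Qed.

Let al := nal k A B.
Let be := nbe k A B.

(** The equation is sqrt(1 + q^2 r^2) + lam r = 0. A positive root requires lam < 0 and (lam^2 -
    q^2) r^2 = 1. *)
Let focal lam : (exists2 r, 0 < r & al r + rho0 * lam * be r = 0) <->
  (0 < lam ^+ 2 + kappa /\ (kappa <= 0 -> lam < 0)).
Proof.
have k0 : kappa <= 0 by rewrite oppr_le0 sqr_ge0.
split.
  move=> [r r0 /eqP]; rewrite nfocal // /A /B -mulrA -mulrDr mulf_eq0 gt_eqF //= => /eqP E.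
  have sr := s_gt0 r.
  have l0 : lam < 0.
    rewrite ltNge; apply/negP => l0; have : 0 <= lam * r by rewrite mulr_ge0 // ltW.
    lra.
  split=> //.
  have E2 : (lam ^+ 2 - q ^+ 2) * r ^+ 2 = 1.
    have sE : s r = - (lam * r) by lra.
    by have := s_sq r; rewrite sE => H; lra.
  have r2 : 0 < r ^+ 2 by rewrite exprn_gt0.
  by rewrite -(pmulr_lgt0 _ r2) E2.
move=> [h /(_ k0) l0]; rewrite /kappa in h.
pose r := (Num.sqrt (lam ^+ 2 - q ^+ 2))^-1.
have w0 : 0 < Num.sqrt (lam ^+ 2 - q ^+ 2) by rewrite sqrtr_gt0.
have r0 : 0 < r by rewrite invr_gt0.
have r2 : (lam ^+ 2 - q ^+ 2) * r ^+ 2 = 1.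
  by rewrite /r exprVn sqr_sqrtr ?(ltW h) // divff // gt_eqF.
exists r => //; apply/eqP; rewrite nfocal // /A /B -mulrA -mulrDr mulf_eq0; apply/orP; right.
rewrite addr_eq0; apply/eqP.
have -> : s r = Num.sqrt ((- (lam * r)) ^+ 2).
  by rewrite /s; congr Num.sqrt; rewrite sqrrN exprMn; lra.
rewrite sqrtr_sqr ger0_norm // oppr_ge0 mulr_le0_ge0 ?ltW //.
Qed.

(** By [normE], the point of parameter r on a ray is projected to Q = rho0^2 + ck r^2. D recovers r
    from Q and rescales the projection to the level r of rho. *)
Let D x := (Num.sqrt ((Qf k (P x) (P x) - rho0 ^+ 2) / ck) / rho k (P x)) *: P x.
Let D' x := P' ((Num.sqrt (rho0 ^+ 2 + ck * rho k x ^+ 2) / rho k x) *: x).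

Let C'P z : C' z -> 0 < Qf k z z - rho0 ^+ 2.
Proof.
by move=> [Cz rz]; rewrite -(rho_sq Cz) subr_gt0; move: rho0_gt0 rz; nra.
Qed.

Let DU x : U x -> cone k (D x) /\ D' (D x) = x.
Proof.
move=> Ux; have [Ox Cx rx] := Ux; have C'x : C' (P x) by split.
have Qx := C'P C'x; have rp := rho_gt0 Cx.
have ckp : 0 < ck by [].
set w := Num.sqrt ((Qf k (P x) (P x) - rho0 ^+ 2) / ck).
have w0 : 0 < w by rewrite sqrtr_gt0 divr_gt0.
have c0 : 0 < w / rho k (P x) by rewrite divr_gt0.
have CD : cone k (D x) by exact: coneZ.
split=> //; rewrite /D' rhoZ // -/w divfK ?gt_eqF //.
have -> : w ^+ 2 = (Qf k (P x) (P x) - rho0 ^+ 2) / ck by rewrite sqr_sqrtr // ltW // divr_gt0.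
have -> : rho0 ^+ 2 + ck * ((Qf k (P x) (P x) - rho0 ^+ 2) / ck) = Qf k (P x) (P x).
  by field; rewrite gt_eqF.
rewrite -/(rho k (P x)) /D -/w scalerA.
have -> : rho k (P x) / w * (w / rho k (P x)) = 1 by field; rewrite !gt_eqF.
by rewrite scale1r; exact: P'P.
Qed.

Let scaled z : cone k z -> C' ((Num.sqrt (rho0 ^+ 2 + ck * rho k z ^+ 2) / rho k z) *: z) /\
  rho k ((Num.sqrt (rho0 ^+ 2 + ck * rho k z ^+ 2) / rho k z) *: z) = Num.sqrt (rho0 ^+ 2 + ck *
    rho k z ^+ 2).
Proof.
move=> Cz; have rp := rho_gt0 Cz; have ckp : 0 < ck by [].
have h : 0 < ck * rho k z ^+ 2 by rewrite mulr_gt0 // exprn_gt0.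
have w0 : 0 < Num.sqrt (rho0 ^+ 2 + ck * rho k z ^+ 2) by rewrite sqrtr_gt0 addr_gt0 // exprn_gt0.
have c0 : 0 < Num.sqrt (rho0 ^+ 2 + ck * rho k z ^+ 2) / rho k z by rewrite divr_gt0.
have E : rho k ((Num.sqrt (rho0 ^+ 2 + ck * rho k z ^+ 2) / rho k z) *: z) = Num.sqrt (rho0 ^+ 2 +
  ck * rho k z ^+ 2).
  by rewrite rhoZ // divfK // gt_eqF.
split=> //; split; first exact: coneZ.
rewrite E -[X in X < _](ger0_norm (ltW rho0_gt0)) -sqrtr_sqr ltr_sqrt ?ltrDl //.
by rewrite addr_gt0 // exprn_gt0.
Qed.

Let DU' z : cone k z -> U (D' z) /\ D (D' z) = z.
Proof.
move=> Cz; have rp := rho_gt0 Cz; have ckp : 0 < ck by [].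
have h : 0 < ck * rho k z ^+ 2 by rewrite mulr_gt0 // exprn_gt0.
have [C'z rE] := scaled Cz; have [UD PD] := PP' C'z; split=> //.
rewrite /D /D' PD -(rho_sq (proj1 C'z)) rE sqr_sqrtr; last by rewrite addr_ge0 ?sqr_ge0 // ltW.
have -> : (rho0 ^+ 2 + ck * rho k z ^+ 2 - rho0 ^+ 2) / ck = rho k z ^+ 2.
  by field; rewrite gt_eqF.
rewrite sqrtr_sqr gtr0_norm // scalerA.
have w0 : 0 < Num.sqrt (rho0 ^+ 2 + ck * rho k z ^+ 2) by rewrite sqrtr_gt0 addr_gt0 // exprn_gt0.
have -> : rho k z / Num.sqrt (rho0 ^+ 2 + ck * rho k z ^+ 2) * (Num.sqrt (rho0 ^+ 2 + ck * rho k z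
  ^+ 2) / rho k z) = 1.
  by field; rewrite !gt_eqF.
by rewrite scale1r.
Qed.

Let oC' : open C'.
Proof.
have -> : C' = cone k `&` rho k @^-1` [set t | rho0 < t] by [].
apply: open_preimage; [exact: open_cone|exact: open_gt|].
by move=> x; apply: smooth_cont; exact: smooth_rho.
Qed.

Let oU : open U.
Proof.
have -> : U = O `&` P @^-1` C'.
  by apply/seteqP; split=> x; [move=> [Ox Cx rx]|move=> [Ox [Cx rx]]]; split.
by apply: open_preimage => // x; apply: smooth_cont.
Qed.

Let sD : smooth_on U D.
Proof.
apply: smooth_smooth_on => // p.
have sPU : Ck p U P by apply: Ck_sub (sP p) => x [].
have sQ : Ck p U (fun x => Qf k (P x) (P x)) by exact: smooth_Qf.
apply: Ck_scale => //; apply: Ck_mulr => //.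
  apply: Ck_sqrt => //.
    by move=> x [_ Cx rx]; rewrite divr_gt0 // C'P.
  by apply: Ck_mulr => //; [apply: Ck_sub_fun => //; exact: Ck_cst|exact: Ck_cst].
apply: Ck_inv => //; first by move=> x [_ /rho_gt0 rx _]; rewrite gt_eqF.
by apply: (Ck_comp (P := cone k) (g := rho k)) => //; [move=> x []|exact: smooth_rho].
Qed.

Let sD' : smooth_on (cone k) D'.
Proof.
have oC := @open_cone R n k.
apply: (smooth_on_comp (B := C') (g := P')) => //; first by move=> z /scaled [].
apply: smooth_smooth_on => // p.
apply: Ck_scale => //; last exact: Ck_id.
apply: Ck_mulr => //.
  apply: Ck_sqrt => //.
    by move=> x _; rewrite ltr_pwDl ?exprn_gt0 // mulr_ge0 ?sqr_ge0 // ltW.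
  apply: Ck_add => //; first exact: Ck_cst.
  by apply: Ck_mulr => //; [exact: Ck_cst|apply: Ck_exp => //; exact: smooth_rho].
by apply: Ck_inv => //; [move=> x /rho_gt0 rx; rewrite gt_eqF|exact: smooth_rho].
Qed.

Let ray_eq p u : N p -> tangent N p u -> metric kappa p u u = 1 ->
  ray kappa p u = [set x | exists2 r, 0 < r &
    x = D' (r *: (al r *: (rho0^-1 *: P p) + be r *: 'D_u P p))].
Proof.
move=> Np tu mu; rewrite ray_P //.
have [Sy _] := N_th Np; set y := rho0^-1 *: P p in Sy *.
have [c Hc] := tu; have [_ _ _ _ Qh] := theta_path oO sP NO N_th Np Hc.
have rn : rho0^-1 != 0 by rewrite invr_eq0 gt_eqF.
have Qyu : Qf k y ('D_u P p) = 0.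
  by move: Qh; rewrite QfZr => /eqP; rewrite mulf_eq0 (negbTE rn) /= => /eqP.
have Quu : Qf k ('D_u P p) ('D_u P p) = k.
  by rewrite (Qf_Bf hk Qyu Sy) -metric_P // mu mulr1.
clearbody y.
suff E r : 0 < r -> D' (r *: (al r *: y + be r *: 'D_u P p)) =
    P' ((rho0 * Num.sqrt (1 + q ^+ 2 * r ^+ 2)) *: y + r *: 'D_u P p).
  by apply/seteqP; split=> x [r r0 ->]; exists r; rewrite ?E.
move=> r0; set z := al r *: y + be r *: 'D_u P p.
have [Qy yp] := (csphP _ _).1 Sy.
have Qz : Qf k z z = 1.
  rewrite /z Qf_comb Qy Qyu Quu.
  by apply: etrans (nal_nbe norm_gt0 r); rewrite -/al -/be; ring.
have pn : 0 < pair_norm k A B r := pair_norm_gt0 norm_gt0 r.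
have zE : pair_norm k A B r *: z = A r *: y + B r *: 'D_u P p.
  rewrite /z scalerDr !scalerA /al /be /nal /nbe.
  by congr (_ *: _ + _ *: _); field; rewrite gt_eqF.
have rz : rho k (r *: z) = r.
  by rewrite /rho (QfZl k r z (r *: z)) (QfZr k r z z) Qz mulr1 -expr2 sqrtr_sqr gtr0_norm.
rewrite /D' rz scalerA divfK ?gt_eqF // -normE -/(pair_norm k A B r) zE.
by [].
Qed.

Lemma nonpositive_bifoliates v : unit_vector_field kappa N v ->
  bifoliates kappa n N U v <->
  forall p, N p -> forall lam, nabla_perp_eigenvalue kappa N v p lam -> lam ^+ 2 + kappa <= 0.
Proof.
have sal : smooth setT al := nal_smooth sA sB norm_gt0.
have sbe : smooth setT be := nbe_smooth sA sB norm_gt0.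
have al0 : al 0 = 1 := @nal0 _ k rho0 A B A0 erefl rho0_gt0.
have be0 : be 0 = 0 := nbe0 k A (erefl (B 0)).
have be_gt0 r : 0 < r -> 0 < be r by exact: nbe_gt0.
apply: (model_bifoliates hk oO sP NO rho0_gt0 svth N_th S_vth sD sD' DU DU' ray_eq metric_P cov_P
  metric_gt0 sal sbe (nal_nbe norm_gt0) _ al0 be0 be_gt0 _ focal).
- by move=> r k0; exact: nal_gt0.
- by move=> r r0; exact: (nwron sA sB norm_gt0 wronAB).
Qed.

End Nonpositive.

(** * Embeddings in linear spaces and geodesics *)

Section BilinearForm.
Context {R : realType} {l : nat}.
Local Notation L := 'rV[R]_l.
Variable BL : L -> L -> R.
Hypotheses (BLC : forall X Z, BL X Z = BL Z X).
Hypotheses (BLD : forall X Y Z, BL (X + Y) Z = BL X Z + BL Y Z).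
Hypotheses (BLZ : forall a X Z, BL (a *: X) Z = a * BL X Z).

Lemma BL_sum (I : finType) (F : I -> L) Z : BL (\sum_i F i) Z = \sum_i BL (F i) Z.
Proof.
have BL0 : BL 0 Z = 0 by rewrite -(scale0r (0 : L)) BLZ mul0r.
by elim/big_rec2: _ => // i x y _ <-; rewrite BLD.
Qed.

Lemma BL_coord X Z : BL X Z = \sum_i X ord0 i * BL (delta_mx ord0 i) Z.
Proof. by rewrite {1}[X]row_sum_delta BL_sum; apply: eq_bigr => i _; rewrite BLZ. Qed.

Lemma diff_coord (T : normedModType R) (f : T -> L) t u i : differentiable f t ->
  differentiable (fun s => f s ord0 i) t /\ 'D_u (fun s => f s ord0 i) t = 'D_u f t ord0 i.
Proof.
move=> df; have dc : differentiable (coordl ord0 i) (f t).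
  by apply: linear_differentiable; exact: coordl_continuous.
split; first exact: (differentiable_comp df dc).
by rewrite (derive_comp (g := coordl ord0 i) u df dc) derive_clin //; exact: coordl_continuous.
Qed.

Lemma diff_linr (T : normedModType R) (f : T -> L) (a : 'I_l -> R) t u : differentiable f t ->
  differentiable (fun s => \sum_i f s ord0 i * a i) t /\
  'D_u (fun s => \sum_i f s ord0 i * a i) t = \sum_i 'D_u f t ord0 i * a i.
Proof.
move=> df.
have H i := diff_scale u (proj1 (diff_coord u i df)) (differentiable_cst (a i) t).
have [d E] := derive_sumf u (fun i => proj1 (H i)); split; first exact: d.
rewrite [LHS]E; apply: eq_bigr => i _.
by rewrite (proj2 (H i)) derive_cst scaler0 addr0 (proj2 (diff_coord u i df)).
Qed.

Lemma diff_BL (T : normedModType R) (f g : T -> L) t u :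
  differentiable f t -> differentiable g t ->
  differentiable (fun s => BL (f s) (g s)) t /\
  'D_u (fun s => BL (f s) (g s)) t = BL ('D_u f t) (g t) + BL (f t) ('D_u g t).
Proof.
move=> df dg.
have E1 : (fun s => BL (f s) (g s)) =
    (fun s => \sum_i f s ord0 i * \sum_j g s ord0 j * BL (delta_mx ord0 j) (delta_mx ord0 i)).
  apply/funext => s; rewrite BL_coord; apply: eq_bigr => i _; congr (_ * _).
  by rewrite BLC BL_coord.
have dgi i := diff_linr (fun j => BL (delta_mx ord0 j) (delta_mx ord0 i)) u dg.
have H i := diff_scale u (proj1 (diff_coord u i df)) (proj1 (dgi i)).
have [d E] := derive_sumf u (fun i => proj1 (H i)).
rewrite E1; split; first exact: d.
rewrite [LHS]E; under eq_bigr => i _ do rewrite (proj2 (H i)) (proj2 (dgi i)) (proj2 (diff_coord u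
  i df)).
rewrite big_split /=; congr (_ + _).
  by rewrite [RHS]BL_coord; apply: eq_bigr => i _; rewrite [in RHS]BLC [in RHS]BL_coord.
rewrite [RHS]BL_coord; apply: eq_bigr => i _.
by rewrite [in RHS]BLC [in RHS]BL_coord.
Qed.

End BilinearForm.

(** * Uniqueness for linear differential equations *)

Section LinearODE.
Context {R : realType}.

Lemma const_derive0 (f : R -> R) : smooth setT f -> (forall t, 'D_1 f t = 0) -> forall t, f t = f 0.
Proof.
move=> sf f0 t; apply: is_derive_0_is_cst => x.
apply: DeriveDef; last exact: f0.
by apply: diff_derivable; exact: (smooth_diff sf (I : setT x)).
Qed.

Let dI (f : R -> R) t (sf : smooth setT f) : differentiable f t := smooth_diff sf (I : setT t).
Let oT := @openT R.

(** The energy q^2 f^2 + f'^2 is constant, hence 0. *)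
Lemma ode_pos (q : R) (f : R -> R) : smooth setT f -> 0 < q ->
  (forall t, 'D_1 (fun s => 'D_1 f s) t = - q ^+ 2 * f t) -> f 0 = 0 -> 'D_1 f 0 = 0 ->
  forall t, f t = 0.
Proof.
move=> sf q0 E f0 f'0.
have sf' := smooth_derive (1 : R) sf.
pose e t := q ^+ 2 * (f t * f t) + 'D_1 f t * 'D_1 f t.
have se : smooth setT e.
  move=> p; apply: Ck_add => //; last exact: Ck_mulr.
  by apply: Ck_mulr; [|exact: Ck_cst|exact: Ck_mulr].
have de t : 'D_1 e t = 0.
  have [d1 E1] := diff_scale (1 : R) (dI t sf) (dI t sf).
  have [d2 E2] := diff_scale (1 : R) (dI t sf') (dI t sf').
  have [d3 E3] := diff_scalec (q ^+ 2) (1 : R) d1.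
  have [_ E4] := diff_add (1 : R) d3 d2.
  by rewrite [LHS]E4 E3 E1 E2 E /GRing.scale /=; ring.
move=> t; have := const_derive0 se de t; rewrite /e f0 f'0 !mulr0 addr0 -!expr2 => H.
have h1 := sqr_ge0 (f t); have h2 := sqr_ge0 ('D_1 f t).
have : q ^+ 2 * f t ^+ 2 = 0.
  have : 0 <= q ^+ 2 * f t ^+ 2 by rewrite mulr_ge0 // sqr_ge0.
  lra.
by move/eqP; rewrite mulf_eq0 !sqrf_eq0 gt_eqF //= => /eqP.
Qed.

Lemma ode_exp (q : R) (f : R -> R) : smooth setT f -> (forall t, 'D_1 f t = q * f t) -> f 0 = 0 ->
  forall t, f t = 0.
Proof.
move=> sf E f0.
pose ex (t : R) := expR (- q * t).
have sl : smooth setT (fun t : R => - q * t).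
  by move=> p; apply: Ck_mulr; [|exact: Ck_cst|exact: Ck_id].
have sex : smooth setT ex by move=> p; apply: Ck_expR => //; exact: sl.
have dex t : 'D_1 ex t = ex t * - q.
  have [_ ->] := diff_derive1_comp (1 : R) (dI t sl) (is_derive_expR (- q * t)).
  have [_ E1] := diff_scalec (- q) (1 : R) (differentiable_idf t).
  by rewrite [X in _ * X]E1 derive_id /GRing.scale /= mulr1.
have sg : smooth setT (fun t => ex t * f t) by move=> p; apply: Ck_mulr.
have dg t : 'D_1 (fun t => ex t * f t) t = 0.
  have [_ E1] := diff_scale (1 : R) (dI t sex) (dI t sf).
  by rewrite [LHS]E1 dex E /GRing.scale /=; ring.
move=> t; have := const_derive0 sg dg t; rewrite f0 mulr0 => /eqP.
by rewrite mulf_eq0 gt_eqF ?expR_gt0 //= => /eqP.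
Qed.

(** The equation factors: g = f' - q f satisfies g' = - q g, so g = 0, and then f' = q f. The case q
    = 0 serves for straight lines. *)
Lemma ode_neg (q : R) (f : R -> R) : smooth setT f ->
  (forall t, 'D_1 (fun s => 'D_1 f s) t = q ^+ 2 * f t) -> f 0 = 0 -> 'D_1 f 0 = 0 ->
  forall t, f t = 0.
Proof.
move=> sf E f0 f'0; have sf' := smooth_derive (1 : R) sf.
have sg : smooth setT (fun t => 'D_1 f t + (- q) * f t).
  by move=> p; apply: Ck_add => //; apply: Ck_mulr; [|exact: Ck_cst|].
have g0 t : 'D_1 f t + (- q) * f t = 0.
  apply: (@ode_exp (- q) _ sg) => [s|]; last by rewrite f0 f'0 mulr0 addr0.
  have [d1 E1] := diff_scalec (- q) (1 : R) (dI s sf).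
  have [_ E2] := diff_add (1 : R) (dI s sf') d1.
  by rewrite [LHS]E2 E1 E /GRing.scale /=; ring.
by apply: (@ode_exp q) => // t; have := g0 t; lra.
Qed.

End LinearODE.

(* The space form is embedded by j in a space with a bilinear form BL, which induces its metric and
   for which inner_cov is the ordinary second derivative. The hypersurface is cut out by ell = c0,
   and pi drops the coordinate ell. *)
Section LinearModel.
Context {R : realType} {m l n : nat}.
Local Notation E := 'rV[R]_m.+1.
Local Notation L := 'rV[R]_l.
Local Notation V := 'rV[R]_n.+1.
Variables (kappa k : R) (O N : set E) (j : E -> L) (BL : L -> L -> R).
Variables (ell : {linear L -> R}) (pi : {linear L -> V}) (c0 : R).
Hypotheses (ellc : continuous ell) (pic : continuous pi).
Hypotheses (oO : open O) (sj : smooth O j) (NO : N `<=` O).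
Hypothesis inner_covE : forall p x y a z, N p -> tangent N p x -> tangent N p y -> tangent N p z ->
  inner_cov kappa p x y a z = BL ('D_x (fun s => 'D_y j s) p + 'D_a j p) ('D_z j p).
Hypothesis metricE : forall p x z, N p -> tangent N p x -> tangent N p z ->
  metric kappa p x z = BL ('D_x j p) ('D_z j p).
Hypothesis BL_ell : forall X Z, ell X = 0 -> ell Z = 0 -> BL X Z = Bf k (pi X) (pi Z).
Hypothesis ellN : forall p, N p -> ell (j p) = c0.

Lemma derive_clin_comp (W : normedModType R) (f : {linear L -> W}) p x : continuous f -> O p ->
  differentiable (fun s => f (j s)) p /\ 'D_x (fun s => f (j s)) p = f ('D_x j p).
Proof.
move=> fc Op; have dj := smooth_diff sj Op.
have df : differentiable f (j p) by exact: linear_differentiable.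
split; first exact: (differentiable_comp dj df).
by rewrite (derive_comp x dj df) derive_clin.
Qed.

Lemma ell_tangent p x : N p -> tangent N p x -> ell ('D_x j p) = 0.
Proof.
move=> Np [c Hc]; have [c00 dc Dc Nc] := curve_diff Hc.
have sl : smooth O (fun s => ell (j s)) by move=> i; exact: Ck_clin.
have [_ E1] := curve_deriv oO sl (NO Np) Hc.
have [_ E2] := derive_clin_comp x ellc (NO Np).
rewrite -E2 -E1 (near_eq_derive (g := fun _ => c0)) ?derive_cst //.
by apply: filterS Nc => t /ellN.
Qed.

Lemma linear_metric_P p x z : N p -> tangent N p x -> tangent N p z ->
  metric kappa p x z = Bf k ('D_x (fun s => pi (j s)) p) ('D_z (fun s => pi (j s)) p).
Proof.
move=> Np tx tz; rewrite metricE // BL_ell ?(ell_tangent Np) //.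
by rewrite !(proj2 (derive_clin_comp _ pic (NO Np))).
Qed.

(** The vector that [inner_cov] pairs with z is the derivative along c of the image of v under the
    differential of j. As v is tangent to N this image is killed by ell, and so is its derivative;
    hence BL can be computed as Bf after pi. *)
Lemma linear_cov_P v p x z c : unit_vector_field kappa N v -> N p ->
  curve_at N p x c -> tangent N p z ->
  inner_cov kappa p x (v p) (derive1 (v \o c) 0) z =
  Bf k ('D_1 (fun e : R => 'D_(v (c e)) (fun s => pi (j s)) (c e)) 0) ('D_z (fun s => pi (j s)) p).
Proof.
move=> [sv Hv] Np Hc tz; have [tv _] := Hv p Np.
have [c00 dc Dc Nc] := curve_diff Hc.
have tx : tangent N p x by exists c.
have dvc : differentiable (fun e => v (c e)) 0.
  have Nc0 : N (c 0) by rewrite c00.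
  have [Q [F [oQ Qx sF FE]]] := sv _ Nc0.
  have NQ := differentiable_near_open oQ Qx dc.
  have Nt : \forall e \near (0 : R), F (c e) = v (c e).
    by apply: filterS2 NQ Nc => e Qe Ne; apply: FE.
  apply: near_differentiable Nt _; exact: (differentiable_comp dc (smooth_diff sF Qx)).
have Oc0 : O (c 0) by rewrite c00; exact: NO.
have [dw Dw] := derive_dir (1 : R) oO Oc0 (sj 2) dvc dc.
rewrite c00 Dc in Dw.
rewrite inner_covE // derive1E.
have E1 : 'D_1 (fun e => 'D_(v (c e)) j (c e)) (0 : R) =
    'D_x (fun s => 'D_(v p) j s) p + 'D_('D_1 (v \o c) 0) j p by rewrite Dw addrC.
rewrite -E1.
have lw : ell ('D_1 (fun e => 'D_(v (c e)) j (c e)) (0 : R)) = 0.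
  have dl : differentiable ell ('D_(v (c 0)) j (c 0)) by exact: linear_differentiable.
  have := derive_comp (1 : R) dw dl; rewrite derive_clin // => <-.
  rewrite (near_eq_derive (g := fun _ => 0 : R)) ?derive_cst //.
  by apply: filterS Nc => e Ne; apply: ell_tangent => //; have [] := Hv _ Ne.
rewrite BL_ell // ?(ell_tangent Np) // (proj2 (derive_clin_comp _ pic (NO Np))); congr (Bf k _ _).
have dp : differentiable pi ('D_(v (c 0)) j (c 0)) by exact: linear_differentiable.
have := derive_comp (1 : R) dw dp; rewrite derive_clin // => <-.
apply: near_eq_derive; apply: filterS Nc => e Ne.
by rewrite (proj2 (derive_clin_comp _ pic (NO Ne))).
Qed.

End LinearModel.

Section CosSin.
Context {R : realType}.
Variable q : R.

(** [csp], [snp] and [csh], [snh] are the solutions of f'' = - kappa f with initial data (1, 0) and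
    (0, 1), for kappa = q^2 and kappa = - q^2 respectively. *)
Definition csp t := cos (q * t).
Definition snp t := sin (q * t) / q.
Definition csh (t : R) := (expR (q * t) + expR (- (q * t))) / 2.
Definition snh (t : R) := (expR (q * t) - expR (- (q * t))) / (2 * q).

Let oT := @openT R.
Let sl : smooth setT (fun t : R => q * t).
Proof. by move=> p; apply: Ck_mulr; [|exact: Ck_cst|exact: Ck_id]. Qed.
Let dl t : differentiable (fun t : R => q * t) t /\ 'D_1 (fun t : R => q * t) t = q.
Proof.
have [d E] := diff_scalec q (1 : R) (differentiable_idf t).
by split=> //; rewrite [LHS]E derive_id /GRing.scale /= mulr1.
Qed.

Lemma csp_snp_smooth : smooth setT csp /\ smooth setT snp.
Proof.
split=> p; first exact: (proj2 (Ck_sin_cos oT (sl p))).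
by apply: Ck_mulr => //; [exact: (proj1 (Ck_sin_cos oT (sl p)))|exact: Ck_cst].
Qed.

Lemma csp_snp_derive t : q != 0 -> 'D_1 csp t = - q ^+ 2 * snp t /\ 'D_1 snp t = csp t.
Proof.
move=> q0; have [_ E1] := diff_derive1_comp (1 : R) (proj1 (dl t)) (is_derive_cos (q * t)).
have [d2 E2] := diff_derive1_comp (1 : R) (proj1 (dl t)) (is_derive_sin (q * t)).
split; first by rewrite [LHS]E1 (proj2 (dl t)) /snp; field.
have [_ E3] := diff_scalec q^-1 (1 : R) d2.
have -> : snp = (fun s => q^-1 *: sin (q * s)) by apply/funext => s; rewrite /snp mulrC.
by rewrite [LHS]E3 E2 (proj2 (dl t)) /csp /GRing.scale /=; field.
Qed.

Lemma csh_snh_smooth : smooth setT csh /\ smooth setT snh.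
Proof.
have s1 p : Ck p setT (fun t => expR (q * t)) by exact: Ck_expR.
have s2 p : Ck p setT (fun t => expR (- (q * t))) by apply: Ck_expR => //; apply: Ck_opp => //;
  exact: sl.
split=> p; apply: Ck_mulr => //; try exact: Ck_cst; first exact: Ck_add.
exact: Ck_sub_fun.
Qed.

Lemma csh_snh_derive t : q != 0 -> 'D_1 csh t = q ^+ 2 * snh t /\ 'D_1 snh t = csh t.
Proof.
move=> q0; have [d1 E1] := diff_derive1_comp (1 : R) (proj1 (dl t)) (is_derive_expR (q * t)).
have [dn En] := diff_scalec (-1) (1 : R) (proj1 (dl t)).
have En' : 'D_1 (fun y : R => -1 *: (q * y)) t = - q by rewrite [LHS]En (proj2 (dl t)) scaleN1r.
have [d2 E2] := diff_derive1_comp (1 : R) dn (is_derive_expR (-1 *: (q * t))).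
have [d3 E3] := diff_scalec (-1) (1 : R) d2.
have [d4 E4] := diff_add (1 : R) d1 d2; have [d5 E5] := diff_add (1 : R) d1 d3.
have [_ E6] := diff_scalec 2^-1 (1 : R) d4; have [_ E7] := diff_scalec (2 * q)^-1 (1 : R) d5.
have -> : csh = (fun s : R => 2^-1 *: (expR (q * s) + expR (-1 *: (q * s)))).
  by apply/funext => s; rewrite /csh scaleN1r mulrC.
have -> : snh = (fun s : R => (2 * q)^-1 *: (expR (q * s) + -1 *: expR (-1 *: (q * s)))).
  by apply/funext => s; rewrite /snh !scaleN1r mulrC.
rewrite E6 E4 E7 E5 E3 E1 E2 En' (proj2 (dl t)) /GRing.scale /=.
by split; field.
Qed.

Lemma csh_snh_sq t : q != 0 -> csh t ^+ 2 = 1 + q ^+ 2 * snh t ^+ 2.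
Proof.
move=> q0; rewrite /csh /snh.
have E : expR (q * t) * expR (- (q * t)) = 1 by rewrite -expRD subrr expR0.
set a := expR (q * t) in E *; set b := expR (- (q * t)) in E *.
have -> : 1 + q ^+ 2 * ((a - b) / (2 * q)) ^+ 2 = 1 + (a ^+ 2 + b ^+ 2 - 2 * (a * b)) / 4 by field.
by rewrite E; have -> : ((a + b) / 2) ^+ 2 = (a ^+ 2 + b ^+ 2 + 2 * (a * b)) / 4; [field|rewrite E;
  field].
Qed.

Lemma csh_gt0 t : 0 < csh t.
Proof. by rewrite divr_gt0 // addr_gt0 // expR_gt0. Qed.

Lemma snh_surj r : 0 < q -> 0 < r -> exists2 t, 0 < t & snh t = r.
Proof.
(* w plays the part of exp(q t): it is the positive root of w - 1 / w = 2 q r. *)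
move=> q0 r0; pose w := q * r + Num.sqrt (1 + (q * r) ^+ 2).
have qr : 0 < q * r by rewrite mulr_gt0.
have s1 : 0 <= 1 + (q * r) ^+ 2 by rewrite addr_ge0 // sqr_ge0.
have s2 := sqr_sqrtr s1; have s3 := sqrtr_ge0 (1 + (q * r) ^+ 2).
set s := Num.sqrt _ in s2 s3.
have ws : w = q * r + s by [].
have w1 : 1 < w by nra.
have w0 : 0 < w by apply: lt_trans w1.
exists (ln w / q); first by rewrite divr_gt0 // ln_gt0.
have qn : q != 0 by rewrite gt_eqF.
have qw : q * (ln w / q) = ln w by field.
rewrite /snh qw expRN lnK //.
have wi : w^-1 = s - q * r.
  apply: (mulfI (lt0r_neq0 w0)); rewrite divff ?lt0r_neq0 // ws; nra.
by rewrite wi ws; field; rewrite gt_eqF.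
Qed.

Lemma snh_gt0 t : 0 < q -> 0 < t -> 0 < snh t.
Proof.
move=> q0 t0; rewrite divr_gt0 ?mulr_gt0 // subr_gt0 ltr_expR.
have : 0 < q * t by rewrite mulr_gt0.
lra.
Qed.

End CosSin.

Lemma diff_scale_vec (R : realType) (T W : normedModType R) (a : T -> R) (w : W) t u :
  differentiable a t ->
  differentiable (fun s => a s *: w) t /\ 'D_u (fun s => a s *: w) t = 'D_u a t *: w.
Proof.
move=> da; have [d E] := diff_scale u da (g := fun _ : T => w) (differentiable_cst w t).
by split=> //; rewrite E derive_cst scaler0 addr0.
Qed.

(** * Geodesics of a quadric in a linear space *)

Section LinearGeodesic.
Context {R : realType} {m l : nat}.
Local Notation E := 'rV[R]_m.+1.
Local Notation L := 'rV[R]_l.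
Variables (kappa : R) (O : set E) (j : E -> L) (BL : L -> L -> R) (cs sn : R -> R).
Local Notation M := (@space_form R m kappa).
Hypotheses (BLC : forall X Z, BL X Z = BL Z X).
Hypotheses (BLD : forall X Y Z, BL (X + Y) Z = BL X Z + BL Y Z).
Hypotheses (BLZ : forall a X Z, BL (a *: X) Z = a * BL X Z).
Hypotheses (k0 : kappa != 0) (oO : open O) (MO : M `<=` O) (sj : smooth O j).
Hypothesis jM : forall p, M p -> BL (j p) (j p) = kappa^-1.
Hypothesis nondeg : forall p X, M p -> (forall z, tangent M p z -> BL X ('D_z j p) = 0) ->
  exists mu, X = mu *: j p.
Hypothesis inner_covM : forall p x y a z, M p ->
  inner_cov kappa p x y a z = BL ('D_x (fun s => 'D_y j s) p + 'D_a j p) ('D_z j p).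
Hypothesis metricM : forall p x z, M p -> metric kappa p x z = BL ('D_x j p) ('D_z j p).
Hypotheses (scs : smooth setT cs) (ssn : smooth setT sn) (cs0 : cs 0 = 1) (sn0 : sn 0 = 0).
Hypotheses (dcs : forall t, 'D_1 cs t = - kappa * sn t) (dsn : forall t, 'D_1 sn t = cs t).
Hypothesis uniq : forall f : R -> R, smooth setT f ->
  (forall t, 'D_1 (fun s => 'D_1 f s) t = - kappa * f t) -> f 0 = 0 -> 'D_1 f 0 = 0 ->
  forall t, f t = 0.

Let oT := @openT R.

Definition lin_geod (p u : E) t : L := cs t *: j p + sn t *: 'D_u j p.

Lemma lin_geod_smooth p u : smooth setT (lin_geod p u).
Proof. by move=> i; apply: Ck_add => //; apply: Ck_scale => //; exact: Ck_cst. Qed.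

Lemma lin_geod_derive p u t : 'D_1 (lin_geod p u) t = (- kappa * sn t) *: j p + cs t *: 'D_u j p /\
  'D_1 (fun s => 'D_1 (lin_geod p u) s) t = - kappa *: lin_geod p u t.
Proof.
have dc s := smooth_diff scs (I : setT s); have ds s := smooth_diff ssn (I : setT s).
have D1 s : 'D_1 (lin_geod p u) s = (- kappa * sn s) *: j p + cs s *: 'D_u j p.
  have [d1 E1] := diff_scale_vec (j p) (1 : R) (dc s).
  have [d2 E2] := diff_scale_vec ('D_u j p) (1 : R) (ds s).
  have [_ E3] := diff_add (1 : R) d1 d2.
  by rewrite /lin_geod E3 E1 E2 dcs dsn.
split=> //.
have -> : (fun s => 'D_1 (lin_geod p u) s) = (fun s => (- kappa) *: (sn s *: j p) + cs s *: 'D_u j p).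
  by apply/funext => s; rewrite D1 scalerA.
have [d1 E1] := diff_scale_vec (j p) (1 : R) (ds t).
have [d2 E2] := diff_scale_vec ('D_u j p) (1 : R) (dc t).
have [d1' E1'] := diff_scalec (- kappa) (1 : R) d1.
have [_ E3] := diff_add (1 : R) d1' d2.
rewrite E3 E1' E1 E2 dcs dsn.
by rewrite /lin_geod (scalerDr (- kappa) (cs t *: j p) (sn t *: 'D_u j p)) (scalerA _ (sn t)).
Qed.

Lemma derive1n2E (V : normedModType R) (c : R -> V) t :
  derive1n 2 c t = 'D_1 (fun s => 'D_1 c s) t.
Proof.
have E : derive1 c = (fun s => 'D_1 c s) by apply/funext => s; rewrite derive1E.
by rewrite derive1nS derive1n1 E derive1E.
Qed.

Lemma curve_second (c : R -> E) : smooth setT c -> (forall t, O (c t)) ->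
  smooth setT (fun t => j (c t)) /\
  forall t, 'D_1 (fun s => j (c s)) t = 'D_('D_1 c t) j (c t) /\
   'D_1 (fun s => 'D_1 (fun s => j (c s)) s) t =
     'D_('D_1 c t) (fun s => 'D_('D_1 c t) j s) (c t) + 'D_('D_1 (fun s => 'D_1 c s) t) j (c t).
Proof.
move=> sc cO.
have sjc : smooth setT (fun t => j (c t)).
  by move=> i; apply: (Ck_comp (P := O)) => //; exact: sj.
split; first exact: sjc.
move=> t; have D1 s : 'D_1 (fun s => j (c s)) s = 'D_('D_1 c s) j (c s).
  by rewrite (derive_comp (1 : R) (smooth_diff sc (I : setT s)) (smooth_diff sj (cO s))).
split; first exact: D1.
have -> : (fun s => 'D_1 (fun s => j (c s)) s) = (fun s => 'D_('D_1 c s) j (c s)).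
  by apply/funext => s; exact: D1.
have sc' := smooth_derive (1 : R) sc.
have [_ ->] := derive_dir (1 : R) oO (cO t) (sj 2) (smooth_diff sc' (I : setT t)) (smooth_diff sc
  (I : setT t)).
by rewrite addrC.
Qed.

Lemma M_tangent_orth p z : M p -> tangent M p z -> BL (j p) ('D_z j p) = 0.
Proof.
move=> Mp [c Hc]; have [d1 E1] := curve_deriv oO sj (MO Mp) Hc.
have [c00 _ _ Mc] := curve_diff Hc.
have [_ E2] := diff_BL BLC BLD BLZ (1 : R) d1 d1.
have Z : 'D_1 (fun s => BL (j (c s)) (j (c s))) (0 : R) = 0.
  rewrite (near_eq_derive (g := fun _ => kappa^-1)) ?derive_cst //.
  by apply: filterS Mc => t /jM.
by move: E2; rewrite Z E1 c00 (BLC ('D_z j p)) => E2; lra.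
Qed.

Lemma curve_translate (S : set E) (c : R -> E) t : smooth setT c -> (forall s, S (c s)) ->
  tangent S (c t) ('D_1 c t).
Proof.
move=> sc cS; exists (fun s => c (t + s)), 1; split; [exact: ltr01| | |by rewrite addr0|].
- apply: smooth_smooth_on; first exact: (@open_oo R).
  move=> i; apply: (Ck_comp1 (P := setT) (f := fun s => t + s) (g := c)) => //; try exact: (@open_oo R).
  by apply: Ck_add; [exact: (@open_oo R)|exact: Ck_cst|exact: Ck_id].
- by move=> s _; exact: cS.
have [d E1] := diff_add (1 : R) (differentiable_cst t (0 : R)) (differentiable_idf (0 : R)).
have dc : differentiable c (t + 0) := smooth_diff sc (I : setT (t + 0)).
by rewrite derive1E (derive_comp (1 : R) d dc) E1 derive_cst derive_id add0r addr0.
Qed.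

(** The acceleration of X = j o c is orthogonal to the tangent space, so by [nondeg] it is a
    multiple of X. The constancy of BL(X, X) and of the speed makes the factor - kappa, and [uniq]
    compares X with the explicit solution coordinate by coordinate. *)
Lemma geodesic_lin p u c : M p -> metric kappa p u u = 1 -> geodesic kappa p u c ->
  forall t, j (c t) = lin_geod p u t.
Proof.
move=> Mp mu [sc0 cM c00 c'0 acc].
have sc := smooth_on_smooth oT sc0.
have cO t : O (c t) by apply: MO.
have [sX DX] := curve_second sc cO; set X := fun t => j (c t) in sX DX.
have sX' := smooth_derive (1 : R) sX.
have dX t := smooth_diff sX (I : setT t); have dX' t := smooth_diff sX' (I : setT t).
have tc t : tangent M (c t) ('D_1 c t) by exact: curve_translate.
have mu_ex t : exists mu, 'D_1 (fun s => 'D_1 X s) t = mu *: X t.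
  apply: (nondeg (cM t)) => z tz; have := acc t z tz.
  by rewrite derive1n2E derive1E (inner_covM _ _ _ _ (cM t)) -(proj2 (DX t)).
have XX t : BL (X t) (X t) = kappa^-1 by exact: jM.
have XX' t : BL (X t) ('D_1 X t) = 0.
  by rewrite (proj1 (DX t)); apply: M_tangent_orth.
have XX'' t : BL (X t) ('D_1 (fun s => 'D_1 X s) t) = - BL ('D_1 X t) ('D_1 X t).
  have [_ E1] := diff_BL BLC BLD BLZ (1 : R) (dX t) (dX' t).
  have Z : 'D_1 (fun s => BL (X s) ('D_1 X s)) t = 0.
    have -> : (fun s => BL (X s) ('D_1 X s)) = (fun _ => 0) by apply/funext => s; exact: XX'.
    by rewrite derive_cst.
  by move: E1; rewrite Z => E1; lra.
have sXX : smooth setT (fun t => BL ('D_1 X t) ('D_1 X t)).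
  have -> : (fun t => BL ('D_1 X t) ('D_1 X t)) = (fun t => \sum_i 'D_1 X t ord0 i *
      \sum_i' 'D_1 X t ord0 i' * BL (delta_mx ord0 i') (delta_mx ord0 i)).
    apply/funext => s; rewrite (BL_coord BLD BLZ); apply: eq_bigr => i _; congr (_ * _).
    by rewrite BLC (BL_coord BLD BLZ).
  move=> i; apply: Ck_sum => // i1 _; apply: Ck_mulr => //; first exact: Ck_coord.
  by apply: Ck_sum => // i2 _; apply: Ck_mulr => //; [exact: Ck_coord|exact: Ck_cst].
have speed t : BL ('D_1 X t) ('D_1 X t) = 1.
  rewrite (const_derive0 sXX).
    rewrite (proj1 (DX 0)) c00 -derive1E c'0 -metricM //.
  move=> s; have [_ ->] := diff_BL BLC BLD BLZ (1 : R) (dX' s) (dX' s).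
  have [mu' E1] := mu_ex s.
  by rewrite E1 BLZ (BLC ('D_1 X s)) BLZ XX' mulr0 addr0.
have ode t : 'D_1 (fun s => 'D_1 X s) t = - kappa *: X t.
  have [mu' E1] := mu_ex t; rewrite E1; congr (_ *: _).
  have := XX'' t; rewrite E1 BLC BLZ XX speed => /(congr1 ( *%R kappa)).
  by rewrite mulrCA divff // mulr1 mulrN1.
move=> t; apply/rowP => i; apply/eqP; rewrite -subr_eq0; apply/eqP.
have sG := lin_geod_smooth p u; have sG' := smooth_derive (1 : R) sG.
pose f s := X s ord0 i - lin_geod p u s ord0 i.
have sf : smooth setT f by move=> i'; apply: Ck_sub_fun => //; exact: Ck_coord.
have dsub (Y Z : R -> L) s : differentiable Y s -> differentiable Z s ->
    'D_1 (fun s => Y s ord0 i - Z s ord0 i) s = 'D_1 Y s ord0 i - 'D_1 Z s ord0 i.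
  move=> dY dZ; have [d1 E1] := diff_coord (1 : R) i dY; have [d2 E2] := diff_coord (1 : R) i dZ.
  have [d3 E3] := diff_scalec (-1) (1 : R) d2; have [_ E4] := diff_add (1 : R) d1 d3.
  have -> : (fun s => Y s ord0 i - Z s ord0 i) = (fun s => Y s ord0 i + -1 *: Z s ord0 i).
    by apply/funext => s'; rewrite scaleN1r.
  by rewrite E4 E3 E1 E2 scaleN1r.
have dG s := smooth_diff sG (I : setT s); have dG' s := smooth_diff sG' (I : setT s).
have f1 : (fun s => 'D_1 f s) = (fun s => 'D_1 X s ord0 i - 'D_1 (lin_geod p u) s ord0 i).
  by apply/funext => s; exact: dsub.
apply: (uniq sf).
- move=> s; rewrite f1 dsub // ode (proj2 (lin_geod_derive p u s)) /f mxE mxE; ring.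
- by rewrite /f /X c00 /lin_geod cs0 sn0 scale1r scale0r addr0 subrr.
- have := congr1 (fun g => g 0) f1 => /= ->.
  rewrite (proj1 (lin_geod_derive p u 0)) (proj1 (DX 0)) c00 -derive1E c'0 cs0 sn0.
  by rewrite mulr0 scale0r add0r scale1r subrr.
Qed.

Variables (ML : set L) (i : L -> E).
Hypotheses (si : smooth_on ML i) (iM : forall X, ML X -> M (i X) /\ j (i X) = X).
Hypotheses (Mi : forall p, M p -> ML (j p) /\ i (j p) = p).
Hypothesis exp_in : forall p u t, M p -> tangent M p u -> metric kappa p u u = 1 -> ML (lin_geod p u t).

(** The second derivative of the explicit curve is - kappa times its position, hence orthogonal to
    tangent vectors. Its initial velocity is read through a local smooth extension F of i, a left
    inverse of j on M. *)
Lemma lin_geodesic p u : M p -> tangent M p u -> metric kappa p u u = 1 ->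
  geodesic kappa p u (fun t => i (lin_geod p u t)).
Proof.
move=> Mp tu mu.
have sG := lin_geod_smooth p u.
have GM t : ML (lin_geod p u t) by exact: exp_in.
have sc0 : smooth_on setT (fun t => i (lin_geod p u t)).
  by apply: (smooth_on_comp (B := ML)) => //; exact: smooth_smooth_on.
have sc := smooth_on_smooth oT sc0.
have cM t : M (i (lin_geod p u t)) by have [] := iM (GM t).
have jc t : j (i (lin_geod p u t)) = lin_geod p u t by have [] := iM (GM t).
have cO t : O (i (lin_geod p u t)) by apply: MO.
have G0 : lin_geod p u 0 = j p by rewrite /lin_geod cs0 sn0 scale1r scale0r addr0.
have [sX DX] := curve_second sc cO.
have XE : (fun t => j (i (lin_geod p u t))) = lin_geod p u by apply/funext.
rewrite XE in DX.
split=> //.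
- by rewrite G0; have [] := Mi Mp.
- have [MLp ip] := Mi Mp; have [Q [F [oQ Qx sF FE]]] := si MLp.
  have [c Hc] := tu; have [dj Ej] := curve_deriv oO sj (MO Mp) Hc.
  have [c00 dc Dc Mc] := curve_diff Hc.
  have Qc0 : Q (j (c 0)) by rewrite c00.
  have NQ := differentiable_near_open oQ Qc0 dj.
  have Nt : \forall t \near (0 : R), F (j (c t)) = c t.
    by apply: filterS2 NQ Mc => t Qt /Mi [MLt {2}<-]; apply: FE.
  have Eu : 'D_('D_u j p) F (j p) = u.
    have dF : differentiable F (j (c 0)) by rewrite c00; exact: smooth_diff sF Qx.
    by have := derive_comp (1 : R) dj dF; rewrite (near_eq_derive _ Nt) Dc Ej c00.
  have dG := smooth_diff sG (I : setT (0 : R)).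
  have QG0 : Q (lin_geod p u 0) by rewrite G0.
  have NG := differentiable_near_open oQ QG0 dG.
  have Nt2 : \forall t \near (0 : R), F (lin_geod p u t) = i (lin_geod p u t).
    by apply: filterS NG => t Qt; apply: FE; split.
  rewrite derive1E -(near_eq_derive _ Nt2).
  have dF : differentiable F (lin_geod p u 0) by exact: smooth_diff sF QG0.
  rewrite (derive_comp (1 : R) dG dF) (proj1 (lin_geod_derive p u 0)) cs0 sn0 mulr0 scale0r add0r
    scale1r.
  by rewrite G0.
move=> t z tz; rewrite (inner_covM _ _ _ _ (cM t)).
have [E1 E2] := DX t.
rewrite derive1n2E derive1E -E2 (proj2 (lin_geod_derive p u t)) BLZ.
by have := M_tangent_orth (cM t) tz; rewrite jc => ->; rewrite mulr0.
Qed.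

Lemma ray_lin p u : M p -> tangent M p u -> metric kappa p u u = 1 ->
  ray kappa p u = [set x | exists t, [/\ 0 < t, 0 < kappa -> t < pi / Num.sqrt kappa &
    x = i (lin_geod p u t)]].
Proof.
move=> Mp tu mu; apply/seteqP; split=> x.
  move=> [c [t [gc t0 tk ->]]]; exists t; split=> //.
  rewrite -(geodesic_lin Mp mu gc); have [_ /(_ t) Mt _ _ _] := gc.
  by have [_ ->] := Mi Mt.
move=> [t [t0 tk ->]]; exists (fun t => i (lin_geod p u t)), t; split=> //.
exact: lin_geodesic.
Qed.

Lemma geodesic_sphere_lin p r : M p -> geodesic_sphere kappa p r =
  [set x | exists u, [/\ tangent M p u, metric kappa p u u = 1 & x = i (lin_geod p u r)]].
Proof.
move=> Mp; apply/seteqP; split=> x.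
  move=> [u [c [tu mu gc ->]]]; exists u; split=> //.
  rewrite -(geodesic_lin Mp mu gc); have [_ /(_ r) Mt _ _ _] := gc.
  by have [_ ->] := Mi Mt.
move=> [u [tu mu ->]]; exists u, (fun t => i (lin_geod p u t)); split=> //.
exact: lin_geodesic.
Qed.

End LinearGeodesic.

(** * Symmetry of second derivatives *)

Section Schwarz.
Context {R : realType}.

Lemma mvt_line (V : normedModType R) (f : V -> R) p u (h : R) : 0 < h ->
  (forall t, 0 <= t <= h -> differentiable f (p + t *: u)) ->
  exists t, 0 < t < h /\ f (p + h *: u) - f p = h * 'D_u f (p + t *: u).
Proof.
move=> h0 df; pose g (t : R) := f (p + t *: u).
have dg (t : R) : 0 <= t <= h -> differentiable g t /\ 'D_1 g t = 'D_u f (p + t *: u).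
  move=> t01; have [dl El] := diff_line p u t; split; first exact: (differentiable_comp dl (df t t01)).
  by rewrite [LHS](derive_comp (1 : R) dl (df t t01)) El.
have [] := @MVT _ g (fun t => 'D_1 g t) 0 h h0.
- move=> t; rewrite in_itv /= => /andP[t0 th].
  have t01 : 0 <= t <= h by rewrite !ltW.
  by apply: DeriveDef => //; apply: diff_derivable; exact: (proj1 (dg t t01)).
- apply: continuous_in_subspaceT => t /set_mem /=; rewrite in_itv /= => t01.
  by apply: differentiable_continuous; exact: (proj1 (dg t t01)).
move=> t; rewrite in_itv /= => t01 E; exists t; split=> //.
have {}E : g h - g 0 = 'D_1 g t * (h - 0) := E.
rewrite subr0 (proj2 (dg t _)) in E; last by case/andP: t01 => *; rewrite !ltW.
by rewrite mulrC -E /g scale0r addr0.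
Qed.

Lemma second_difference m (O : set 'rV[R]_m) (f : 'rV[R]_m -> R) p x y (e h : R) :
  smooth O f -> 0 < e -> 0 < h -> h < e ->
  (forall s t, 0 <= s <= e -> 0 <= t <= e -> O (p + s *: x + t *: y)) ->
  exists s t, [/\ 0 < s < h, 0 < t < h &
    f (p + h *: x + h *: y) - f (p + h *: x) - (f (p + h *: y) - f p) =
    h * (h * 'D_y (fun q => 'D_x f q) (p + s *: x + t *: y))].
Proof.
move=> sf e0 h0 he HO.
pose g q := f (q + h *: y) - f q.
have O1 s : 0 <= s <= h -> O (p + s *: x + h *: y).
  by move=> /andP[s0 s1]; apply: HO; rewrite ?s0 ?(le_trans s1) ?ltW.
have O2 s : 0 <= s <= h -> O (p + s *: x).
  move=> /andP[s0 s1]; rewrite -[p + _]addr0 -(scale0r y); apply: HO.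
    by rewrite s0 (le_trans s1) // ltW.
  by rewrite lexx ltW.
have dg s : 0 <= s <= h -> differentiable g (p + s *: x) /\
    'D_x g (p + s *: x) = 'D_x f (p + s *: x + h *: y) - 'D_x f (p + s *: x).
  move=> s01; have d1 := smooth_diff sf (O1 s s01); have d2 := smooth_diff sf (O2 s s01).
  have [d3 E3] := diff_add x (differentiable_idf (p + s *: x)) (differentiable_cst (h *: y) (p + s
    *: x)).
  have d4 := differentiable_comp d3 d1.
  have E4 := derive_comp x d3 d1; rewrite E3 derive_cst derive_id addr0 in E4.
  have [d5 E5] := diff_scalec (-1) x d2; have [d6 E6] := diff_add x d4 d5.
  have gE : g = (fun q => (f \o (fun q => q + h *: y)) q + -1 *: f q).
    by apply/funext => q; rewrite /g scaleN1r.
  by rewrite gE; split=> //; rewrite E6 E5 E4 scaleN1r.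
have [s [s01 Es]] := mvt_line h0 (fun s Hs => proj1 (dg s Hs)).
have s01' : 0 <= s <= h by case/andP: s01 => *; rewrite !ltW.
have sf' := smooth_derive x sf.
have O3 t : 0 <= t <= h -> O (p + s *: x + t *: y).
  move=> /andP[t0 t1]; case/andP: s01' => s0 s1.
  by apply: HO; rewrite ?s0 ?t0 ?(le_trans s1) ?(le_trans t1) ?ltW.
have [t [t01 Et]] := mvt_line (p := p + s *: x) (u := y) h0 (fun t Ht => smooth_diff sf' (O3 t Ht)).
exists s, t; split=> //.
by move: Es; rewrite (proj2 (dg s s01')) Et => <-; rewrite /g.
Qed.

(** By [second_difference], both mixed derivatives, each at some point near p, are equal to the same
    second difference divided by h^2; continuity would separate these values if they differed at
    p. *)
Lemma schwarz1 m (O : set 'rV[R]_m) (f : 'rV[R]_m -> R) p x y :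
  open O -> smooth O f -> O p ->
  'D_x (fun q => 'D_y f q) p = 'D_y (fun q => 'D_x f q) p.
Proof.
move=> oO sf Op; apply: contrapT => /eqP ne.
set A := 'D_x _ p in ne; set B := 'D_y _ p in ne.
have e0 : 0 < `|A - B| / 2 by rewrite divr_gt0 // normr_gt0 subr_eq0.
have cA : {for p, continuous (fun q => 'D_x (fun q => 'D_y f q) q)}.
  by apply: smooth_cont Op; do 2 apply: smooth_derive.
have cB : {for p, continuous (fun q => 'D_y (fun q => 'D_x f q) q)}.
  by apply: smooth_cont Op; do 2 apply: smooth_derive.
have N : \forall q \near p, [/\ O q, `|A - 'D_x (fun q => 'D_y f q) q| < `|A - B| / 2 &
    `|B - 'D_y (fun q => 'D_x f q) q| < `|A - B| / 2].
  have N1 := open_nbhs_nbhs (conj oO Op).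
  have /cvgrPdist_lt /(_ _ e0) N2 := cA.
  have /cvgrPdist_lt /(_ _ e0) N3 := cB.
  by apply: filterS3 N1 N2 N3 => q H1 H2 H3; split; [exact: H1|exact: H2|exact: H3].
have /nbhs_ballP [d /= d0 dN] := N.
pose K := `|x| + `|y| + 1; have K0 : 0 < K by rewrite ltr_wpDl // addr_ge0.
pose e := d / K / 2; have ep : 0 < e by rewrite !divr_gt0.
have In s t : 0 <= s <= e -> 0 <= t <= e -> ball p d (p + s *: x + t *: y).
  move=> /andP[s0 s1] /andP[t0 t1]; rewrite -ball_normE /= -addrA opprD addNKr normrN.
  apply: le_lt_trans (ler_normD _ _) _; rewrite !normrZ !ger0_norm //.
  have h1 : s * `|x| <= e * `|x| by rewrite ler_wpM2r.
  have h2 : t * `|y| <= e * `|y| by rewrite ler_wpM2r.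
  have h3 : e * `|x| + e * `|y| < e * K by rewrite -mulrDr ltr_pM2l // ltrDl.
  have h4 : e * K = d / 2 by rewrite /e; field; rewrite gt_eqF.
  lra.
have HO s t : 0 <= s <= e -> 0 <= t <= e -> O (p + s *: x + t *: y).
  by move=> hs ht; have [] := dN _ (In s t hs ht).
have HO' s t : 0 <= s <= e -> 0 <= t <= e -> O (p + s *: y + t *: x).
  by move=> hs ht; rewrite addrAC; exact: HO.
pose h := e / 2; have h0 : 0 < h by rewrite divr_gt0.
have he : h < e by rewrite /h ltr_pdivrMr // ltr_pMr // ltr1n.
have [s [t [s01 t01 E1]]] := second_difference sf ep h0 he HO.
have [s' [t' [s01' t01' E2]]] := second_difference sf ep h0 he HO'.
have wk r : 0 < r < h -> 0 <= r <= e by case/andP => r0 r1; rewrite ltW //= ltW // (lt_trans r1).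
have [_ _ hB] := dN _ (In s t (wk s s01) (wk t t01)).
have [_ hA _] := dN _ (In t' s' (wk t' t01') (wk s' s01')).
have hn : h != 0 by rewrite gt_eqF.
have fE : f (p + h *: x + h *: y) - f (p + h *: x) - (f (p + h *: y) - f p) =
    f (p + h *: y + h *: x) - f (p + h *: y) - (f (p + h *: x) - f p).
  by rewrite [p + h *: y + _]addrAC; ring.
rewrite [p + t' *: x + _]addrAC in hA.
rewrite fE E2 in E1.
have E3 := mulfI hn (mulfI hn E1).
rewrite -E3 in hB; move: hA hB; set C := 'D_x _ _ => hA hB.
clear -A B C hA hB; clearbody A B C.
have h1 := ler_distD C A B; rewrite (distrC C) in h1.
lra.
Qed.

Lemma schwarz m l (O : set 'rV[R]_m) (f : 'rV[R]_m -> 'rV[R]_l) p x y :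
  open O -> smooth O f -> O p ->
  'D_x (fun q => 'D_y f q) p = 'D_y (fun q => 'D_x f q) p.
Proof.
move=> oO sf Op; apply/rowP => i.
have sfi : smooth O (fun q => f q ord0 i) by move=> k; exact: Ck_coord.
have E u w : 'D_u (fun q => 'D_w f q) p ord0 i = 'D_u (fun q => 'D_w (fun q => f q ord0 i) q) p.
  have sw := smooth_derive w sf.
  rewrite -(proj2 (diff_coord u i (smooth_diff sw Op))); apply: near_eq_derive.
  have := open_nbhs_nbhs (conj oO Op); apply: filterS => q Oq.
  by rewrite (proj2 (diff_coord w i (smooth_diff sf Oq))).
refine (etrans (E x y) (etrans _ (esym (E y x)))).
exact: (@schwarz1 m O (fun q => f q ord0 i) p x y oO sfi Op).
Qed.

End Schwarz.

(** * Hyperbolic space *)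

Section Tail.
Context {R : realType} {n : nat}.

Lemma dotE (x y : 'rV[R]_n.+1) : dot x y = x ord0 ord0 * y ord0 ord0 + tdot x y.
Proof. by rewrite /dot big_ord_recl. Qed.

Lemma dot_Qf (x y : 'rV[R]_n.+1) : dot x y = Qf 1 x y.
Proof. by rewrite dotE /Qf mul1r. Qed.

Lemma dot_Bf (x y : 'rV[R]_n.+1) : dot x y = Bf 1 x y.
Proof. by rewrite dotE /Bf mul1r addrC. Qed.

Lemma dot_gt0 (x : 'rV[R]_n.+1) : x != 0 -> 0 < dot x x.
Proof.
move=> x0; rewrite lt_neqAle; apply/andP; split; last first.
  by apply: sumr_ge0 => i _; rewrite -expr2 sqr_ge0.
apply: contraNneq x0 => /esym /eqP; rewrite psumr_eq0; last by move=> i _; rewrite -expr2 sqr_ge0.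
move=> /allP H; apply/eqP/rowP => i; rewrite mxE; apply/eqP.
by have := H i (mem_index_enum i); rewrite /= mulf_eq0 orbb.
Qed.

Definition tl (X : 'rV[R]_n.+2) : 'rV[R]_n.+1 := \row_i X ord0 (lift ord0 i).
Lemma tl_is_linear : linear tl.
Proof. by move=> a X Y; apply/rowP => i; rewrite !mxE. Qed.
HB.instance Definition _ := GRing.isLinear.Build R 'rV[R]_n.+2 'rV[R]_n.+1 _ tl tl_is_linear.

Lemma linear_row_continuous p m (f : {linear 'rV[R]_p -> 'rV[R]_m}) : continuous f.
Proof.
have sf : smooth setT f.
  move=> k; have oT := @openT 'rV[R]_p.
  have -> : (f : _ -> _) = (fun x => \sum_i coordl ord0 i x *: f (delta_mx ord0 i)).
    apply/funext => x; rewrite {1}[x]row_sum_delta linear_sum.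
    by apply: eq_bigr => i _; rewrite linearZ.
  apply: Ck_sum => // i _; apply: Ck_scale => //; last exact: Ck_cst.
  by apply: Ck_lin; exact: coordl_continuous.
by move=> x; exact: smooth_cont sf (I : setT x).
Qed.

Lemma linear_scalar_continuous p (f : {linear 'rV[R]_p -> R}) : continuous f.
Proof.
have sf : smooth setT f.
  move=> k; have oT := @openT 'rV[R]_p.
  have -> : (f : _ -> _) = (fun x => \sum_i coordl ord0 i x * f (delta_mx ord0 i)).
    apply/funext => x; rewrite {1}[x]row_sum_delta linear_sum.
    by apply: eq_bigr => i _; rewrite linearZ.
  apply: Ck_sum => // i _; apply: Ck_mulr => //; last exact: Ck_cst.
  by apply: Ck_lin; exact: coordl_continuous.
by move=> x; exact: smooth_cont sf (I : setT x).
Qed.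

End Tail.

Lemma curve_image (R : realType) m p (S O : set 'rV[R]_m.+1) (S' : set 'rV[R]_p.+1)
    (h : 'rV[R]_m.+1 -> 'rV[R]_p.+1) x u c :
  open O -> smooth O h -> S `<=` O -> (forall y, S y -> S' (h y)) -> S x -> curve_at S x u c ->
  curve_at S' (h x) ('D_u h x) (fun t => h (c t)).
Proof.
move=> oO sh SO SS' Sx Hc; have [_ E] := curve_deriv oO sh (SO _ Sx) Hc.
have [e [e0 sc cS c0 dc]] := Hc; exists e; split; [exact: e0| | | |].
- by apply: (smooth_on_comp (B := O)) => //; [move=> t /cS /SO|exact: smooth_smooth_on].
- by move=> t /cS /SS'.
- by rewrite c0.
- by rewrite derive1E E.
Qed.

Lemma curve_line (R : realType) m (S : set 'rV[R]_m.+1) p u : open S -> S p ->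
  curve_at S p u (fun t => p + t *: u).
Proof.
move=> oS Sp; have [dl El] := diff_line p u 0.
have Sp0 : S (p + (0 : R) *: u) by rewrite scale0r addr0.
have N := @differentiable_near_open R R _ S (fun t : R => p + t *: u) 0 oS Sp0 dl.
have /nbhs_ballP [e /= e0 eN] := N.
exists e; split; [exact: e0| | | |].
- apply: smooth_smooth_on; first exact: (@open_oo R).
  have oe := @open_oo R e.
  move=> k; apply: Ck_add => //; first exact: Ck_cst.
  by apply: Ck_scale => //; [exact: Ck_id|exact: Ck_cst].
- by move=> t te; apply: eN; rewrite -ball_normE /= sub0r normrN ltr_norml.
- by rewrite scale0r addr0.
- by rewrite derive1E El.
Qed.

Section HalfSpace.
Context {R : realType} {n : nat}.
Local Notation E := 'rV[R]_n.+1.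
Local Notation L := 'rV[R]_n.+2.

(* [iota] sends the half-space to the hyperboloid {Bm X X = -1}, in the light-cone coordinates
   X_- = |x|^2 / x_0 (of index 0), X_+ = 1 / x_0 and X_i = x_i / x_0; thus X_+ = tl X ord0 ord0. *)
Definition lamv (x : E) : L :=
  \row_i oapp (fun i' => if i' == ord0 then 1 else x ord0 i') (dot x x) (unlift ord0 i).
Definition dlam (x u : E) : L :=
  \row_i oapp (fun i' => if i' == ord0 then 0 else u ord0 i') (2 * dot x u) (unlift ord0 i).
Definition iota (x : E) : L := (x ord0 ord0)^-1 *: lamv x.
Definition iotai (X : L) : E :=
  \row_i (if i == ord0 then (tl X ord0 ord0)^-1 else tl X ord0 i / tl X ord0 ord0).
Definition Bm (X Z : L) : R :=
  tdot (tl X) (tl Z) - (X ord0 ord0 * tl Z ord0 ord0 + tl X ord0 ord0 * Z ord0 ord0) / 2.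

Lemma BmC X Z : Bm X Z = Bm Z X. Proof. by rewrite /Bm tdotC; field. Qed.
Lemma BmD X Y Z : Bm (X + Y) Z = Bm X Z + Bm Y Z.
Proof. by rewrite /Bm linearD tdotDl !mxE; field. Qed.
Lemma BmZ a X Z : Bm (a *: X) Z = a * Bm X Z.
Proof. by rewrite /Bm linearZ tdotZl !mxE; field. Qed.

Lemma lamv0 x : lamv x ord0 ord0 = dot x x. Proof. by rewrite mxE unlift_none. Qed.
Lemma lamvt0 x : tl (lamv x) ord0 ord0 = 1. Proof. by rewrite !mxE liftK. Qed.
Lemma lamvt x i : tl (lamv x) ord0 (lift ord0 i) = x ord0 (lift ord0 i).
Proof. by rewrite !mxE liftK. Qed.
Lemma dlam0 x u : dlam x u ord0 ord0 = 2 * dot x u. Proof. by rewrite mxE unlift_none. Qed.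
Lemma dlamt0 x u : tl (dlam x u) ord0 ord0 = 0. Proof. by rewrite !mxE liftK. Qed.
Lemma dlamt x u i : tl (dlam x u) ord0 (lift ord0 i) = u ord0 (lift ord0 i).
Proof. by rewrite !mxE liftK. Qed.

Lemma tdot_lamv x y : tdot (tl (lamv x)) y = tdot x y.
Proof. by apply: eq_bigr => i _; rewrite lamvt. Qed.
Lemma tdot_dlam x u y : tdot (tl (dlam x u)) y = tdot u y.
Proof. by apply: eq_bigr => i _; rewrite dlamt. Qed.

Lemma Bm_lamv x : Bm (lamv x) (lamv x) = - x ord0 ord0 ^+ 2.
Proof. by rewrite /Bm tdot_lamv tdotC tdot_lamv lamv0 lamvt0 dotE; field. Qed.
Lemma Bm_lamv_dlam x u : Bm (lamv x) (dlam x u) = - (x ord0 ord0 * u ord0 ord0).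
Proof. by rewrite /Bm tdot_lamv tdotC tdot_dlam lamv0 lamvt0 dlam0 dlamt0 !dotE (tdotC u); field. Qed.
Lemma Bm_dlam x u w : Bm (dlam x u) (dlam x w) = tdot u w.
Proof. by rewrite /Bm tdot_dlam tdotC tdot_dlam dlamt0 (tdotC w) !dlamt0; field. Qed.

Definition halfspace : set E := [set x | 0 < x ord0 ord0].

Lemma open_halfspace : open halfspace.
Proof.
have -> : halfspace = setT `&` (fun x : E => x ord0 ord0) @^-1` [set t | 0 < t].
  by apply/seteqP; split=> x //= [].
apply: open_preimage; [exact: openT|exact: open_gt|] => x _; exact: coordl_continuous.
Qed.

Lemma smooth_lamv (O : set E) : open O -> smooth O lamv.
Proof.
move=> oO k; apply: Ck_row => // i; case: unlift => [i'|] /=.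
  by case: eqP => _; [exact: Ck_cst|apply: Ck_coord => //; exact: Ck_id].
have -> : (fun x : E => dot x x) = (fun x => Qf 1 x x) by apply/funext => x; rewrite dot_Qf.
by apply: smooth_Qf => //; exact: Ck_id.
Qed.

Lemma derive_lamv x u : 'D_u lamv x = dlam x u.
Proof.
have dl := smooth_diff (smooth_lamv (@openT E)) (I : setT x).
apply/rowP => i; rewrite -(proj2 (diff_coord u i dl)) mxE.
case: (unliftP ord0 i) => [i' ->|->] /=.
  have -> : (fun s : E => lamv s ord0 (lift ord0 i')) = (fun s => if i' == ord0 then 1 else s ord0 i').
    by apply/funext => s; rewrite mxE liftK.
  case: eqP => _; first by rewrite derive_cst.
  by rewrite (proj2 (diff_coord u i' (differentiable_idf x))) derive_id.
have -> : (fun s : E => lamv s ord0 ord0) = (fun s => Qf 1 s s).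
  by apply/funext => s; rewrite lamv0 dot_Qf.
rewrite (proj2 (diff_Qf 1 u (differentiable_idf x) (differentiable_idf x))) derive_id.
by rewrite (QfC 1 u x) -dot_Qf; ring.
Qed.

Lemma smooth_iota : smooth halfspace iota.
Proof.
have oH := open_halfspace => k; apply: Ck_scale => //; last exact: smooth_lamv.
apply: Ck_inv => //; first by move=> x; rewrite /halfspace /= => x0; rewrite gt_eqF.
by apply: Ck_coord => //; exact: Ck_id.
Qed.

Lemma derive_iota x u : halfspace x ->
  'D_u iota x = (- (u ord0 ord0 / x ord0 ord0 ^+ 2)) *: lamv x + (x ord0 ord0)^-1 *: dlam x u.
Proof.
move=> Hx; have xn : x ord0 ord0 != 0 by rewrite gt_eqF.
have [d1 E1] := diff_coord u ord0 (differentiable_idf x); rewrite derive_id in E1.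
have d2 := @differentiableV _ _ (fun s : E => s ord0 ord0) x d1 xn.
have d1v : derivable (fun s : E => s ord0 ord0) x u by exact: diff_derivable.
have E2 := @deriveV _ _ (fun s : E => s ord0 ord0) x u xn d1v.
have d3 := smooth_diff (smooth_lamv (@openT E)) (I : setT x).
have [_ E3] := diff_scale u d2 d3.
rewrite [LHS]E3 [X in X *: _ + _]E2 E1 derive_lamv; congr (_ *: _ + _).
by rewrite /GRing.scale /= mulNr mulrC.
Qed.

Lemma Bm_iota x : halfspace x -> Bm (iota x) (iota x) = -1.
Proof.
move=> Hx; rewrite /iota BmZ BmC BmZ Bm_lamv.
by field; rewrite gt_eqF.
Qed.

Lemma Bm_derive_iota x u w : halfspace x ->
  Bm ('D_u iota x) ('D_w iota x) = dot u w / x ord0 ord0 ^+ 2.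
Proof.
move=> Hx; have xn : x ord0 ord0 != 0 by rewrite gt_eqF.
rewrite !derive_iota // BmD !BmZ (BmC (lamv x)) BmD !BmZ (BmC (dlam x u)) BmD !BmZ.
rewrite (BmC (dlam x w) (lamv x)) !Bm_lamv_dlam Bm_lamv Bm_dlam (tdotC w u) dotE.
by field.
Qed.

Lemma iota_tl0 x : tl (iota x) ord0 ord0 = (x ord0 ord0)^-1.
Proof. by rewrite /iota linearZ /= mxE lamvt0 mulr1. Qed.

Lemma iotaiK x : halfspace x -> iotai (iota x) = x.
Proof.
move=> Hx; have xn : x ord0 ord0 != 0 by rewrite gt_eqF.
apply/rowP => i; rewrite mxE !iota_tl0 invrK; case: eqP => [->//|/eqP i0].
rewrite /iota linearZ /= mxE; case: (unliftP ord0 i) i0 => [i' ->|->]; last by rewrite eqxx.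
by rewrite lamvt => _; field.
Qed.

Definition upper_sheet : set L := [set X | Bm X X = -1 /\ 0 < tl X ord0 ord0].

Lemma iota_sheet x : halfspace x -> upper_sheet (iota x).
Proof. by move=> Hx; split; [exact: Bm_iota|rewrite iota_tl0 invr_gt0]. Qed.

Lemma sheet_iotai X : upper_sheet X -> halfspace (iotai X) /\ iota (iotai X) = X.
Proof.
move=> [BX X0]; have xn : tl X ord0 ord0 != 0 by rewrite gt_eqF.
have i0 : iotai X ord0 ord0 = (tl X ord0 ord0)^-1 by rewrite mxE eqxx.
split; first by rewrite /halfspace /= i0 invr_gt0.
have il (i : 'I_n) : iotai X ord0 (lift ord0 i) = tl X ord0 (lift ord0 i) / tl X ord0 ord0.
  by rewrite mxE.
apply/rowP => i; rewrite /iota mxE i0 invrK.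
case: (unliftP ord0 i) => [i' ->|->].
  rewrite [lamv _ _ _]mxE liftK /=; case: eqP => [->|/eqP i'0]; first by rewrite mulr1 mxE.
  case: (unliftP ord0 i') i'0 => [i'' ->|->]; last by rewrite eqxx.
  by move=> _; rewrite il mulrC divfK // mxE.
rewrite lamv0 dotE i0.
have -> : tdot (iotai X) (iotai X) = tdot (tl X) (tl X) / tl X ord0 ord0 ^+ 2.
  rewrite /tdot mulr_suml; apply: eq_bigr => i' _; rewrite il; field.
  exact: xn.
have : tdot (tl X) (tl X) = X ord0 ord0 * tl X ord0 ord0 - 1.
  by move: BX; rewrite /Bm => BX; have -> : tdot (tl X) (tl X) = -1 + (X ord0 ord0 * tl X ord0 ord0
    + tl X ord0 ord0 * X ord0 ord0) / 2 by [rewrite -BX; ring]; field.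
by move=> ->; field.
Qed.

Definition pos_tl : set L := [set X | 0 < tl X ord0 ord0].
Lemma open_pos_tl : open pos_tl.
Proof.
have -> : pos_tl = setT `&` coordl ord0 (lift ord0 ord0) @^-1` [set t | 0 < t].
  by apply/seteqP; split=> X; rewrite /pos_tl /= mxE // => -[].
apply: open_preimage; [exact: openT|exact: open_gt|] => x _; exact: coordl_continuous.
Qed.

Lemma smooth_iotai : smooth pos_tl iotai.
Proof.
have oH := open_pos_tl => k.
have sc i : Ck k pos_tl (fun X => tl X ord0 i).
  apply: Ck_coord => //; apply: (Ck_clin (g := tl)) => //; last exact: Ck_id.
  exact: linear_row_continuous.
have si : Ck k pos_tl (fun X => (tl X ord0 ord0)^-1).
  by apply: Ck_inv => // X X0; rewrite gt_eqF.
by apply: Ck_row => // i; case: eqP => _ //; exact: Ck_mulr.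
Qed.

(** Orthogonality to the image of the basis vector e_i, i > 0, gives X_i = X_+ x_i; orthogonality to
    the image of e_0 then determines X_-. *)
Lemma Bm_nondeg x X : halfspace x -> (forall z, Bm X ('D_z iota x) = 0) ->
  exists mu, X = mu *: iota x.
Proof.
move=> Hx H; have xn : x ord0 ord0 != 0 by rewrite gt_eqF.
set x0 : R := x ord0 ord0 in xn *.
have H1 (z : E) : z ord0 ord0 = 0 -> Bm X (dlam x z) = 0.
  move=> z0; have := H z; rewrite derive_iota // z0 mul0r oppr0 scale0r add0r BmC BmZ => /eqP.
  by rewrite mulf_eq0 invr_eq0 (negbTE xn) /= BmC => /eqP.
pose Xp := tl X ord0 ord0.
have T i : tl X ord0 (lift ord0 i) = Xp * x ord0 (lift ord0 i).
  pose e : E := delta_mx ord0 (lift ord0 i).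
  have e00 : e ord0 ord0 = 0 by rewrite mxE.
  have td (y : E) : tdot y e = y ord0 (lift ord0 i).
    rewrite /tdot (bigD1 i) //= mxE !eqxx mulr1 big1 ?addr0 // => i' ii'.
    by rewrite mxE eqxx /= (inj_eq lift_inj) (negbTE ii') mulr0.
  have E1 := H1 e e00.
  rewrite /Bm (tdotC (tl X)) tdot_dlam dlam0 dlamt0 -/Xp dotE e00 (tdotC e) !td in E1.
  have -> : tl X ord0 (lift ord0 i) = tl X ord0 (lift ord0 i) -
      (X ord0 ord0 * 0 + Xp * (2 * (x ord0 ord0 * 0 + x ord0 (lift ord0 i)))) / 2 +
      Xp * x ord0 (lift ord0 i) by field.
  by rewrite E1 add0r.
have t1 : tdot (tl X) x = Xp * tdot x x.
  by rewrite /tdot mulr_sumr; apply: eq_bigr => i _; rewrite T mulrA.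
pose e : E := delta_mx ord0 ord0.
have e00 : e ord0 ord0 = 1 by rewrite mxE.
have te (y : E) : tdot y e = 0 by apply: big1 => i _; rewrite mxE /= mulr0.
have := H e; rewrite derive_iota // e00 -/x0 BmC BmD !BmZ BmC (BmC (dlam _ _)).
have b1 : Bm X (dlam x e) = - (Xp * x0).
  rewrite /Bm (tdotC (tl X)) tdot_dlam dlam0 dlamt0 -/Xp dotE e00 (tdotC e) !te -/x0.
  by field.
have b2 : Bm X (lamv x) = Xp * tdot x x - (X ord0 ord0 + Xp * (x0 ^+ 2 + tdot x x)) / 2.
  by rewrite /Bm tdotC tdot_lamv tdotC t1 lamv0 lamvt0 mulr1 dotE -/x0 -/Xp expr2.
rewrite b1 b2 => E1.
have E2 : X ord0 ord0 = Xp * (x0 ^+ 2 + tdot x x).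
  have : (- (1 / x0 ^+ 2) * (Xp * tdot x x - (X ord0 ord0 + Xp * (x0 ^+ 2 + tdot x x)) / 2) +
     x0^-1 * - (Xp * x0)) * (2 * x0 ^+ 2) = 0 by rewrite E1 mul0r.
  have -> : (- (1 / x0 ^+ 2) * (Xp * tdot x x - (X ord0 ord0 + Xp * (x0 ^+ 2 + tdot x x)) / 2) +
     x0^-1 * - (Xp * x0)) * (2 * x0 ^+ 2) = X ord0 ord0 - Xp * (x0 ^+ 2 + tdot x x) by field.
  by move/eqP; rewrite subr_eq0 => /eqP.
exists (Xp * x0); rewrite /iota scalerA -/x0 mulfK //; apply/rowP => i; rewrite mxE.
case: (unliftP ord0 i) => [i' ->|->]; last by rewrite lamv0 dotE -/x0 E2 expr2.
have -> : X ord0 (lift ord0 i') = tl X ord0 i' by rewrite mxE.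
have -> : lamv x ord0 (lift ord0 i') = tl (lamv x) ord0 i' by rewrite [RHS]mxE.
case: (unliftP ord0 i') => [i'' ->|->]; first by rewrite T lamvt.
by rewrite lamvt0 mulr1.
Qed.

End HalfSpace.

(** u is found from the coordinates of X other than X_-. The error W has only that coordinate, which
    vanishes because W is orthogonal to iota x, whose X_+ is nonzero. *)
Lemma iota_surj (R : realType) n (x : 'rV[R]_n.+1) X : halfspace x -> Bm X (iota x) = 0 ->
  exists u, 'D_u iota x = X.
Proof.
move=> Hx BX; have xn : x ord0 ord0 != 0 by rewrite gt_eqF.
pose u : 'rV[R]_n.+1 := \row_i (if i == ord0 then - (x ord0 ord0 ^+ 2 * tl X ord0 ord0)
  else x ord0 ord0 * (tl X ord0 i - tl X ord0 ord0 * x ord0 i)).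
have u0 : u ord0 ord0 = - (x ord0 ord0 ^+ 2 * tl X ord0 ord0) by rewrite mxE eqxx.
exists u; apply/eqP; rewrite -subr_eq0; apply/eqP; set W := 'D_u iota x - X.
have tW : tl W = 0.
  apply/rowP => i; rewrite /W linearB derive_iota //= u0 !mxE.
  rewrite !liftK /=; case: eqP => [->|i0]; first by field.
  have -> : u ord0 i = x ord0 ord0 * (tl X ord0 i - tl X ord0 ord0 * x ord0 i).
    by rewrite mxE (introF eqP i0).
  by rewrite !mxE; field.
have BI : Bm (iota x) ('D_u iota x) = 0.
  rewrite derive_iota // /iota BmZ BmC BmD !BmZ Bm_lamv (BmC (dlam x u)) Bm_lamv_dlam.
  by field.
have : Bm W (iota x) = 0.
  by rewrite /W -scaleN1r BmD BmZ BX mulr0 addr0 BmC.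
have t0 : tl W ord0 ord0 = 0 by rewrite tW mxE.
rewrite /Bm t0 tW mul0r addr0 iota_tl0 /tdot big1 ?sub0r; last by move=> i _; rewrite mxE mul0r.
move=> /eqP; rewrite oppr_eq0 !mulf_eq0 !invr_eq0 (negbTE xn) pnatr_eq0 !orbF => /eqP W0.
clearbody W; apply/rowP => i; rewrite [RHS]mxE; case: (unliftP ord0 i) => [i' ->|->]; last exact: W0.
by have /rowP /(_ i') := tW; rewrite !mxE.
Qed.

Section Hyperbolic.
Context {R : realType} {n : nat}.
Local Notation E := 'rV[R]_n.+1.
Local Notation L := 'rV[R]_n.+2.
Variables (q : R) (f g : E -> E).
Hypothesis q0 : 0 < q.
Let kappa := - q ^+ 2.
Local Notation M := (@space_form R n kappa).
Hypotheses (sf : smooth_on M f) (sg : smooth_on M g).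
Hypothesis fM : forall p, M p -> M (f p) /\ g (f p) = p.
Hypothesis gM : forall p, M p -> M (g p) /\ f (g p) = p.
Hypothesis isoM : forall p u w c d, curve_at M p u c -> curve_at M p w d ->
  metric kappa (f p) (derive1 (f \o c) 0) (derive1 (f \o d) 0) = metric kappa p u w.

Let kn : kappa < 0. Proof. by rewrite oppr_lt0 exprn_gt0. Qed.
Let k0 : kappa != 0. Proof. by rewrite lt_eqF. Qed.
Let qn : q != 0. Proof. by rewrite gt_eqF. Qed.

Lemma space_form_neg : M = @halfspace R n.
Proof.
apply/seteqP; split=> x; rewrite /space_form /halfspace /= (lt_gtF kn); first by apply.
by [].
Qed.

Let oM : open M. Proof. by rewrite space_form_neg; exact: open_halfspace. Qed.
Let sg' := smooth_on_smooth oM sg.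
Let sf' := smooth_on_smooth oM sf.

Lemma metric_neg (p u w : E) : metric kappa p u w = dot u w / (q ^+ 2 * p ord0 ord0 ^+ 2).
Proof. by rewrite /metric kn opprK. Qed.

Lemma tangent_neg (p u : E) : M p -> tangent M p u.
Proof. by move=> Mp; exists (fun t => p + t *: u); exact: curve_line. Qed.

Lemma isom_inv (p u w : E) : M p -> metric kappa (g p) ('D_u g p) ('D_w g p) = metric kappa p u w.
Proof.
move=> Mp; have [Mgp fgp] := gM Mp.
have H x : curve_at M (g p) ('D_x g p) (fun t => g (p + t *: x)).
  refine (curve_image oM sg' (fun y My => My) (fun y My => proj1 (gM My)) Mp _).
  exact: curve_line.
have D x : derive1 (f \o (fun t : R => g (p + t *: x))) 0 = x.
  have [dl El] := diff_line p x 0.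
  have Mp0 : M (p + (0 : R) *: x) by rewrite scale0r addr0.
  have N := @differentiable_near_open R R _ M (fun t : R => p + t *: x) 0 oM Mp0 dl.
  rewrite derive1E (near_eq_derive (g := fun t : R => p + t *: x)) ?El //.
  by apply: filterS N => t Mt; have [] := gM Mt.
by rewrite -(isoM (H u) (H w)) fgp !D.
Qed.

(** The inverse isometry g comes first, so that the image under f of a standard hypersurface is
    embedded as that standard hypersurface. *)
Definition hyp_embed x := iota (g x).
Definition hyp_form X Z := @Bm R n X Z / q ^+ 2.
Definition hyp_unembed X := f (iotai X).

Lemma hyp_formC X Z : hyp_form X Z = hyp_form Z X. Proof. by rewrite /hyp_form BmC. Qed.
Lemma hyp_formD X Y Z : hyp_form (X + Y) Z = hyp_form X Z + hyp_form Y Z. Proof. by rewrite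
  /hyp_form BmD mulrDl. Qed.
Lemma hyp_formZ a X Z : hyp_form (a *: X) Z = a * hyp_form X Z. Proof. by rewrite /hyp_form BmZ
  mulrA. Qed.

Let Hg p : M p -> halfspace (g p).
Proof. by move=> /gM []; rewrite space_form_neg. Qed.

Lemma smooth_hyp_embed : smooth M hyp_embed.
Proof.
move=> k; exact: (Ck_comp (P := @halfspace R n) oM Hg (sg' k) (@smooth_iota R n k)).
Qed.

Lemma derive_hyp_embed p u : M p -> 'D_u hyp_embed p = 'D_('D_u g p) iota (g p).
Proof.
move=> Mp; exact: (derive_comp u (smooth_diff sg' Mp) (smooth_diff (@smooth_iota R n) (Hg Mp))).
Qed.

Lemma hyp_embed_sq p : M p -> hyp_form (hyp_embed p) (hyp_embed p) = kappa^-1.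
Proof. by move=> Mp; rewrite /hyp_form /kappa (Bm_iota (Hg Mp)); field. Qed.

Lemma hyp_metricE p x z : M p -> metric kappa p x z = hyp_form ('D_x hyp_embed p) ('D_z hyp_embed p).
Proof.
move=> Mp; rewrite -(isom_inv x z Mp) metric_neg !(derive_hyp_embed _ Mp) /hyp_form (Bm_derive_iota
  _ _ (Hg Mp)).
have gn : g p ord0 ord0 != 0 by rewrite gt_eqF //; exact: Hg.
by field; rewrite gn qn.
Qed.

(** Differentiating the metric, as a product of first derivatives of the embedding, produces six
    terms with second derivatives. By their symmetry four cancel and two combine, as in the
    uniqueness of the Levi-Civita connection. *)
Lemma hyp_inner_covE p x y a z : M p ->
  inner_cov kappa p x y a z = hyp_form ('D_x (fun s => 'D_y hyp_embed s) p + 'D_a hyp_embed p)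
    ('D_z hyp_embed p).
Proof.
move=> Mp; have sj := smooth_hyp_embed.
have dj u := smooth_diff (smooth_derive u sj) Mp.
pose F (b d : E) := 'D_b (fun s => 'D_d hyp_embed s) p.
have FC b d : F b d = F d b by exact: schwarz oM sj Mp.
have dm u w t : 'D_t (fun s => metric kappa s u w) p =
    hyp_form (F t u) ('D_w hyp_embed p) + hyp_form ('D_u hyp_embed p) (F t w).
  rewrite -(proj2 (diff_BL hyp_formC hyp_formD hyp_formZ t (dj u) (dj w))); apply: near_eq_derive.
  by have := open_nbhs_nbhs (conj oM Mp); apply: filterS => s; exact: hyp_metricE.
apply: (etrans _ (esym (hyp_formD (F x y) ('D_a hyp_embed p) ('D_z hyp_embed p)))).
transitivity (hyp_form ('D_a hyp_embed p) ('D_z hyp_embed p) + 2^-1 *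
  ((hyp_form (F x y) ('D_z hyp_embed p) + hyp_form ('D_y hyp_embed p) (F x z)) +
   (hyp_form (F y x) ('D_z hyp_embed p) + hyp_form ('D_x hyp_embed p) (F y z)) -
   (hyp_form (F z x) ('D_y hyp_embed p) + hyp_form ('D_x hyp_embed p) (F z y)))).
  rewrite /inner_cov; congr (_ + _ * (_ + _ - _)).
  - exact: hyp_metricE.
  - exact: dm.
  - exact: dm.
  - exact: dm.
have alg (X Y Z A xy xz yz yx zx zy : L) : yx = xy -> zx = xz -> zy = yz ->
    hyp_form A Z + 2^-1 * ((hyp_form xy Z + hyp_form Y xz) + (hyp_form yx Z + hyp_form X yz) -
      (hyp_form zx Y + hyp_form X zy)) =
    hyp_form xy Z + hyp_form A Z.
  by move=> -> -> ->; rewrite (hyp_formC Y xz); field.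
exact: (alg _ _ _ _ _ _ _ _ _ _ (FC y x) (FC z x) (FC z y)).
Qed.

Lemma isom_derive_inv p z : M p -> 'D_('D_z f (g p)) g p = z.
Proof.
move=> Mp; have [Mgp fgp] := gM Mp.
have df := smooth_diff sf' Mgp.
have dg' : differentiable g (f (g p)) by rewrite fgp; exact: smooth_diff sg' Mp.
have := derive_comp z df dg'; rewrite fgp => <-.
rewrite (near_eq_derive (g := fun s => s)) ?derive_id //.
by have := open_nbhs_nbhs (conj oM Mgp); apply: filterS => s /fM [].
Qed.

Lemma hyp_nondeg p X : M p -> (forall z, tangent M p z -> hyp_form X ('D_z hyp_embed p) = 0) ->
  exists mu, X = mu *: hyp_embed p.
Proof.
move=> Mp H; refine (Bm_nondeg (Hg Mp) _) => z.
have := H _ (tangent_neg ('D_z f (g p)) Mp).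
rewrite derive_hyp_embed // (isom_derive_inv z Mp) /hyp_form => /eqP.
by rewrite mulf_eq0 invr_eq0 expf_eq0 (negbTE qn) orbF => /eqP.
Qed.

Lemma hyp_tangent_surj p X : M p -> hyp_form X (hyp_embed p) = 0 -> exists2 u, tangent M p u & 'D_u
  hyp_embed p = X.
Proof.
move=> Mp; rewrite /hyp_form => /eqP; rewrite mulf_eq0 invr_eq0 expf_eq0 (negbTE qn) orbF => /eqP BX.
have [w Dw] := iota_surj (Hg Mp) BX.
exists ('D_w f (g p)); first exact: tangent_neg.
by rewrite (derive_hyp_embed _ Mp) (isom_derive_inv w Mp).
Qed.

Lemma hyp_unembed_smooth : smooth_on (@upper_sheet R n) hyp_unembed.
Proof.
apply: (smooth_on_comp (B := M)) => //.
  by move=> X /sheet_iotai []; rewrite space_form_neg.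
apply: (smooth_on_sub (B := @pos_tl R n)); first by move=> X [].
by apply: smooth_smooth_on; [exact: open_pos_tl|exact: smooth_iotai].
Qed.

Lemma hyp_unembedK X : upper_sheet X -> M (hyp_unembed X) /\ hyp_embed (hyp_unembed X) = X.
Proof.
move=> HX; have [Hi EX] := sheet_iotai HX.
have Mi : M (iotai X) by rewrite space_form_neg.
have [Mf gf] := fM Mi; split=> //.
by rewrite /hyp_embed /hyp_unembed gf.
Qed.

Lemma hyp_embedK p : M p -> upper_sheet (hyp_embed p) /\ hyp_unembed (hyp_embed p) = p.
Proof.
move=> Mp; split; first exact: iota_sheet (Hg Mp).
by rewrite /hyp_unembed /hyp_embed (iotaiK (Hg Mp)); have [] := gM Mp.
Qed.

Let scs := proj1 (@csh_snh_smooth R q).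
Let ssn := proj2 (@csh_snh_smooth R q).
Let cs0 : csh q 0 = 1. Proof. by rewrite /csh mulr0 oppr0 expR0; field. Qed.
Let sn0 : snh q 0 = 0. Proof. by rewrite /snh mulr0 oppr0 expR0 subrr mul0r. Qed.
Let dcs t : 'D_1 (csh q) t = - kappa * snh q t.
Proof. by rewrite opprK; exact: (proj1 (csh_snh_derive t qn)). Qed.
Let dsn t : 'D_1 (snh q) t = csh q t.
Proof. exact: (proj2 (csh_snh_derive t qn)). Qed.
Let uniq (h : R -> R) : smooth setT h ->
  (forall t, 'D_1 (fun s => 'D_1 h s) t = - kappa * h t) -> h 0 = 0 -> 'D_1 h 0 = 0 ->
  forall t, h t = 0.
Proof. by move=> sh; rewrite opprK => E; exact: ode_neg. Qed.

Local Notation G := (lin_geod hyp_embed (csh q) (snh q)).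

(** Bm keeps the value -1 by cosh^2 - sinh^2 = 1. With X_+ = 0, Bm X X would be a sum of squares; so
    X_+ never vanishes and keeps its sign at time 0. *)
Lemma hyp_geodesic_in p u t : M p -> tangent M p u -> metric kappa p u u = 1 -> upper_sheet (G p u t).
Proof.
move=> Mp tu mu.
have orth : hyp_form (hyp_embed p) ('D_u hyp_embed p) = 0.
  exact: (M_tangent_orth hyp_formC hyp_formD hyp_formZ oM (fun x Hx => Hx) smooth_hyp_embed
    hyp_embed_sq Mp tu).
have BG s : Bm (G p u s) (G p u s) = -1.
  have h1 : hyp_form (G p u s) (G p u s) = kappa^-1.
    have alg (J U : L) b d : hyp_form J U = 0 -> hyp_form J J = kappa^-1 -> hyp_form U U = 1 ->
        hyp_form (b *: J + d *: U) (b *: J + d *: U) = b ^+ 2 * kappa^-1 + d ^+ 2.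
      move=> h1 h2 h3; rewrite hyp_formD !hyp_formZ (hyp_formC J) (hyp_formC U) !hyp_formD
        !hyp_formZ h2 h3 h1 (hyp_formC U) h1.
      by ring.
    have := csh_snh_sq s qn; rewrite /lin_geod (alg _ _ _ _ orth (hyp_embed_sq Mp));
      last by rewrite -(hyp_metricE u u Mp).
    by rewrite /kappa => ->; field.
  move: h1; rewrite /hyp_form /kappa => h1.
  have qq : q ^+ 2 != 0 by rewrite expf_neq0.
  by apply: (mulIf (invr_neq0 qq)); rewrite h1; field.
split=> //.
have nz s : tl (G p u s) ord0 ord0 != 0.
  apply: contraTneq (ltr01 : (0 : R) < 1) => E; have := BG s;
    rewrite /Bm E mulr0 mul0r addr0 mul0r subr0 => h.
  by have := tdot_ge0 (tl (G p u s)); rewrite h; rewrite oppr_ge0 => /le_gtF ->.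
pose h s := tl (G p u s) ord0 ord0.
have h00 : 0 < h 0.
  by rewrite /h /lin_geod cs0 sn0 scale1r scale0r addr0 iota_tl0 invr_gt0; exact: Hg.
have ch : continuous h.
  have sG := lin_geod_smooth hyp_embed scs ssn p u.
  have sh : smooth setT h.
    move=> k; have oT := @openT R; apply: Ck_coord => //; apply: (Ck_clin (g := tl)) => //.
    exact: linear_row_continuous.
  by move=> s; exact: smooth_cont sh (I : setT s).
rewrite ltNge; apply/negP => ht.
have [|||s _ Es] := @IVT R h (Num.min 0 t) (Num.max 0 t) 0.
- by rewrite ge_min le_max lexx.
- exact: continuous_subspaceT.
- by case: (leP 0 t) => _; rewrite ge_min le_max ht (ltW h00) ?orbT.
by move: (nz s); rewrite -/(h s) Es eqxx.
Qed.

Lemma hyp_ray p u : M p -> tangent M p u -> metric kappa p u u = 1 ->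
  ray kappa p u = [set x | exists2 t, 0 < t & x = hyp_unembed (G p u t)].
Proof.
move=> Mp tu mu.
rewrite (ray_lin hyp_formC hyp_formD hyp_formZ k0 oM (fun x Hx => Hx) smooth_hyp_embed hyp_embed_sq
  hyp_nondeg hyp_inner_covE hyp_metricE
  scs ssn cs0 sn0 dcs dsn uniq hyp_unembed_smooth hyp_unembedK hyp_embedK hyp_geodesic_in Mp tu mu).
apply/seteqP; split=> x; first by move=> [t [t0 _ ->]]; exists t.
by move=> [t t0 ->]; exists t; split=> //; rewrite (lt_gtF kn).
Qed.

Lemma hyp_sphere p r : M p -> geodesic_sphere kappa p r =
  [set x | exists u, metric kappa p u u = 1 /\ x = hyp_unembed (G p u r)].
Proof.
move=> Mp.
rewrite (geodesic_sphere_lin hyp_formC hyp_formD hyp_formZ k0 oM (fun x Hx => Hx) smooth_hyp_embed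
  hyp_embed_sq hyp_nondeg hyp_inner_covE hyp_metricE
  scs ssn cs0 sn0 dcs dsn uniq hyp_unembed_smooth hyp_unembedK hyp_embedK hyp_geodesic_in r Mp).
apply/seteqP; split=> x; first by move=> [u [_ mu ->]]; exists u.
by move=> [u [mu ->]]; exists u; split=> //; exact: tangent_neg.
Qed.

(** Along a geodesic from p, minus the product with the image of p is cosh(q t). Conversely, the
    component Y of X orthogonal to this image, normalised, is the initial direction of a geodesic
    reaching X at time r. *)
Lemma hyp_sphereE p r : M p -> 0 < r -> geodesic_sphere kappa p r =
  [set x | M x /\ - Bm (hyp_embed x) (hyp_embed p) = csh q r].
Proof.
move=> Mp r0; rewrite (hyp_sphere r Mp).
have BJ s : M s -> Bm (hyp_embed s) (hyp_embed s) = -1 by move=> Ms; exact: Bm_iota (Hg Ms).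
have sn : snh q r != 0 by rewrite gt_eqF // snh_gt0.
apply/seteqP; split=> x.
  move=> [u [mu ->]]; have tu := tangent_neg u Mp.
  have [Mi ji] := hyp_unembedK (hyp_geodesic_in r Mp tu mu); split=> //; rewrite ji /lin_geod.
  have := M_tangent_orth hyp_formC hyp_formD hyp_formZ oM (fun y My => My) smooth_hyp_embed
    hyp_embed_sq Mp tu.
  rewrite /hyp_form => /eqP; rewrite mulf_eq0 invr_eq0 expf_eq0 (negbTE qn) orbF => /eqP orth.
  have alg (J U : L) a b : Bm J U = 0 -> Bm J J = -1 -> - Bm (a *: J + b *: U) J = a.
    by move=> h1 h2; rewrite BmD !BmZ h2 (BmC U) h1; ring.
  exact: alg orth (BJ _ Mp).
have alg1 (X J : L) a b : Bm (b *: (X + a *: J)) J = b * (Bm X J + a * Bm J J).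
  by rewrite BmZ BmD BmZ.
have alg2 (X J : L) a b : Bm (b *: (X + a *: J)) (b *: (X + a *: J)) =
    b ^+ 2 * (Bm X X + 2 * a * Bm X J + a ^+ 2 * Bm J J).
  rewrite BmZ BmD BmZ (BmC X) (BmC J) !alg1 BmZ BmD BmZ (BmC J X); ring.
move=> [Mx lx]; set J := hyp_embed p in lx *; set X := hyp_embed x in lx *.
have JJ : Bm J J = -1 by exact: BJ.
have XX : Bm X X = -1 by exact: BJ.
pose Y := (snh q r)^-1 *: (X + (- csh q r) *: J).
have BXJ : Bm X J = - csh q r by rewrite -lx opprK.
have YJ : Bm Y J = 0 by rewrite /Y alg1 JJ BXJ; ring.
have YY : hyp_form Y Y = 1.
  have sq := csh_snh_sq r qn.
  rewrite /hyp_form /Y alg2 XX JJ BXJ.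
  have -> : (snh q r)^-1 ^+ 2 * (-1 + 2 * - csh q r * - csh q r + (- csh q r) ^+ 2 * -1) / q ^+ 2
    = (csh q r ^+ 2 - 1) / (snh q r ^+ 2 * q ^+ 2) by field; rewrite sn qn.
  by rewrite sq; field; rewrite sn qn.
have [u tu Du] : exists2 u, tangent M p u & 'D_u hyp_embed p = Y.
  by apply: hyp_tangent_surj => //; rewrite /hyp_form YJ mul0r.
exists u; split; first by rewrite (hyp_metricE u u Mp) Du.
have alg3 (X' J' : L) a b : b != 0 -> a *: J' + b *: (b^-1 *: (X' + (- a) *: J')) = X'.
  by move=> b0; rewrite scalerA divff // scale1r scaleNr addrC subrK.
rewrite /lin_geod Du /Y alg3 //.
by have [_ ->] := hyp_embedK Mx.
Qed.

End Hyperbolic.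

(** * Exteriors and mean curvature *)

Section Components.
Context {R : realType} {m : nat}.
Local Notation V := 'rV[R]_m.+1.

Lemma line_component (A : set V) x y :
  (forall t : R, 0 <= t <= 1 -> A (x + t *: (y - x))) -> connected_component A x y.
Proof.
move=> H; pose f (t : R) := x + t *: (y - x).
have f0 : f 0 = x by rewrite /f scale0r addr0.
have f1 : f 1 = y by rewrite /f scale1r subrKC.
have I0 : `[0, 1]%classic (0 : R) by rewrite /= in_itv /= lexx ler01.
have I1 : `[0, 1]%classic (1 : R) by rewrite /= in_itv /= lexx ler01.
have cf : connected (f @` `[0, 1]%classic).
  apply: connected_continuous_connected; first exact: segment_connected.
  apply: continuous_subspaceT => t; apply: differentiable_continuous.
  exact: (proj1 (diff_line x (y - x) t)).
have fx : (f @` `[0, 1]%classic) x by exists 0.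
have fA : f @` `[0, 1]%classic `<=` A by move=> _ [t + <-]; rewrite /= in_itv /=; exact: H.
by apply: (connected_component_max fx fA cf); exists 1.
Qed.

Lemma star_connected (A : set V) x : (forall y, A y -> connected_component A x y) -> A x ->
  connected A.
Proof.
move=> H Ax.
have -> : A = connected_component A x.
  by apply/seteqP; split; [exact: H|exact: connected_component_sub].
exact: component_connected.
Qed.

(** ht has no zero on A, so it has one sign on the connected set U, positive because of y. Hence U
    lies in W, and W, being connected, lies in the component U. *)
Lemma exterior_component (A U W : set V) (ht : V -> R) q y : A q ->
  U = connected_component A q -> connected W -> W = [set x | A x /\ 0 < ht x] ->
  (forall x, A x -> {for x, continuous ht}) -> (forall x, A x -> ht x != 0) ->
  U y -> 0 < ht y -> U = W.
Proof.
move=> Aq UE cW WE ch hn Uy hy.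
have UA : U `<=` A by rewrite UE; exact: connected_component_sub.
have cU : connected U by rewrite UE; exact: component_connected.
have Wy : W y by rewrite WE; split=> //; exact: UA.
apply/seteqP; split=> x.
  move=> Ux; rewrite WE; split; first exact: UA.
  rewrite ltNge; apply/negP => hx.
  have ci : connected (ht @` U).
    apply: connected_continuous_connected => //; apply: continuous_in_subspaceT => z.
    by rewrite inE => /UA; exact: ch.
  move/connected_intervalP : ci => /(_ (ht x) (ht y)).
  have hxU : (ht @` U) (ht x) by exists x.
  have hyU : (ht @` U) (ht y) by exists y.
  move=> /(_ hxU hyU 0); rewrite hx (ltW hy) => /(_ isT) [z Uz z0].
  by have := hn z (UA _ Uz); rewrite z0 eqxx.
have WA : W `<=` A by rewrite WE => z [].
move=> Wx; have Wcy := connected_component_max Wy WA cW Wx.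
rewrite UE in Uy *; exact: connected_component_trans Uy Wcy.
Qed.

End Components.

(** * Connectedness of cones *)

Section ConeConnected.
Context {R : realType} {n : nat}.
Local Notation V := 'rV[R]_n.+1.
Variable k : R.
Hypothesis hk : [\/ k = 1, k = 0 | k = -1].
Hypothesis n0 : (0 < n)%N.

(** For k = -1 this is Cauchy-Schwarz on the space coordinates of two vectors of the upper light
    cone. It makes the cone convex. *)
Lemma cone_pairing (x y : V) : k <= 0 -> cone k x -> cone k y -> 0 <= Qf k x y.
Proof.
move=> k0 [Qx /(_ k0) x0] [Qy /(_ k0) y0]; case: hk k0 => kE; rewrite kE.
- by rewrite ler10.
- by move=> _; rewrite /Qf mul0r addr0 mulr_ge0 ?ltW.
- move=> _; move: Qx Qy; rewrite /Qf kE !mulN1r !subr_gt0 subr_ge0 => Qx Qy.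
  have h := tdot_CS x y; have tx := tdot_ge0 x; have ty := tdot_ge0 y.
  have xy0 : 0 <= x ord0 ord0 * y ord0 ord0 by rewrite mulr_ge0 ?ltW.
  apply: le_trans (ler_norm _) _.
  rewrite -(ler_pXn2r (n := 2)) // ?nnegrE // real_normK ?num_real //.
  apply: le_trans h _; rewrite exprMn !expr2.
  by apply: ler_pM => //; exact: ltW.
Qed.

Lemma cone_line (x y : V) : cone k x -> cone k y -> k <= 0 -> forall t : R, 0 <= t <= 1 ->
  cone k (x + t *: (y - x)).
Proof.
move=> Cx Cy k0 t /andP[t0 t1].
have -> : x + t *: (y - x) = (1 - t) *: x + t *: y.
  by rewrite scalerBr scalerBl scale1r addrA addrAC.
have Qxy := cone_pairing k0 Cx Cy; have [Qx /(_ k0) x0] := Cx; have [Qy /(_ k0) y0] := Cy.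
split=> [|_].
  rewrite Qf_comb; have t1' : 0 <= 1 - t by rewrite subr_ge0.
  move: t1'; set s := 1 - t => s0.
  have [tz|tp] := eqVneq t 0.
    by rewrite /s tz; lra.
  have tp' : 0 < t by rewrite lt_neqAle eq_sym tp.
  have h1 : 0 < t ^+ 2 * Qf k y y by rewrite mulr_gt0 // exprn_gt0.
  have h2 : 0 <= s ^+ 2 * Qf k x x by rewrite mulr_ge0 // ?sqr_ge0 // ltW.
  have h3 : 0 <= 2 * s * t * Qf k x y by rewrite !mulr_ge0.
  lra.
rewrite !mxE.
have [tz|tp] := eqVneq t 0; first by rewrite tz mul0r addr0 subr0 mul1r.
have tp' : 0 < t by rewrite lt_neqAle eq_sym tp.
by rewrite ltr_wpDl ?mulr_gt0 // mulr_ge0 ?subr_ge0 // ltW.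
Qed.

(** For k <= 0 the cone is convex. For k = 1 every x is joined to (1, ..., 1) by a segment; if that
    meets the origin, x is proportional to (1, ..., 1), and a detour through e_0 works since there
    are at least two coordinates. *)
Lemma cone_connected : connected (cone k : set V).
Proof.
have [k0|k1] := leP k 0.
  pose e : V := delta_mx ord0 ord0.
  have Ce : cone k e.
    split; last by rewrite mxE.
    rewrite /Qf mxE eqxx mulr1 /tdot big1 ?mulr0 ?addr0 // => i _.
    by rewrite mxE /= mul0r.
  apply: (star_connected (x := e)) => // y Cy.
  by apply: line_component => t; exact: cone_line.
have kE : k = 1 by case: hk => kE; move: k1; rewrite kE ?ltxx // ltr0N1.
have CE : cone k = [set x : V | x != 0].
  apply/seteqP; split=> x /=.
    by move=> [Qx _]; apply: contraTneq Qx => ->; rewrite kE -dot_Qf /dot big1 ?ltxx // => i _;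
      rewrite mxE mul0r.
  by move=> x0; split; [rewrite kE -dot_Qf; exact: dot_gt0|rewrite kE ler10].
rewrite CE.
pose i1 : 'I_n.+1 := Ordinal (n0 : (1 < n.+1)%N).
pose e : V := delta_mx ord0 ord0; pose y : V := \row_i 1.
have en : e != 0 by apply/eqP => /rowP /(_ ord0); rewrite !mxE !eqxx => /eqP; rewrite oner_eq0.
have yn : y != 0 by apply/eqP => /rowP /(_ ord0); rewrite !mxE => /eqP; rewrite oner_eq0.
have seg (x z : V) : (forall t : R, 0 <= t <= 1 -> x + t *: (z - x) != 0) ->
   connected_component [set x : V | x != 0] x z by exact: line_component.
apply: (star_connected (x := y)) => // x xn.
apply: connected_component_sym.
have [/seg //|/existsNP [t /not_implyP [/andP[t0 t1] /negP /negPn /eqP E]]] :=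
  pselect (forall t : R, 0 <= t <= 1 -> x + t *: (y - x) != 0).
have x1 : x ord0 i1 != 0.
  apply/eqP => x1; have /rowP /(_ i1) := E; rewrite !mxE x1 subr0 add0r mulr1 => tz.
  by move: E; rewrite tz scale0r addr0; apply/eqP.
apply: (connected_component_trans (y := e)); apply: seg => s /andP[s0 s1]; apply/eqP => Es.
  have := congr1 (fun z : V => z ord0 i1) Es; rewrite !mxE /= sub0r.
  move=> E1; have E2 : (1 - s) * x ord0 i1 = 0 by rewrite -[RHS]E1; ring.
  move/eqP: E2; rewrite mulf_eq0 (negbTE x1) orbF subr_eq0 => /eqP sE.
  by move: Es; rewrite -sE scale1r subrKC; apply/eqP.
have := congr1 (fun z : V => z ord0 ord0) Es; rewrite !mxE !eqxx subrr mulr0 addr0 => /eqP.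
by rewrite oner_eq0.
Qed.

(** The continuous map z |-> (1 + c / rho z) z increases rho by c and sends the cone onto this part
    of it. *)
Lemma exterior_cone_connected (c : R) : 0 < c -> connected [set z : V | cone k z /\ c < rho k z].
Proof.
move=> c0; pose f (z : V) := (1 + c * (rho k z)^-1) *: z.
have f_in z : cone k z -> cone k (f z) /\ rho k (f z) = rho k z + c.
  move=> Cz; have r0 := rho_gt0 Cz.
  have h : 0 < 1 + c * (rho k z)^-1 by rewrite addr_gt0 // mulr_gt0 // invr_gt0.
  split; first exact: coneZ.
  by rewrite /f rhoZ // mulrDl mul1r mulfVK // gt_eqF.
have -> : [set z : V | cone k z /\ c < rho k z] = f @` cone k.
  apply/seteqP; split=> z.
    move=> [Cz cz]; have r0 := rho_gt0 Cz.
    have h : 0 < (rho k z - c) / rho k z by rewrite divr_gt0 // subr_gt0.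
    exists (((rho k z - c) / rho k z) *: z); first exact: coneZ.
    rewrite /f rhoZ // scalerA -[RHS]scale1r; congr (_ *: _).
    by field; rewrite !gt_eqF // subr_gt0.
  by move=> [y Cy <-]; have [h1 h2] := f_in y Cy; split=> //; rewrite h2 ltrDr rho_gt0.
apply: connected_continuous_connected; first exact: cone_connected.
apply: continuous_in_subspaceT => z; rewrite inE => Cz.
have oC := @open_cone R n k.
have sf : smooth (cone k) f.
  move=> p; apply: Ck_scale => //; last exact: Ck_id.
  apply: Ck_add => //; first exact: Ck_cst.
  apply: Ck_mulr => //; first exact: Ck_cst.
  by apply: Ck_inv => //; [move=> x /rho_gt0 rx; rewrite gt_eqF|exact: smooth_rho].
exact: smooth_cont sf Cz.
Qed.

Lemma exterior_connected m (c : R) (P' : V -> 'rV[R]_m.+1) : 0 < c ->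
  smooth_on [set z : V | cone k z /\ c < rho k z] P' ->
  connected (P' @` [set z : V | cone k z /\ c < rho k z]).
Proof.
move=> c0 sP'; apply: connected_continuous_connected; first exact: exterior_cone_connected.
apply: continuous_in_subspaceT => z; rewrite inE => Cz.
have oC : open [set z : V | cone k z /\ c < rho k z].
  have -> : [set z : V | cone k z /\ c < rho k z] = cone k `&` rho k @^-1` [set t | c < t] by [].
  apply: open_preimage; [exact: open_cone|exact: open_gt|].
  by move=> x; apply: smooth_cont; exact: smooth_rho.
exact: smooth_cont (smooth_on_smooth oC sP') Cz.
Qed.

End ConeConnected.

(** * Mean curvature of hyperplane sections *)

Section MeanCurvature.
Context {R : realType} {n m l : nat}.
Local Notation E := 'rV[R]_m.+1.
Local Notation L := 'rV[R]_l.
Variables (kappa : R) (O N : set E) (j : E -> L) (BL : L -> L -> R) (ell : {linear L -> R}).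
Variables (A : L) (c0 : R).
Local Notation M := (@space_form R m kappa).
Hypotheses (BLC : forall X Z, BL X Z = BL Z X).
Hypotheses (BLD : forall X Y Z, BL (X + Y) Z = BL X Z + BL Y Z).
Hypotheses (BLZ : forall a X Z, BL (a *: X) Z = a * BL X Z).
Hypotheses (k0 : kappa != 0) (oO : open O) (MO : M `<=` O) (sj : smooth O j) (NM : N `<=` M).
Hypothesis jM : forall p, M p -> BL (j p) (j p) = kappa^-1.
Hypothesis inner_covM : forall p x y a z, M p ->
  inner_cov kappa p x y a z = BL ('D_x (fun s => 'D_y j s) p + 'D_a j p) ('D_z j p).
Hypothesis metricM : forall p x z, M p -> metric kappa p x z = BL ('D_x j p) ('D_z j p).
Hypothesis ellA : forall X, ell X = BL X A.
Hypothesis ellN : forall p, N p -> ell (j p) = c0.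
Hypothesis surj : forall p X, M p -> BL X (j p) = 0 -> exists2 z, tangent M p z & 'D_z j p = X.

Let NO : N `<=` O. Proof. by move=> p /NM /MO. Qed.
Let ellc : continuous ell. Proof. exact: linear_scalar_continuous. Qed.

Let tangentNM p x : tangent N p x -> tangent M p x.
Proof. by move=> [c [e [e0 sc cN cp dc]]]; exists c, e; split=> // t /cN /NM. Qed.

(** W is the second derivative of j o c. The two equations come from differentiating twice the
    constants ell (j o c) and BL (j o c) (j o c). *)
Lemma curve_acceleration p x c : N p -> curve_at N p x c ->
  let W := 'D_x (fun s => 'D_x j s) p + 'D_(derive1n 2 c 0) j p in
  ell W = 0 /\ BL W (j p) = - metric kappa p x x.
Proof.
move=> Np Hc W; have [e [e0 sc cN cp dc]] := Hc; pose I := [set t : R | - e < t < e].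
have oI : open I by exact: (@open_oo R).
have I0 : I 0 by rewrite /I /= oppr_lt0 e0.
have sc' := smooth_on_smooth oI sc.
have sX : smooth I (fun t => j (c t)).
  by move=> i; apply: (Ck_comp (P := O)) => // t /cN /NO.
have D1 t : I t -> 'D_1 (fun t => j (c t)) t = 'D_('D_1 c t) j (c t).
  move=> It; have Oc : O (c t) by apply: NO; exact: cN.
  exact: (derive_comp (1 : R) (smooth_diff sc' It) (smooth_diff sj Oc)).
have nI : \forall t \near (0 : R), I t by have := open_nbhs_nbhs (conj oI I0).
have Dc : 'D_1 c (0 : R) = x by rewrite -derive1E.
have Oc0 : O (c 0) by rewrite cp; exact: NO.
have dc0 := smooth_diff sc' I0.
have ddc := smooth_diff (smooth_derive (1 : R) sc') I0.
have [_ Dw] := derive_dir (1 : R) oO Oc0 (sj 2) ddc dc0.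
have WE : 'D_1 (fun s => 'D_1 (fun t => j (c t)) s) (0 : R) = W.
  rewrite (near_eq_derive (g := fun t => 'D_('D_1 c t) j (c t))); last first.
    by apply: filterS nI => t; exact: D1.
  by rewrite Dw Dc cp addrC /W derive1n2E.
have sX1 := smooth_derive (1 : R) sX.
have dX t (It : I t) := smooth_diff sX It.
have dX1 := smooth_diff sX1 I0.
split.
  have sl : smooth I (fun t => ell (j (c t))) by move=> i; exact: Ck_clin.
  have e1 t : I t -> 'D_1 (fun s => ell (j (c s))) t = ell ('D_1 (fun s => j (c s)) t).
    move=> It; have dl : differentiable ell (j (c t)) by exact: linear_differentiable.
    by rewrite (derive_comp (1 : R) (dX t It) dl) derive_clin.
  have e2 : 'D_1 (fun t => 'D_1 (fun s => ell (j (c s))) t) (0 : R) = ell W.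
    rewrite (near_eq_derive (g := fun t => ell ('D_1 (fun s => j (c s)) t))); last first.
      by apply: filterS nI => t; exact: e1.
    have dl : differentiable ell ('D_1 (fun s => j (c s)) (0 : R)) by exact: linear_differentiable.
    by rewrite (derive_comp (1 : R) dX1 dl) derive_clin // WE.
  rewrite -e2 (near_eq_derive (g := fun _ : R => 0 : R)) ?derive_cst //.
  apply: filterS nI => t It; rewrite (near_eq_derive (g := fun _ : R => c0)) ?derive_cst //.
  have := open_nbhs_nbhs (conj oI It); apply: filterS => s /cN; exact: ellN.
have b1 t : I t -> BL ('D_1 (fun s => j (c s)) t) (j (c t)) = 0.
  move=> It; have [_ b] := diff_BL BLC BLD BLZ (1 : R) (dX t It) (dX t It).
  have : 'D_1 (fun s => BL (j (c s)) (j (c s))) t = 0.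
    rewrite (near_eq_derive (g := fun _ : R => kappa^-1)) ?derive_cst //.
    by have := open_nbhs_nbhs (conj oI It); apply: filterS => s /cN /NM; exact: jM.
  rewrite b (BLC (j (c t))) => b'; lra.
have [_ b2] := diff_BL BLC BLD BLZ (1 : R) dX1 (dX 0 I0).
have b3 : 'D_1 (fun t => BL ('D_1 (fun s => j (c s)) t) (j (c t))) (0 : R) = 0.
  rewrite (near_eq_derive (g := fun _ : R => 0 : R)) ?derive_cst //.
  by apply: filterS nI.
rewrite b3 WE (D1 0 I0) Dc cp -(metricM _ _ (NM Np)) in b2.
by apply/eqP; rewrite -addr_eq0 -b2.
Qed.

(** The sign of kappa c0 thus tells on which side of the section - h points, and so which component
    is the exterior. *)
Lemma mean_curvature_linear p h : (0 < n)%N -> N p -> mean_curvature kappa n N p h ->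
  ell ('D_h j p) = kappa * c0.
Proof.
move=> n0 Np [th hN [e [c [Hc on HH]]]]; have Mp := NM Np.
(* X is normal to N in M; along a curve of N, (j c)'' has products 0 with A and
   - |c'|^2 with j. *)
pose X := A + (- (kappa * c0)) *: j p.
have BX Y : BL Y X = ell Y - kappa * c0 * BL Y (j p).
  by rewrite /X BLC BLD BLZ (BLC A) -ellA (BLC (j p)) mulNr.
have [z tz zE] : exists2 z, tangent M p z & 'D_z j p = X.
  apply: surj => //; rewrite BLC BX ellN // jM //.
  by rewrite mulrAC divff // mul1r subrr.
have orth u : tangent M p u -> BL ('D_u j p) (j p) = 0.
  by move=> tu; rewrite BLC; exact: (M_tangent_orth BLC BLD BLZ oO MO sj jM Mp tu).
have zN x : tangent N p x -> metric kappa p z x = 0.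
  move=> tx; rewrite metricM // zE BLC BX (orth x (tangentNM tx)) mulr0 subr0.
  exact: (ell_tangent ellc oO sj NO ellN Np tx).
have := HH z tz zN; rewrite metricM // zE BX (orth h th) mulr0 subr0.
rewrite (eq_bigr (fun _ => kappa * c0)); last first.
  move=> i _; rewrite inner_covM // zE BX.
  have [-> ->] := curve_acceleration Np (Hc i).
  by rewrite on eqxx /=; ring.
rewrite sumr_const card_ord -[RHS]mulr_natl.
by apply: mulfI; rewrite pnatr_eq0 -lt0n.
Qed.

End MeanCurvature.

(** * Hypersurfaces of hyperbolic space *)

Lemma derive_gt0_right (R : realType) (f : R -> R) : differentiable f (0 : R) -> f 0 = 0 ->
  0 < 'D_1 f (0 : R) -> \forall t \near 0^'+, 0 < f t.
Proof.
move=> df f0 Df.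
have d : derivable f (0 : R) (1 : R) by exact: diff_derivable.
have HH : nbhs (0 : R) [set t | t != 0 -> 0 < t^-1 *: (f (t *: 1 + 0) - f 0)].
  exact: cvgr_gt _ d _ Df.
have /nbhs_ballP [e /= e0 He] := HH.
suff : nbhs (0 : R) [set t | 0 < t -> 0 < f t] by [].
apply/nbhs_ballP; exists e => //= t bt t0; have H := He t bt.
have tn : t != 0 by rewrite gt_eqF.
have := H tn; rewrite f0 subr0 addr0 /GRing.scale /= mulr1.
by rewrite pmulr_rgt0 // invr_gt0.
Qed.

Lemma exterior_point (R : realType) m (U S O : set 'rV[R]_m.+1) (ht : 'rV[R]_m.+1 -> R) p u c :
  open O -> O p -> smooth O ht -> curve_at S p u c -> ht p = 0 -> 0 < 'D_u ht p ->
  (\forall t \near 0^'+, U (c t)) -> exists2 y, U y & 0 < ht y.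
Proof.
move=> oO Op sh Hc h0 Dh HU.
have [c00 _ _ _] := curve_diff Hc.
have [d E] := curve_deriv oO sh Op Hc.
have H : \forall t \near (0 : R)^'+, 0 < ht (c t).
  apply: (derive_gt0_right d); first by rewrite c00.
  by rewrite E.
near (0 : R)^'+ => t; exists (c t); near: t; [exact: HU|exact: H].
Unshelve. all: by end_near. Qed.

(* After the isometry g, the hypersurface is a section ell = c of the hyperboloid, its exterior is
   ell > c, and pi maps the part ell > 0 of the hyperboloid to the cone, with inverse lft. *)
Section HyperbolicModel.
Context {R : realType} {n : nat}.
Local Notation E := 'rV[R]_n.+1.
Local Notation L := 'rV[R]_n.+2.
Local Notation V := 'rV[R]_n.+1.
Variables (q : R) (f g : E -> E).
Hypothesis q0 : 0 < q.
Let kappa := - q ^+ 2.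
Local Notation M := (@space_form R n kappa).
Hypotheses (sf : smooth_on M f) (sg : smooth_on M g).
Hypothesis fM : forall p, M p -> M (f p) /\ g (f p) = p.
Hypothesis gM : forall p, M p -> M (g p) /\ f (g p) = p.
Hypothesis isoM : forall p u w c d, curve_at M p u c -> curve_at M p w d ->
  metric kappa (f p) (derive1 (f \o c) 0) (derive1 (f \o d) 0) = metric kappa p u w.

Variables (k c : R) (ell : {linear L -> R}) (pi : {linear L -> V}) (A : L) (lft : V -> L).
(** On the hyperboloid Q(pi X) = ell(X)^2 - k, so the condition Q + k > 0 allows ell to be recovered
    as a positive square root. *)
Let G := [set z : V | cone k z /\ 0 < Qf k z z + k].
Hypothesis hk : [\/ k = 1, k = 0 | k = -1].
Hypotheses (c_gt0 : 0 < c) (ck_gt0 : 0 < c ^+ 2 - k) (n_gt0 : (0 < n)%N).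
Hypothesis ellA : forall X, ell X = Bm X A.
Hypothesis Qpi : forall X, Qf k (pi X) (pi X) = ell X ^+ 2 + k * Bm X X.
Hypothesis Bpi : forall X Z, ell X = 0 -> ell Z = 0 -> Bm X Z = Bf k (pi X) (pi Z).
Hypothesis slft : smooth_on G lft.
Hypothesis lftG : forall z, G z -> [/\ upper_sheet (lft z), pi (lft z) = z & 0 < ell (lft z)].
Hypothesis lft_pi : forall X, upper_sheet X -> 0 < ell X -> G (pi X) -> lft (pi X) = X.
Hypothesis pi_gt0 : forall X, upper_sheet X -> 0 < ell X -> k <= 0 -> 0 < pi X ord0 ord0.

Local Notation j := (hyp_embed g).
Local Notation i := (@hyp_unembed R n f).
Let N := [set x | M x /\ ell (j x) = c].
Let O := [set x | M x /\ 0 < ell (j x)].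
Let W := [set x | M x /\ c < ell (j x)].

Let kn : kappa < 0. Proof. by rewrite oppr_lt0 exprn_gt0. Qed.
Let k0 : kappa != 0. Proof. by rewrite lt_eqF. Qed.
Let qn : q != 0. Proof. by rewrite gt_eqF. Qed.
Let oM : open M. Proof. by rewrite (space_form_neg q0); exact: open_halfspace. Qed.
Let sj : smooth M j := smooth_hyp_embed q0 sg gM.
Let ellc : continuous ell. Proof. exact: linear_scalar_continuous. Qed.
Let ellZ a X : ell (a *: X) = a * ell X. Proof. exact: linearZ. Qed.
Let piZ a X : pi (a *: X) = a *: pi X. Proof. exact: linearZ. Qed.
Let piD X Y : pi (X + Y) = pi X + pi Y. Proof. exact: linearD. Qed.
Let pi' : {linear L -> V} := q^-1 \*: pi.
Let pi'E X : pi' X = q^-1 *: pi X. Proof. by []. Qed.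
Let pic : continuous pi'. Proof. exact: linear_row_continuous. Qed.
Let P x := pi' (j x).
(** On N, Q(pi X) = c^2 - k; the division by q reflects the factor 1 / q^2 in [hyp_form]. *)
Let rho0 := Num.sqrt (c ^+ 2 - k) / q.
Let rho0_gt0 : 0 < rho0. Proof. by rewrite divr_gt0 // sqrtr_gt0. Qed.
Let rho0_sq : rho0 ^+ 2 * q ^+ 2 = c ^+ 2 - k.
Proof. by rewrite -exprMn /rho0 divfK // sqr_sqrtr // ltW. Qed.
Let vth (y : V) := i (lft ((q * rho0) *: y)).
Let P' (z : V) := i (lft (q *: z)).
Let C' := [set z : V | cone k z /\ rho0 < rho k z].

Let smooth_ell : smooth M (fun x => ell (j x)).
Proof. by move=> a; exact: Ck_clin. Qed.
Let sP : smooth M P. Proof. by move=> a; exact: Ck_clin. Qed.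

Let oO : open O.
Proof.
have -> : O = M `&` (fun x => ell (j x)) @^-1` [set t | 0 < t].
  by apply/seteqP; split=> x [].
apply: open_preimage; [exact: oM|exact: open_gt|].
by move=> x; exact: smooth_cont smooth_ell.
Qed.
Let OM : O `<=` M. Proof. by move=> x []. Qed.
Let NM : N `<=` M. Proof. by move=> x []. Qed.
Let NO : N `<=` O. Proof. by move=> x [Mx lx]; split=> //; rewrite lx. Qed.
Let sjO : smooth O j. Proof. by move=> a; apply: Ck_sub (sj a). Qed.
Let sPO : smooth O P. Proof. by move=> a; apply: Ck_sub (sP a). Qed.

Let sheetQ X : upper_sheet X -> Qf k (pi X) (pi X) = ell X ^+ 2 - k.
Proof. by move=> [BX _]; rewrite Qpi BX mulrN1. Qed.

Let piG X : upper_sheet X -> 0 < ell X -> 0 < ell X ^+ 2 - k -> G (pi X).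
Proof.
move=> SX lX h; have E := sheetQ SX; split; last by rewrite E subrK exprn_gt0.
by split; [rewrite E|exact: pi_gt0].
Qed.

Let scaleG a z : 0 < a -> cone k z -> 0 < a ^+ 2 * Qf k z z + k -> G (a *: z).
Proof. by move=> a0 Cz h; split; [exact: coneZ|rewrite QfZl QfZr mulrA -expr2]. Qed.

Let ell_lft z : G z -> ell (lft z) ^+ 2 = Qf k z z + k.
Proof. by move=> Gz; have [SX pX lX] := lftG Gz; have := sheetQ SX; rewrite pX => ->;
  rewrite subrK. Qed.

Let G_csph y : csph k y -> G ((q * rho0) *: y).
Proof.
move=> Sy; have [Qy _] := (csphP _ _).1 Sy; apply: scaleG; first by rewrite mulr_gt0.
  by have [] := Sy.
by rewrite Qy mulr1 exprMn mulrC rho0_sq subrK exprn_gt0.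
Qed.

Let C'Q z : C' z -> c ^+ 2 < q ^+ 2 * Qf k z z + k.
Proof.
move=> [Cz hz]; rewrite -(rho_sq Cz) -ltrBlDr -rho0_sq mulrC ltr_pM2l ?exprn_gt0 //.
by rewrite ltr_pXn2r // ?nnegrE ltW // rho_gt0.
Qed.

Let G_C' z : C' z -> G (q *: z).
Proof.
move=> C'z; have [Cz _] := C'z; apply: scaleG => //.
by apply: lt_trans (C'Q C'z); rewrite exprn_gt0.
Qed.

Let svth : smooth_on (csph k) vth.
Proof.
apply: (smooth_on_comp (B := @upper_sheet R n) (f := fun y => lft ((q * rho0) *: y)) (g := i)).
- by move=> y /G_csph /lftG [].
- apply: (smooth_on_comp (B := G) (f := fun y : V => (q * rho0) *: y) (g := lft)) => //.
  apply: (smooth_on_sub (B := setT)) => //; apply: smooth_smooth_on; first exact: openT.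
  by move=> a; have oT := @openT V; apply: Ck_scale => //; [exact: Ck_cst|exact: Ck_id].
- exact: (hyp_unembed_smooth q0 sf).
Qed.

Let sP' : smooth_on C' P'.
Proof.
apply: (smooth_on_comp (B := @upper_sheet R n) (f := fun y => lft (q *: y)) (g := i)).
- by move=> y /G_C' /lftG [].
- apply: (smooth_on_comp (B := G) (f := fun y : V => q *: y) (g := lft)) => //.
  apply: (smooth_on_sub (B := setT)) => //; apply: smooth_smooth_on; first exact: openT.
  by move=> a; have oT := @openT V; apply: Ck_scale => //; [exact: Ck_cst|exact: Ck_id].
- exact: (hyp_unembed_smooth q0 sf).
Qed.

Let sheet_j p : M p -> upper_sheet (j p). Proof. by move=> Mp; have [] := hyp_embedK q0 gM Mp. Qed.
Let i_j p : M p -> i (j p) = p. Proof. by move=> Mp; have [] := hyp_embedK q0 gM Mp. Qed.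

Let N_th p : N p -> csph k (rho0^-1 *: P p) /\ vth (rho0^-1 *: P p) = p.
Proof.
move=> [Mp lp]; have SX := sheet_j Mp; have lX : 0 < ell (j p) by rewrite lp.
have rn : rho0 != 0 by rewrite gt_eqF.
split.
  apply/csphP; split=> [|kl].
    rewrite /P pi'E scalerA QfZl QfZr (sheetQ SX) lp -rho0_sq.
    by field; rewrite rn qn.
  rewrite /P pi'E scalerA mxE mulr_gt0 //; first by rewrite -invfM invr_gt0 mulr_gt0.
  exact: pi_gt0.
rewrite /vth /P pi'E !scalerA.
have -> : q * rho0 * rho0^-1 * q^-1 = 1 by field; rewrite rn qn.
rewrite scale1r lft_pi // ?i_j //.
by apply: piG => //; rewrite lp.
Qed.

Let S_vth y : csph k y -> N (vth y) /\ P (vth y) = rho0 *: y.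
Proof.
move=> Sy; have Gy := G_csph Sy; have [SX pX lX] := lftG Gy; have [Mi ji] := hyp_unembedK q0 fM SX.
have [Qy _] := (csphP _ _).1 Sy.
split; last by rewrite /P /vth ji pi'E pX scalerA mulrA mulVf // mul1r.
split=> //; rewrite /vth ji; apply/eqP; rewrite -(eqrXn2 (n := 2)) ?ltW //.
by rewrite ell_lft // QfZl QfZr Qy mulr1 -expr2 exprMn mulrC rho0_sq subrK.
Qed.

Let WE : W = [set x | [/\ O x, cone k (P x) & rho0 < rho k (P x)]].
Proof.
have qi : 0 < q^-1 by rewrite invr_gt0.
apply/seteqP; split=> x.
  move=> [Mx cx]; have SX := sheet_j Mx; have lX := lt_trans c_gt0 cx.
  have l2 : c ^+ 2 < ell (j x) ^+ 2 by rewrite ltr_pXn2r // nnegrE ltW.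
  have [Cp _] := piG SX lX (lt_trans ck_gt0 (ltr_leD l2 (lexx (- k)))).
  have CP : cone k (P x) by rewrite /P pi'E; exact: coneZ.
  split=> //; rewrite -(ltr_pXn2r (n := 2)) // ?nnegrE ?ltW ?rho_gt0 //.
  rewrite rho_sq // /P pi'E QfZl QfZr (sheetQ SX) mulrA -invfM -expr2 mulrC.
  by rewrite ltr_pdivlMr ?exprn_gt0 // rho0_sq ltrD2r.
move=> [[Mx lx] CP rp]; split=> //; have SX := sheet_j Mx.
rewrite -(ltr_pXn2r (n := 2)) // ?nnegrE ?ltW //.
have := C'Q (conj CP rp); rewrite /P pi'E QfZl QfZr (sheetQ SX).
by have -> : q ^+ 2 * (q^-1 * (q^-1 * (ell (j x) ^+ 2 - k))) + k = ell (j x) ^+ 2 by field.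
Qed.

Let P'P x : [/\ O x, cone k (P x) & rho0 < rho k (P x)] -> P' (P x) = x.
Proof.
move=> [[Mx lx] CP rp]; have SX := sheet_j Mx.
have := G_C' (conj CP rp); rewrite /P' /P pi'E scalerA divff // scale1r => Gx.
by rewrite lft_pi // i_j.
Qed.

Let PP' z : C' z -> [/\ O (P' z), cone k (P (P' z)) & rho0 < rho k (P (P' z))] /\ P (P' z) = z.
Proof.
move=> C'z; have [Cz rz] := C'z; have Gz := G_C' C'z; have [SX pX lX] := lftG Gz.
have [Mi ji] := hyp_unembedK q0 fM SX.
have E : P (P' z) = z by rewrite /P /P' ji pi'E pX scalerA mulVf // scale1r.
by split=> //; rewrite E; split=> //; split=> //; rewrite ji.
Qed.

Let inner_covN p x y a z : M p ->
  inner_cov kappa p x y a z = hyp_form q ('D_x (fun s => 'D_y j s) p + 'D_a j p) ('D_z j p).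
Proof. exact: (hyp_inner_covE q0 sg gM isoM). Qed.
Let metricN p x z : M p -> metric kappa p x z = hyp_form q ('D_x j p) ('D_z j p).
Proof. exact: (hyp_metricE q0 sg gM isoM). Qed.
Let Bell X Z : ell X = 0 -> ell Z = 0 -> hyp_form q X Z = Bf k (pi' X) (pi' Z).
Proof.
move=> lX lZ; rewrite /hyp_form (Bpi lX lZ) !pi'E BfZl BfZr.
by rewrite mulrA -invfM -expr2 mulrC.
Qed.
Let ellN p : N p -> ell (j p) = c. Proof. by case. Qed.

Let metric_P p x z : N p -> tangent N p x -> tangent N p z ->
  metric kappa p x z = Bf k ('D_x P p) ('D_z P p).
Proof.
apply: (linear_metric_P ellc pic oO sjO NO _ Bell ellN) => s x' z' Ns _ _.
by apply: metricN; exact: NM.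
Qed.

Let cov_P v p x z d : unit_vector_field kappa N v -> N p ->
  curve_at N p x d -> tangent N p z ->
  inner_cov kappa p x (v p) (derive1 (v \o d) 0) z =
  Bf k ('D_1 (fun e : R => 'D_(v (d e)) P (d e)) 0) ('D_z P p).
Proof.
apply: (linear_cov_P ellc pic oO sjO NO _ Bell ellN) => s x' y' a z' Ns _ _ _.
by apply: inner_covN; exact: NM.
Qed.

Let metric_gt0 p x : N p -> x != 0 -> 0 < metric kappa p x x.
Proof.
move=> [Mp _] x0; rewrite (metric_neg q0) divr_gt0 ?dot_gt0 // mulr_gt0 ?exprn_gt0 //.
by move: Mp; rewrite (space_form_neg q0).
Qed.

Let ray_P p u : N p -> tangent N p u -> metric kappa p u u = 1 ->
  ray kappa p u = [set x | exists2 r, 0 < r &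
    x = P' ((rho0 * Num.sqrt (1 + q ^+ 2 * r ^+ 2)) *: (rho0^-1 *: P p) + r *: 'D_u P p)].
Proof.
move=> Np tu mu; have [Mp lp] := Np.
have tM := tangent_neg q0 u Mp.
have lu := ell_tangent ellc oO sjO NO ellN Np tu.
have Du : 'D_u P p = q^-1 *: pi ('D_u j p) by rewrite (proj2 (derive_clin_comp sjO u pic (NO Np))).
have key t : 0 < t -> P' ((rho0 * Num.sqrt (1 + q ^+ 2 * snh q t ^+ 2)) *: (rho0^-1 *: P p) +
    snh q t *: 'D_u P p) = i (lin_geod j (csh q) (snh q) p u t).
  move=> t0; rewrite -csh_snh_sq // sqrtr_sqr (gtr0_norm (csh_gt0 q t)) scalerA mulrAC divff
    ?gt_eqF // mul1r.
  have SG := hyp_geodesic_in q0 sg gM isoM t Mp tM mu.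
  set X := lin_geod _ _ _ _ _ _ in SG *.
  have lX : ell X = csh q t * c by rewrite /X /lin_geod linearD (ellZ _ (j p)) (ellZ _ ('D_u j p))
    lu lp mulr0 addr0.
  have csh1 : 1 <= csh q t ^+ 2 by rewrite csh_snh_sq // lerDl mulr_ge0 // sqr_ge0.
  have l2 : 0 < ell X ^+ 2 - k.
    apply: lt_le_trans ck_gt0 _; rewrite lerD2r lX exprMn ler_peMl // sqr_ge0 //.
  have lX0 : 0 < ell X by rewrite lX mulr_gt0 // csh_gt0.
  have E : q *: (csh q t *: P p + snh q t *: 'D_u P p) = pi X.
    rewrite Du /P pi'E /X /lin_geod piD (piZ _ (j p)) (piZ _ ('D_u j p)) scalerDr !scalerA.
    by congr (_ *: _ + _ *: _); field.
  by rewrite /P' E lft_pi //; exact: piG.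
rewrite (hyp_ray q0 sf sg fM gM isoM Mp tM mu).
apply/seteqP; split=> x.
  by move=> [t t0 ->]; exists (snh q t); [exact: snh_gt0|rewrite key].
by move=> [r r0 ->]; have [t t0 <-] := snh_surj q0 r0; exists t => //; rewrite key.
Qed.

Lemma hyperbolic_bifoliates v : unit_vector_field kappa N v ->
  bifoliates kappa n N W v <->
  forall p, N p -> forall lam, nabla_perp_eigenvalue kappa N v p lam -> lam ^+ 2 + kappa <= 0.
Proof.
have ck' : 0 < rho0 ^+ 2 * q ^+ 2 + k by rewrite rho0_sq subrK exprn_gt0.
rewrite WE; exact: (nonpositive_bifoliates hk oO sPO NO rho0_gt0 ck' svth N_th S_vth
  sP' P'P PP' ray_P metric_P cov_P metric_gt0).
Qed.

Lemma hyperbolic_exterior U : exterior kappa n N U -> U = W.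
Proof.
move=> [[z Az UE] HU].
pose y0 : V := delta_mx ord0 ord0.
have Sy : csph k y0.
  apply/csphP; split; last by rewrite mxE.
  by rewrite /Qf mxE /tdot big1 ?mulr0 ?addr0 ?mulr1 // => a _; rewrite mxE mul0r.
have [Np _] := S_vth Sy; set p := vth y0 in Np; clearbody p.
have Mp := NM Np.
have [h [d [Hh Hd Ud]]] := HU p Np.
pose ht x := ell (j x) - c.
have sht : smooth M ht by move=> a; apply: Ck_sub_fun => //; exact: Ck_cst.
have ellA' X : ell X = hyp_form q X (q ^+ 2 *: A).
  by rewrite /hyp_form BmC BmZ BmC mulrC mulKf ?expf_neq0 // ellA.
have Dh := mean_curvature_linear (@hyp_formC R n q) (@hyp_formD R n q) (@hyp_formZ R n q) k0 oM
  (fun x Hx => Hx) sj NM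
  (hyp_embed_sq q0 gM) inner_covN metricN ellA' ellN (hyp_tangent_surj q0 sf sg fM gM) n_gt0 Np Hh.
(* Moving against the mean curvature vector raises ell, since kappa < 0 < c. *)
have Dht : 'D_(- h) ht p = - (kappa * c).
  have dl := proj1 (derive_clin_comp sj h ellc Mp).
  have [_ E1] := diff_add (- h) dl (differentiable_cst (- c) p).
  rewrite [LHS]E1 derive_cst addr0 (proj2 (derive_clin_comp sj (- h) ellc Mp)) -Dh.
  have dj := smooth_diff sj Mp.
  have -> : 'D_(- h) j p = - 'D_h j p by rewrite !deriveE // linearN.
  exact: linearN.
have htp : ht p = 0 by rewrite /ht ellN // subrr.
have [|y Uy hy] := exterior_point (U := U) oM Mp sht Hd htp _ Ud.
  by rewrite Dht oppr_gt0 pmulr_llt0.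
apply: (exterior_component (ht := ht) Az UE _ _ _ _ Uy hy).
- have -> : W = P' @` C'.
    rewrite WE; apply/seteqP; split=> x; last by move=> [s Cs <-]; have [] := PP' Cs.
    by move=> Hx; exists (P x); [by have [] := Hx|exact: P'P].
  exact: exterior_connected.
- apply/seteqP; split=> x.
    move=> [Mx cx]; split; last by rewrite subr_gt0.
    split=> //; first by move=> [_ E]; move: cx; rewrite E ltxx.
    by rewrite (lt_gtF kn).
  by move=> [[Mx _ _]]; rewrite subr_gt0.
- by move=> x [Mx _ _]; exact: smooth_cont sht Mx.
- by move=> x [Mx Nx _]; apply/eqP => /eqP; rewrite subr_eq0 => /eqP E; apply: Nx.
Qed.

Lemma hyperbolic_case N' U v : N' = N ->
  exterior kappa n N' U -> unit_vector_field kappa N' v ->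
  bifoliates kappa n N' U v <->
  forall p, N' p -> forall lam, nabla_perp_eigenvalue kappa N' v p lam -> lam ^+ 2 + kappa <= 0.
Proof. by move=> -> /hyperbolic_exterior ->; exact: hyperbolic_bifoliates. Qed.

End HyperbolicModel.

(** * The three kinds of sections of the hyperboloid *)

Section LightCone.
Context {R : realType} {n : nat}.
Local Notation L := 'rV[R]_n.+2.
Local Notation V := 'rV[R]_n.+1.

Definition vcons (a : R) (t : 'I_n -> R) : V := \row_i oapp t a (unlift ord0 i).
(** The vector with light-cone coordinates X_- = a and X_+ = b and remaining coordinates t. *)
Definition lcons (a b : R) (t : 'I_n -> R) : L := \row_i oapp (fun i' => vcons b t ord0 i') a
  (unlift ord0 i).

Lemma vcons0 a t : vcons a t ord0 ord0 = a. Proof. by rewrite mxE unlift_none. Qed.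
Lemma vconsl a t i : vcons a t ord0 (lift ord0 i) = t i. Proof. by rewrite mxE liftK. Qed.
Lemma lcons0 a b t : lcons a b t ord0 ord0 = a. Proof. by rewrite mxE unlift_none. Qed.
Lemma tl_lcons a b t : tl (lcons a b t) = vcons b t.
Proof. by apply/rowP => i; rewrite !mxE liftK /= mxE. Qed.

Lemma vcons_linear a x y t s :
  a *: vcons x t + vcons y s = vcons (a * x + y) (fun i => a * t i + s i).
Proof. by apply/rowP => i; rewrite !mxE; case: unlift. Qed.

Lemma lcons_linear a x y x' y' t s : a *: lcons x x' t + lcons y y' s =
  lcons (a * x + y) (a * x' + y') (fun i => a * t i + s i).
Proof. by apply/rowP => i; rewrite !mxE; case: unlift => //= i'; rewrite -vcons_linear !mxE. Qed.

Lemma vconsE (z : V) : z = vcons (z ord0 ord0) (fun i => z ord0 (lift ord0 i)).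
Proof.
by apply/rowP => i; case: (unliftP ord0 i) => [i' ->|->]; rewrite mxE ?liftK ?unlift_none.
Qed.
Lemma lconsE (X : L) : X = lcons (X ord0 ord0) (tl X ord0 ord0) (fun i => tl X ord0 (lift ord0 i)).
Proof.
apply/rowP => i; case: (unliftP ord0 i) => [i' ->|->]; last by rewrite lcons0.
by rewrite [RHS]mxE liftK /= -vconsE mxE.
Qed.

Lemma tdot_vcons a b t s : tdot (vcons a t) (vcons b s) = \sum_i t i * s i.
Proof. by apply: eq_bigr => i _; rewrite !vconsl. Qed.
Lemma tdotE (x y : V) : tdot x y = \sum_i x ord0 (lift ord0 i) * y ord0 (lift ord0 i).
Proof. by []. Qed.

Lemma lcons_sheet a b t : upper_sheet (lcons a b t) <-> \sum_i t i * t i + 1 = a * b /\ 0 < b.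
Proof.
rewrite /upper_sheet /= /Bm tl_lcons vcons0 lcons0 tdot_vcons (mulrC b).
have -> : (a * b + a * b) / 2 = a * b by field.
by split=> -[E b0]; split=> //; lra.
Qed.

Lemma sheet_prod (X : L) : upper_sheet X ->
  X ord0 ord0 * tl X ord0 ord0 = tdot (tl X) (tl X) + 1 /\ 0 < tl X ord0 ord0.
Proof. by rewrite {1}[X]lconsE => /lcons_sheet [E X0]; split=> //; rewrite -E. Qed.

Lemma Ck_vcons (T : normedModType R) k (O : set T) (a : T -> R) (t : 'I_n -> T -> R) : open O ->
  Ck k O a -> (forall i, Ck k O (t i)) -> Ck k O (fun z => vcons (a z) (fun i => t i z)).
Proof. by move=> oO Ha Ht; apply: Ck_row => // i; case: unlift => [i'|] /=. Qed.

Lemma Ck_lcons (T : normedModType R) k (O : set T) (a b : T -> R) (t : 'I_n -> T -> R) : open O ->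
  Ck k O a -> Ck k O b -> (forall i, Ck k O (t i)) ->
  Ck k O (fun z => lcons (a z) (b z) (fun i => t i z)).
Proof.
move=> oO Ha Hb Ht; apply: Ck_row => // i; case: unlift => [i'|] //=.
by apply: Ck_coord => //; exact: Ck_vcons.
Qed.

Lemma open_coneQ (k : R) : open [set z : V | cone k z /\ 0 < Qf k z z + k].
Proof.
have oT := @openT V.
have -> : [set z : V | cone k z /\ 0 < Qf k z z + k] =
    cone k `&` (fun z => Qf k z z + k) @^-1` [set t | 0 < t] by [].
apply: open_preimage; [exact: open_cone|exact: open_gt|] => x _.
apply: (smooth_cont (O := setT)) => // p; apply: Ck_add => //; last exact: Ck_cst.
by apply: smooth_Qf => //; exact: Ck_id.
Qed.

Lemma lift_smooth (k : R) (lft : V -> L) :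
  (forall p, Ck p [set z : V | cone k z /\ 0 < Qf k z z + k] lft) ->
  smooth_on [set z : V | cone k z /\ 0 < Qf k z z + k] lft.
Proof. by move=> H; apply: smooth_smooth_on => //; exact: open_coneQ. Qed.

End LightCone.

Definition isometry_pair (R : realType) n (kappa : R) (f g : 'rV[R]_n.+1 -> 'rV[R]_n.+1) :=
  [/\ smooth_on (space_form kappa) f, smooth_on (space_form kappa) g,
      forall p, space_form kappa p -> space_form kappa (f p) /\ g (f p) = p,
      forall p, space_form kappa p -> space_form kappa (g p) /\ f (g p) = p &
      forall p u w c d, curve_at (space_form kappa) p u c -> curve_at (space_form kappa) p w d ->
        metric kappa (f p) (derive1 (f \o c) 0) (derive1 (f \o d) 0) = metric kappa p u w].

Section Instances.
Context {R : realType} {n : nat}.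
Local Notation E := 'rV[R]_n.+1.
Local Notation L := 'rV[R]_n.+2.
Local Notation V := 'rV[R]_n.+1.
Variables (q : R) (f g : E -> E).
Hypotheses (q0 : 0 < q) (n_gt0 : (0 < n)%N).
Let kappa := - q ^+ 2.
Local Notation M := (@space_form R n kappa).
Hypothesis fg : isometry_pair kappa f g.

Section Horosphere.
(** X_+ of [iota] x is 1 / x_0. The normal A of this section is light-like, so k = 0; the lift finds
    X_- from X_- X_+ = |t|^2 + 1. *)
Definition hor_ell (X : L) : R := tl X ord0 ord0.
Lemma hor_ell_linear : linear hor_ell. Proof. by move=> a X Y; rewrite /hor_ell !mxE. Qed.
HB.instance Definition _ := GRing.isLinear.Build R L R _ hor_ell hor_ell_linear.
Definition hor_lift (z : V) : L :=
  lcons ((tdot z z + 1) / z ord0 ord0) (z ord0 ord0) (fun i => z ord0 (lift ord0 i)).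

Lemma horosphere_bifoliates N U v : N = [set x | M x /\ tl (iota (g x)) ord0 ord0 = 1] ->
  exterior kappa n N U -> unit_vector_field kappa N v ->
  bifoliates kappa n N U v <->
  forall p, N p -> forall lam, nabla_perp_eigenvalue kappa N v p lam -> lam ^+ 2 + kappa <= 0.
Proof.
have [sf sg fM gM iso] := fg.
pose ell : {linear L -> R} := hor_ell; pose pi : {linear L -> V} := @tl R n.
have ellE X : ell X = tl X ord0 ord0 by [].
have piE X : pi X = tl X by [].
have H0 (z : V) : cone 0 z -> 0 < z ord0 ord0 by move=> [_]; apply.
apply: (hyperbolic_case (k := 0) (c := 1) (ell := ell) (pi := pi) (A := lcons (-2) 0 (fun=> 0))
  (lft := hor_lift) q0 sf sg fM gM iso _ ltr01 _ n_gt0).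
- exact: Or32.
- by rewrite subr0 expr1n.
- move=> X; have tA : tdot (tl X) (tl (lcons (-2) 0 (fun=> 0))) = 0.
    by apply: big1 => i _; rewrite tl_lcons vconsl mulr0.
  by rewrite ellE /Bm tA lcons0 tl_lcons vcons0; field.
- by move=> X; rewrite /Qf piE ellE; ring.
- by move=> X Z; rewrite !ellE !piE /Bm /Bf => -> ->; ring.
- apply: lift_smooth => p; have oG := @open_coneQ R n 0.
  have Cz i : Ck p [set z : V | cone 0 z /\ 0 < Qf 0 z z + 0] (fun z => z ord0 i).
    by apply: Ck_coord => //; exact: Ck_id.
  apply: Ck_lcons => //; apply: Ck_mulr => //.
    apply: Ck_add => //; last exact: Ck_cst.
    have -> : (fun z : V => tdot z z) = (fun z => Qf 1 z z - z ord0 ord0 * z ord0 ord0).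
      by apply/funext => z; rewrite /Qf; ring.
    by apply: Ck_sub_fun => //; [apply: smooth_Qf => //; exact: Ck_id|exact: Ck_mulr].
  by apply: Ck_inv => // z [/H0 z0 _]; rewrite gt_eqF.
- move=> z [/H0 z0 _]; rewrite ellE piE tl_lcons vcons0 -vconsE; split=> //.
  by apply/lcons_sheet; rewrite -tdotE divfK // gt_eqF.
- move=> X /sheet_prod [E1 X0] _ _; rewrite piE [RHS]lconsE /hor_lift -E1 mulfK // gt_eqF //.
- by move=> X [].
Qed.

End Horosphere.
Section Sphere.
(** Half of X_+ + X_- is the time coordinate. Its normal has square -1, so k = 1; the lift restores
    the time as the positive square root of Q + 1. *)
Definition sph_ell (X : L) : R := (tl X ord0 ord0 + X ord0 ord0) / 2.
Lemma sph_ell_linear : linear sph_ell.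
Proof. by move=> a X Y; rewrite /sph_ell !mxE /GRing.scale /=; ring. Qed.
HB.instance Definition _ := GRing.isLinear.Build R L R _ sph_ell sph_ell_linear.
Definition sph_pi (X : L) : V := vcons ((X ord0 ord0 - tl X ord0 ord0) / 2) (fun i => tl X ord0
  (lift ord0 i)).
Lemma sph_pi_linear : linear sph_pi.
Proof.
move=> a X Y; rewrite /sph_pi vcons_linear; congr vcons; first by rewrite !mxE; ring.
by apply/funext => i; rewrite !mxE.
Qed.
HB.instance Definition _ := GRing.isLinear.Build R L V _ sph_pi sph_pi_linear.
Definition sph_lift (z : V) : L := let s := Num.sqrt (Qf 1 z z + 1) in
  lcons (s + z ord0 ord0) (s - z ord0 ord0) (fun i => z ord0 (lift ord0 i)).

Lemma hyperbolic_sphere_bifoliates c N U v : 1 < c ->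
  N = [set x | M x /\ sph_ell (iota (g x)) = c] ->
  exterior kappa n N U -> unit_vector_field kappa N v ->
  bifoliates kappa n N U v <->
  forall p, N p -> forall lam, nabla_perp_eigenvalue kappa N v p lam -> lam ^+ 2 + kappa <= 0.
Proof.
move=> c1; have [sf sg fM gM iso] := fg.
pose ell : {linear L -> R} := sph_ell; pose pi : {linear L -> V} := sph_pi.
have ellE X : ell X = (tl X ord0 ord0 + X ord0 ord0) / 2 by [].
have piE X : pi X = vcons ((X ord0 ord0 - tl X ord0 ord0) / 2) (fun i => tl X ord0 (lift ord0 i)) by [].
have tpi X Z : tdot (pi X) (pi Z) = tdot (tl X) (tl Z) by rewrite !piE tdot_vcons.
have pi0 X : pi X ord0 ord0 = (X ord0 ord0 - tl X ord0 ord0) / 2 by rewrite piE vcons0.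
have Q0 (z : V) : 0 < Qf 1 z z + 1.
  by rewrite /Qf mul1r ltr_wpDl // addr_ge0 ?tdot_ge0 // -expr2 sqr_ge0.
have Qpi X : Qf 1 (pi X) (pi X) = ell X ^+ 2 + 1 * Bm X X.
  by rewrite /Qf tpi !pi0 ellE /Bm; field.
apply: (hyperbolic_case (k := 1) (c := c) (ell := ell) (pi := pi) (A := lcons (-1) (-1) (fun=> 0))
  (lft := sph_lift) q0 sf sg fM gM iso _ _ _ n_gt0).
- exact: Or31.
- exact: lt_trans ltr01 c1.
- by rewrite subr_gt0 exprn_egt1.
- move=> X; have tA : tdot (tl X) (tl (lcons (-1) (-1) (fun=> 0))) = 0.
    by apply: big1 => i _; rewrite tl_lcons vconsl mulr0.
  by rewrite ellE /Bm tA lcons0 tl_lcons vcons0; field.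
- exact: Qpi.
- move=> X Z; rewrite !ellE => lX lZ; rewrite /Bf tpi !pi0 /Bm.
  have -> : X ord0 ord0 = - tl X ord0 ord0 by lra.
  have -> : Z ord0 ord0 = - tl Z ord0 ord0 by lra.
  by field.
- apply: lift_smooth => p; have oG := @open_coneQ R n 1.
  have Cz i : Ck p [set z : V | cone 1 z /\ 0 < Qf 1 z z + 1] (fun z => z ord0 i).
    by apply: Ck_coord => //; exact: Ck_id.
  have Cs : Ck p [set z : V | cone 1 z /\ 0 < Qf 1 z z + 1] (fun z => Num.sqrt (Qf 1 z z + 1)).
    apply: Ck_sqrt => //; apply: Ck_add => //; last exact: Ck_cst.
    by apply: smooth_Qf => //; exact: Ck_id.
  by apply: Ck_lcons => //; [exact: Ck_add|exact: Ck_sub_fun].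
- move=> z _; rewrite /sph_lift; set s := Num.sqrt _.
  have s0 : 0 < s by rewrite sqrtr_gt0.
  have s2 : s ^+ 2 = Qf 1 z z + 1 by rewrite sqr_sqrtr // ltW.
  have Qz : Qf 1 z z = z ord0 ord0 ^+ 2 + tdot z z by rewrite /Qf; ring.
  have tz := tdot_ge0 z.
  split.
  + apply/lcons_sheet; rewrite -tdotE; split; first by rewrite Qz in s2; lra.
    have h : z ord0 ord0 ^+ 2 < s ^+ 2 by rewrite s2 Qz; lra.
    by rewrite subr_gt0 ltNge; apply/negP => h2; move: h;
      rewrite ltNge ler_pXn2r ?nnegrE ?h2 ?(ltW s0) // (le_trans (ltW s0)).
  + rewrite piE tl_lcons vcons0 lcons0 [RHS]vconsE; congr vcons; first by field.
    by apply/funext => i; rewrite vconsl.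
  + by rewrite ellE tl_lcons vcons0 lcons0; have -> : (s - z ord0 ord0 + (s + z ord0 ord0)) / 2 = s
    by field.
- move=> X SX lX _; have [BX _] := SX.
  have sE : Num.sqrt (Qf 1 (pi X) (pi X) + 1) = ell X.
    by rewrite Qpi BX mulrN1 subrK sqrtr_sqr gtr0_norm.
  rewrite /sph_lift sE pi0 ellE [RHS]lconsE; congr lcons; try by field.
  by apply/funext => i; rewrite piE vconsl.
- by move=> X _ _; rewrite ler10.
Qed.

End Sphere.
End Instances.

Section Hyperplane.
Context {R : realType} {n : nat}.
Local Notation E := 'rV[R]_n.+2.
Local Notation L := 'rV[R]_n.+3.
Local Notation V := 'rV[R]_n.+2.
Variables (q : R) (f g : E -> E).
Hypotheses (q0 : 0 < q).
Let kappa := - q ^+ 2.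
Local Notation M := (@space_form R n.+1 kappa).
Hypothesis fg : isometry_pair kappa f g.

(** On [iota] x this is x_1 / x_0. Its normal has square 1, so k = -1; [hyp_pi] drops this
    coordinate and puts the time first, and the lift restores it as a positive square root. *)
Definition hyp_ell (X : L) : R := tl (tl X) ord0 ord0.
Lemma hyp_ell_linear : linear hyp_ell. Proof. by move=> a X Y; rewrite /hyp_ell !mxE. Qed.
HB.instance Definition _ := GRing.isLinear.Build R L R _ hyp_ell hyp_ell_linear.
Definition hyp_pi (X : L) : V := lcons ((X ord0 ord0 + tl X ord0 ord0) / 2)
  ((X ord0 ord0 - tl X ord0 ord0) / 2) (fun i => tl (tl X) ord0 (lift ord0 i)).
Lemma hyp_pi_linear : linear hyp_pi.
Proof.
move=> a X Y; rewrite /hyp_pi lcons_linear; congr lcons; try by rewrite !mxE; ring.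
by apply/funext => i; rewrite !mxE.
Qed.
HB.instance Definition _ := GRing.isLinear.Build R L V _ hyp_pi hyp_pi_linear.
Definition hyp_lift (z : V) : L := lcons (z ord0 ord0 + tl z ord0 ord0) (z ord0 ord0 - tl z ord0 ord0)
  (fun i => vcons (Num.sqrt (Qf (-1) z z + -1)) (fun i' => tl z ord0 (lift ord0 i')) ord0 i).

Lemma tdot_split (X Z : V) : tdot X Z = tl X ord0 ord0 * tl Z ord0 ord0 + tdot (tl X) (tl Z).
Proof.
rewrite /tdot big_ord_recl; congr (_ + _); first by rewrite !mxE.
by apply: eq_bigr => i _; rewrite !mxE.
Qed.

Lemma hyperplane_bifoliates c N U v : 0 < c ->
  N = [set x | M x /\ hyp_ell (iota (g x)) = c] ->
  exterior kappa n.+1 N U -> unit_vector_field kappa N v ->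
  bifoliates kappa n.+1 N U v <->
  forall p, N p -> forall lam, nabla_perp_eigenvalue kappa N v p lam -> lam ^+ 2 + kappa <= 0.
Proof.
move=> c0; have [sf sg fM gM iso] := fg.
pose ell : {linear L -> R} := hyp_ell; pose pi : {linear L -> V} := hyp_pi.
have ellE X : ell X = tl (tl X) ord0 ord0 by [].
have pi0 X : pi X ord0 ord0 = (X ord0 ord0 + tl X ord0 ord0) / 2 by rewrite lcons0.
have tpi X : tl (pi X) = vcons ((X ord0 ord0 - tl X ord0 ord0) / 2)
  (fun i => tl (tl X) ord0 (lift ord0 i)) by rewrite /= /hyp_pi tl_lcons.
have tdpi X Z : tdot (pi X) (pi Z) = (X ord0 ord0 - tl X ord0 ord0) / 2 * ((Z ord0 ord0 - tl Z ord0
  ord0) / 2) +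
    tdot (tl (tl X)) (tl (tl Z)) by rewrite tdot_split !tpi !vcons0 tdot_vcons.
have Qpi X : Qf (-1) (pi X) (pi X) = ell X ^+ 2 + -1 * Bm X X.
  by rewrite /Qf tdpi !pi0 ellE /Bm (tdot_split (tl X)); field.
have Gs : open [set z : V | cone (-1) z /\ 0 < Qf (-1) z z + -1] by exact: open_coneQ.
apply: (hyperbolic_case (k := -1) (c := c) (ell := ell) (pi := pi)
  (A := lcons 0 0 (fun i => vcons 1 (fun=> 0) ord0 i)) (lft := hyp_lift) q0 sf sg fM gM iso).
- exact: Or33.
- exact: c0.
- by rewrite opprK addr_gt0 // exprn_gt0.
- exact: ltn0Sn.
- move=> X; rewrite ellE /Bm lcons0 tl_lcons vcons0 tdot_split.
  have -> : tl (vcons 0 (fun i => vcons 1 (fun=> 0) ord0 i)) = vcons 1 (fun=> 0) :> 'rV[R]_n.+1.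
    by apply/rowP => i; rewrite mxE vconsl.
  rewrite vcons0 /tdot big1; last by move=> i _; rewrite vconsl mulr0.
  by field.
- exact: Qpi.
- move=> X Z; rewrite !ellE => lX lZ; rewrite /Bf tdpi !pi0 /Bm tdot_split lX lZ.
  by field.
- apply: lift_smooth => p.
  have Cz i : Ck p [set z : V | cone (-1) z /\ 0 < Qf (-1) z z + -1] (fun z => z ord0 i).
    by apply: Ck_coord => //; exact: Ck_id.
  have Ct i : Ck p [set z : V | cone (-1) z /\ 0 < Qf (-1) z z + -1] (fun z => tl z ord0 i).
    by apply: Ck_ext (Cz (lift ord0 i)) => // z _; rewrite mxE.
  apply: Ck_lcons => //; [exact: Ck_add|exact: Ck_sub_fun|move=> i].
  apply: Ck_coord => //; apply: Ck_vcons => //.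
  apply: Ck_sqrt => //; first by move=> z [].
  apply: Ck_add => //; last exact: Ck_cst.
  by apply: smooth_Qf => //; exact: Ck_id.
- move=> z [[Qz /(_ (lerN10 _)) z0] Qz1]; rewrite /hyp_lift; set s := Num.sqrt _.
  have s0 : 0 < s by rewrite sqrtr_gt0.
  have s2 : s ^+ 2 = Qf (-1) z z + -1 by rewrite sqr_sqrtr // ltW.
  have QE : Qf (-1) z z = z ord0 ord0 ^+ 2 - tl z ord0 ord0 ^+ 2 - tdot (tl z) (tl z).
    by rewrite /Qf tdot_split; ring.
  have tz := tdot_ge0 (tl z).
  have tt : tl (vcons (z ord0 ord0 - tl z ord0 ord0) (fun i => vcons s (fun i' => tl z ord0 (lift
    ord0 i')) ord0 i)) =
      vcons s (fun i' => tl z ord0 (lift ord0 i')) :> 'rV[R]_n.+1.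
    by apply/rowP => i; rewrite mxE vconsl.
  split.
  + apply/lcons_sheet; split.
      rewrite big_ord_recl vcons0.
      under eq_bigr do rewrite vconsl.
      by rewrite -tdotE -expr2 s2 QE; ring.
    have h : tl z ord0 ord0 ^+ 2 < z ord0 ord0 ^+ 2 by rewrite QE in Qz; lra.
    by rewrite subr_gt0 ltNge; apply/negP => h2; move: h;
      rewrite ltNge ler_pXn2r ?nnegrE ?h2 ?(ltW z0) // (le_trans (ltW z0)).
  + rewrite /= /hyp_pi tl_lcons vcons0 lcons0 tt [RHS]lconsE; congr lcons; try by field.
    by apply/funext => i; rewrite vconsl.
  + by rewrite ellE tl_lcons tt vcons0.
- move=> X SX lX _; have [BX _] := SX.
  have sE : Num.sqrt (Qf (-1) (pi X) (pi X) + -1) = ell X.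
    by rewrite Qpi BX mulrNN mulr1 addrK sqrtr_sqr gtr0_norm.
  rewrite /hyp_lift sE pi0 tpi vcons0 [RHS]lconsE; congr lcons; try by field.
  apply/funext => i; have -> : tl X ord0 (lift ord0 i) = tl (tl X) ord0 i by rewrite [RHS]mxE.
  rewrite [in RHS](vconsE (tl (tl X))); congr (vcons _ _ ord0 i).
  by apply/funext => i'; rewrite vconsl.
- move=> X SX lX _; have [E1 X0] := sheet_prod SX.
  by rewrite pi0 divr_gt0 // addr_gt0 // -(pmulr_lgt0 _ X0) E1 ltr_wpDl // tdot_ge0.
Qed.

End Hyperplane.

(** * Isometries of the half-space *)

Section Isometries.
Context {R : realType} {n : nat}.
Local Notation E := 'rV[R]_n.+1.
Variable q : R.
Hypothesis q0 : 0 < q.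
Let kappa := - q ^+ 2.
Local Notation M := (@space_form R n kappa).
Let oM : open M. Proof. by rewrite (space_form_neg q0); exact: open_halfspace. Qed.

Lemma isometry_comp (f0 g0 f1 g1 : E -> E) : isometry_pair kappa f0 g0 -> isometry_pair kappa f1 g1 ->
  isometry_pair kappa (fun x => f0 (f1 x)) (fun x => g1 (g0 x)).
Proof.
move=> [sf0 sg0 fM0 gM0 iso0] [sf1 sg1 fM1 gM1 iso1]; split.
- by apply: (smooth_on_comp (B := M)) => // x /fM1 [].
- by apply: (smooth_on_comp (B := M)) => // x /gM0 [].
- by move=> p Mp; have [M1 E1] := fM1 _ Mp; have [M0 E0] := fM0 _ M1; rewrite E0.
- by move=> p Mp; have [M1 E1] := gM0 _ Mp; have [M0 E0] := gM1 _ M1; rewrite E0.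
move=> p u w c d Hc Hd; have Mp : M p by have [e [e0 _ cM <- _]] := Hc; apply: cM; rewrite oppr_lt0 e0.
have s1 := smooth_on_smooth oM sf1.
have I x e : curve_at M p x e -> curve_at M (f1 p) ('D_x f1 p) (fun t => f1 (e t)).
  by move=> He; exact: (curve_image oM s1 (fun y My => My) (fun y My => proj1 (fM1 _ My)) Mp He).
have D x e : curve_at M p x e -> derive1 (f1 \o e) 0 = 'D_x f1 p.
  by move=> He; rewrite derive1E (proj2 (curve_deriv oM s1 Mp He)).
by rewrite [LHS](iso0 _ _ _ _ _ (I _ _ Hc) (I _ _ Hd)) -(D _ _ Hc) -(D _ _ Hd); exact: iso1.
Qed.

(** T will be the identity or a reflection; taking it as an involution makes the inverse
    explicit. *)
Lemma affine_isometry (T : {linear E -> E}) (s : R) (t : E) : 0 < s -> t ord0 ord0 = 0 ->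
  (forall x, T (T x) = x) -> (forall x y, dot (T x) (T y) = dot x y) ->
  (forall x, T x ord0 ord0 = x ord0 ord0) ->
  isometry_pair kappa (fun x => s *: T x + t) (fun x => s^-1 *: T (x - t)).
Proof.
move=> s0 t0 TT dT T0; have sn : s != 0 by rewrite gt_eqF.
have Tc : continuous T by exact: linear_row_continuous.
have oT := @openT E.
have sf : smooth setT (fun x => s *: T x + t).
  move=> k; apply: Ck_add => //; last exact: Ck_cst.
  by apply: Ck_scale => //; [exact: Ck_cst|apply: Ck_clin => //; exact: Ck_id].
have sg : smooth setT (fun x => s^-1 *: T (x - t)).
  move=> k; apply: Ck_scale => //; first exact: Ck_cst.
  by apply: (Ck_clin (g := T)) => //; apply: Ck_sub_fun => //; [exact: Ck_id|exact: Ck_cst].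
split.
- by apply: (smooth_on_sub (B := setT)) => //; exact: smooth_smooth_on.
- by apply: (smooth_on_sub (B := setT)) => //; exact: smooth_smooth_on.
- move=> p; rewrite (space_form_neg q0) /halfspace /= => p0; split.
    by rewrite !mxE T0 t0 addr0 mulr_gt0.
  by rewrite addrK linearZ /= TT scalerA mulVf // scale1r.
- move=> p; rewrite (space_form_neg q0) /halfspace /= => p0; split.
    by rewrite !mxE T0 !mxE t0 subr0 mulr_gt0 // invr_gt0.
  by rewrite linearZ /= TT scalerA divff // scale1r subrK.
move=> p u w c d Hc Hd; have Mp : M p by have [e [e0 _ cM <- _]] := Hc; apply: cM; rewrite oppr_lt0 e0.
have D x e : curve_at M p x e -> derive1 ((fun x => s *: T x + t) \o e) 0 = s *: T x.
  move=> He; rewrite derive1E (proj2 (curve_deriv oT sf I He)).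
  have dT' : differentiable T p by exact: linear_differentiable.
  have [d1 E1] := diff_scalec s x dT'.
  have [_ E2] := diff_add x d1 (differentiable_cst t p).
  by rewrite [LHS]E2 E1 derive_cst addr0 derive_clin.
rewrite (D _ _ Hc) (D _ _ Hd) !(metric_neg q0) !mxE T0 t0 addr0.
have -> : dot (s *: T u) (s *: T w) = s ^+ 2 * dot u w.
  by rewrite dot_Qf QfZl QfZr -dot_Qf dT mulrA.
have pn : p ord0 ord0 != 0 by move: Mp; rewrite (space_form_neg q0) => Mp; rewrite gt_eqF.
by field; rewrite sn pn gt_eqF.
Qed.

End Isometries.

Section Reflection.
Context {R : realType} {n : nat}.
Local Notation E := 'rV[R]_n.+1.

(** Orthogonal reflection in the hyperplane normal to b. For b = 0 division by zero makes it the
    identity, so [refl_swap] covers equal vectors. *)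
Definition refl (b x : E) : E := x - (2 * dot b x / dot b b) *: b.
Lemma refl_linear b : linear (refl b).
Proof.
move=> a x y; rewrite /refl !dot_Qf (QfC 1 b (a *: x + y)) QfDl QfZl (QfC 1 x) (QfC 1 y).
rewrite scalerBr addrACA -opprD scalerA -scalerDl; congr (_ - _ *: _); ring.
Qed.
HB.instance Definition _ b := GRing.isLinear.Build R E E _ (refl b) (refl_linear b).

Lemma dotC (x y : E) : dot x y = dot y x. Proof. by rewrite !dot_Qf QfC. Qed.
Lemma dotBl (x y z : E) : dot (x - y) z = dot x z - dot y z.
Proof. by rewrite !dot_Qf -scaleN1r QfDl QfZl mulN1r. Qed.
Lemma dotZl a (x z : E) : dot (a *: x) z = a * dot x z.
Proof. by rewrite !dot_Qf QfZl. Qed.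
Lemma dotDl (x y z : E) : dot (x + y) z = dot x z + dot y z.
Proof. by rewrite !dot_Qf QfDl. Qed.

Lemma dot_eq0 (x : E) : dot x x = 0 -> x = 0.
Proof. by move=> h; apply/eqP/negPn/negP => /dot_gt0; rewrite h ltxx. Qed.

Lemma refl_id b x : dot b b = 0 -> refl b x = x.
Proof. by move=> h; rewrite /refl h invr0 mulr0 scale0r subr0. Qed.

Lemma reflK b x : refl b (refl b x) = x.
Proof.
have [h|h] := eqVneq (dot b b) 0; first by rewrite !refl_id.
rewrite {1}/refl {2}/refl dotC dotBl dotZl (dotC x) /refl -addrA -opprD -scalerDl.
have -> : 2 * dot b x / dot b b + 2 * (dot b x - 2 * dot b x / dot b b * dot b b) / dot b b = 0.
  by field.
by rewrite scale0r subr0.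
Qed.

Lemma dot_refl b x y : dot (refl b x) (refl b y) = dot x y.
Proof.
have [h|h] := eqVneq (dot b b) 0; first by rewrite !refl_id.
have alg (c d : R) : dot (x - c *: b) (y - d *: b) =
    dot x y - d * dot b x - c * dot b y + c * d * dot b b.
  rewrite dotBl dotZl (dotC x (y - _)) (dotC b (y - _)) !dotBl !dotZl (dotC y x) (dotC y b).
  by ring.
by rewrite /refl alg; field.
Qed.

Lemma refl0 (b x : E) : b ord0 ord0 = 0 -> refl b x ord0 ord0 = x ord0 ord0.
Proof. by move=> b0; rewrite !mxE b0 mulr0 subr0. Qed.

Lemma refl_swap (x y : E) : dot x x = dot y y -> refl (x - y) x = y.
Proof.
move=> xy; have [h|h] := eqVneq (dot (x - y) (x - y)) 0.
  by rewrite refl_id //; apply/eqP; rewrite -subr_eq0; apply/eqP; exact: dot_eq0.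
have E1 : dot (x - y) (x - y) = 2 * dot (x - y) x.
  by rewrite !dotBl !(dotC _ (x - y)) !dotBl (dotC y x) -xy; ring.
by rewrite /refl -E1 divff // scale1r opprB addrC subrK.
Qed.

Lemma refl_perp (b x : E) : dot b x = 0 -> refl b x = x.
Proof. by move=> h; rewrite /refl h mulr0 mul0r scale0r subr0. Qed.

End Reflection.

(** * Umbilic hypersurfaces in negative curvature *)

Section NegativeCurvature.
Context {R : realType}.

(** A similarity of the half-space sends e = (1, 0, ..., 0) to p. Seen from there, the sphere is the
    level cosh(q r) of [sph_ell], which is minus the product with iota e. *)
Lemma geodesic_sphere_bifoliates n (q : R) (p : 'rV[R]_n.+1) r U v : 0 < q -> (0 < n)%N ->
  space_form (- q ^+ 2) p -> 0 < r ->
  exterior (- q ^+ 2) n (geodesic_sphere (- q ^+ 2) p r) U ->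
  unit_vector_field (- q ^+ 2) (geodesic_sphere (- q ^+ 2) p r) v ->
  bifoliates (- q ^+ 2) n (geodesic_sphere (- q ^+ 2) p r) U v <->
  forall s, geodesic_sphere (- q ^+ 2) p r s -> forall lam,
    nabla_perp_eigenvalue (- q ^+ 2) (geodesic_sphere (- q ^+ 2) p r) v s lam ->
    lam ^+ 2 + - q ^+ 2 <= 0.
Proof.
move=> q0 n0 Mp r0.
pose e : 'rV[R]_n.+1 := delta_mx ord0 ord0.
have p0 : 0 < p ord0 ord0 by move: Mp; rewrite (space_form_neg q0).
have t0 : (p - p ord0 ord0 *: e) ord0 ord0 = 0 by rewrite !mxE mulr1 subrr.
have fg := affine_isometry q0 (T := idfun) p0 t0 (fun x => erefl) (fun x y => erefl) (fun x => erefl).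
have [sf sg fM gM iso] := fg.
have gp : (p ord0 ord0)^-1 *: (p - (p - p ord0 ord0 *: e)) = e.
  by rewrite opprB addrCA subrr addr0 scalerA mulVf ?scale1r // gt_eqF.
have c1 : 1 < csh q r.
  rewrite -(ltr_pXn2r (n := 2)) // ?nnegrE ?(ltW (csh_gt0 q r)) // expr1n csh_snh_sq ?gt_eqF //.
  by rewrite ltrDl mulr_gt0 // exprn_gt0 // snh_gt0.
have key X : sph_ell X = - Bm X (iota e).
  have ie0 : iota e ord0 ord0 = 1.
    rewrite /iota mxE lamv0 mxE eqxx invr1 mul1r dotE /tdot big1 ?mxE ?mulr1 ?addr0 // => i _.
    by rewrite mxE mul0r.
  have iet : tl (iota e) ord0 ord0 = 1 by rewrite iota_tl0 mxE eqxx invr1.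
  have tX : tdot (tl X) (tl (iota e)) = 0.
    apply: big1 => i _; have -> : tl (iota e) ord0 (lift ord0 i) = 0; last by rewrite mulr0.
    by rewrite /iota linearZ [LHS]mxE lamvt !mxE /= mulr0.
  by rewrite /sph_ell /Bm tX ie0 iet; field.
apply: (hyperbolic_sphere_bifoliates q0 n0 fg c1).
rewrite (hyp_sphereE q0 sf sg fM gM iso Mp r0).
by apply/seteqP; split=> x [Mx lx]; split=> //; move: lx; rewrite key /hyp_embed /= gp.
Qed.

Lemma horosphere_image_bifoliates n (q : R) (f : 'rV[R]_n.+1 -> 'rV[R]_n.+1) N U v :
  0 < q -> (0 < n)%N -> space_form_isometry (- q ^+ 2) f -> N = f @` [set y : 'rV[R]_n.+1 | y ord0
    ord0 = 1] ->
  exterior (- q ^+ 2) n N U -> unit_vector_field (- q ^+ 2) N v ->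
  bifoliates (- q ^+ 2) n N U v <->
  forall s, N s -> forall lam, nabla_perp_eigenvalue (- q ^+ 2) N v s lam ->
    lam ^+ 2 + - q ^+ 2 <= 0.
Proof.
move=> q0 n0 [g fg] ->; apply: (horosphere_bifoliates q0 n0 fg).
have [sf sg fM gM iso] := fg.
apply/seteqP; split=> x.
  move=> [y y1 <-]; have My : space_form (- q ^+ 2) y by rewrite (space_form_neg q0) /halfspace /= y1.
  by have [Mf gf] := fM _ My; split=> //; rewrite gf iota_tl0 y1 invr1.
move=> [Mx]; rewrite iota_tl0 => g1; have [_ fgx] := gM _ Mx; exists (g x) => //=.
by apply: invr_inj; rewrite g1 invr1.
Qed.

(** A reflection fixing coordinate 0 makes the part of a with coordinate 0 removed a multiple of
    e_1. The hyperplane then reads x_1 / x_0 = |a_0| / al, with al the length of that part. *)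
Lemma hyperplane_image_bifoliates n (q : R) (f : 'rV[R]_n.+2 -> 'rV[R]_n.+2)
    (a : 'rV[R]_n.+2) N U v :
  0 < q -> space_form_isometry (- q ^+ 2) f ->
  a ord0 ord0 != 0 -> (exists2 i, i != ord0 & a ord0 i != 0) ->
  N = f @` [set y : 'rV[R]_n.+2 | 0 < y ord0 ord0 /\ dot a y = 0] ->
  exterior (- q ^+ 2) n.+1 N U -> unit_vector_field (- q ^+ 2) N v ->
  bifoliates (- q ^+ 2) n.+1 N U v <->
  forall s, N s -> forall lam, nabla_perp_eigenvalue (- q ^+ 2) N v s lam ->
    lam ^+ 2 + - q ^+ 2 <= 0.
Proof.
move=> q0 [g fg] a0 [i i0 ai] ->.
pose e0 : 'rV[R]_n.+2 := delta_mx ord0 ord0.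
pose e1 : 'rV[R]_n.+2 := delta_mx ord0 (lift ord0 ord0).
have de0 (y : 'rV[R]_n.+2) : dot e0 y = y ord0 ord0.
  rewrite dotE mxE eqxx mul1r /tdot big1 ?addr0 // => j _; by rewrite mxE mul0r.
have de1 (y : 'rV[R]_n.+2) : dot e1 y = y ord0 (lift ord0 ord0).
  rewrite dotE mxE mul0r add0r /tdot (bigD1 ord0) //= mxE !eqxx mul1r big1 ?addr0 // => j j0.
  by rewrite mxE eqxx /= (inj_eq lift_inj) (negbTE j0) mul0r.
(* The sign of a_0 is moved into w, so that the level |a_0| / al is positive, as
   [hyperplane_bifoliates] asks. *)
pose s := a ord0 ord0 / `|a ord0 ord0|.
have na : `|a ord0 ord0| != 0 by rewrite normr_eq0.
have s2 : s ^+ 2 = 1 by rewrite /s expr_div_n real_normK ?num_real // divff // expf_neq0.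
have aa : a ord0 ord0 = s * `|a ord0 ord0| by rewrite /s divfK.
clearbody s.
have dd : dot (a - a ord0 ord0 *: e0) (a - a ord0 ord0 *: e0) = tdot a a.
  rewrite dotE !mxE eqxx mulr1 subrr mul0r add0r.
  by apply: eq_bigr => j _; rewrite !mxE mulr0 subr0.
have ta : 0 < tdot a a.
  rewrite lt_neqAle tdot_ge0 andbT eq_sym; apply: contra_neq ai => ta0.
  have aE : a - a ord0 ord0 *: e0 = 0.
    by apply: dot_eq0; rewrite dd.
  move/rowP: aE => /(_ i); rewrite !mxE (negbTE i0) mulr0 subr0 //.
pose al := Num.sqrt (tdot a a).
have al0 : 0 < al by rewrite sqrtr_gt0.
have al2 : al ^+ 2 = tdot a a by rewrite sqr_sqrtr // ltW.
have aln : al != 0 by rewrite gt_eqF.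
pose w := (- (s / al)) *: (a - a ord0 ord0 *: e0).
have dw : dot w w = 1.
  rewrite /w dotZl dotC dotZl dd -al2.
  have -> : - (s / al) * (- (s / al) * al ^+ 2) = s ^+ 2 by field.
  exact: s2.
have dee : dot e1 e1 = 1 by rewrite de1 mxE !eqxx.
have w0 : w ord0 ord0 = 0 by rewrite !mxE eqxx mulr1 subrr mulr0.
pose b := e1 - w.
have b0 : b ord0 ord0 = 0 by rewrite mxE [(- w) _ _]mxE w0 mxE subr0.
have Te : refl b e1 = w by apply: refl_swap; rewrite dw dee.
have Tw : refl b w = e1 by rewrite -Te reflK.
have T0 : refl b e0 = e0 by apply: refl_perp; rewrite dotC de0.
have aE : a = a ord0 ord0 *: e0 + (- (s * al)) *: w.
  rewrite /w scalerA; have -> : - (s * al) * - (s / al) = s ^+ 2 by field.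
  by rewrite s2 scale1r subrKC.
have Ta (y : 'rV[R]_n.+2) : dot a (refl b y) = a ord0 ord0 * y ord0 ord0 - s * al * y ord0 (lift
  ord0 ord0).
  have RZ d x : refl b (d *: x) = d *: refl b x by exact: linearZ.
  have RD x z : refl b (x + z) = refl b x + refl b z by exact: linearD.
  by rewrite -(dot_refl b) reflK {1}aE RD (RZ _ e0) (RZ _ w) T0 Tw dotDl !dotZl de0 de1 mulNr.
have fg1 := affine_isometry q0 (T := refl b) ltr01 (mxE _ _ _ _ : (0 : 'rV[R]_n.+2) ord0 ord0 = 0)
  (reflK b) (dot_refl b) (fun x => refl0 x b0).
have fg2 := isometry_comp q0 fg fg1.
have c0 : 0 < `|a ord0 ord0| / al by rewrite divr_gt0 // normr_gt0.
apply: (hyperplane_bifoliates q0 fg2 c0).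
have [sf sg fM gM iso] := fg.
have hE (y : 'rV[R]_n.+2) : hyp_ell (iota y) = y ord0 (lift ord0 ord0) / y ord0 ord0.
  by rewrite /hyp_ell /iota !linearZ /= mxE [tl _ _ _]mxE lamvt mulrC.
have key (y : 'rV[R]_n.+2) : 0 < y ord0 ord0 -> (dot a (refl b y) = 0) <-> (hyp_ell (iota y) = `|a
  ord0 ord0| / al).
  move=> y0; rewrite Ta hE; have yn : y ord0 ord0 != 0 by rewrite gt_eqF.
  have sn : s != 0 by apply/eqP => s0; move: s2; rewrite s0 expr0n => /eqP; rewrite eq_sym oner_eq0.
  rewrite {1}aa -!mulrA -mulrBr; split.
    move=> /eqP; rewrite mulf_eq0 (negbTE sn) /= subr_eq0 => /eqP E.
    apply/eqP; rewrite eqr_div //; apply/eqP; rewrite [RHS]E; ring.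
  move=> /eqP; rewrite eqr_div // => /eqP E.
  by rewrite -[`|_| * _]E (mulrC _ al) subrr mulr0.
have gE x : 1^-1 *: refl b (g x - 0) = refl b (g x) by rewrite invr1 scale1r subr0.
have pos x : space_form (- q ^+ 2) x -> 0 < refl b (g x) ord0 ord0.
  by move=> /gM []; rewrite (space_form_neg q0) refl0.
apply/seteqP; split=> x.
  move=> [y [y0 ay] <-]; have My : space_form (- q ^+ 2) y by rewrite (space_form_neg q0).
  have [Mf gf] := fM _ My; split=> //; rewrite gE; apply/key; first exact: pos.
  by rewrite reflK gf.
move=> [Mx]; rewrite gE => /key; rewrite reflK => H; have [Mg fgx] := gM _ Mx.
exists (g x) => //; split; last by apply: H; exact: pos.
by move: Mg; rewrite (space_form_neg q0).
Qed.

Lemma negative_bifoliates n (q : R) (N U : set 'rV[R]_n.+1) v : 0 < q -> (0 < n)%N ->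
  umbilic_hypersurface (- q ^+ 2) N -> exterior (- q ^+ 2) n N U ->
  unit_vector_field (- q ^+ 2) N v ->
  bifoliates (- q ^+ 2) n N U v <->
  forall s, N s -> forall lam, nabla_perp_eigenvalue (- q ^+ 2) N v s lam ->
    lam ^+ 2 + - q ^+ 2 <= 0.
Proof.
move=> q0 n0 HN; have kn : - q ^+ 2 < 0 by rewrite oppr_lt0 exprn_gt0.
case: HN => [p r k0|p r k0|p r _ Mp r0|f _ Hf|f a _ Hf a0 ai].
- by move: kn; rewrite k0 ltxx.
- by move: kn; rewrite (lt_gtF k0).
- exact: geodesic_sphere_bifoliates.
- exact: (horosphere_image_bifoliates q0 n0 Hf erefl).
(* The coordinate x_1 exists because n is a successor. *)
case: n n0 f a N U v Hf a0 ai => // n _ f a _ U v Hf a0 ai.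
exact: (hyperplane_image_bifoliates q0 Hf a0 ai erefl).
Qed.

End NegativeCurvature.

(** * Spheres of Euclidean space *)

Section Flat.
Context {R : realType} {n : nat}.
Local Notation E := 'rV[R]_n.+1.
(* Curvature 0 in the form required by [nonpositive_bifoliates], with q = 0. *)
Let kappa : R := - 0 ^+ 2.
Let k0 : kappa = 0. Proof. by rewrite /kappa expr0n oppr0. Qed.
Local Notation M := (@space_form R n kappa).

Lemma space_form_flat : M = setT.
Proof. by apply/seteqP; split=> x // _; rewrite /space_form /= k0 ltxx. Qed.

Lemma metric_flat (p x z : E) : metric kappa p x z = dot x z.
Proof. by rewrite /metric k0 ltxx. Qed.

Lemma inner_cov_flat (p x y a z : E) : inner_cov kappa p x y a z = dot a z.
Proof.
have D (t u w : E) : 'D_t (fun q : E => metric kappa q u w) p = 0.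
  have -> : (fun q : E => metric kappa q u w) = (fun _ => dot u w).
    by apply/funext => q; rewrite metric_flat.
  by rewrite derive_cst.
by rewrite /inner_cov (D x y z) (D y x z) (D z x y) metric_flat addr0 subrr mulr0 addr0.
Qed.

Lemma tangent_flat (p u : E) : tangent M p u.
Proof.
exists (fun t => p + t *: u); apply: curve_line; rewrite space_form_flat //; exact: openT.
Qed.

Lemma smooth_line (p u : E) : smooth setT (fun t : R => p + t *: u).
Proof.
move=> k; have oT := @openT R; apply: Ck_add => //; first exact: Ck_cst.
by apply: Ck_scale => //; [exact: Ck_id|exact: Ck_cst].
Qed.

Lemma derive_line (p u : E) t :
  'D_1 (fun t : R => p + t *: u) t = u /\ 'D_1 (fun s => 'D_1 (fun t : R => p + t *: u) s) t = 0.
Proof.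
have D s : 'D_1 (fun t : R => p + t *: u) s = u by have [] := diff_line p u s.
split=> //; have -> : (fun s => 'D_1 (fun t : R => p + t *: u) s) = (fun _ => u).
  by apply/funext.
by rewrite derive_cst.
Qed.

(** The acceleration is orthogonal to all vectors, hence 0; [ode_neg] with q = 0 then gives the
    straight line. *)
Lemma geodesic_flat (p u : E) c : geodesic kappa p u c <-> c = fun t : R => p + t *: u.
Proof.
have oT := @openT R.
split=> [[sc cM c0 dc acc]|->].
  have sc' := smooth_on_smooth oT sc.
  apply/funext => t; apply/rowP => i.
  pose f (t : R) := c t ord0 i - (p + t *: u) ord0 i.
  have sf : smooth setT f.
    by move=> k; apply: Ck_sub_fun => //; apply: Ck_coord => //; exact: smooth_line.
  have D1 s : 'D_1 f s = 'D_1 c s ord0 i - u ord0 i.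
    have [d1 E1] := diff_coord (1 : R) i (smooth_diff sc' (I : setT s)).
    have [d2 E2] := diff_coord (1 : R) i (smooth_diff (smooth_line p u) (I : setT s)).
    have dv1 : derivable (fun y : R => c y ord0 i) s (1 : R) by exact: diff_derivable.
    have dv2 : derivable (fun y : R => (p + y *: u) ord0 i) s (1 : R) by exact: diff_derivable.
    by rewrite [LHS](deriveB dv1 dv2) E1 E2 (proj1 (derive_line p u s)).
  have c2 s : 'D_1 (fun t => 'D_1 c t) s = 0.
    by apply: dot_eq0; have := acc s _ (tangent_flat (c s) (derive1n 2 c s));
      rewrite inner_cov_flat derive1n2E.
  have D2 s : 'D_1 (fun t => 'D_1 f t) s = 0 ^+ 2 * f s.
    have -> : (fun t => 'D_1 f t) = (fun t => 'D_1 c t ord0 i - u ord0 i) by apply/funext.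
    have [d1 E1] := diff_coord (1 : R) i (smooth_diff (smooth_derive (1 : R) sc') (I : setT s)).
    have [_ E2] := diff_add (1 : R) d1 (differentiable_cst (- u ord0 i) s).
    by rewrite [LHS]E2 E1 c2 derive_cst mxE addr0 expr0n mul0r.
  have f0 : f 0 = 0 by rewrite /f c0 scale0r addr0 subrr.
  have f1 : 'D_1 f (0 : R) = 0 by rewrite D1 -derive1E dc subrr.
  by apply/eqP; rewrite -subr_eq0; apply/eqP; exact: (ode_neg sf D2 f0 f1).
split.
- exact: smooth_smooth_on (smooth_line p u).
- by rewrite space_form_flat.
- by rewrite scale0r addr0.
- by rewrite derive1E (proj1 (derive_line p u 0)).
- move=> t z _; rewrite inner_cov_flat derive1n2E (proj2 (derive_line p u t)).
  by rewrite /dot big1 // => i _; rewrite mxE mul0r.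
Qed.

Variables (p0 : E) (r : R).
Hypotheses (r0 : 0 < r) (n0 : (0 < n)%N).
Let N := [set q : E | dot (q - p0) (q - p0) = r ^+ 2].
Let P (x : E) := x - p0.
Let C' := [set z : E | cone 1 z /\ r < rho 1 z].
Let hk : [\/ (1 : R) = 1, (1 : R) = 0 | (1 : R) = -1]. Proof. exact: Or31. Qed.
Let sP : smooth setT P.
Proof. by move=> k; have oT := @openT E; apply: Ck_sub_fun => //; [exact: Ck_id|exact: Ck_cst]. Qed.
Let DP x u : 'D_u P x = u.
Proof.
by rewrite [LHS](proj2 (diff_add u (differentiable_idf x) (differentiable_cst (- p0) x)))
  derive_cst derive_id addr0.
Qed.
Let W := [set x : E | r ^+ 2 < dot (x - p0) (x - p0)].

Let C'E z : C' z <-> r ^+ 2 < dot z z.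
Proof.
split.
  move=> [Cz rz]; rewrite dot_Qf -(rho_sq Cz) ltr_pXn2r // nnegrE ltW //.
  exact: rho_gt0.
move=> h; have Cz : cone 1 z.
  by split; [rewrite -dot_Qf; apply: lt_trans h; rewrite exprn_gt0|rewrite ler10].
split=> //; rewrite -(ltr_pXn2r (n := 2)) // ?nnegrE ?(ltW r0) ?(ltW (rho_gt0 Cz)) //.
by rewrite rho_sq // -dot_Qf.
Qed.

Lemma flat_bifoliates v : unit_vector_field kappa N v ->
  bifoliates kappa n N W v <->
  forall p, N p -> forall lam, nabla_perp_eigenvalue kappa N v p lam -> lam ^+ 2 + kappa <= 0.
Proof.
have WE : W = [set x | [/\ setT x, cone 1 (P x) & r < rho 1 (P x)]].
  apply/seteqP; split=> x; first by move=> /C'E [].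
  by move=> [_ h1 h2]; apply/C'E.
rewrite WE; apply: (nonpositive_bifoliates (rho0 := r) (P := P) (vth := fun y => p0 + r *: y)
  (P' := fun z => z + p0) hk openT sP) => //.
- by rewrite expr0n mulr0 add0r.
- apply: (smooth_on_sub (B := setT)) => //; apply: smooth_smooth_on; first exact: openT.
  move=> k; have oT := @openT E; apply: Ck_add => //; first exact: Ck_cst.
  by apply: Ck_scale => //; [exact: Ck_cst|exact: Ck_id].
- move=> p Np; split; last by rewrite /P scalerA divff ?gt_eqF // scale1r subrKC.
  apply/csphP; split; last by rewrite ler10.
  by rewrite QfZl QfZr -dot_Qf [dot _ _]Np; field; rewrite gt_eqF.
- move=> y /csphP [Qy _]; split; last by rewrite /P addrAC subrr add0r.
  by rewrite /N /= addrAC subrr add0r dot_Qf QfZl QfZr Qy; ring.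
- apply: (smooth_on_sub (B := setT)) => //; apply: smooth_smooth_on; first exact: openT.
  by move=> k; have oT := @openT E; apply: Ck_add => //; [exact: Ck_id|exact: Ck_cst].
- by move=> x _; rewrite /P subrK.
- move=> z [Cz rz]; have E1 : P (z + p0) = z by rewrite /P addrK.
  by split=> //=; rewrite E1.
- move=> p u Np tu mu.
  have E1 t : (r * Num.sqrt (1 + 0 ^+ 2 * t ^+ 2)) *: (r^-1 *: P p) + t *: 'D_u P p + p0 = p + t *: u.
    rewrite expr0n mul0r addr0 sqrtr1 mulr1 scalerA divff ?gt_eqF // scale1r DP /P.
    by rewrite addrAC subrK.
  apply/seteqP; split=> x.
    by move=> [c [t [/geodesic_flat -> t0 _ ->]]]; exists t; rewrite ?E1.
  move=> [t t0 ->]; exists (fun t : R => p + t *: u), t; split=> //.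
  - exact/geodesic_flat.
  - by rewrite -/kappa k0 ltxx.
- by move=> p x z _ _ _; rewrite metric_flat !DP dot_Bf.
- move=> v' p x z c hv Np Hc tz; rewrite inner_cov_flat DP dot_Bf derive1E.
  have -> // : (fun e : R => 'D_(v' (c e)) P (c e)) = v' \o c.
  by apply/funext => e; rewrite DP.
- by move=> p x _ x0; rewrite metric_flat; exact: dot_gt0.
Qed.

(** Differentiate |c - p0|^2 = r^2 twice. It is the counterpart of [curve_acceleration], with the
    sphere N itself as quadric. *)
Lemma flat_curve_second p x c : curve_at N p x c ->
  dot (p - p0) x = 0 /\ dot (derive1n 2 c 0) (p - p0) = - dot x x.
Proof.
move=> [e [e0 sc cN cp dc]]; pose I := [set t : R | - e < t < e].
have oI : open I by exact: (@open_oo R).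
have I0 : I 0 by rewrite /I /= oppr_lt0 e0.
have sc' := smooth_on_smooth oI sc.
have nI : \forall t \near (0 : R), I t by have := open_nbhs_nbhs (conj oI I0).
have dX t : I t -> differentiable (fun s => c s - p0) t /\ 'D_1 (fun s => c s - p0) t = 'D_1 c t.
  move=> It; have [d E1] := diff_add (1 : R) (smooth_diff sc' It) (differentiable_cst (- p0) t).
  by split=> //; rewrite [LHS]E1 derive_cst addr0.
have b1 t : I t -> Qf 1 ('D_1 c t) (c t - p0) = 0.
  move=> It; have [d E1] := dX t It; have [_ b] := diff_Qf 1 (1 : R) d d.
  have : 'D_1 (fun s => Qf 1 (c s - p0) (c s - p0)) t = 0.
    rewrite (near_eq_derive (g := fun _ : R => r ^+ 2)) ?derive_cst //.
    by have := open_nbhs_nbhs (conj oI It); apply: filterS => s /cN; rewrite -dot_Qf.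
  by rewrite b E1 (QfC 1 (c t - p0)) => b'; lra.
have [d0 E0] := dX 0 I0.
have [_ b2] := diff_Qf 1 (1 : R) (smooth_diff (smooth_derive (1 : R) sc') I0) d0.
have b3 : 'D_1 (fun t => Qf 1 ('D_1 c t) (c t - p0)) (0 : R) = 0.
  rewrite (near_eq_derive (g := fun _ : R => 0 : R)) ?derive_cst //.
  by apply: filterS nI.
have Dc : 'D_1 c (0 : R) = x by rewrite -derive1E.
rewrite b3 E0 Dc cp in b2.
split; first by have := b1 0 I0; rewrite Dc cp QfC -dot_Qf.
by rewrite derive1n2E !dot_Qf; apply/eqP; rewrite -addr_eq0 -b2.
Qed.

Lemma flat_exterior U : exterior kappa n N U -> U = W.
Proof.
move=> [[z Az UE] HU].
pose p := p0 + r *: (delta_mx ord0 ord0 : E).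
have Np : N p.
  rewrite /N /= /p addrAC subrr add0r dotZl dotC dotZl dotE !mxE !eqxx /tdot big1 ?addr0.
    by rewrite /= !mulr1 expr2.
  by move=> i _; rewrite mxE mul0r.
clearbody p.
have Mp : M p by rewrite space_form_flat.
have [h [d [[th hN [e [c [Hc on HH]]]] Hd Ud]]] := HU p Np.
pose ht (x : E) := dot (x - p0) (x - p0) - r ^+ 2.
have sht : smooth setT ht.
  move=> k; have oT := @openT E; apply: Ck_sub_fun => //; last exact: Ck_cst.
  have -> : (fun x : E => dot (x - p0) (x - p0)) = (fun x => Qf 1 (P x) (P x)).
    by apply/funext => x; rewrite dot_Qf.
  by apply: smooth_Qf => //; exact: sP.
have dh : dot h (p - p0) = -1.
  have zN x : tangent N p x -> metric kappa p (p - p0) x = 0.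
    by move=> [cx /flat_curve_second []]; rewrite metric_flat.
  have := HH (p - p0) (tangent_flat p _) zN; rewrite metric_flat.
  rewrite (eq_bigr (fun _ => -1)); last first.
    move=> i _; have [_ E2] := flat_curve_second (Hc i).
    by rewrite inner_cov_flat E2 -(metric_flat p) on eqxx.
  rewrite sumr_const card_ord -[RHS]mulr_natl.
  by apply: mulfI; rewrite pnatr_eq0 -lt0n.
have dP x := smooth_diff sP (I : setT x).
have Dht : 'D_(- h) ht p = 2.
  have [dq Eq] := diff_Qf 1 (- h) (dP p) (dP p).
  have [_ E1] := diff_add (- h) dq (differentiable_cst (- r ^+ 2) p).
  have -> : ht = fun x => Qf 1 (P x) (P x) + - r ^+ 2 by apply/funext => x; rewrite /ht dot_Qf.
  rewrite [LHS]E1 derive_cst Eq DP addr0 (QfC 1 (P p)) -dot_Qf -scaleN1r dotZl /P dh.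
  by ring.
have htp : ht p = 0 by rewrite /ht [dot _ _]Np subrr.
have [|y Uy hy] := exterior_point (U := U) openT I sht Hd htp _ Ud.
  by rewrite Dht.
apply: (exterior_component (ht := ht) Az UE _ _ _ _ Uy hy).
- have -> : W = (fun z => z + p0) @` C'.
    apply/seteqP; split=> x.
      by move=> Wx; exists (x - p0); [apply/C'E|rewrite subrK].
    by move=> [s /C'E Cs <-]; rewrite /W /= addrK.
  apply: exterior_connected => //.
  apply: (smooth_on_sub (B := setT)) => //; apply: smooth_smooth_on; first exact: openT.
  by move=> k; have oT := @openT E; apply: Ck_add => //; [exact: Ck_id|exact: Ck_cst].
- apply/seteqP; split=> x.
    move=> Wx; split; last by rewrite subr_gt0.
    split; [by rewrite space_form_flat| |by rewrite k0 ltxx].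
    by move=> Nx; move: Wx; rewrite /W /= [dot _ _]Nx ltxx.
  by move=> [_]; rewrite subr_gt0.
- by move=> x _; exact: smooth_cont sht I.
- by move=> x [_ Nx _]; apply/eqP => /eqP; rewrite subr_eq0 => /eqP E; apply: Nx.
Qed.

End Flat.

(** * Small spheres of the round sphere *)

Section RoundSphere.
Context {R : realType} {n : nat}.
Local Notation E := 'rV[R]_n.+2.
Variable q : R.
Hypothesis q0 : 0 < q.
Let kappa := q ^+ 2.
Let kp : 0 < kappa. Proof. by rewrite exprn_gt0. Qed.
Let k0 : kappa != 0. Proof. by rewrite gt_eqF. Qed.
Let qn : q != 0. Proof. by rewrite gt_eqF. Qed.
Local Notation M := (@space_form R n.+1 kappa).

Lemma space_form_pos : M = [set x : E | dot x x = kappa^-1].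
Proof. by apply/seteqP; split=> x; rewrite /space_form /= kp. Qed.

Lemma metric_pos (p x z : E) : metric kappa p x z = dot x z.
Proof. by rewrite /metric (lt_gtF kp). Qed.

Lemma smooth_idE : smooth (@setT E) (fun x => x). Proof. by move=> k; exact: Ck_id. Qed.

Lemma metric_pos_id (p x z : E) : M p ->
  metric kappa p x z = dot ('D_x (fun s : E => s) p) ('D_z (fun s : E => s) p).
Proof. by move=> _; rewrite !derive_id metric_pos. Qed.

Lemma inner_cov_pos (p x y a z : E) : M p -> inner_cov kappa p x y a z =
  dot ('D_x (fun s => 'D_y (fun s : E => s) s) p + 'D_a (fun s : E => s) p) ('D_z (fun s : E => s) p).
Proof.
move=> _; have D (t u w : E) : 'D_t (fun s : E => metric kappa s u w) p = 0.
  have -> : (fun s : E => metric kappa s u w) = (fun _ => dot u w).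
    by apply/funext => s; rewrite metric_pos.
  by rewrite derive_cst.
have -> : (fun s => 'D_y (fun s : E => s) s) = (fun _ => y) by apply/funext => s; rewrite derive_id.
rewrite /inner_cov (D x y z) (D y x z) (D z x y) metric_pos addr0 subrr mulr0 addr0.
by rewrite derive_cst add0r !derive_id.
Qed.

Lemma sphere_M (p : E) : M p -> dot p p = kappa^-1. Proof. by rewrite space_form_pos. Qed.

Lemma dot_gcircle (p u : E) a b : M p -> dot p u = 0 ->
  dot (a *: p + b *: u) (a *: p + b *: u) = a ^+ 2 / kappa + b ^+ 2 * dot u u.
Proof.
by move=> Mp pu; rewrite !dot_Qf Qf_comb -!dot_Qf pu (sphere_M Mp); ring.
Qed.

Lemma tangent_sphere (p u : E) : M p -> dot p u = 0 -> tangent M p u.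
Proof.
move=> Mp pu; have [u0|un] := eqVneq u 0.
  exists (fun _ => p), 1; rewrite ltr01; split=> //.
    apply: smooth_smooth_on; first exact: (@open_oo R).
    by move=> k; exact: Ck_cst.
  by rewrite derive1E derive_cst u0.
(* Angular speed |u| q: the curve cos(w t) p + sin(w t) / w u has velocity u at p and stays on the
   sphere because |u|^2 / w^2 = 1 / q^2. *)
pose w := q * Num.sqrt (dot u u).
have uu : 0 < dot u u by exact: dot_gt0.
have w0 : 0 < w by rewrite mulr_gt0 // sqrtr_gt0.
have wn : w != 0 by rewrite gt_eqF.
have w2 : w ^+ 2 = kappa * dot u u by rewrite exprMn sqr_sqrtr // ltW.
have oT := @openT R; have [sc ss] := csp_snp_smooth w.
have s : smooth setT (fun t => csp w t *: p + snp w t *: u).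
  by move=> k; apply: Ck_add => //; apply: Ck_scale => //; exact: Ck_cst.
exists (fun t => csp w t *: p + snp w t *: u), 1; rewrite ltr01; split=> //.
- by apply: smooth_smooth_on; [exact: (@open_oo R)|move=> k; exact: Ck_sub (s k)].
- move=> t _; rewrite space_form_pos /= (dot_gcircle _ _ Mp pu) /csp /snp.
  have -> : dot u u = w ^+ 2 / kappa by rewrite w2; field.
  rewrite -[RHS]mul1r -(cos2Dsin2 (w * t)); field; rewrite wn.
  by rewrite k0.
- by rewrite /csp /snp mulr0 cos0 sin0 mul0r scale0r scale1r addr0.
have [d1 E1] := diff_scale_vec p (1 : R) (smooth_diff sc (I : setT (0 : R))).
have [d2 E2] := diff_scale_vec u (1 : R) (smooth_diff ss (I : setT (0 : R))).
have [_ E3] := diff_add (1 : R) d1 d2.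
have [D1 D2] := csp_snp_derive 0 wn.
rewrite derive1E [LHS]E3 E1 E2 D1 D2 /csp /snp !mulr0 sin0 cos0 mul0r mulr0.
by rewrite scale0r add0r scale1r.
Qed.

Let BC (x z : E) : dot x z = dot z x := dotC x z.
Let BD (x y z : E) : dot (x + y) z = dot x z + dot y z := dotDl x y z.
Let BZ a (x z : E) : dot (a *: x) z = a * dot x z := dotZl a x z.
Let oT := @openT E.

Lemma sphere_tangent (p u : E) : M p -> tangent M p u -> dot p u = 0.
Proof.
move=> Mp tu; have := M_tangent_orth BC BD BZ oT (fun _ _ => I) smooth_idE sphere_M Mp tu.
by rewrite derive_id.
Qed.

Lemma sphere_nondeg (p x : E) : M p ->
  (forall z, tangent M p z -> dot x ('D_z (fun s : E => s) p) = 0) -> exists mu, x = mu *: p.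
Proof.
move=> Mp H; pose mu := kappa * dot x p; exists mu.
pose z := x - mu *: p.
have pz : dot p z = 0 by rewrite dotC /z dotBl dotZl (sphere_M Mp) /mu; field.
have xz : dot x z = 0 by have := H z (tangent_sphere Mp pz); rewrite derive_id.
apply/eqP; rewrite -subr_eq0; apply/eqP/dot_eq0.
by rewrite -/z {1}/z dotBl dotZl xz pz mulr0 subrr.
Qed.

Let scs := proj1 (csp_snp_smooth q).
Let ssn := proj2 (csp_snp_smooth q).
Let cs0 : csp q 0 = 1. Proof. by rewrite /csp mulr0 cos0. Qed.
Let sn0 : snp q 0 = 0. Proof. by rewrite /snp mulr0 sin0 mul0r. Qed.
Let dcs t : 'D_1 (csp q) t = - kappa * snp q t.
Proof. exact: (proj1 (csp_snp_derive t qn)). Qed.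
Let dsn t : 'D_1 (snp q) t = csp q t. Proof. exact: (proj2 (csp_snp_derive t qn)). Qed.
Let uniq (h : R -> R) : smooth setT h ->
  (forall t, 'D_1 (fun s => 'D_1 h s) t = - kappa * h t) -> h 0 = 0 -> 'D_1 h 0 = 0 ->
  forall t, h t = 0.
Proof. by move=> sh; exact: ode_pos. Qed.

Lemma csp_snp_sq t : csp q t ^+ 2 / kappa + snp q t ^+ 2 = kappa^-1.
Proof. by rewrite /csp /snp cos2sin2 /kappa; field. Qed.

Let exp_in (p u : E) t : M p -> tangent M p u -> metric kappa p u u = 1 ->
  M (lin_geod (fun s : E => s) (csp q) (snp q) p u t).
Proof.
move=> Mp tu; rewrite metric_pos => mu; rewrite space_form_pos /lin_geod /= derive_id.
by rewrite (dot_gcircle _ _ Mp (sphere_tangent Mp tu)) mu mulr1 csp_snp_sq.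
Qed.

Let smid : smooth_on M (fun s : E => s).
Proof. by apply: (smooth_on_sub (B := setT)) => //; exact: smooth_smooth_on smooth_idE. Qed.

Lemma sphere_ray (p u : E) : M p -> tangent M p u -> dot u u = 1 ->
  ray kappa p u = [set x | exists t, [/\ 0 < t, t < pi / q & x = csp q t *: p + snp q t *: u]].
Proof.
move=> Mp tu mu; have mu' : metric kappa p u u = 1 by rewrite metric_pos.
rewrite (ray_lin BC BD BZ k0 oT (fun _ _ => I) smooth_idE sphere_M sphere_nondeg inner_cov_pos
  metric_pos_id scs ssn cs0 sn0 dcs dsn uniq smid (fun X MX => conj MX erefl)
  (fun X MX => conj MX erefl) exp_in Mp tu mu').
have sk : Num.sqrt kappa = q by rewrite sqrtr_sqr gtr0_norm.
apply/seteqP; split=> x [t [t0 tp ->]]; exists t; split=> //.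
- by rewrite -sk; exact: tp.
- by rewrite /lin_geod derive_id.
- by rewrite sk.
- by rewrite /lin_geod derive_id.
Qed.

Lemma sphere_sphere (p : E) r : M p -> 0 < r < pi / q -> geodesic_sphere kappa p r =
  [set x | M x /\ dot x (q *: p) = cos (q * r) / q].
Proof.
move=> Mp /andP[r0 rp].
rewrite (geodesic_sphere_lin BC BD BZ k0 oT (fun _ _ => I) smooth_idE sphere_M sphere_nondeg
  inner_cov_pos metric_pos_id scs ssn cs0 sn0 dcs dsn uniq smid (fun X MX => conj MX erefl)
  (fun X MX => conj MX erefl) exp_in r Mp).
have pp := sphere_M Mp.
apply/seteqP; split=> x.
  move=> [u [tu mu ->]]; split; first exact: exp_in.
  have pu := sphere_tangent Mp tu.
  rewrite /lin_geod derive_id dotC dotZl dotC dotDl !dotZl (dotC u p) pu pp /csp /kappa.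
  by field.
move=> [Mx]; rewrite dotC dotZl dotC => xp.
have sr : 0 < sin (q * r).
  by apply: sin_gt0_pi; rewrite mulr_gt0 //= mulrC -ltr_pdivlMr.
have sn : sin (q * r) != 0 by rewrite gt_eqF.
have xp' : dot x p = cos (q * r) / kappa.
  by apply: (mulfI qn); rewrite xp /kappa; field.
pose u := (snp q r)^-1 *: (x - csp q r *: p).
have snn : snp q r != 0 by rewrite mulf_neq0 // invr_eq0.
have pu : dot p u = 0.
  by rewrite dotC /u dotZl dotBl dotZl pp xp' /csp; ring.
have uu : dot u u = 1.
  rewrite {1}/u dotZl dotBl dotZl pu mulr0 subr0 /u dotC dotZl dotBl dotZl (sphere_M Mx) (dotC p) xp'.
  rewrite /snp /csp.
  have -> : (sin (q * r) / q)^-1 * ((sin (q * r) / q)^-1 * (kappa^-1 - cos (q * r) * (cos (q * r) /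
    kappa)))
     = (1 - cos (q * r) ^+ 2) / sin (q * r) ^+ 2 by rewrite /kappa; field; rewrite sn qn.
  by rewrite -sin2cos2 divff // expf_neq0.
exists u; split; first exact: tangent_sphere.
  by rewrite metric_pos.
by rewrite /lin_geod derive_id /u scalerA divff // scale1r subrKC.
Qed.

End RoundSphere.

(** * The zone between a small sphere and its antipode *)

Section Zone.
Context {R : realType} {n : nat}.
Local Notation E := 'rV[R]_n.+2.
Local Notation V := 'rV[R]_n.+1.
Variables (q c : R) (a : E).
Hypotheses (q0 : 0 < q) (aa : dot a a = 1) (c0 : c != 0) (cq : c ^+ 2 < (q ^+ 2)^-1) (n_gt0 : (0 <
  n)%N).
Let kappa := q ^+ 2.
Let kp : 0 < kappa. Proof. by rewrite exprn_gt0. Qed.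
Let qn : q != 0. Proof. by rewrite gt_eqF. Qed.
Let kn : kappa != 0. Proof. by rewrite gt_eqF. Qed.
Local Notation M := (@space_form R n.+1 kappa).

Let e0 : E := delta_mx ord0 ord0.
(** The reflection T exchanges the axis a and e_0, so that dropping coordinate 0 after T is the
    orthogonal projection along a, with n + 1 coordinates. *)
Let T : {linear E -> E} := refl (a - e0).
Let de0 x : dot x e0 = x ord0 ord0.
Proof.
rewrite dotE mxE eqxx mulr1 /tdot big1 ?addr0 // => j _; by rewrite mxE mulr0.
Qed.
Let Ta : T a = e0.
Proof. by apply: refl_swap; rewrite aa de0 mxE eqxx. Qed.
Let TT x : T (T x) = x. Proof. exact: reflK. Qed.
Let dT x y : dot (T x) (T y) = dot x y. Proof. exact: dot_refl. Qed.
Let T0 x : T x ord0 ord0 = dot x a. Proof. by rewrite -de0 -Ta dT. Qed.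

Definition height (x : E) : R := dot x a.
Lemma height_linear : linear height.
Proof. by move=> b x y; rewrite /height dotDl dotZl. Qed.
HB.instance Definition _ := GRing.isLinear.Build R E R _ height height_linear.
Let pi : {linear E -> V} := @tl R n \o T.
Let hcons (s : R) (z : V) : E := vcons s (fun i => z ord0 i).
Let J s z : E := T (hcons s z).
Let tl_hcons s z : tl (hcons s z) = z.
Proof. by apply/rowP => i; rewrite mxE vconsl. Qed.
Let hconsK (x : E) : hcons (x ord0 ord0) (tl x) = x.
Proof. by rewrite [RHS]vconsE; congr vcons; apply/funext => i; rewrite mxE. Qed.
Let hJ s z : height (J s z) = s. Proof. by rewrite /height -T0 TT vcons0. Qed.
Let piJ s z : pi (J s z) = z. Proof. by rewrite /pi /= TT tl_hcons. Qed.
Let JE x : J (height x) (pi x) = x. Proof. by rewrite /J /height /pi /= -T0 hconsK TT. Qed.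
Let dot_split x z : dot x z = height x * height z + dot (pi x) (pi z).
Proof.
rewrite -dT dotE !T0; congr (_ + _); rewrite /pi /= /dot; apply: eq_bigr => i _.
by rewrite [tl _ _ _]mxE [X in _ = _ * X]mxE.
Qed.
Let J_linear b d s s' z z' : J (b * s + d * s') (b *: z + d *: z') = b *: J s z + d *: J s' z'.
Proof.
rewrite /J; have -> : hcons (b * s + d * s') (b *: z + d *: z') = b *: hcons s z + d *: hcons s' z'.
  have -> : d *: hcons s' z' = hcons (d * s') (d *: z').
    by apply/rowP => i; rewrite !mxE; case: unlift => //= i'; rewrite mxE.
  by rewrite vcons_linear; congr vcons; apply/funext => i; rewrite !mxE.
by rewrite linearD !linearZ.
Qed.

Let ellc : continuous height. Proof. exact: linear_scalar_continuous. Qed.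
Let pic : continuous pi. Proof. exact: linear_row_continuous. Qed.
Let oT := @openT E.
Let sid := @smooth_idE R n.

Let rho0 := Num.sqrt (kappa^-1 - c ^+ 2).
Let rho0_gt0 : 0 < rho0. Proof. by rewrite sqrtr_gt0 subr_gt0. Qed.
Let rho0_sq : rho0 ^+ 2 = kappa^-1 - c ^+ 2. Proof. by rewrite sqr_sqrtr // ltW // subr_gt0. Qed.
Let N := [set x | M x /\ height x = c].
Let W := [set x | M x /\ height x ^+ 2 < c ^+ 2].
(** Half-angle form of the coefficients of the projected ray, multiplied by 1 + r^2: with r = tan(q
    t / 2), times in (0, pi / q) correspond to r > 0. *)
Let A (r : R) := rho0 * (1 - r ^+ 2).
Let B (r : R) := 2 / q * r.
Let hk : [\/ (1 : R) = 1, (1 : R) = 0 | (1 : R) = -1]. Proof. exact: Or31. Qed.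

Let qi : 0 < 2 / q. Proof. by rewrite divr_gt0. Qed.
Let den r : 0 < 1 + r ^+ 2 :> R. Proof. by rewrite ltr_pwDl // sqr_ge0. Qed.
Let norm_gt0 r : 0 < A r ^+ 2 + 1 * B r ^+ 2.
Proof.
rewrite mul1r; have [->|r1] := eqVneq r 0.
  by rewrite /A expr0n subr0 mulr1 ltr_wpDr ?sqr_ge0 // exprn_gt0.
by rewrite ltr_wpDl ?sqr_ge0 // lt_neqAle sqr_ge0 andbT eq_sym expf_neq0 // mulf_neq0 // gt_eqF.
Qed.
Let sA : smooth setT A.
Proof.
move=> k; have o := @openT R; apply: Ck_mulr => //; first exact: Ck_cst.
by apply: Ck_sub_fun => //; [exact: Ck_cst|apply: Ck_exp => //; exact: Ck_id].
Qed.
Let sB : smooth setT B.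
Proof. by move=> k; have o := @openT R; apply: Ck_mulr => //; [exact: Ck_cst|exact: Ck_id]. Qed.
Let A0 : A 0 = rho0. Proof. by rewrite /A expr0n subr0 mulr1. Qed.
Let B0 : B 0 = 0. Proof. by rewrite /B mulr0. Qed.
Let B_gt0 r : 0 < r -> 0 < B r. Proof. by move=> r0; rewrite mulr_gt0. Qed.
Let A_gt0 r : (1 : R) <= 0 -> 0 < A r. Proof. by rewrite ler10. Qed.

Let wronAB r : 0 < r -> A r * 'D_1 B r - 'D_1 A r * B r != 0.
Proof.
move=> r0; have di := differentiable_idf r.
have [_ EB] := diff_scalec (2 / q) (1 : R) di.
have [d2 E2] := diff_scale (1 : R) di di.
have [d3 E3] := diff_scalec (-1) (1 : R) d2.
have [d4 E4] := diff_add (1 : R) (differentiable_cst (1 : R) r) d3.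
have [_ EA] := diff_scalec rho0 (1 : R) d4.
have AE : A = (fun s => rho0 *: (1 + -1 *: (s *: s))).
  by apply/funext => s; rewrite /A /GRing.scale /=; ring.
have EA' : 'D_1 A r = - (2 * rho0 * r).
  by rewrite AE [LHS]EA E4 E3 E2 derive_cst derive_id /GRing.scale /=; ring.
have -> : A r * 'D_1 B r - 'D_1 A r * B r = rho0 * (2 / q) * (1 + r ^+ 2).
  by rewrite [X in _ * X - _]EB EA' derive_id /A /B /GRing.scale /=; ring.
by rewrite gt_eqF // !mulr_gt0 ?invr_gt0.
Qed.

Let al := nal 1 A B.
Let be := nbe 1 A B.
Let nrm := pair_norm 1 A B.
Let nrm_gt0 r : 0 < nrm r. Proof. exact: pair_norm_gt0. Qed.

(** With b = lam / q the equation is 1 + 2 b r - r^2 = 0, whose root b + sqrt(b^2 + 1) is positive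
    for every real lam. *)
Let focal lam : (exists2 r, 0 < r & al r + rho0 * lam * be r = 0) <->
  (0 < lam ^+ 2 + kappa /\ (kappa <= 0 -> lam < 0)).
Proof.
split=> _; first by rewrite ltr_wpDl ?sqr_ge0 //; split=> //; rewrite leNgt kp.
pose b := lam / q; pose s := Num.sqrt (b ^+ 2 + 1).
have h1 : 0 <= b ^+ 2 + 1 by rewrite addr_ge0 // sqr_ge0.
have s2 : s ^+ 2 = b ^+ 2 + 1 by rewrite sqr_sqrtr.
have s0 : 0 <= s by rewrite sqrtr_ge0.
exists (b + s).
  have [b0|b0] := leP 0 b; first by rewrite ltr_wpDl // sqrtr_gt0 ltr_wpDl // sqr_ge0.
  rewrite ltNge; apply/negP => h.
  have h2 : s ^+ 2 <= (- b) ^+ 2 by rewrite ler_pXn2r ?nnegrE //; lra.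
  by move: h2; rewrite sqrrN s2; lra.
apply/eqP; rewrite nfocal //; apply/eqP; rewrite /A /B.
have lE : lam = b * q by rewrite /b divfK.
clearbody b s; rewrite lE.
transitivity (rho0 * (1 + b ^+ 2 - s ^+ 2)); first by field.
by rewrite s2; ring.
Qed.

(* The point at time t of a ray has parameter r = tan (q t / 2) in the cone, so that its height is
   c cos (q t) = c (1 - r^2) / (1 + r^2). *)
Let D x := (Num.sqrt ((c - height x) / (c + height x)) / rho 1 (pi x)) *: pi x.
Let hr (r : R) := c * ((1 - r ^+ 2) / (1 + r ^+ 2)).
Let D' z := J (hr (rho 1 z)) ((nrm (rho 1 z) / (1 + rho 1 z ^+ 2) / rho 1 z) *: z).

Let pi_sq x : M x -> Qf 1 (pi x) (pi x) = kappa^-1 - height x ^+ 2.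
Proof. by move=> /sphere_M <- //; rewrite dot_split -dot_Qf; ring. Qed.

Let hr_sq r : kappa^-1 - hr r ^+ 2 = (nrm r / (1 + r ^+ 2)) ^+ 2.
Proof.
rewrite expr_div_n pair_norm_sq // /A; have -> : (rho0 * (1 - r ^+ 2)) ^+ 2 = rho0 ^+ 2 * (1 - r ^+
  2) ^+ 2 by ring.
rewrite rho0_sq /B /hr /kappa.
by field; rewrite qn gt_eqF.
Qed.

Let MJ s z : M (J s z) <-> s ^+ 2 + Qf 1 z z = kappa^-1.
Proof.
by rewrite space_form_pos // /= dot_split hJ piJ dot_Qf -expr2.
Qed.

(** For s the height of x, r^2 = (c - s) / (c + s) is positive for either sign of c, as s^2 < c^2
    makes c - s and c + s of equal sign. *)
Let Wfacts x : W x -> [/\ 0 < (c - height x) / (c + height x), cone 1 (pi x),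
  c + height x != 0 & hr (Num.sqrt ((c - height x) / (c + height x))) = height x].
Proof.
move=> [Mx hx]; set s := height x in hx *.
have h1 : 0 < (c - s) * (c + s) by rewrite -subr_sqr subr_gt0.
have cs : c + s != 0 by apply: contraTneq h1 => ->; rewrite mulr0 ltxx.
have h2 : 0 < (c - s) / (c + s).
  have -> : (c - s) / (c + s) = (c - s) * (c + s) / (c + s) ^+ 2 by field.
  by rewrite divr_gt0 // lt_neqAle sqr_ge0 andbT eq_sym expf_neq0.
split=> //.
  split; last by rewrite ler10.
  by rewrite (pi_sq Mx) subr_gt0; exact: lt_trans hx cq.
rewrite /hr sqr_sqrtr ?(ltW h2) //.
have c2 : c + s + (c - s) != 0 by have -> : c + s + (c - s) = 2 * c by [ring];
  rewrite mulf_neq0 // pnatr_eq0.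
by field; rewrite c2 cs.
Qed.

Let DU x : W x -> cone 1 (D x) /\ D' (D x) = x.
Proof.
move=> Wx; have [h1 Cx cs hE] := Wfacts Wx; have [Mx hx] := Wx; have rx := rho_gt0 Cx.
set r := Num.sqrt _ in hE.
have r0 : 0 < r by rewrite sqrtr_gt0.
have cc : 0 < r / rho 1 (pi x) by rewrite divr_gt0.
have rD : rho 1 (D x) = r by rewrite /D rhoZ // divfK // gt_eqF.
split; first exact: coneZ.
rewrite /D' rD hE /D -/r scalerA.
have -> : nrm r / (1 + r ^+ 2) / r * (r / rho 1 (pi x)) = 1.
  have E1 : nrm r / (1 + r ^+ 2) = rho 1 (pi x).
    by rewrite /rho (pi_sq Mx) -hE hr_sq sqrtr_sqr gtr0_norm // divr_gt0.
  by rewrite E1; field; rewrite !gt_eqF.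
by rewrite scale1r JE.
Qed.

Let D'pi z : pi (D' z) = (nrm (rho 1 z) / (1 + rho 1 z ^+ 2) / rho 1 z) *: z.
Proof. exact: piJ. Qed.

Let DU' z : cone 1 z -> W (D' z) /\ D (D' z) = z.
Proof.
move=> Cz; have r0 := rho_gt0 Cz; set r := rho 1 z in r0.
have g0 : 0 < nrm r / (1 + r ^+ 2) / r by rewrite !divr_gt0.
have dn := den r.
have MD : M (D' z).
  apply/MJ; rewrite QfZl QfZr -(rho_sq Cz) -/r mulrA -expr2.
  have -> : (nrm r / (1 + r ^+ 2) / r) ^+ 2 * r ^+ 2 = (nrm r / (1 + r ^+ 2)) ^+ 2.
    by field; rewrite !gt_eqF.
  by rewrite -hr_sq subrKC.
have hD : height (D' z) = hr r by exact: hJ.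
have rn : 1 + r ^+ 2 != 0 by rewrite gt_eqF.
have WD : W (D' z).
  split=> //; rewrite hD -subr_gt0.
  have -> : c ^+ 2 - hr r ^+ 2 = c ^+ 2 * (4 * r ^+ 2) / (1 + r ^+ 2) ^+ 2.
    by rewrite /hr; field.
  have c2 : 0 < c ^+ 2 by rewrite lt_neqAle sqr_ge0 andbT eq_sym expf_neq0.
  have r2 : 0 < r ^+ 2 by rewrite exprn_gt0.
  apply: divr_gt0; last by rewrite exprn_gt0.
  by apply: mulr_gt0 => //; apply: mulr_gt0.
split=> //; have [_ _ cs _] := Wfacts WD.
rewrite /D hD D'pi -/r rhoZ // -/r.
have -> : (c - hr r) / (c + hr r) = r ^+ 2.
  rewrite hD in cs.
  have E1 : c + hr r = 2 * c / (1 + r ^+ 2) by rewrite /hr; field.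
  have E2 : c - hr r = 2 * c * r ^+ 2 / (1 + r ^+ 2) by rewrite /hr; field.
  by rewrite E1 E2; field; rewrite rn c0.
rewrite sqrtr_sqr gtr0_norm // scalerA.
have -> : r / (nrm r / (1 + r ^+ 2) / r * r) * (nrm r / (1 + r ^+ 2) / r) = 1.
  by field; rewrite rn !gt_eqF.
by rewrite scale1r.
Qed.

Let sh : smooth setT height.
Proof. by move=> k; apply: (Ck_clin (g := height)) => //. Qed.
Let spi : smooth setT pi.
Proof. by move=> k; apply: (Ck_clin (g := pi)) => //. Qed.

Let sD : smooth_on W D.
Proof.
pose O := setT `&` height @^-1` [set t | t ^+ 2 < c ^+ 2] `&` pi @^-1` (cone 1).
have o1 : open (setT `&` height @^-1` [set t | t ^+ 2 < c ^+ 2]).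
  apply: open_preimage => //; last by move=> x _; exact: ellc.
  have -> : [set t : R | t ^+ 2 < c ^+ 2] = setT `&` (fun t => c ^+ 2 - t ^+ 2) @^-1` [set t | 0 < t].
    by apply/seteqP; split=> t /=; rewrite subr_gt0 //; case.
  apply: open_preimage; [exact: openT|exact: open_gt|] => t _.
  have s1 : smooth setT (fun t : R => c ^+ 2 - t ^+ 2).
    move=> k; have o := @openT R; apply: Ck_sub_fun => //; first exact: Ck_cst.
    by apply: Ck_exp => //; exact: Ck_id.
  exact: smooth_cont s1 I.
have oO : open O.
  by apply: open_preimage; [exact: o1|exact: open_cone|move=> x _; exact: pic].
apply: (smooth_on_sub (B := O)).
  by move=> x Wx; have [_ Cx _ _] := Wfacts Wx; have [] := Wx.
apply: smooth_smooth_on => // k.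
have sh' : Ck k O height by apply: Ck_sub (sh k).
have sp' : Ck k O pi by apply: Ck_sub (spi k).
have h1 x : O x -> 0 < (c - height x) * (c + height x).
  by move=> [[_ hx] _]; rewrite -subr_sqr subr_gt0.
have h2 x : O x -> c + height x != 0.
  by move=> /h1 h; apply: contraTneq h => ->; rewrite mulr0 ltxx.
apply: Ck_scale => //; apply: Ck_mulr => //.
  apply: Ck_sqrt => //.
    move=> x Ox; have h := h2 x Ox.
    have -> : (c - height x) / (c + height x) = (c - height x) * (c + height x) / (c + height x) ^+
      2 by field.
    by rewrite divr_gt0 ?h1 // lt_neqAle sqr_ge0 andbT eq_sym expf_neq0.
  apply: Ck_mulr => //; first by apply: Ck_sub_fun => //; exact: Ck_cst.
  by apply: Ck_inv => //; apply: Ck_add => //; exact: Ck_cst.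
apply: Ck_inv => //; first by move=> x [_ /rho_gt0 rx]; rewrite gt_eqF.
by apply: (Ck_comp (P := cone 1) (g := rho 1)) => //; [move=> x []|exact: smooth_rho].
Qed.

Let smooth_J (O : set V) (f : V -> R) (g : V -> V) : open O -> smooth O f -> smooth O g ->
  smooth O (fun z => J (f z) (g z)).
Proof.
move=> oO sf sg k; apply: (Ck_clin (g := T)) => //; first exact: linear_row_continuous.
by apply: Ck_vcons => // i; apply: Ck_coord => //; exact: sg.
Qed.

Let sD' : smooth_on (cone 1) D'.
Proof.
have oC := @open_cone R n 1.
have sr : smooth (cone 1) (rho 1 : V -> R) by exact: smooth_rho.
have sden : smooth (cone 1) (fun z : V => (1 + rho 1 z ^+ 2)^-1).
  move=> k; apply: Ck_inv => //; first by move=> z _; rewrite gt_eqF.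
  by apply: Ck_add => //; [exact: Ck_cst|exact: Ck_exp].
apply: smooth_smooth_on => //; apply: smooth_J => //.
  move=> k; apply: Ck_mulr => //; first exact: Ck_cst.
  apply: Ck_mulr; [exact: oC| |exact: sden].
  by apply: Ck_sub_fun => //; [exact: Ck_cst|exact: Ck_exp].
move=> k; apply: Ck_scale => //; last exact: Ck_id.
apply: Ck_mulr => //; last by apply: Ck_inv => //; move=> z /rho_gt0 rz; rewrite gt_eqF.
apply: Ck_mulr; [exact: oC| |exact: sden].
have snrm : smooth setT nrm.
  move=> i; have o := @openT R; apply: Ck_sqrt => //; apply: Ck_add => //; first exact: Ck_exp.
  by apply: Ck_mulr => //; [exact: Ck_cst|exact: Ck_exp].
exact: (Ck_comp1 (P := setT) (f := rho 1) (g := nrm) oC (fun _ _ => I) (sr k) (snrm k)).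
Qed.

Let vth y := J c (rho0 *: y).
Let svth : smooth_on (csph 1) vth.
Proof.
apply: (smooth_on_sub (B := setT)) => //; apply: smooth_smooth_on; first exact: openT.
have oV := @openT V.
apply: smooth_J => // k; first exact: Ck_cst.
by apply: Ck_scale => //; [exact: Ck_cst|exact: Ck_id].
Qed.

Let N_th p : N p -> csph 1 (rho0^-1 *: pi p) /\ vth (rho0^-1 *: pi p) = p.
Proof.
move=> [Mp hp]; have rn : rho0 != 0 by rewrite gt_eqF.
split; last by rewrite /vth scalerA divff // scale1r -hp JE.
apply/csphP; split; last by rewrite ler10.
by rewrite QfZl QfZr (pi_sq Mp) hp -rho0_sq; field.
Qed.

Let S_vth y : csph 1 y -> N (vth y) /\ pi (vth y) = rho0 *: y.
Proof.
move=> /csphP [Qy _]; split; last exact: piJ.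
split; last exact: hJ.
by apply/MJ; rewrite QfZl QfZr Qy mulr1 -expr2 rho0_sq subrKC.
Qed.

Let NM : N `<=` M. Proof. by move=> x []. Qed.
Let Dpi p u : 'D_u pi p = pi u. Proof. by rewrite derive_clin. Qed.
Let B_height X Z : height X = 0 -> height Z = 0 -> dot X Z = Bf 1 (pi X) (pi Z).
Proof. by move=> hX hZ; rewrite dot_split hX mul0r add0r dot_Bf. Qed.
Let ellN p : N p -> height p = c. Proof. by case. Qed.

Let metric_P p x z : N p -> tangent N p x -> tangent N p z ->
  metric kappa p x z = Bf 1 ('D_x pi p) ('D_z pi p).
Proof.
apply: (linear_metric_P (j := fun s : E => s) ellc pic oT sid (fun _ _ => I) _ B_height ellN).
by move=> s x' z' Ns _ _; apply: metric_pos_id => //; exact: NM.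
Qed.

Let cov_P v p x z d : unit_vector_field kappa N v -> N p ->
  curve_at N p x d -> tangent N p z ->
  inner_cov kappa p x (v p) (derive1 (v \o d) 0) z =
  Bf 1 ('D_1 (fun e : R => 'D_(v (d e)) pi (d e)) 0) ('D_z pi p).
Proof.
apply: (linear_cov_P (j := fun s : E => s) ellc pic oT sid (fun _ _ => I) _ B_height ellN).
by move=> s x' y' b z' Ns _ _ _; apply: inner_cov_pos => //; exact: NM.
Qed.

Let metric_gt0 p x : N p -> x != 0 -> 0 < metric kappa p x x.
Proof. by move=> _ x0; rewrite metric_pos // dot_gt0. Qed.

Let half_angle r : 0 < r -> exists t, [/\ 0 < t, t < trigo.pi / q,
  csp q t = (1 - r ^+ 2) / (1 + r ^+ 2) & snp q t = 2 * r / (1 + r ^+ 2) / q].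
Proof.
move=> r0; pose C := (1 - r ^+ 2) / (1 + r ^+ 2).
have dn := den r; have rn : 1 + r ^+ 2 != 0 by rewrite gt_eqF.
have r2 : 0 < r ^+ 2 by rewrite exprn_gt0.
have C1 : C < 1 by rewrite /C ltr_pdivrMr // mul1r; lra.
have C2 : -1 < C by rewrite /C ltr_pdivlMr //; lra.
have CI : -1 <= C <= 1 by rewrite !ltW.
have CK : cos (acos C) = C by apply: acosK; rewrite in_itv.
have t0 : 0 < acos C by apply: acos_gt0; rewrite C1 ltW.
have tp : acos C < trigo.pi by apply: acos_ltpi; rewrite C2 ltW.
have qt : q * (acos C / q) = acos C by rewrite mulrC divfK.
exists (acos C / q); split; [by rewrite divr_gt0|by rewrite ltr_pM2r // invr_gt0| |].
  by rewrite /csp qt.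
rewrite /snp qt; congr (_ / q).
have s0 : 0 < sin (acos C) by rewrite sin_gt0_pi // t0.
have s1 : 0 < 2 * r / (1 + r ^+ 2) by rewrite divr_gt0 // mulr_gt0.
apply/eqP; rewrite -(eqrXn2 (n := 2)) ?ltW //; apply/eqP; rewrite sin2cos2 CK /C.
by field.
Qed.

Let half_angle' t : 0 < t -> t < trigo.pi / q -> exists r, [/\ 0 < r,
  csp q t = (1 - r ^+ 2) / (1 + r ^+ 2) & snp q t = 2 * r / (1 + r ^+ 2) / q].
Proof.
move=> t0 tp; have s0 : 0 < sin (q * t).
  by rewrite sin_gt0_pi // mulr_gt0 //= mulrC -ltr_pdivlMr.
rewrite /csp /snp; set S := sin _ in s0 *; set C := cos _.
have E1 : S ^+ 2 = 1 - C ^+ 2 by exact: sin2cos2.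
have C1 : 0 < 1 + C.
  rewrite ltNge; apply/negP => h; have : 0 < S ^+ 2 by rewrite exprn_gt0.
  rewrite E1; have := cos_geN1 (q * t); rewrite -/C; nra.
have Cn : 1 + C != 0 by rewrite gt_eqF.
exists (S / (1 + C)).
have E2 : (S / (1 + C)) ^+ 2 = (1 - C) / (1 + C) by rewrite expr_div_n E1; field.
have two : 1 + C + (1 - C) != 0 by have -> : 1 + C + (1 - C) = 2 by [ring]; rewrite pnatr_eq0.
split; first by rewrite divr_gt0.
  by rewrite E2; field; rewrite two Cn.
by congr (_ / q); rewrite E2; field; rewrite two Cn.
Qed.

Let ray_eq p u : N p -> tangent N p u -> metric kappa p u u = 1 ->
  ray kappa p u = [set x | exists2 r, 0 < r &
    x = D' (r *: (al r *: (rho0^-1 *: pi p) + be r *: 'D_u pi p))].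
Proof.
move=> Np tu; have [Mp hp] := Np; rewrite metric_pos // => mu.
have tM : tangent M p u.
  by have [d [e [e0' sc cN cp dc]]] := tu; exists d, e; split=> // t /cN /NM.
have hu : height u = 0.
  by have := ell_tangent (j := fun s : E => s) ellc oT sid (fun _ _ => I) ellN Np tu; rewrite derive_id.
have pu := sphere_tangent q0 Mp tM.
have rn : rho0 != 0 by rewrite gt_eqF.
have pp : dot (pi p) (pi p) = rho0 ^+ 2 by rewrite dot_Qf (pi_sq Mp) hp rho0_sq.
have puu : dot (pi u) (pi u) = 1 by rewrite -mu dot_split hu mul0r add0r.
have ppu : dot (pi p) (pi u) = 0 by rewrite -pu dot_split hu mulr0 add0r.
set y := rho0^-1 *: pi p.
have yy : Qf 1 y y = 1 by rewrite QfZl QfZr -dot_Qf pp; field.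
have yu : Qf 1 y (pi u) = 0 by rewrite QfZl -dot_Qf ppu mulr0.
have uu : Qf 1 (pi u) (pi u) = 1 by rewrite -dot_Qf.
have key r t : 0 < r -> csp q t = (1 - r ^+ 2) / (1 + r ^+ 2) -> snp q t = 2 * r / (1 + r ^+ 2) / q ->
    D' (r *: (al r *: y + be r *: 'D_u pi p)) = csp q t *: p + snp q t *: u.
  move=> r0 cE sE; have dn := den r; rewrite Dpi; set z := al r *: y + be r *: pi u.
  have nn : nrm r != 0 by rewrite gt_eqF.
  have Qz : Qf 1 z z = 1.
    rewrite /z Qf_comb yy yu uu; apply: etrans (nal_nbe norm_gt0 r).
    by rewrite -/al -/be; ring.
  have rz : rho 1 (r *: z) = r.
    by rewrite /rho QfZl QfZr Qz mulr1 -expr2 sqrtr_sqr gtr0_norm.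
  have sz : (nrm r / (1 + r ^+ 2) / r) *: (r *: z) = csp q t *: pi p + snp q t *: pi u.
    rewrite /z scalerA scalerDr !scalerA cE sE /al /be /nal /nbe -/nrm /A /B.
    by congr (_ *: _ + _ *: _); field; rewrite ?rn ?nn ?qn !gt_eqF.
  rewrite /D' rz sz.
  have -> : hr r = csp q t * height p + snp q t * height u.
    by rewrite hp hu mulr0 addr0 cE mulrC.
  by rewrite J_linear !JE.
rewrite (sphere_ray q0 Mp tM mu); apply/seteqP; split=> x.
  move=> [t [t0 tp ->]]; have [r [r0 cE sE]] := half_angle' t0 tp.
  by exists r => //; rewrite (key r t).
by move=> [r r0 ->]; have [t [t0 tp cE sE]] := half_angle r0; exists t; split=> //; exact: key.
Qed.

Lemma zone_bifoliates v : unit_vector_field kappa N v ->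
  bifoliates kappa n N W v <->
  forall p, N p -> forall lam, nabla_perp_eigenvalue kappa N v p lam -> lam ^+ 2 + kappa <= 0.
Proof.
have sal : smooth setT al := nal_smooth sA sB norm_gt0.
have sbe : smooth setT be := nbe_smooth sA sB norm_gt0.
have al0 : al 0 = 1 := @nal0 _ 1 rho0 A B A0 B0 rho0_gt0.
have be0 : be 0 = 0 := nbe0 1 A B0.
have be_gt0 r : 0 < r -> 0 < be r by move=> r0; apply: nbe_gt0 => //; exact: B_gt0.
apply: (model_bifoliates hk oT spi (fun _ _ => I) rho0_gt0 svth N_th S_vth sD sD' DU DU' ray_eq
  metric_P cov_P metric_gt0 sal sbe (nal_nbe norm_gt0) _ al0 be0 be_gt0 _ focal).
- by move=> r; rewrite ler10.
- by move=> r r0; exact: (nwron sA sB norm_gt0 wronAB).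
Qed.

Lemma zone_exterior U : exterior kappa n N U -> U = W.
Proof.
move=> [[z Az UE] HU].
pose y0 : V := delta_mx ord0 ord0.
have Sy : csph 1 y0.
  apply/csphP; split; last by rewrite mxE.
  by rewrite /Qf mxE /tdot big1 ?mulr0 ?addr0 ?mulr1 // => i _; rewrite mxE mul0r.
have [Np _] := S_vth Sy; set p := vth y0 in Np; clearbody p.
have Mp := NM Np.
have [h [d [Hh Hd Ud]]] := HU p Np.
(* The zone is bounded by the heights c and - c of N and -N, so a function of the squared height
   detects both. *)
pose ht x := c ^+ 2 - height x ^+ 2.
have sht : smooth setT ht.
  move=> k; apply: Ck_sub_fun => //; first exact: Ck_cst.
  by apply: Ck_exp => //; exact: sh.
have surj s X : M s -> dot X s = 0 -> exists2 u, tangent M s u & 'D_u (fun t : E => t) s = X.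
  by move=> Ms Xs; exists X; [apply: tangent_sphere => //; rewrite dotC|rewrite derive_id].
have Dh := mean_curvature_linear (j := fun s : E => s) (ell := height) (@dotC R n.+1) (@dotDl R n.+1)
  (@dotZl R n.+1) kn oT (fun _ _ => I) sid NM (sphere_M q0)
  (inner_cov_pos q0) (metric_pos_id q0) (fun X => erefl) ellN surj n_gt0 Np Hh.
rewrite derive_id in Dh.
have Dht : 'D_(- h) ht p = 2 * (kappa * c ^+ 2).
  have dl := smooth_diff sh (I : setT p).
  have [d2 E2] := diff_scale (- h) dl dl.
  have [d3 E3] := diff_scalec (-1) (- h) d2.
  have [_ E4] := diff_add (- h) (differentiable_cst (c ^+ 2) p) d3.
  have -> : ht = (fun x => c ^+ 2 + -1 *: (height x *: height x)).
    by apply/funext => x; rewrite /ht /GRing.scale /=; ring.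
  rewrite [LHS]E4 E3 E2 derive_cst derive_clin // linearN Dh ellN // /GRing.scale /=.
  by ring.
have htp : ht p = 0 by rewrite /ht ellN // subrr.
have [|y Uy hy] := exterior_point (U := U) oT I sht Hd htp _ Ud.
  have c2 : 0 < c ^+ 2 by rewrite lt_neqAle sqr_ge0 andbT eq_sym expf_neq0.
  by rewrite Dht; apply: mulr_gt0 => //; exact: mulr_gt0.
have hN x : height (- x) = - height x by exact: linearN.
apply: (exterior_component (ht := ht) Az UE _ _ _ _ Uy hy).
- have -> : W = D' @` cone 1.
    apply/seteqP; split=> x; last by move=> [s Cs <-]; have [] := DU' Cs.
    by move=> Wx; have [Cx Ex] := DU Wx; exists (D x).
  apply: connected_continuous_connected; first exact: cone_connected.
  apply: continuous_in_subspaceT => s; rewrite inE => Cs.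
  exact: smooth_cont (smooth_on_smooth (@open_cone R n 1) sD') Cs.
- apply/seteqP; split=> x.
    move=> [Mx cx]; split; last by rewrite subr_gt0.
    split=> //; first by move=> [_ E]; move: cx; rewrite E ltxx.
    by move=> _ [_ E]; move: cx; rewrite hN in E; rewrite -E sqrrN ltxx.
  by move=> [[Mx _ _]]; rewrite subr_gt0.
- by move=> x _; exact: smooth_cont sht I.
- move=> x [Mx Nx Nx']; apply/eqP => /eqP; rewrite subr_eq0 eqf_sqr => /orP[/eqP E|/eqP E].
    by apply: Nx.
  have MN : M (- x).
    move: Mx; rewrite !space_form_pos //= => <-.
    by rewrite -scaleN1r dotZl dotC dotZl; ring.
  by apply: (Nx' kp); split=> //; rewrite hN -E.
Qed.

End Zone.

(** * Eigenvalues of the covariant derivative *)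

Section Multiplicity.
Variable F : fieldType.

Lemma char_poly_conj n (B P : 'M[F]_n) : P \in unitmx ->
  char_poly (invmx P *m B *m P) = char_poly B.
Proof.
move=> uP; rewrite /char_poly; pose Pc := map_mx (@polyC F) P; pose Qc := map_mx (@polyC F) (invmx P).
have QP : Qc *m Pc = 1%:M by rewrite -map_mxM mulVmx // map_mx1.
have -> : char_poly_mx (invmx P *m B *m P) = Qc *m char_poly_mx B *m Pc.
  by rewrite /char_poly_mx mulmxBr mulmxBl !map_mxM scalar_mxC -[_%:M *m _ *m _]mulmxA QP mulmx1.
by rewrite !det_mulmx mulrAC -det_mulmx QP det1 mul1r.
Qed.

(* In a basis of column vectors starting with g, the matrix B becomes block triangular, with
   diagonal blocks 0 and C. *)
Lemma mup0_char_poly n (B : 'M[F]_n) (g : 'cV[F]_n) : B *m g = 0 -> g != 0 ->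
  (mup 0 (char_poly B) = 1)%N <-> forall u : 'rV_n, u *m B = 0 -> u *m g = 0 -> u = 0.
Proof.
case: n B g => [|n] B g Bg g0; first by rewrite [g]flatmx0 eqxx in g0.
pose e : 'cV[F]_(1 + n) := col_mx 1%:M 0.
have [P uP Pe] : exists2 P : 'M[F]_(1 + n), P \in unitmx & P *m e = g.
  have rg : \rank g = 1%N.
    by apply/eqP; rewrite eqn_leq rank_leq_col lt0n mxrank_eq0.
  have E := mulmx_ebase g; rewrite rg in E.
  pose t := row_ebase g ord0 ord0.
  have tE : row_ebase g = t%:M by rewrite [LHS]mx11_scalar.
  have t0 : t != 0.
    have := row_ebase_unit g; rewrite tE unitmxE det_scalar1 unitfE //.
  exists (t *: col_ebase g); first by rewrite unitmxZ ?unitfE // col_ebase_unit.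
  rewrite -[RHS]E tE mul_mx_scalar -scalemxAl; congr (_ *: (_ *m _)).
  apply/matrixP => i j; rewrite !mxE (ord1 j); case: splitP => k /= ik.
    by rewrite ik (ord1 k) mxE /=.
  by rewrite ik mxE.
pose B' : 'M[F]_(1 + n) := invmx P *m B *m P.
have B'e : B' *m e = 0 by rewrite -!mulmxA Pe Bg mulmx0.
have [ul0 dl0] : ulsubmx B' = 0 /\ dlsubmx B' = 0.
  have H : block_mx (ulsubmx B') (ursubmx B') (dlsubmx B') (drsubmx B') *m e = 0 by rewrite submxK.
  rewrite /e mul_block_col !mulmx0 !addr0 !mulmx1 in H.
  by split; [have := congr1 usubmx H|have := congr1 dsubmx H]; rewrite ?col_mxKu ?col_mxKd linear0.
set w := ursubmx B'; set C := drsubmx B'.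
have B'E : B' = block_mx 0 w 0 C by rewrite -[LHS]submxK ul0 dl0.
have cE : char_poly B = 'X * char_poly C.
  have -> : char_poly B = @char_poly F (1 + n) (block_mx 0 w 0 C).
    by rewrite -B'E -(char_poly_conj B uP).
  rewrite /char_poly /char_poly_mx map_block_mx !map_mx0.
  by rewrite scalar_mx_block opp_block_mx add_block_mx !oppr0 !addr0 !add0r det_ublock det_scalar1.
have c0 : char_poly C != 0 by rewrite monic_neq0 // char_poly_monic.
have mE : mup 0 (char_poly B) = (1 + mup 0 (char_poly C))%N.
  rewrite cE mupM ?polyX_eq0 //; congr (_ + _)%N.
  by have := mup_XsubCX 1 0 (0 : F); rewrite expr1 subr0 eqxx.
have eqv : (mup 0 (char_poly B) = 1)%N <-> ~~ eigenvalue C 0.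
  rewrite mE eigenvalue_root_char; split=> [[h]|h]; last by rewrite mupNroot.
  by rewrite root_factor_theorem XsubC_dvd //; case: (mup _ _) h.
have uPE (u : 'rV_n.+1) : u = (u *m P) *m invmx P by rewrite mulmxK.
have BP (u : 'rV_n.+1) : u *m B = 0 <-> (u *m P) *m B' = 0.
  rewrite /B' !mulmxA mulmxK //; split=> [->|h]; first by rewrite mul0mx.
  by rewrite -[u *m B](mulmxK uP) h mul0mx.
have key (z : 'rV[F]_(1 + n)) : z *m B' = 0 <-> lsubmx z *m w + rsubmx z *m C = 0.
  rewrite -{1}[z]hsubmxK B'E mul_row_block !mulmx0 addr0; split=> [h|->]; last exact: row_mx0.
  by have := congr1 rsubmx h; rewrite row_mxKr linear0.
have zg (u : 'rV[F]_n.+1) : u *m g = lsubmx (u *m P).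
  rewrite -Pe mulmxA -{1}[u *m P]hsubmxK mul_row_col mulmx1 mulmx0 addr0 //.
rewrite eqv; split=> [/eigenvalueP H u uB ug|H].
  have l0 : lsubmx (u *m P) = 0 by rewrite -zg.
  have /key := (BP u).1 uB; rewrite l0 mul0mx add0r => rC.
  have r0 : rsubmx (u *m P) = 0.
    apply/eqP/negPn/negP => r0; apply: H; exists (rsubmx (u *m P)) => //.
    by rewrite rC scale0r.
  by rewrite [u]uPE -[u *m P]hsubmxK l0 r0 row_mx0 mul0mx.
apply/eigenvalueP => -[z zC z0]; rewrite scale0r in zC.
have : row_mx 0 z *m invmx P = 0.
  apply: H.
    by apply/BP; rewrite mulmxKV //; apply/key; rewrite row_mxKl row_mxKr mul0mx add0r.
  by rewrite zg mulmxKV // row_mxKl.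
move=> /(congr1 (fun y => rsubmx (y *m P))); rewrite mulmxKV // row_mxKr mul0mx linear0.
by apply/eqP.
Qed.

End Multiplicity.

Section CovariantDerivative.
Context {R : realType} {m : nat}.
Local Notation E := 'rV[R]_m.+1.
Variables (kappa : R) (N : set E) (v : E -> E).
Hypotheses (NM : N `<=` space_form kappa) (hv : unit_vector_field kappa N v).

(** v has values of interest on N only. A local smooth extension F makes its derivative along curves
    depend linearly on the velocity, independently of the curve. *)
Lemma field_along_curves p : N p -> exists F : E -> E, differentiable F p /\
  forall x c, curve_at N p x c -> differentiable (v \o c) 0 /\ derive1 (v \o c) 0 = 'D_x F p.
Proof.
move=> Np; have [sv _] := hv; have [Q [F [oQ Qp sF FE]]] := sv _ Np.
have dF := smooth_diff sF Qp; exists F; split=> // x c Hc.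
have [c00 dc Dc Nc] := curve_diff Hc.
have NQ : \forall e \near (0 : R), Q (c e).
  by apply: (@differentiable_near_open R R _ Q c 0) => //; rewrite c00.
have Nt : \forall e \near (0 : R), F (c e) = v (c e).
  by apply: filterS2 NQ Nc => e Qe Ne; apply: FE.
have [d E1] := curve_deriv oQ sF Qp Hc.
split; first exact: near_differentiable Nt d.
rewrite derive1E -E1; apply: near_eq_derive.
by apply: filterS Nt => e /esym.
Qed.

(** In each model the metric is the Euclidean product times a conformal factor, whose derivatives
    give all Christoffel terms. *)
Let wt (q : E) : R := if kappa < 0 then (- kappa * q ord0 ord0 ^+ 2)^-1 else 1.
Let metricE (q u w : E) : metric kappa q u w = dot u w * wt q.
Proof. by rewrite /metric /wt; case: ifP => _; rewrite ?mulr1. Qed.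

Let wt_diff p : N p -> differentiable wt p.
Proof.
move=> /NM; rewrite /space_form /= /wt.
case: (ltP kappa 0) => k0; last by move=> _; exact: differentiable_cst.
rewrite (lt_gtF k0) => /(_ isT) p0.
pose O := [set x : E | 0 < x ord0 ord0].
have oO : open O by exact: open_halfspace.
have s : smooth O (fun q : E => (- kappa * q ord0 ord0 ^+ 2)^-1).
  move=> i; apply: Ck_inv => //.
    by move=> x x0; rewrite gt_eqF // mulr_gt0 ?oppr_gt0 // exprn_gt0.
  apply: Ck_mulr => //; first exact: Ck_cst.
  by apply: Ck_exp => //; apply: Ck_coord => //; exact: Ck_id.
exact: smooth_diff s (p0 : O p).
Qed.

(** Paired with v(p), the last two Christoffel terms of [inner_cov] cancel; what remains is half the
    derivative of the constant metric square of v along c. *)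
Lemma cov_deriv_orth p x w : N p -> cov_deriv kappa N v p x w -> metric kappa p w (v p) = 0.
Proof.
move=> Np [tw [c [Hc H]]]; have [_ Hv] := hv; have [tv _] := Hv _ Np.
rewrite (H _ tv).
have [F [dF HF]] := field_along_curves Np; have [dV _] := HF _ _ Hc.
have [c00 dc Dc Nc] := curve_diff Hc.
have dw := wt_diff Np.
have dwc : differentiable wt (c 0) by rewrite c00.
have Dw y z t : 'D_t (fun q => metric kappa q y z) p = dot y z * 'D_t wt p.
  have -> : (fun q => metric kappa q y z) = (fun q => dot y z *: wt q).
    by apply/funext => q; rewrite metricE.
  by rewrite (proj2 (diff_scalec (dot y z) t dw)).
rewrite derive1E /inner_cov (Dw (v p) (v p) x) (Dw x (v p) (v p)) metricE.
set V := v \o c in dV *.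
have [dQ EQ] := diff_Qf 1 (1 : R) dV dV.
have dcw : differentiable (fun e => wt (c e)) (0 : R) by exact: (differentiable_comp dc dwc).
have [_ E1] := diff_scale (1 : R) dQ dcw.
have E2 := derive_comp (1 : R) dc dwc; rewrite c00 Dc in E2.
have E0 : 'D_1 (fun e : R => Qf 1 (V e) (V e) *: wt (c e)) (0 : R) = 0.
  rewrite (near_eq_derive (g := fun _ : R => 1 : R)) ?derive_cst //.
  apply: filterS Nc => e Ne; apply: etrans (proj2 (Hv _ Ne)).
  by rewrite metricE dot_Qf.
rewrite E0 E2 EQ (QfC 1 (V 0)) -!dot_Qf in E1.
have VE : V 0 = v p by rewrite /V /= c00.
rewrite VE /GRing.scale /= c00 in E1.
have alg (a b d w' dw' : R) : 0 = b * dw' + (a + a) * w' -> a * w' + 2^-1 * (b * dw' + d - d) = 0.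
  by move=> h; rewrite addrK; lra.
by apply: alg; rewrite [LHS]E1; ring.
Qed.

Lemma nabla_eigen_orth p x lam : N p -> cov_deriv kappa N v p x (lam *: x) ->
  lam = 0 \/ metric kappa p x (v p) = 0.
Proof.
move=> Np /(cov_deriv_orth Np); rewrite !metricE dotZl -mulrA => /eqP.
by rewrite mulf_eq0 => /orP[/eqP|/eqP]; [left|right].
Qed.

(** An eigenvalue whose eigenvector is not orthogonal to v is 0, for which the bound in (b) is the
    assumption kappa <= 0. *)
Lemma nonpositive_eigenvalues : kappa <= 0 ->
  (forall p, N p -> forall lam, nabla_perp_eigenvalue kappa N v p lam -> lam ^+ 2 + kappa <= 0) <->
  (forall p, N p -> forall lam, nabla_eigenvalue kappa N v p lam ->
    [/\ kappa = 0 -> lam = 0,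
        0 < kappa -> lam = 0 /\ nabla_alg_multiplicity kappa m N v p lam 1 &
        kappa < 0 -> lam ^+ 2 <= - kappa]).
Proof.
move=> k0; split=> H p Np lam.
  move=> [x [tx x0 cx]]; have h : lam ^+ 2 + kappa <= 0.
    have [->|xv] := nabla_eigen_orth Np cx; first by rewrite expr0n add0r.
    by apply: (H p) => //; exists x.
  split; last by rewrite -subr_le0 opprK.
    move=> kE; move: h; rewrite kE addr0 => h; apply/eqP; rewrite -sqrf_eq0.
    by rewrite eq_le h sqr_ge0.
  by rewrite ltNge k0.
move=> [x [tx xv x0 cx]].
have [H0 _ Hn] : [/\ kappa = 0 -> lam = 0,
    0 < kappa -> lam = 0 /\ nabla_alg_multiplicity kappa m N v p lam 1 &
    kappa < 0 -> lam ^+ 2 <= - kappa] by apply: H => //; exists x.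
move: k0; rewrite le_eqVlt => /orP[/eqP kE|/Hn].
  by rewrite (H0 kE) kE expr0n add0r.
by rewrite -subr_le0 opprK.
Qed.

End CovariantDerivative.

Lemma projection_linear (R : realType) n (a w : 'rV[R]_n.+1) (r b : R) (x y : 'rV[R]_n.+1) :
  b *: x + y - dot (b *: x + y) a *: a - (dot (b *: x + y) w / r) *: w =
  b *: (x - dot x a *: a - (dot x w / r) *: w) + (y - dot y a *: a - (dot y w / r) *: w).
Proof.
rewrite !dotDl !dotZl; move: (dot x a) (dot y a) (dot x w) (dot y w) (r^-1) => s t s' t' r'.
by apply/rowP => i; rewrite !mxE; ring.
Qed.

Section PositiveEigenvalues.
Context {R : realType} {n : nat}.
Local Notation E := 'rV[R]_n.+2.
Variables (q c : R) (a : E) (v : E -> E).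
Hypotheses (q0 : 0 < q) (aa : dot a a = 1) (cq : c ^+ 2 < (q ^+ 2)^-1).
Let kappa := q ^+ 2.
Let kp : 0 < kappa. Proof. by rewrite exprn_gt0. Qed.
Local Notation M := (@space_form R n.+1 kappa).
Let N := [set x | M x /\ height a x = c].
Hypothesis hv : unit_vector_field kappa N v.
Let NM : N `<=` M. Proof. by move=> x []. Qed.
Let oT := @openT E.
Let metricE (p x z : E) : metric kappa p x z = dot x z := metric_pos q0 p x z.
Let rr := kappa^-1 - c ^+ 2.
Let rr0 : 0 < rr. Proof. by rewrite subr_gt0. Qed.

Let wdot p : N p -> [/\ dot (p - c *: a) a = 0, dot (p - c *: a) (p - c *: a) = rr &
  dot (p - c *: a) p = rr].
Proof.
move=> [Mp hp]; have pp := sphere_M q0 Mp.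
have pa : dot p a = c by [].
have h1 : dot (p - c *: a) a = 0 by rewrite dotBl dotZl aa pa; ring.
have h2 : dot (p - c *: a) p = rr by rewrite dotBl dotZl (dotC a) pa pp /rr; ring.
by split=> //; rewrite dotBl dotZl (dotC p (p - _)) (dotC a (p - _)) h1 h2 mulr0 subr0.
Qed.

Lemma zone_tangent p x : N p -> tangent N p x <-> dot x a = 0 /\ dot x p = 0.
Proof.
move=> Np; have [Mp hp] := Np; have [wa ww wp] := wdot Np; split.
  move=> tx; have tM : tangent M p x.
    by have [d [e [e0' sc cN cp dc]]] := tx; exists d, e; split=> // t /cN /NM.
  split; last by rewrite dotC; exact: (sphere_tangent q0 Mp tM).
  have lc : continuous (height a) by exact: linear_scalar_continuous.
  have lN s : N s -> height a s = c by case.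
  have := ell_tangent (j := fun s : E => s) lc oT (@smooth_idE R n) (fun _ _ => I) lN Np tx.
  by rewrite derive_id.
move=> [xa xp]; have xw : dot x (p - c *: a) = 0.
  by rewrite dotC dotBl dotZl (dotC p) (dotC a) xa xp mulr0 subrr.
pose w := p - c *: a.
have [x0|xn] := eqVneq x 0.
  exists (fun _ => p), 1; rewrite ltr01; split=> //.
    apply: smooth_smooth_on; first exact: (@open_oo R).
    by move=> k; exact: Ck_cst.
  by rewrite derive1E derive_cst x0.
(* The circle of N through p with centre c a has squared radius rr; the angular speed om gives it
   the velocity x at p. *)
pose om := Num.sqrt (dot x x / rr).
have xx : 0 < dot x x by exact: dot_gt0.
have o0 : 0 < om by rewrite sqrtr_gt0 divr_gt0.
have on : om != 0 by rewrite gt_eqF.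
have o2 : dot x x = om ^+ 2 * rr by rewrite sqr_sqrtr ?divfK ?gt_eqF // ltW // divr_gt0.
have [sc ss] := csp_snp_smooth om.
have s : smooth setT (fun t : R => c *: a + (csp om t *: w + snp om t *: x)).
  move=> k; have oR := @openT R; apply: Ck_add => //; first exact: Ck_cst.
  by apply: Ck_add => //; apply: Ck_scale => //; exact: Ck_cst.
exists (fun t => c *: a + (csp om t *: w + snp om t *: x)), 1; rewrite ltr01; split=> //.
- by apply: smooth_smooth_on; [exact: (@open_oo R)|move=> k; exact: Ck_sub (s k)].
- move=> t _; have ha : dot (csp om t *: w + snp om t *: x) a = 0.
    by rewrite dotDl !dotZl wa xa !mulr0 addr0.
  split; last by rewrite /height dotDl dotZl aa ha mulr1 addr0.
  rewrite space_form_pos //= dotDl dotZl dotC dotDl dotZl aa ha addr0 mulr1.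
  rewrite (dotC _ (c *: a + _)) dotDl dotZl (dotC a) ha mulr0 add0r.
  rewrite dot_Qf Qf_comb -!dot_Qf ww (dotC w) xw o2 /csp /snp.
  have cc := cos2Dsin2 (om * t).
  have -> : c * c + (cos (om * t) ^+ 2 * rr + 2 * cos (om * t) * (sin (om * t) / om) * 0 +
      (sin (om * t) / om) ^+ 2 * (om ^+ 2 * rr)) = c ^+ 2 + (cos (om * t) ^+ 2 + sin (om * t) ^+ 2)
        * rr by field.
  by rewrite cc mul1r subrKC.
- by rewrite /csp /snp mulr0 cos0 sin0 mul0r scale0r scale1r addr0 /w subrKC.
have [d1 E1] := diff_scale_vec w (1 : R) (smooth_diff sc (I : setT (0 : R))).
have [d2 E2] := diff_scale_vec x (1 : R) (smooth_diff ss (I : setT (0 : R))).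
have [d3 E3] := diff_add (1 : R) d1 d2.
have [_ E4] := diff_add (1 : R) (differentiable_cst (c *: a) (0 : R)) d3.
have [D1 D2] := csp_snp_derive 0 on.
rewrite derive1E [LHS]E4 E3 E1 E2 derive_cst D1 D2 /csp /snp !mulr0 sin0 cos0 mul0r mulr0.
by rewrite scale0r !add0r scale1r.
Qed.

(** G is the derivative of a local extension of v followed by the orthogonal projection to the
    tangent space of N, which removes the components along a and p - c a. As a linear function of x
    it can be put into a matrix. *)
Lemma zone_nabla p : N p -> exists G : E -> E,
  [/\ forall b x y, G (b *: x + y) = b *: G x + G y,
      forall x, tangent N p x -> cov_deriv kappa N v p x (G x) &
      forall x w, tangent N p x -> cov_deriv kappa N v p x w -> w = G x].
Proof.
move=> Np; have [F [dF HF]] := field_along_curves hv Np.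
have [wa ww wp] := wdot Np; set w := p - c *: a in wa ww wp.
have rn : rr != 0 by rewrite gt_eqF.
pose pr (y : E) := y - dot y a *: a - (dot y w / rr) *: w.
have prT y : tangent N p (pr y).
  apply/(zone_tangent _ Np).
  have h1 : dot (pr y) a = 0 by rewrite /pr !dotBl !dotZl aa wa; ring.
  have h2 : dot (pr y) w = 0 by rewrite /pr !dotBl !dotZl ww (dotC a) wa; field.
  split=> //; have -> : p = c *: a + w by rewrite /w subrKC.
  by rewrite dotC dotDl dotZl !(dotC _ (pr y)) h1 h2 mulr0 addr0.
have tdot0 z : tangent N p z -> dot a z = 0 /\ dot w z = 0.
  move=> /(zone_tangent _ Np) [za zp]; rewrite (dotC a) za; split=> //.
  by rewrite /w dotBl dotZl (dotC p) (dotC a) za zp mulr0 subrr.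
have prE y z : tangent N p z -> dot (pr y) z = dot y z.
  by move=> /tdot0 [za zw]; rewrite /pr !dotBl !dotZl za zw !mulr0 !subr0.
have covE x y z d : inner_cov kappa p x y d z = dot d z.
  rewrite (inner_cov_pos q0 _ _ _ _ (NM Np)).
  have -> : (fun s => 'D_y (fun t : E => t) s) = (fun _ => y) by apply/funext => s; rewrite derive_id.
  by rewrite derive_cst add0r !derive_id.
exists (fun x => pr ('D_x F p)); split.
- by move=> b x y; rewrite (derive_lin dF); exact: projection_linear.
- move=> x tx; split; first exact: prT.
  have [d Hd] := tx; exists d; split=> // z tz.
  by rewrite metricE covE (prE _ _ tz) (proj2 (HF _ _ Hd)).
- move=> x y tx [ty [d [Hd H]]].
  have E1 z : tangent N p z -> dot (y - pr ('D_x F p)) z = 0.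
    by move=> tz; have := H z tz; rewrite metricE covE (proj2 (HF _ _ Hd)) dotBl (prE _ _ tz) =>
      ->; rewrite subrr.
  apply/eqP; rewrite -subr_eq0; apply/eqP/dot_eq0/E1.
  have [h1 h2] := (zone_tangent _ Np).1 ty; have [h3 h4] := (zone_tangent _ Np).1 (prT ('D_x F p)).
  by apply/(zone_tangent _ Np); split; rewrite dotBl ?h1 ?h2 ?h3 ?h4 subrr.
Qed.

(** The tangent space is the orthogonal complement of a and p, which are independent because c^2 < 1
    / kappa; this gives its dimension n. *)
Lemma zone_basis p : N p -> exists e : 'M[R]_(n, n.+2),
  row_free e /\ forall x, tangent N p x <-> (x <= e)%MS.
Proof.
move=> Np; have [wa ww wp] := wdot Np.
pose A : 'M[R]_(1 + 1, n.+2) := col_mx a p.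
have dE (x y : E) : x *m y^T = (dot x y)%:M.
  apply/matrixP => i j; rewrite !mxE !ord1 eqxx; apply: eq_bigr => k _; by rewrite mxE.
have d0 (y : E) : dot 0 y = 0 by rewrite /dot big1 // => i _; rewrite mxE mul0r.
have rA : row_free A.
  apply: inj_row_free => u; rewrite -[u]hsubmxK mul_row_col.
  rewrite [lsubmx u]mx11_scalar [rsubmx u]mx11_scalar !mul_scalar_mx.
  set s := lsubmx u _ _; set t := rsubmx u _ _ => H.
  have t0 : t = 0.
    have : dot (s *: a + t *: p) (p - c *: a) = 0 by rewrite H d0.
    rewrite dotDl !dotZl !(dotC _ (p - _)) wa wp mulr0 add0r => /eqP.
    by rewrite mulf_eq0 (gt_eqF rr0) orbF => /eqP.
  have s0 : s = 0.
    have : dot (s *: a + t *: p) a = 0 by rewrite H d0.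
    by rewrite t0 scale0r addr0 dotZl aa mulr1.
  by rewrite s0 t0; apply/rowP => i; rewrite !mxE; case: splitP => j _; rewrite !mxE mul0rn.
pose K := kermx A^T.
have rK : \rank K = n by rewrite mxrank_ker mxrank_tr (eqP rA) subSS subSS subn0.
exists (castmx (rK, erefl) (row_base K)); split.
  by rewrite row_free_castmx row_base_free.
move=> x; rewrite (zone_tangent _ Np).
have -> : (x <= castmx (rK, erefl) (row_base K))%MS = (x <= K)%MS.
  by rewrite (eqmx_cast (row_base K) (rK, erefl)) eq_row_base.
rewrite /K; split.
  move=> [xa xp]; apply/sub_kermxP; rewrite /A tr_col_mx mul_mx_row !dE xa xp.
  by rewrite -row_mx0; congr row_mx; apply/matrixP => i j; rewrite !mxE mul0rn.
move=> /sub_kermxP; rewrite /A tr_col_mx mul_mx_row !dE => H.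
have h1 := congr1 lsubmx H; have h2 := congr1 rsubmx H.
rewrite row_mxKl linear0 in h1; rewrite row_mxKr linear0 in h2.
split; [have := congr1 (fun Z : 'M[R]_1 => Z ord0 ord0) h1|have := congr1 (fun Z : 'M[R]_1 => Z
  ord0 ord0) h2].
all: by rewrite !mxE.
Qed.

Lemma zone_eigenvalues :
  (forall p, N p -> forall lam, nabla_perp_eigenvalue kappa N v p lam -> lam ^+ 2 + kappa <= 0) <->
  (forall p, N p -> forall lam, nabla_eigenvalue kappa N v p lam ->
    [/\ kappa = 0 -> lam = 0,
        0 < kappa -> lam = 0 /\ nabla_alg_multiplicity kappa n N v p lam 1 &
        kappa < 0 -> lam ^+ 2 <= - kappa]).
Proof.
have [_ Hv] := hv.
have dotlin u (e : 'M[R]_(n, n.+2)) y : dot (u *m e) y = (u *m (e *m y^T)) ord0 ord0.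
  by rewrite mulmxA mxE; apply: eq_bigr => k _; rewrite [y^T _ _]mxE.
(* In the basis e, a row u stands for u e and nabla v acts by B. The column g of products with v
   satisfies B g = 0 by [cov_deriv_orth], and u g = 0 says that u e is orthogonal to v, so
   [mup0_char_poly] applies. *)
have mult p (e : 'M[R]_(n, n.+2)) (B : 'M[R]_n) : N p -> row_free e ->
    (forall x, tangent N p x <-> (x <= e)%MS) ->
    (forall i, cov_deriv kappa N v p (row i e) (row i (B *m e))) ->
    (mup 0 (char_poly B) = 1)%N <-> ~ nabla_perp_eigenvalue kappa N v p 0.
  move=> Np fe te cB; have [tv vv] := Hv _ Np; rewrite metricE in vv.
  have [G [Glin Gcov Guniq]] := zone_nabla Np.
  have G0 : G 0 = 0 by have := Glin 1 0 0; rewrite !scale1r addr0 => h; apply: (addrI (G 0));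
    rewrite -h addr0.
  have GB i : G (row i e) = row i (B *m e).
    by apply/esym/Guniq => //; apply/te; exact: row_sub.
  have Ge (u : 'rV[R]_n) : G (u *m e) = u *m (B *m e).
    rewrite (mulmx_sum_row u e) (mulmx_sum_row u (B *m e)).
    elim/big_rec2: _ => [|i y z _ IH]; first exact: G0.
    by rewrite Glin IH GB.
  pose g : 'cV[R]_n := e *m (v p)^T.
  have Bg : B *m g = 0.
    apply/colP => i; rewrite /g mulmxA [RHS]mxE.
    have := cov_deriv_orth NM hv Np (cB i); rewrite metricE => <-.
    by rewrite !mxE /dot; apply: eq_bigr => k _; rewrite [(v p)^T _ _]mxE [row _ _ _ _]mxE.
  have g0 : g != 0.
    apply/eqP => g0; have /te /submxP [u uE] := tv.
    by move: vv; rewrite {1}uE dotlin -/g g0 mulmx0 mxE => /eqP; rewrite eq_sym oner_eq0.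
  rewrite (mup0_char_poly Bg g0); split.
    move=> H [x [tx xv x0 cx]]; rewrite scale0r in cx; rewrite metricE in xv.
    have /te /submxP [u uE] := tx.
    have : u = 0.
      apply: H.
        apply: (row_free_inj fe); rewrite mul0mx -mulmxA -Ge -uE.
        by apply/esym/Guniq.
      by apply/matrixP => i j; rewrite !ord1 [RHS]mxE -[RHS]xv uE dotlin.
    by move=> u0; move: x0; rewrite uE u0 mul0mx eqxx.
  move=> H u uB ug; apply/eqP/negPn/negP => u0; apply: H; exists (u *m e).
  have tu : tangent N p (u *m e) by apply/te; exact: submxMl.
  split=> //.
  - by rewrite metricE dotlin ug mxE.
  - by apply: contra u0 => /eqP h; apply/eqP; apply: (row_free_inj fe); rewrite h mul0mx.
  - by rewrite scale0r; have := Gcov _ tu; rewrite Ge mulmxA uB mul0mx.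
split=> H p Np lam.
  move=> [x [tx x0 cx]]; split; [by move=> kE; move: kp; rewrite kE ltxx| |by rewrite (lt_gtF kp)].
  move=> _; have no l : ~ nabla_perp_eigenvalue kappa N v p l.
    by move=> /(H p Np l); rewrite leNgt ltr_wpDl ?sqr_ge0.
  have l0 : lam = 0.
    have [//|xv] := nabla_eigen_orth NM hv Np cx.
    by case: (no lam); exists x.
  split=> //; rewrite l0.
  have [e [fe te]] := zone_basis Np; have [G [Glin Gcov Guniq]] := zone_nabla Np.
  pose Wm : 'M[R]_(n, n.+2) := \matrix_i G (row i e).
  have cW i : cov_deriv kappa N v p (row i e) (row i Wm).
    by rewrite rowK; apply: Gcov; apply/te; exact: row_sub.
  have We : (Wm <= e)%MS by apply/row_subP => i; apply/te; have [] := cW i.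
  (* The rows of Wm are tangent, so Wm factors through the basis e and the factor is the matrix of
     nabla v. *)
  exists e, (Wm *m pinvmx e); split=> //; first by move=> i; rewrite mulmxKpV.
  apply/(mult p e) => // i; by rewrite mulmxKpV.
move=> [x [tx xv x0 cx]].
have [_ /(_ kp) [l0 [e [B [fe te cB m1]]]] _] : [/\ kappa = 0 -> lam = 0,
    0 < kappa -> lam = 0 /\ nabla_alg_multiplicity kappa n N v p lam 1 &
    kappa < 0 -> lam ^+ 2 <= - kappa] by apply: H => //; exists x.
case: ((mult p e B Np fe te cB).1 _); first by rewrite -{1}l0.
by exists x; split=> //; rewrite -l0.
Qed.

End PositiveEigenvalues.

Lemma umbilic_subset (R : realType) m (kappa : R) (N : set 'rV[R]_m.+1) : kappa != 0 ->
  umbilic_hypersurface kappa N -> N `<=` space_form kappa.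
Proof.
move=> k0; case=> [p r kE|p r _ _ _ _|p r _ _ _|f kn [g [_ _ fM _ _]]|f a kn [g [_ _ fM _ _]] _ _].
- by rewrite kE eqxx in k0.
- by move=> x [u [c [_ _ [_ cM _ _ _] ->]]]; exact: cM.
- by move=> x [u [c [_ _ [_ cM _ _ _] ->]]]; exact: cM.
- move=> _ [y y1 <-]; apply: (proj1 (fM y _)).
  by rewrite /space_form /= (lt_gtF kn) [y _ _]y1.
- move=> _ [y [y0 _] <-]; apply: (proj1 (fM y _)).
  by rewrite /space_form /= (lt_gtF kn).
Qed.

(** * The equivalences by the sign of the curvature *)

Section Curvature.
Context {R : realType}.

Lemma positive_equivalence n (q : R) (N U : set 'rV[R]_n.+2) v : 0 < q -> (0 < n)%N ->
  umbilic_hypersurface (q ^+ 2) N -> exterior (q ^+ 2) n N U -> unit_vector_field (q ^+ 2) N v ->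
  (bifoliates (q ^+ 2) n N U v <->
    forall p, N p -> forall lam, nabla_perp_eigenvalue (q ^+ 2) N v p lam -> lam ^+ 2 + q ^+ 2 <= 0) /\
  ((forall p, N p -> forall lam, nabla_perp_eigenvalue (q ^+ 2) N v p lam -> lam ^+ 2 + q ^+ 2 <= 0) <->
   forall p, N p -> forall lam, nabla_eigenvalue (q ^+ 2) N v p lam ->
    [/\ q ^+ 2 = 0 -> lam = 0,
        0 < q ^+ 2 -> lam = 0 /\ nabla_alg_multiplicity (q ^+ 2) n N v p lam 1 &
        q ^+ 2 < 0 -> lam ^+ 2 <= - q ^+ 2]).
Proof.
move=> q0 n0 HN; have qn : q != 0 by rewrite gt_eqF.
have k0 : 0 < q ^+ 2 by rewrite exprn_gt0.
case: HN => [p r kE|p r _ Mp rI r2|p r kE|f kE|f a kE].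
- by move: k0; rewrite kE ltxx.
- have sq : Num.sqrt (q ^+ 2) = q by rewrite sqrtr_sqr gtr0_norm.
  rewrite sq in rI r2; rewrite (sphere_sphere q0 Mp rI).
  have /andP[r0 rp] := rI.
  have qr0 : 0 < q * r by rewrite mulr_gt0.
  have qrp : q * r < pi by rewrite mulrC -ltr_pdivlMr.
  have aa : dot (q *: p) (q *: p) = 1.
    by rewrite dotZl dotC dotZl (sphere_M q0 Mp); field.
  (* The height of N is nonzero exactly because the geodesic sphere is not a great sphere. *)
  have c0 : cos (q * r) / q != 0.
    rewrite mulf_neq0 ?invr_eq0 // -cos_pihalf; apply: contra_neq r2 => /cos_inj E.
    have -> : r = q * r / q by rewrite mulrC mulKf.
    rewrite E; first by field.
      by rewrite in_itv /= !ltW.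
    by rewrite in_itv /= divr_ge0 ?pi_ge0 //= ler_pdivrMr // ler_peMr ?pi_ge0 // ler1n.
  have cq : (cos (q * r) / q) ^+ 2 < (q ^+ 2)^-1.
    rewrite expr_div_n ltr_pdivrMr // mulVf ?gt_eqF // cos2sin2 gtrBl exprn_gt0 //.
    by rewrite sin_gt0_pi // qr0.
  move=> /(zone_exterior q0 aa c0 cq n0) -> hv; split; first exact: zone_bifoliates.
  exact: zone_eigenvalues.
- by move: kE; rewrite (lt_gtF k0).
- by move: kE; rewrite (lt_gtF k0).
- by move: kE; rewrite (lt_gtF k0).
Qed.

Lemma nonpositive_equivalence n (kappa : R) (N U : set 'rV[R]_n.+1) v : kappa <= 0 -> (0 < n)%N ->
  umbilic_hypersurface kappa N -> exterior kappa n N U -> unit_vector_field kappa N v ->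
  (bifoliates kappa n N U v <->
    forall p, N p -> forall lam, nabla_perp_eigenvalue kappa N v p lam -> lam ^+ 2 + kappa <= 0) /\
  ((forall p, N p -> forall lam, nabla_perp_eigenvalue kappa N v p lam -> lam ^+ 2 + kappa <= 0) <->
   forall p, N p -> forall lam, nabla_eigenvalue kappa N v p lam ->
    [/\ kappa = 0 -> lam = 0,
        0 < kappa -> lam = 0 /\ nabla_alg_multiplicity kappa n N v p lam 1 &
        kappa < 0 -> lam ^+ 2 <= - kappa]).
Proof.
move=> k0 n0 HN HU hv; split; last first.
  apply: nonpositive_eigenvalues => //.
  have [kE|kn] := eqVneq kappa 0; last exact: umbilic_subset.
  by move=> x _; rewrite /space_form /= kE ltxx.
move: k0; rewrite le_eqVlt => /orP[/eqP kE|kn]; last first.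
  have q0 : 0 < Num.sqrt (- kappa) by rewrite sqrtr_gt0 oppr_gt0.
  have kE : kappa = - Num.sqrt (- kappa) ^+ 2 by rewrite sqr_sqrtr ?opprK // oppr_ge0 ltW.
  by move: HN HU hv; rewrite kE; exact: negative_bifoliates.
have {kE} kE : kappa = - 0 ^+ 2 by rewrite kE expr0n oppr0.
have k00 : - 0 ^+ 2 = 0 :> R by rewrite expr0n oppr0.
subst kappa; case: HN HU hv => [p r _ r0|p r k|p r k|f k|f a k].
- by move=> /(flat_exterior r0 n0) -> hv; exact: flat_bifoliates.
- by rewrite k00 ltxx in k.
- by rewrite k00 ltxx in k.
- by rewrite k00 ltxx in k.
- by rewrite k00 ltxx in k.
Qed.

End Curvature.

Unset Implicit Arguments.

(* The coordinate space has dimension n + 2 if 0 < kappa and n + 1 otherwise. *)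
Theorem theorem3 (R : realType) (n : nat) (kappa : R)
    (N U : set 'rV[R]_(n + (0 < kappa)%R).+1)
    (v : 'rV[R]_(n + (0 < kappa)%R).+1 -> 'rV[R]_(n + (0 < kappa)%R).+1)
    (hn : (0 < n)%N)
    (hN : umbilic_hypersurface kappa N)
    (hU : exterior kappa n N U)
    (hv : unit_vector_field kappa N v) :
  let a := bifoliates kappa n N U v in
  let b := forall p, N p -> forall lambda : R,
    nabla_perp_eigenvalue kappa N v p lambda -> lambda ^+ 2 + kappa <= 0 in
  let c := forall p, N p -> forall lambda : R,
    nabla_eigenvalue kappa N v p lambda ->
    [/\ kappa = 0 -> lambda = 0,
        0 < kappa -> lambda = 0 /\ nabla_alg_multiplicity kappa n N v p lambda 1 &
        kappa < 0 -> lambda ^+ 2 <= - kappa] in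
  (a <-> b) /\ (b <-> c).
Proof.
(* The size of the coordinate space depends on the sign of kappa; with m in its place, it can be
   replaced by n or n + 1 once the sign is known. *)
have gen m (N' U' : set 'rV[R]_m.+1) v' : m = (n + (0 < kappa)%R)%N ->
    umbilic_hypersurface kappa N' -> exterior kappa n N' U' -> unit_vector_field kappa N' v' ->
    (bifoliates kappa n N' U' v' <->
      forall p, N' p -> forall lam, nabla_perp_eigenvalue kappa N' v' p lam -> lam ^+ 2 + kappa <= 0) /\
    ((forall p, N' p -> forall lam,
        nabla_perp_eigenvalue kappa N' v' p lam -> lam ^+ 2 + kappa <= 0) <->
     forall p, N' p -> forall lam, nabla_eigenvalue kappa N' v' p lam ->
      [/\ kappa = 0 -> lam = 0,
          0 < kappa -> lam = 0 /\ nabla_alg_multiplicity kappa n N' v' p lam 1 &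
          kappa < 0 -> lam ^+ 2 <= - kappa]).
  move=> mE; have [k0|] := boolP (kappa <= 0).
    rewrite (le_gtF k0) addn0 in mE; subst m; exact: nonpositive_equivalence.
  rewrite -ltNge => k0; rewrite k0 addn1 in mE; subst m.
  have q0 : 0 < Num.sqrt kappa by rewrite sqrtr_gt0.
  have -> : kappa = Num.sqrt kappa ^+ 2 by rewrite sqr_sqrtr // ltW.
  exact: positive_equivalence.
exact: gen erefl hN hU hv.
Qed.
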